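(* Let $\phi$ satisfy Hypothesis 1 and let $n_0$ be the number of local minima of $\phi$. There exist $\delta,h_0>0$ such that the following assertions hold for all $h\in(0,h_0]$. First, $\sigma(\mathbf T_h^\star)\subset[-1+\delta,1]$ and $\sigma_{ess}(\mathbf T_h^\star)\subset[-1+\delta,1-\delta]$. Moreover, $\mathbf T_h^\star$ has exactly $n_0$ eigenvalues (counted with multiplicity) in $[1-\delta h,1]$, and these are in fact in $[1-e^{-\delta/h},1]$. Finally, $1$ is a simple eigenvalue of $\mathbf T_h^\star$, with eigenstate $d\nu_{h,\infty}\in\mathcal H_h$.
   Context: Hypothesis 1: $\phi:\mathbb R^d\to\mathbb R$ is a smooth Morse function (all critical points non-degenerate) and there exist $c,R>0$ and constants $C_\alpha>0$ such that for all $|x|\ge R$: $|\partial_x^\alpha\phi(x)|\le C_\alpha$ for every $\alpha\in\mathbb N^d\setminus\{0\}$, $|\nabla\phi(x)|\ge c$ and $\phi(x)\ge c|x|$. In particular $\phi$ has finitely many critical points. For $h\in(0,1]$ let $d\mu_h(x)=Z_he^{-\phi(x)/h}dx$ be the probability measure on $\mathbb R^d$ ($Z_h>0$ is the normalizing constant), $B(x,h)$ the open Euclidean ball, and $d\nu_{h,\infty}(x)=\widetilde Z_h\,\mu_h(B(x,h))\,d\mu_h(x)$, with $\widetilde Z_h>0$ such that $\nu_{h,\infty}$ is a probability measure. Let $\mathcal H_h=L^2(\mathbb R^d,d\nu_{h,\infty})$. A function $f\in\mathcal H_h$ is identified with the measure $f\,d\nu_{h,\infty}$; in particular $d\nu_{h,\infty}$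 corresponds to the constant function $1$. On bounded measures $$\mathbf T_h^\star(d\nu)=\Big(\int_{\mathbb R^d}\mathbf 1_{|x-y|<h}\,\mu_h(B(y,h))^{-1}d\nu(y)\Big)d\mu_h(x).$$ Under the identification, $\mathbf T_h^\star$ acts on $\mathcal H_h$ as the bounded selfadjoint operator $f\mapsto \frac1{\mu_h(B(x,h))}\int_{|x-y|<h}f(y)\,d\mu_h(y)$, of norm $1$. $\sigma$ and $\sigma_{ess}$ denote the spectrum and essential spectrum on $\mathcal H_h$. *)

(* Defs.v *)
From HB Require Import structures.
From mathcomp Require Import all_boot all_order all_algebra.
From mathcomp Require Import all_classical all_reals all_analysis.
From mathcomp Require Import measurable_realfun complex.

Set Implicit Arguments.
Unset Strict Implicit.
Unset Printing Implicit Defensive.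

Import Order.TTheory GRing.Theory Num.Theory.
Import numFieldNormedType.Exports.

Local Open Scope classical_set_scope.
Local Open Scope ring_scope.

(* R^n is 'rV[R]_n with its Borel sigma-algebra. *)

HB.instance Definition _ (R : realType) (n : nat) :=
  @isMeasurable.Build (sigma_display (@open 'rV[R]_n)) 'rV[R]_n
    <<s @open 'rV[R]_n >>
    (@sigma_algebra0 _ setT _) (@sigma_algebraC _ _)
    (@sigma_algebra_bigcup _ setT _).

Section borel_rV.
Context {R : realType} {n : nat}.

Lemma open_measurable_rV (U : set 'rV[R]_n) : open U -> measurable U.
Proof. by move=> oU; exact: sub_sigma_algebra. Qed.

Let rat_ball (p : 'rV[rat]_n * nat) : set 'rV[R]_n :=
  ball (\row_i (ratr (p.1 ord0 i) : R)) p.2.+1%:R^-1.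

Let open_rat_balls (U : set 'rV[R]_n) : open U ->
  U = \bigcup_p (if `[< rat_ball p `<=` U >] then rat_ball p else set0).
Proof.
move=> oU; apply/seteqP; split; last first.
  by move=> x [p _]; case: asboolP => // + xp; exact.
move=> x Ux.
have /nbhs_ballP[e /= e0 xeU] : nbhs x U by exact: open_nbhs_nbhs.
have [k ke] : exists k : nat, k.+1%:R^-1 < e / 2 :> R.
  have e20 : 0 < e / 2 by rewrite divr_gt0.
  have [k _ /(_ k (leqnn k))/= ?] := near_infty_natSinv_lt (PosNum e20).
  by exists k.
have /choice[q xq] : forall i, exists q : rat,
    x ord0 i - k.+1%:R^-1 < ratr q < x ord0 i.
  move=> i; have /rat_in_itvoo[q] : x ord0 i - k.+1%:R^-1 < x ord0 i.
    by rewrite gtrBl invr_gt0.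
  by rewrite in_itv/= => ?; exists q.
have xb : rat_ball (\row_i q i, k) x.
  split=> /=; first by rewrite invr_gt0.
  move=> i j; rewrite (ord1 i) !mxE /ball/=.
  have /andP[q1 q2] := xq j.
  by rewrite distrC gtr0_norm ?subr_gt0// ltrBlDl -ltrBlDr.
exists (\row_i q i, k) => //; case: asboolP => // -[]; apply: subset_trans xeU.
move=> y yb; rewrite (splitr e); apply: (@ball_triangle _ _ (\row_j (ratr ((\row_i q i) ord0 j) : R))).
  by apply: ball_sym; apply: le_ball xb; exact: ltW.
by apply: le_ball yb; exact: ltW.
Qed.

Lemma measurable_fun_rV d (T : measurableType d) (f : T -> 'rV[R]_n) :
  (forall i, measurable_fun setT (fun t => f t ord0 i)) ->
  measurable_fun setT f.
Proof.
move=> mf; apply: (measurability (@open 'rV[R]_n)) => //.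
move=> _ [U oU <-]; rewrite setTI (open_rat_balls oU) preimage_bigcup.
apply: countable_bigcupT_measurable => // p.
case: asboolP => _; last by rewrite preimage_set0.
have -> : f @^-1` rat_ball p = \bigcap_(i in [set: 'I_n])
    (fun t => f t ord0 i) @^-1` ball (ratr (p.1 ord0 i) : R) p.2.+1%:R^-1.
  apply/seteqP; split=> [t [_ /= fb] i _ /=|t fb].
    by have := fb ord0 i; rewrite mxE.
  split=> [|i j]; first by rewrite invr_gt0.
  by rewrite (ord1 i) mxE; exact: fb.
apply: fin_bigcap_measurable => [|i _]; first exact: finite_finset.
rewrite -[X in measurable X]setTI; apply: mf => //.
by apply: open_measurable; exact: ball_open.
Qed.

Lemma continuous_measurable_rV (f : 'rV[R]_n -> R) :
  continuous f -> measurable_fun setT f.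
Proof.
move=> /continuousP cf; apply: (measurability _ (RGenOpens.measurableE R)).
move=> _ [_ [a [b ->]] <-]; rewrite setTI.
by apply: open_measurable_rV; apply: cf; exact: interval_open.
Qed.

Lemma measurable_coord (i : 'I_n) :
  measurable_fun setT (fun x : 'rV[R]_n => x ord0 i).
Proof. by apply: continuous_measurable_rV; exact: coord_continuous. Qed.

End borel_rV.

Section lebesgue_rV.
Context {R : realType}.

Definition cons_rV n (p : R * 'rV[R]_n) : 'rV[R]_n.+1 :=
  row_mx (const_mx p.1 : 'rV_1) p.2.

Lemma measurable_cons_rV n : measurable_fun setT (@cons_rV n).
Proof.
apply: measurable_fun_rV => i; case: (@split_ordP 1 n i) => j ->.
  rewrite (_ : (fun _ => _) = fst) //.
  apply/funext => p; have := row_mxEl (const_mx p.1 : 'rV_1) p.2 ord0 j.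
  by rewrite [X in _ = X]mxE.
rewrite (_ : (fun _ => _) = (fun x : 'rV[R]_n => x ord0 j) \o snd).
  by apply: measurableT_comp => //; exact: measurable_coord.
by apply/funext => p; exact: (row_mxEr (const_mx p.1 : 'rV_1) p.2 ord0 j).
Qed.

Section product.
Local Open Scope ereal_scope.
Variables (n : nat) (m : {measure set 'rV[R]_n -> \bar R}).

Definition product_rV : set 'rV[R]_n.+1 -> \bar R :=
  pushforward (@lebesgue_measure R \x^ m) (@cons_rV n).

Let product_rV0 : product_rV set0 = 0.
Proof. by rewrite /product_rV /pushforward preimage_set0 measure0. Qed.

Let product_rV_ge0 A : 0 <= product_rV A.
Proof. by apply: measure_ge0; exact: measurable_cons_rV. Qed.

Let product_rV_sigma_additive : semi_sigma_additive product_rV.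
Proof. by apply: measure_semi_sigma_additive; exact: measurable_cons_rV. Qed.

HB.instance Definition _ := isMeasure.Build _ _ _
  product_rV product_rV0 product_rV_ge0 product_rV_sigma_additive.

End product.

(* Lebesgue measure on R^n. *)
Fixpoint leb n : {measure set 'rV[R]_n -> \bar R} :=
  match n with
  | 0 => dirac (0 : 'rV[R]_0)
  | m.+1 => product_rV (leb m)
  end.

Lemma leb_box n (a b : 'rV[R]_n) : (forall i, a ord0 i <= b ord0 i) ->
  leb n [set x | forall i, a ord0 i <= x ord0 i <= b ord0 i] =
  (\prod_i (b ord0 i - a ord0 i))%:E.
Proof.
elim: n a b => [|n IH] a b ab.
  by rewrite big_ord0 /= diracE mem_set// => -[].
pose tl (x : 'rV[R]_n.+1) : 'rV[R]_n := \row_i x ord0 (lift ord0 i).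
have -> : leb n.+1 [set x | forall i, a ord0 i <= x ord0 i <= b ord0 i] =
    (@lebesgue_measure R \x^ leb n)%E (`[a ord0 ord0, b ord0 ord0] `*`
    [set x : 'rV[R]_n | forall i, tl a ord0 i <= x ord0 i <= tl b ord0 i]).
  rewrite /= /product_rV /pushforward; congr (_ _).
  have tlE (p : R * 'rV[R]_n) i :
      cons_rV p ord0 (lift ord0 i) = p.2 ord0 i.
    rewrite -(row_mxEr (const_mx p.1 : 'rV_1) p.2 ord0 i).
    by congr (cons_rV _ _ _); exact: val_inj.
  have hdE (p : R * 'rV[R]_n) : cons_rV p ord0 ord0 = p.1.
    have := row_mxEl (const_mx p.1 : 'rV_1) p.2 ord0 ord0.
    rewrite [X in _ = X]mxE => <-.
    by congr (cons_rV _ _ _); exact: val_inj.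
  apply/seteqP; split=> [p pab|p [/= p1 p2] i].
    split=> [|i] /=; first by rewrite in_itv/= -hdE; exact: pab.
    by rewrite !mxE -tlE; exact: pab.
  case: (unliftP ord0 i) => [j ->|->]; last by rewrite hdE; rewrite in_itv in p1.
  by rewrite tlE; have := p2 j; rewrite !mxE.
rewrite big_ord_recl product_measure2E//.
  rewrite EFinM; congr (_ * _)%E.
    apply: (etrans (lebesgue_measure_itv `[a ord0 ord0, b ord0 ord0])).
    rewrite /= lte_fin; have := ab ord0.
    by rewrite le_eqVlt => /predU1P[->|->//]; rewrite ltxx subrr.
  rewrite [LHS](IH (tl a) (tl b)); last by move=> i; rewrite !mxE.
  by under eq_bigr do rewrite !mxE.
rewrite (_ : [set _ | _] = \bigcap_(i in [set: 'I_n])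
   (fun x : 'rV[R]_n => x ord0 i) @^-1` `[tl a ord0 i, tl b ord0 i]).
  apply: fin_bigcap_measurable => [|i _]; first exact: finite_finset.
  by rewrite -[X in measurable X]setTI; apply: measurable_coord.
apply/seteqP; split=> [x xab i _ /=|x xab i].
  by rewrite in_itv/=; exact: xab.
by have := xab i I; rewrite /= in_itv.
Qed.

End lebesgue_rV.

Section density.
Local Open Scope ereal_scope.
Context d (T : measurableType d) (R : realType).
Variables (mu : {measure set T -> \bar R}) (f : T -> \bar R).
Hypotheses (mf : measurable_fun setT f) (f0 : forall x, 0 <= f x).

(* The measure f dmu. *)
Definition density of measurable_fun setT f & (forall x, 0 <= f x) :=
  fun A : set T => \int[mu]_(x in A) f x.

Local Notation nu := (density mf f0).

Let density0 : nu set0 = 0. Proof. exact: integral_set0. Qed.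

Let density_ge0 A : 0 <= nu A.
Proof. by apply: integral_ge0 => x _; exact: f0. Qed.

Let density_sigma_additive : semi_sigma_additive nu.
Proof. exact: semi_sigma_additive_nng_induced. Qed.

HB.instance Definition _ :=
  isMeasure.Build _ _ _ nu density0 density_ge0 density_sigma_additive.

End density.

Section euclidean.
Context {R : realType} {d : nat}.
Implicit Types (x : 'rV[R]_d) (f : 'rV[R]_d -> R).

(* The library norm on 'rV[R]_d is the sup norm. *)
Definition enorm x : R := Num.sqrt (\sum_i x ord0 i ^+ 2).

Definition eball x (r : R) : set 'rV[R]_d := [set y | enorm (x - y) < r].

Definition partial (i : 'I_d) f : 'rV[R]_d -> R :=
  fun x => 'D_(delta_mx ord0 i) f x.

Definition partials (s : seq 'I_d) f : 'rV[R]_d -> R := foldr partial f s.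

Definition multi_partial (alpha : 'I_d -> nat) f : 'rV[R]_d -> R :=
  partials (flatten [seq nseq (alpha i) i | i <- enum 'I_d]) f.

(* All iterated partial derivatives exist and are continuous. *)
Definition smooth f := forall s : seq 'I_d,
  continuous (partials s f) /\
  forall i x, derivable (partials s f) x (delta_mx ord0 i).

Definition gradient f x : 'rV[R]_d := \row_i partial i f x.

Definition hessian f x : 'M[R]_d := \matrix_(i, j) partials [:: i; j] f x.

Definition morse f := forall x, gradient f x = 0 -> hessian f x \in unitmx.

Definition local_minima f : set 'rV[R]_d :=
  [set x | \forall y \near x, f x <= f y].

Record hypothesis1 (phi : 'rV[R]_d -> R) : Prop := {
  hyp_smooth : smooth phi ;
  hyp_morse : morse phi ;
  hyp_growth : exists (c r : R) (C : ('I_d -> nat) -> R),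
    [/\ 0 < c, 0 < r, (forall alpha, 0 < C alpha) &
      forall x, r <= enorm x ->
      [/\ forall alpha, (exists i, alpha i != 0%N) ->
            `|multi_partial alpha phi x| <= C alpha,
          c <= enorm (gradient phi x) &
          c * enorm x <= phi x]] }.

Lemma hypothesis1_continuous phi : hypothesis1 phi -> continuous phi.
Proof. by move=> /hyp_smooth /(_ [::]) []. Qed.

Lemma measurable_enorm_sub :
  measurable_fun setT (fun p : 'rV[R]_d * 'rV[R]_d => enorm (p.1 - p.2)).
Proof.
apply: (@measurableT_comp _ _ _ _ _ _ (@Num.sqrt R)).
  by apply: continuous_measurable_fun; exact: sqrt_continuous.
apply: measurable_sum => i; apply: measurable_funX.
rewrite (_ : (fun _ => _) = (fun p : 'rV[R]_d * 'rV[R]_d => p.1 ord0 i) \-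
    (fun p => p.2 ord0 i)); last by apply/funext => p; rewrite /= !mxE.
by apply: measurable_funB;
  apply: (measurableT_comp (measurable_coord i)).
Qed.

Lemma measurable_eball_mass (mu : probability 'rV[R]_d R) (r : R) :
  measurable_fun setT (fun x => mu (eball x r)).
Proof.
have mA : measurable [set p : 'rV[R]_d * 'rV[R]_d | enorm (p.1 - p.2) < r].
  have := measurable_enorm_sub measurableT (measurable_itv `]-oo, r[).
  by rewrite setTI set_itvE.
rewrite (_ : (fun _ => _) = mu \o xsection
  [set p : 'rV[R]_d * 'rV[R]_d | enorm (p.1 - p.2) < r]).
  exact: measurable_fun_xsection.
by apply/funext => x /=; congr (mu _); apply/seteqP; split => y;
  rewrite /xsection/= inE.
Qed.

End euclidean.

Section gibbs.
Context {R : realType} {d : nat} (phi : 'rV[R]_d -> R).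
Hypothesis cphi : continuous phi.
Variable h : R.

Definition boltzmann (x : 'rV[R]_d) : \bar R := (expR (- (phi x / h)))%:E.

Lemma measurable_boltzmann : measurable_fun setT boltzmann.
Proof.
apply/measurable_EFinP; apply: measurableT_comp => //.
apply: measurableT_comp => //; apply: measurable_funM => //.
exact: continuous_measurable_rV.
Qed.

Lemma boltzmann_ge0 x : (0 <= boltzmann x)%E.
Proof. by rewrite lee_fin expR_ge0. Qed.

(* mnormalize divides by the total mass; its second argument is only used when
   that mass is zero or infinite. *)
Definition gibbs : probability 'rV[R]_d R :=
  mnormalize (density (leb d) measurable_boltzmann boltzmann_ge0)
    (dirac (0 : 'rV[R]_d)).

Definition ball_mass (x : 'rV[R]_d) : \bar R := gibbs (eball x h).

Lemma measurable_ball_mass : measurable_fun setT ball_mass.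
Proof. exact: measurable_eball_mass. Qed.

Lemma ball_mass_ge0 x : (0 <= ball_mass x)%E.
Proof. exact: measure_ge0. Qed.

Definition nu_infty : probability 'rV[R]_d R :=
  mnormalize (density gibbs measurable_ball_mass ball_mass_ge0)
    (dirac (0 : 'rV[R]_d)).

Local Open Scope complex_scope.

(* The action of T_h^* on densities f with respect to nu_infty. *)
Definition Tstar (f : 'rV[R]_d -> R[i]) (x : 'rV[R]_d) : R[i] :=
  ((fine (ball_mass x))^-1)%:C *
  ((\int[gibbs]_(y in eball x h) complex.Re (f y)) +i*
   (\int[gibbs]_(y in eball x h) complex.Im (f y))).

End gibbs.

(* Spectral theory on the complex Hilbert space L^2(mu).  An operator is given
   on representatives, as a map A on functions compatible with equality
   mu-almost everywhere. *)
Section spectral.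
Context d (T : measurableType d) (R : realType).
Variable mu : {measure set T -> \bar R}.
Implicit Types (f g : T -> R[i]) (A : (T -> R[i]) -> (T -> R[i])) (z : R[i]).

Definition L2 : set (T -> R[i]) :=
  [set f : T -> R[i] | (@complex.Re R \o f) \in Lfun mu 2%:E /\
                       (@complex.Im R \o f) \in Lfun mu 2%:E].

Definition modulus z : R := ComplexField.Normc.normc z.

Definition L2norm f : \bar R := ('N[mu]_(2%:E)[EFin \o (modulus \o f)])%E.

(* A - z is a bijection of L^2(mu) with bounded inverse. *)
Definition resolvent_set A : set R[i] :=
  [set z : R[i] | exists C : R, forall g, L2 g ->
    exists f, [/\ L2 f,
      (fun x => A f x - z * f x) = g %[ae mu],
      (L2norm f <= C%:E * L2norm g)%E &
      forall f', L2 f' -> (fun x => A f' x - z * f' x) = g %[ae mu] ->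
        f' = f %[ae mu]]].

Definition op_spectrum A : set R[i] := ~` resolvent_set A.

Definition op_eigenspace A z : set (T -> R[i]) :=
  [set f : T -> R[i] | L2 f /\ A f = (fun x => z * f x) %[ae mu]].

Definition op_eigenvector A z f :=
  op_eigenspace A z f /\ ~ (f = cst 0 %[ae mu]).

Definition op_eigenvalue A : set R[i] :=
  [set z : R[i] | exists f, op_eigenvector A z f].

(* The subspace E of L^2(mu) has a basis with n elements. *)
Definition has_dim (E : set (T -> R[i])) (n : nat) :=
  exists b : 'I_n -> T -> R[i],
  [/\ forall i, E (b i),
      forall a : 'I_n -> R[i],
        (fun x => \sum_i a i * b i x) = cst 0 %[ae mu] -> forall i, a i = 0 &
      forall f, E f -> exists a : 'I_n -> R[i],
        f = (fun x => \sum_i a i * b i x) %[ae mu]].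

Definition isolated_point (S : set R[i]) z :=
  S z /\ exists2 e : R, 0 < e & forall w, S w -> modulus (w - z) < e -> w = z.

(* For selfadjoint A: the isolated eigenvalues of finite multiplicity. *)
Definition discrete_spectrum A : set R[i] :=
  [set z : R[i] | [/\ isolated_point (op_spectrum A) z, op_eigenvalue A z &
                     exists n, has_dim (op_eigenspace A z) n]].

Definition essential_spectrum A : set R[i] :=
  op_spectrum A `\` discrete_spectrum A.

(* A has exactly n eigenvalues in I, counted with multiplicity. *)
Definition eigenvalue_count A (I : set R[i]) (n : nat) :=
  exists (s : seq R[i]) (m : R[i] -> nat),
  [/\ uniq s,
      (forall z, z \in s <-> op_eigenvalue A z /\ I z),
      (forall z, z \in s -> has_dim (op_eigenspace A z) (m z)) &
      (\sum_(z <- s) m z)%N = n].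

End spectral.

(* The real segment [a, b] inside R[i]. *)
Definition real_segment {R : realType} (a b : R) : set R[i] :=
  [set z : R[i] | exists2 x : R, a <= x <= b & z = x%:C%C].

(* Main.v *)
Require Import Defs.
From HB Require Import structures.
From mathcomp Require Import all_boot all_order all_algebra.
From mathcomp Require Import fingroup perm sesquilinear finmap.
From mathcomp Require Import all_classical all_reals all_analysis.
From mathcomp Require Import spectral measurable_realfun complex ring lra.
Set Implicit Arguments.
Unset Strict Implicit.
Unset Printing Implicit Defensive.
Import Order.TTheory GRing.Theory Num.Theory.
Import numFieldNormedType.Exports.
Local Open Scope classical_set_scope.
Local Open Scope ring_scope.


(* The operator T is the mu_h-average over balls of radius h. Conjugating with
   W = exp((phi - p)/h), where p flattens phi near its saddles and maxima, and
   comparing the local averages of exp(-phi/h) and exp(-p/h) gives a Lyapunov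
   bound for T: the Dirichlet form controls f everywhere, up to a multiple of the
   mass of f on a small set G. On G the mass is controlled by Poincare
   inequalities on boxes, up to finitely many linear functionals (the means over
   the boxes). Three coverings are used:
   - cells of diameter < h covering a fixed ball, with h-independent constants:
     the spectrum outside [-1+delta, 1-delta] consists of finitely many
     eigenvalues close to 1;
   - cubes of side of order sqrt h around the n0 local minima: the form of 1 - T
     is at least c h modulo n0 functionals, hence at most n0 eigenvalues exceed
     1 - c h;
   - a single large cube: the eigenvalue 1 is simple.
   Conversely the indicators of small balls around the minima have exponentially
   small energy, hence at least n0 eigenvalues are exponentially close to 1. *)
(** * Almost spectral decomposition of a symmetric contraction *)

(** The Lyapunov bound acts through the inequality 2 |f(x) f(y)| <= f(x)^2 W(y)/W(x) + f(y)^2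
    W(x)/W(y): integrated against the kernel, it turns an upper bound for TW/W into a lower bound
    for the forms of both 1 - T and 1 + T. Expanding the averages over a ball, 1 - TW/W shows two
    gains: |grad phi|^2 - |grad p|^2, and h times tr Hess p - tr Hess phi. The second must win at
    critical points, where the first vanishes. So at a critical point that is not a minimum, p gets
    the Hessian (1 - eta)|Hess phi|: as |Hess phi| and Hess phi have the same square, the gradient
    of p stays below that of phi, while the trace is strictly larger. At a minimum |Hess phi| = Hess
    phi and nothing is gained, which is why sets of size sqrt h survive there. Finitely many
    functionals also take the place of compactness: they make maximizing sequences of the Rayleigh
    quotient converge, so eigenvectors can be produced one by one. The number of functionals bounds
    the number of eigenvalues from above, the test functions bound it from below; equality at n0
    forces every eigenvalue in [1 - delta h, 1] into the exponentially small window. *)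

Section semi_hilbert.
Context {R : realType}.

(* The form may be degenerate: it will be the L^2 pairing on functions that are
   not identified almost everywhere. *)
Record semi_hilbert (V : lmodType R) (ip : V -> V -> R) : Prop := SemiHilbert {
  ipC : forall f g, ip f g = ip g f ;
  ipDl : forall f g k, ip (f + g) k = ip f k + ip g k ;
  ipZl : forall a f g, ip (a *: f) g = a * ip f g ;
  ip_ge0 : forall f, 0 <= ip f f ;
  ip_complete : forall u : nat -> V,
    (forall e, 0 < e -> exists N, forall m n, (N <= m)%N -> (N <= n)%N ->
       ip (u m - u n) (u m - u n) < e) ->
    exists f, forall e, 0 < e -> exists N, forall n, (N <= n)%N ->
       ip (u n - f) (u n - f) < e }.

Lemma quadratic_discriminant (a b c : R) : 0 <= c ->
  (forall t, 0 <= a + t * b *+ 2 + t ^+ 2 * c) -> b ^+ 2 <= a * c.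
Proof.
move=> + H; rewrite le_eqVlt => /predU1P[c0|c0]; last first.
  have /= := H (- b / c).
  have -> : a + - b / c * b *+ 2 + (- b / c) ^+ 2 * c = (a * c - b ^+ 2) / c.
    by field; rewrite gt_eqF.
  by rewrite pmulr_lge0 ?invr_gt0// subr_ge0.
have [->|b0] := eqVneq b 0; first by rewrite -c0 expr0n mulr0.
(* With [c = 0] the polynomial is affine in [t]; this [t] gives it the value -1. *)
have := H (- (a + 1) / (2 * b)); rewrite -c0 mulr0.
have -> : a + - (a + 1) / (2 * b) * b *+ 2 + 0 = -1 by field.
by rewrite ler0N1.
Qed.

Section theory.
Context {V : lmodType R} {ip : V -> V -> R} (H : semi_hilbert ip).
Implicit Types (f g : V).

Lemma ip0l g : ip 0 g = 0.
Proof. by rewrite -(scale0r (0 : V)) (ipZl H) mul0r. Qed.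

Lemma ipNl f g : ip (- f) g = - ip f g.
Proof. by rewrite -scaleN1r (ipZl H) mulN1r. Qed.

Lemma ipBl f g k : ip (f - g) k = ip f k - ip g k.
Proof. by rewrite (ipDl H) ipNl. Qed.

Lemma ipNr f g : ip f (- g) = - ip f g.
Proof. by rewrite (ipC H) ipNl (ipC H). Qed.

Lemma ipDr f g k : ip k (f + g) = ip k f + ip k g.
Proof. by rewrite (ipC H) (ipDl H) !(ipC H k). Qed.

Lemma ipBr f g k : ip k (f - g) = ip k f - ip k g.
Proof. by rewrite ipDr ipNr. Qed.

Lemma ipZr a f g : ip f (a *: g) = a * ip f g.
Proof. by rewrite (ipC H) (ipZl H) (ipC H). Qed.

Lemma ip_suml I (r : seq I) (P : pred I) (F : I -> V) g :
  ip (\sum_(i <- r | P i) F i) g = \sum_(i <- r | P i) ip (F i) g.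
Proof.
by apply: (big_morph (fun f => ip f g)) => [x y|]; [exact: ipDl|exact: ip0l].
Qed.

Lemma ip_sumr I (r : seq I) (P : pred I) (F : I -> V) g :
  ip g (\sum_(i <- r | P i) F i) = \sum_(i <- r | P i) ip g (F i).
Proof. by rewrite (ipC H) ip_suml; apply: eq_bigr => i _; exact: ipC. Qed.

Lemma ip_cauchy_schwarz f g : ip f g ^+ 2 <= ip f f * ip g g.
Proof.
apply: quadratic_discriminant => [|t]; first exact: ip_ge0.
have := ip_ge0 H (f + t *: g).
rewrite !(ipDl H, ipDr) !(ipZl H, ipZr) (ipC H g f); set x := ip f g.
by congr (_ <= _); ring.
Qed.

Lemma ip_null f g : ip f f = 0 -> ip f g = 0.
Proof.
move=> f0; have := ip_cauchy_schwarz f g; rewrite f0 mul0r => h.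
by apply/eqP; rewrite -sqrf_eq0 eq_le h sqr_ge0.
Qed.

Lemma ip_sqrD_le f g : ip (f + g) (f + g) <= 2 * ip f f + 2 * ip g g.
Proof.
have := ip_ge0 H (f - g).
by rewrite !(ipBl, ipBr) !(ipDl H, ipDr) (ipC H g f); lra.
Qed.

Lemma ip_sqrB_le f g : ip (f - g) (f - g) <= 2 * ip f f + 2 * ip g g.
Proof. by have := ip_sqrD_le f (- g); rewrite ipNl ipNr opprK. Qed.

(** Banach's fixed point theorem for a seminorm: the iterates from 0 converge by [ip_complete], but
    the limit is fixed only up to a null vector. *)
Lemma contraction_fixpoint (F : V -> V) (k : R) : 0 <= k < 1 ->
  (forall f g, ip (F f - F g) (F f - F g) <= k * ip (f - g) (f - g)) ->
  exists f, ip (F f - f) (F f - f) = 0.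
Proof.
move=> /andP[k0 k1] FL.
pose u n := iter n F 0.
pose s := Num.sqrt k.
have s0 : 0 <= s by exact: sqrtr_ge0.
have s1 : s < 1 by rewrite -sqrtr1 ltr_sqrt.
pose nm f := Num.sqrt (ip f f).
have nmF f g : nm (F f - F g) <= s * nm (f - g).
  by rewrite /nm /s -sqrtrM// ler_sqrt// mulr_ge0// (ip_ge0 H).
have nmD f g : nm (f + g) <= nm f + nm g.
  rewrite -(@ler_pXn2r _ 2)// ?nnegrE ?addr_ge0 ?sqrtr_ge0//.
  rewrite sqrrD !sqr_sqrtr ?(ip_ge0 H)// !(ipDl H, ipDr) (ipC H g f).
  have : ip f g <= nm f * nm g.
    apply: le_trans (ler_norm _) _; rewrite -sqrtr_sqr -sqrtrM ?(ip_ge0 H)//.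
    by rewrite ler_sqrt ?mulr_ge0 ?(ip_ge0 H)// ip_cauchy_schwarz.
  by lra.
pose c := nm (u 1%N - u 0%N) / (1 - s).
have c0 : 0 <= c by rewrite divr_ge0 ?sqrtr_ge0// subr_ge0 ltW.
have nmS n : nm (u n.+1 - u n) <= s ^+ n * nm (u 1%N - u 0%N).
  elim: n => [|n IH]; first by rewrite mul1r.
  apply: le_trans (nmF _ _) _; rewrite exprS -mulrA ler_wpM2l//.
have nmu n m : nm (u (n + m)%N - u n) <= s ^+ n * c.
  (* The exact partial geometric sum is what the induction on [m] can carry. *)
  suff : nm (u (n + m)%N - u n) <= s ^+ n * c * (1 - s ^+ m).
    move=> /le_trans; apply; apply: ler_piMr.
      by apply: mulr_ge0 => //; exact: exprn_ge0.
    by rewrite gerBl exprn_ge0.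
  elim: m => [|m IH]; first by rewrite addn0 subrr expr0 subrr mulr0 /nm ip0l sqrtr0.
  have -> : u (n + m.+1)%N - u n = (u (n + m).+1 - u (n + m)%N) + (u (n + m)%N - u n).
    by rewrite addnS addrA subrK.
  apply: le_trans (nmD _ _) _; apply: le_trans (lerD (nmS _) IH) _.
  have -> : nm (u 1%N - u 0%N) = c * (1 - s).
    by rewrite /c divfK// subr_eq0 gt_eqF.
  by rewrite exprD exprS le_eqVlt; apply/orP; left; apply/eqP; ring.
have s_lt e : 0 < e -> exists N, s ^+ N * c < e.
  move=> e0.
  have /cvgrPdist_lt/(_ (e / (c + 1))) : (fun n => s ^+ n) @ \oo --> (0 : R).
    by apply: cvg_expr; rewrite ger0_norm.
  case=> [|N _ /(_ N (leqnn _))/=]; first by rewrite divr_gt0// ltr_wpDl.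
  rewrite sub0r normrN ger0_norm ?exprn_ge0// => h; exists N.
  apply: le_lt_trans (_ : s ^+ N * (c + 1) < e).
    by rewrite ler_wpM2l ?exprn_ge0// lerDl.
  by rewrite -ltr_pdivlMr// ltr_wpDl.
have sqr_lt f e : 0 < e -> nm f < Num.sqrt e -> ip f f < e.
  by move=> e0; rewrite /nm ltr_sqrt.
have u_cauchy m n N : (N <= m)%N -> (N <= n)%N -> nm (u m - u n) <= 2 * (s ^+ N * c).
  move=> Nm Nn; have -> : u m - u n = (u m - u N) + - (u n - u N).
    by rewrite opprB addrA subrK.
  apply: le_trans (nmD _ _) _; rewrite {2}/nm ipNl ipNr opprK -/(nm _).
  have := nmu N (m - N)%N; have := nmu N (n - N)%N.
  by rewrite !subnKC//; lra.
case: (ip_complete H (u := u)) => [e e0|f fu].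
  have e0' : 0 < Num.sqrt e by rewrite sqrtr_gt0.
  have [|N hN] := s_lt (Num.sqrt e / 2); first by lra.
  exists N => m n Nm Nn; apply: sqr_lt => //.
  by apply: le_lt_trans (u_cauchy _ _ _ Nm Nn) _; lra.
exists f; apply/eqP; rewrite eq_le (ip_ge0 H) andbT; apply/ler_addgt0Pl => e e0.
rewrite addr0; have [|N hN] := fu (e / 4); first by lra.
have -> : F f - f = (F f - F (u N)) + (u N.+1 - f).
  by rewrite /u iterS addrA subrK.
apply: le_trans (ip_sqrD_le _ _) _.
have h1 := hN _ (leqnn N); have h2 := hN _ (leqnSn N).
have h3 : ip (F f - F (u N)) (F f - F (u N)) <= ip (u N - f) (u N - f).
  apply: le_trans (FL _ _) _; rewrite -opprB ipNl ipNr opprK.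
  by rewrite ler_piMl ?(ip_ge0 H)// ltW.
by lra.
Qed.

(* The equation S f = g is solved by iterating f |-> f - t S'(S f - g). *)
Lemma bounded_below_surjective (S S' : V -> V) (M k : R) (g : V) :
  (forall f f', ip (S f) f' = ip f (S' f')) ->
  0 < k -> 0 < M ->
  (forall f, ip (S' f) (S' f) <= M * ip f f) ->
  (forall f, k * ip f f <= ip (S f) (S f)) ->
  (forall f, k * ip f f <= ip (S' f) (S' f)) ->
  exists f, ip (S f - g) (S f - g) = 0.
Proof.
move=> adj k0 M0 S'M Sk S'k.
have adj' f f' : ip (S' f) f' = ip f (S f') by rewrite (ipC H) -adj (ipC H).
pose F f := f - M^-1 *: S' (S f - g).
have FB f f' w : ip (F f - F f') w = ip (f - f') w - M^-1 * ip (S' (S (f - f'))) w.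
  rewrite /F !ipBl !(ipZl H) !adj' !adj !ipBl !adj; ring.
(* For [w = f - f'] the square is |w|^2 - 2 |S w|^2 / M + |S' S w|^2 / M^2, and |S' S w|^2 <= M |S
   w|^2. The maximum with 0 avoids comparing [k] with [M]. *)
have FN f f' : ip (F f - F f') (F f - F f') <=
    Num.max 0 (1 - k / M) * ip (f - f') (f - f').
  set w := f - f'.
  have -> : ip (F f - F f') (F f - F f') = ip w w - M^-1 * ip (S' (S w)) w
      - M^-1 * (ip (S' (S w)) w - M^-1 * ip (S' (S w)) (S' (S w))).
    rewrite FB (ipC H (f - f')) (ipC H (S' (S _))) !FB -/w.
    by rewrite (ipC H w (S' (S w))).
  have h1 : ip (S' (S w)) w = ip (S w) (S w) by rewrite adj'.
  rewrite h1; have h2 := S'M (S w).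
  have h3 := Sk w.
  have Mi0 : 0 < M^-1 by rewrite invr_gt0.
  have h4 : M^-1 * ip (S' (S w)) (S' (S w)) <= ip (S w) (S w).
    by rewrite mulrC ler_pdivrMr// mulrC.
  apply: (@le_trans _ _ ((1 - k / M) * ip w w)); last first.
    by rewrite ler_wpM2r ?(ip_ge0 H)// le_max lexx orbT.
  have h5 : M^-1 * (M^-1 * ip (S' (S w)) (S' (S w))) <= M^-1 * ip (S w) (S w).
    by rewrite ler_wpM2l// ltW.
  have h6 : M^-1 * (k * ip w w) <= M^-1 * ip (S w) (S w).
    by rewrite ler_wpM2l// ltW.
  have -> : (1 - k / M) * ip w w = ip w w - M^-1 * (k * ip w w) by ring.
  by rewrite mulrBr; lra.
have [|f Ff] := contraction_fixpoint _ FN.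
  by rewrite le_max lexx /= gt_max ltr01 gtrBl divr_gt0.
(* At the fixed point S'(S f - g) is null, and S' is bounded below. *)
exists f; apply/eqP; rewrite eq_le (ip_ge0 H) andbT.
have := S'k (S f - g); rewrite -[leRHS](@mulKf _ M^-1) ?invr_eq0 ?gt_eqF// invrK.
have -> : M^-1 * ip (S' (S f - g)) (S' (S f - g)) = - ip (F f - f) (S' (S f - g)).
  by rewrite /F addrAC subrr add0r ipNl (ipZl H) opprK.
by rewrite (ip_null _ Ff) oppr0 mulr0 pmulr_rle0.
Qed.

Definition orthonormal k (e : 'I_k -> V) := forall i j, ip (e i) (e j) = (i == j)%:R.

Section top.
Variable T : V -> V.
Hypothesis Tsym : forall f g, ip (T f) g = ip f (T g).
Hypothesis T1 : forall f, ip (T f) f <= ip f f.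
Hypothesis TN1 : forall f, - ip f f <= ip (T f) f.

(** The equation is tested against all vectors, because [T f] and [lam *: f] may differ by a null
    vector. *)
Definition eigen_at (f : V) (lam : R) := forall g, ip (T f) g = lam * ip f g.

Definition eigenfamily (a : R) k (e : 'I_k -> V) (lam : 'I_k -> R) :=
  orthonormal e /\ forall i, eigen_at (e i) (lam i) /\ 1 - a < lam i.

(** The substitute for compactness: [1 - T] is bounded below by [a] on the common kernel of the
    functionals [ip f (l i)]. *)
Definition coercive_mod (a B : R) N (l : 'I_N -> V) := forall f,
  a * ip f f <= ip f f - ip (T f) f + B * \sum_i ip f (l i) ^+ 2.

(** [T] is not assumed linear; symmetry makes it linear when tested against vectors. *)
Lemma T_add f g w : ip (T (f + g)) w = ip (T f) w + ip (T g) w.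
Proof. by rewrite !Tsym (ipDl H). Qed.

Lemma T_scale a f w : ip (T (a *: f)) w = a * ip (T f) w.
Proof. by rewrite !Tsym (ipZl H). Qed.

Lemma T_opp f w : ip (T (- f)) w = - ip (T f) w.
Proof. by rewrite -scaleN1r T_scale mulN1r. Qed.

Lemma T_sub f g w : ip (T (f - g)) w = ip (T f) w - ip (T g) w.
Proof. by rewrite T_add T_opp. Qed.

Lemma T_sum I (r : seq I) (P : pred I) (F : I -> V) w :
  ip (T (\sum_(i <- r | P i) F i)) w = \sum_(i <- r | P i) ip (T (F i)) w.
Proof. by rewrite Tsym ip_suml; apply: eq_bigr => i _; rewrite Tsym. Qed.

Lemma rV_norm_le N (v : 'rV[R]_N) (r : R) : 0 <= r ->
  (forall i, `|v ord0 i| <= r) -> `|v| <= r.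
Proof.
move=> r0 vr; rewrite /Num.Def.normr/= mx_normrE.
by apply: bigmax_le => // -[i j] _ /=; rewrite (ord1 i).
Qed.

Lemma rV_norm_ge N (v : 'rV[R]_N) i : `|v ord0 i| <= `|v|.
Proof.
by rewrite [leRHS]/Num.Def.normr/= mx_normrE;
  apply/bigmax_geP; right; exists (ord0, i).
Qed.

(** Bolzano-Weierstrass from a cluster point. The indices [m n] need not increase: [n <= m n] is
    enough to carry over error bounds that decrease in the index. *)
Lemma bounded_subsequence N (c : nat -> 'rV[R]_N) (r : R) :
  (forall n, `|c n| <= r) ->
  exists (m : nat -> nat) (v : 'rV[R]_N), forall n,
    (n <= m n)%N /\ `|v - c (m n)| < n.+1%:R^-1.
Proof.
move=> cr.
have : compact [set v : 'rV[R]_N | `|v| <= r].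
  apply: bounded_closed_compact.
    by exists r; split; [exact: num_real|move=> s rs v /= /le_trans; apply; exact: ltW].
  rewrite (_ : mkset _ = (fun v : 'rV[R]_N => `|v|) @^-1` [set x | x <= r])//.
  by apply: closed_comp => [v _|]; [exact: norm_continuous|exact: closed_le].
move=> cK; have [|v [_ vc]] := cK (c @ \oo) _.
  by exists 0%N => // n _; exact: cr.
have /choice[m hm] : forall n, exists k, (n <= k)%N /\ `|v - c k| < n.+1%:R^-1.
  move=> n; have := vc (c @` [set k | (n <= k)%N]) (ball v n.+1%:R^-1).
  case=> [||w [[k /= nk <-] wb]].
  - by exists n => // k /= nk; exists k.
  - by apply: nbhsx_ballx; rewrite invr_gt0.
  - by exists k; split=> //; move: wb; rewrite -ball_normE.
by exists m, v.
Qed.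

Lemma ipT_null f : ip f f = 0 -> ip (T f) f = 0.
Proof. by move=> f0; rewrite (ipC H) ip_null. Qed.

Section step.
Variables (N : nat) (l : 'I_N -> V) (a B : R) (k : nat) (e : 'I_k -> V) (lam : 'I_k -> R).
Hypothesis B0 : 0 <= B.
Hypothesis Tl : coercive_mod a B l.
Hypothesis Te : eigenfamily a e lam.

Let D f := forall i, ip f (e i) = 0.

Let DB f g : D f -> D g -> D (f - g).
Proof. by move=> Df Dg i; rewrite ipBl Df Dg subrr. Qed.

Let DZ c f : D f -> D (c *: f).
Proof. by move=> Df i; rewrite (ipZl H) Df mulr0. Qed.

(** The Rayleigh quotients on the complement [D] of the eigenvectors already found; [sup S] will be
    the next eigenvalue. *)
Let S := [set x | exists f, [/\ D f, ip f f = 1 & x = ip (T f) f]].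

Let normalized f : ip f f != 0 ->
  let g := (Num.sqrt (ip f f))^-1 *: f in
  ip g g = 1 /\ ip (T g) g = ip (T f) f / ip f f.
Proof.
move=> f0 g; have q0 : 0 < ip f f by rewrite lt_neqAle eq_sym f0 (ip_ge0 H).
have s2 : (Num.sqrt (ip f f))^-1 * (Num.sqrt (ip f f))^-1 = (ip f f)^-1.
  by rewrite -invfM -expr2 sqr_sqrtr// ltW.
split; first by rewrite /g (ipZl H) ipZr mulrA s2 mulVf.
by rewrite /g T_scale ipZr mulrA s2 mulrC.
Qed.

Let S_ub : ubound S 1.
Proof. by move=> _ [f [_ f1 ->]]; rewrite -f1. Qed.

Let rayleigh_le f : D f -> ip (T f) f <= sup S * ip f f.
Proof.
move=> Df; have [f0|f0] := eqVneq (ip f f) 0.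
  by rewrite f0 mulr0 ipT_null.
have [g1 gT] := normalized f0.
rewrite -ler_pdivrMr; last by rewrite lt_neqAle eq_sym f0 (ip_ge0 H).
apply: ub_le_sup; first by exists 1.
by exists ((Num.sqrt (ip f f))^-1 *: f); split=> //; exact: DZ.
Qed.

(** A form that is nonnegative on [D] and whose null vectors are the maximizers of the Rayleigh
    quotient. *)
Let b f := sup S * ip f f - ip (T f) f.

Let b_ge0 f : D f -> 0 <= b f.
Proof. by move=> /rayleigh_le; rewrite /b subr_ge0. Qed.

Let b_sub f g : b (f - g) + b (f + g) = 2 * b f + 2 * b g.
Proof.
by rewrite /b T_sub T_add !(ipBr, ipDr) !(ipBl, ipDl H) (ipC H g f); ring.
Qed.

(** The supremum is attained. Along a maximizing sequence of unit vectors, thinned so that the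
    finitely many functionals converge, [b] of a difference is small by the parallelogram identity;
    coercivity and [sup S > 1 - a] then make the sequence Cauchy. *)
Let top f0 : D f0 -> (1 - a) * ip f0 f0 < ip (T f0) f0 ->
  exists f, [/\ D f, 0 < ip f f & b f = 0] /\ 1 - a < sup S.
Proof.
move=> Df0 f0a.
have q0 : ip f0 f0 != 0.
  by apply: contraTneq f0a => q0; rewrite ipT_null// q0 mulr0 ltxx.
have [g1 gT] := normalized q0.
have qgt0 : 0 < ip f0 f0 by rewrite lt_neqAle eq_sym q0 (ip_ge0 H).
have Sg : S (ip (T f0) f0 / ip f0 f0).
  by exists ((Num.sqrt (ip f0 f0))^-1 *: f0); split=> //; exact: DZ.
have La : 1 - a < sup S.
  apply: lt_le_trans (ub_le_sup _ Sg); last by exists 1.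
  by rewrite ltr_pdivlMr.
have supS : has_sup S by split; [eexists; exact: Sg|exists 1].
have /choice[u hu] : forall n, exists f, [/\ D f, ip f f = 1 & b f < n.+1%:R^-1].
  move=> n; have [|_ [f [Df f1 ->]] h] := @sup_adherent _ S n.+1%:R^-1 _ supS.
    by rewrite invr_gt0.
  by exists f; split=> //; rewrite /b f1 mulr1 ltrBlDr addrC -ltrBlDr.
pose r : R := 1 + \sum_i ip (l i) (l i).
have r1 : 1 <= r by rewrite /r lerDl sumr_ge0// => i _; exact: (ip_ge0 H).
have [|m [v mv]] := @bounded_subsequence _ (fun n => \row_i ip (u n) (l i)) r.
  move=> n; apply: rV_norm_le => [|i]; first by lra.
  rewrite mxE -(@ler_pXn2r _ 2)// ?nnegrE//; last by lra.
  rewrite real_normK ?num_real//; apply: le_trans (ip_cauchy_schwarz _ _) _.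
  have [_ -> _] := hu n; rewrite mul1r.
  have h1 : ip (l i) (l i) <= r.
    rewrite /r (bigD1 i)//= addrCA lerDl addr_ge0// sumr_ge0// => j _.
    exact: (ip_ge0 H).
  apply: le_trans h1 _; rewrite expr2; apply: ler_peMl => //; lra.
pose w n := u (m n).
have hw n : [/\ D (w n), ip (w n) (w n) = 1 & b (w n) < n.+1%:R^-1].
  have [D1 q1 b1] := hu (m n); split=> //; apply: lt_le_trans b1 _.
  by rewrite lef_pV2 ?posrE// ler_nat; have [] := mv n.
pose c := a - 1 + sup S.
have c0 : 0 < c by rewrite /c; lra.
(* With z = 1/(K+1), each functional of the difference has square at most 4 z^2 <= 4 z, and [b] of
   the difference is at most 4 z. *)
have key n p K : (K <= n)%N -> (K <= p)%N ->
    c * ip (w n - w p) (w n - w p) <= (4 + 4 * B * N%:R) * K.+1%:R^-1.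
  move=> Kn Kp.
  have [D1 q1 b1] := hw n; have [D2 q2 b2] := hw p.
  have h1 := Tl (w n - w p).
  have le1 j : (K <= j)%N -> (j.+1%:R^-1 : R) <= K.+1%:R^-1.
    by move=> Kj; rewrite lef_pV2 ?posrE// ler_nat.
  have h2 : \sum_i ip (w n - w p) (l i) ^+ 2 <= 4 * N%:R * K.+1%:R^-1.
    apply: (@le_trans _ _ (\sum_(i < N) (4 * K.+1%:R^-1))); last first.
      by rewrite sumr_const card_ord -[leLHS]mulr_natr mulrAC.
    apply: ler_sum => i _; rewrite ipBl.
    have vi j : (K <= j)%N -> `|ip (w j) (l i) - v ord0 i| <= K.+1%:R^-1.
      move=> Kj; apply: le_trans (le1 _ Kj); rewrite distrC; apply: le_trans (ltW (mv j).2).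
      have := @rV_norm_ge _ (v - \row_i ip (u (m j)) (l i)) i.
      by rewrite !mxE.
    set z := K.+1%:R^-1; have z1 : z <= 1 by rewrite invf_le1// ler1n.
    have z0 : 0 < z by rewrite invr_gt0.
    have h : `|ip (w n) (l i) - ip (w p) (l i)| <= 2 * z.
      have := vi _ Kn; have := vi _ Kp; rewrite -/z !ler_norml => /andP[p1 p2] /andP[p3 p4].
      by apply/andP; split; lra.
    rewrite -real_normK ?num_real//.
    apply: (@le_trans _ _ ((2 * z) ^+ 2)); first by rewrite ler_pXn2r// nnegrE//; lra.
    rewrite exprMn; have -> : (2 : R) ^+ 2 = 4 by lra.
    by rewrite ler_pM2l// expr2 ger_pMl.
  have h3 : b (w n - w p) <= 4 * K.+1%:R^-1.
    have DD : D (w n + w p) by move=> i; rewrite (ipDl H) D1 D2 addr0.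
    have := b_sub (w n) (w p); have := b_ge0 DD.
    have := lt_le_trans b1 (le1 _ Kn); have := lt_le_trans b2 (le1 _ Kp).
    by set z := K.+1%:R^-1; lra.
  have h4 : B * \sum_i ip (w n - w p) (l i) ^+ 2 <= B * (4 * N%:R * K.+1%:R^-1).
    by rewrite ler_wpM2l.
  rewrite /c; move: h1 h3; rewrite /b => h1 h3.
  rewrite mulrDl mulrBl mul1r.
  have -> : (4 + 4 * B * N%:R) / K.+1%:R = 4 / K.+1%:R + B * (4 * N%:R / K.+1%:R) by ring.
  by move: h1 h3 h4; set z := K.+1%:R^-1; lra.
have small (C eps : R) : 0 < eps -> 0 <= C -> exists K : nat, C * K.+1%:R^-1 < eps.
  move=> e0 C0; have e1 : 0 < eps / (C + 1) by rewrite divr_gt0// ltr_wpDl.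
  have [K _ /(_ K (leqnn K))/= hK] := near_infty_natSinv_lt (PosNum e1).
  exists K; apply: le_lt_trans (_ : (C + 1) * K.+1%:R^-1 < eps).
    by rewrite ler_wpM2r ?invr_ge0// lerDl.
  by rewrite mulrC -ltr_pdivlMr// ltr_wpDl.
have C0 : 0 <= 4 + 4 * B * N%:R by rewrite addr_ge0// !mulr_ge0.
have [eps e0|f fw] := ip_complete H (u := w).
  have [|K hK] := small (4 + 4 * B * N%:R) (c * eps) _ C0; first by rewrite mulr_gt0.
  exists K => n p Kn Kp; rewrite -(ltr_pM2l c0).
  exact: le_lt_trans (key _ _ _ Kn Kp) hK.
have Df : D f.
  move=> i; apply/eqP; rewrite -sqrf_eq0 eq_le sqr_ge0 andbT.
  apply/ler_addgt0Pl => eps e0; rewrite addr0; have [K /(_ K (leqnn K)) hK] := fw _ e0.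
  have := ip_cauchy_schwarz (w K - f) (e i).
  have [D1 _ _] := hw K; rewrite ipBl D1 sub0r sqrrN Te.1 eqxx mulr1 => /le_trans; apply.
  exact: ltW.
exists f; split=> //; split=> //.
  (* A unit vector lies within squared distance 1/4 of [f], so [f] is not null. *)
  have [|K /(_ K (leqnn K)) hK] := fw 4^-1; first by rewrite invr_gt0.
  have [_ q1 _] := hw K; have := ip_sqrD_le (w K - f) f.
  by rewrite subrK q1; lra.
apply/eqP; rewrite eq_le b_ge0// andbT.
apply/ler_addgt0Pl => eps e0; rewrite addr0.
have sS : sup S <= 1 by apply: sup_le_ub => //; exact: supS.1.
have [||K1 hK1] := small 1 (eps / 4); [lra|exact: ler01|].
have [|K2 hK2] := fw (eps / 8); first lra.
pose K := maxn K1 K2.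
have [D1 _ b1] := hw K; have h2 := hK2 K (leq_maxr _ _).
have h1 : b (w K) < eps / 4.
  apply: lt_trans b1 _; rewrite mul1r in hK1; apply: le_lt_trans hK1.
  by rewrite lef_pV2 ?posrE// ler_nat ltnS leq_maxl.
have -> : f = w K - (w K - f) by rewrite subKr.
have h3 : b (w K - f) <= 2 * ip (w K - f) (w K - f).
  rewrite /b; have := TN1 (w K - f).
  have : sup S * ip (w K - f) (w K - f) <= 1 * ip (w K - f) (w K - f).
    by rewrite ler_wpM2r// (ip_ge0 H).
  by lra.
have := b_sub (w K) (w K - f).
have : 0 <= b (w K + (w K - f)).
  by apply: b_ge0 => i; rewrite (ipDl H) DB// D1 addr0.
lra.
Qed.

(** By the discriminant inequality a null vector [f] of the nonnegative form [b] is [b]-orthogonal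
    to all of [D]. The vector [sup S *: f - T f] lies in [D] itself, hence is null. *)
Lemma next_eigenvector f0 : D f0 -> (1 - a) * ip f0 f0 < ip (T f0) f0 ->
  exists f L, [/\ D f, ip f f = 1, eigen_at f L & 1 - a < L].
Proof.
move=> Df0 f0a; have [f [[Df qf bf] La]] := top Df0 f0a.
have bfg g : D g -> sup S * ip f g - ip (T f) g = 0.
  move=> Dg; apply/eqP; rewrite -sqrf_eq0 eq_le sqr_ge0 andbT.
  rewrite -(mul0r (b g)) -bf; apply: quadratic_discriminant => [|t]; first exact: b_ge0.
  have : 0 <= b (f + t *: g).
    by apply: b_ge0 => i; rewrite (ipDl H) (ipZl H) Df Dg mulr0 addr0.
  congr (_ <= _); rewrite /b T_add T_scale !ipDr !ipZr !(ipDl H) !(ipZl H) (ipC H g f).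
  have -> : ip (T g) f = ip (T f) g by rewrite Tsym (ipC H).
  ring.
pose r := sup S *: f - T f.
have Dr : D r.
  move=> i; rewrite /r ipBl (ipZl H) Df mulr0 Tsym.
  by rewrite (ipC H) (Te.2 i).1 (ipC H) Df mulr0 subr0.
have rr : ip r r = 0 by rewrite {1}/r ipBl (ipZl H) bfg.
have fE : eigen_at f (sup S).
  move=> g; have := ip_null g rr; rewrite /r ipBl (ipZl H) => /eqP.
  by rewrite subr_eq0 => /eqP.
have [|g1 _] := @normalized f; first by rewrite gt_eqF.
exists ((Num.sqrt (ip f f))^-1 *: f), (sup S); split=> //; first exact: DZ.
by move=> g; rewrite T_scale (ipZl H) fE mulrCA.
Qed.

End step.

(* A combination of more than N eigenvectors can be chosen orthogonal to all
   the l i. *)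
Lemma eigenfamily_card N (l : 'I_N -> V) a B k (e : 'I_k -> V) lam :
  coercive_mod a B l -> eigenfamily a e lam -> (k <= N)%N.
Proof.
move=> Tl [one Te]; rewrite leqNgt; apply/negP => Nk.
pose A := \matrix_(i < k, j < N) ip (e i) (l j).
have : kermx A != 0.
  rewrite kermx_eq0; apply/negP => /eqP rA.
  by have := rank_leq_col A; rewrite rA leqNgt Nk.
move=> /rowV0Pn[c /sub_kermxP cA c0].
pose f := \sum_i c ord0 i *: e i.
have fe j : ip f (e j) = c ord0 j.
  rewrite ip_suml (bigD1 j)//= big1 ?addr0 => [|i ij].
    by rewrite (ipZl H) one eqxx mulr1.
  by rewrite (ipZl H) one (negbTE ij) mulr0.
have ff : ip f f = \sum_i c ord0 i ^+ 2.
  by rewrite {2}/f ip_sumr; apply: eq_bigr => i _; rewrite ipZr fe expr2.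
have fT : ip (T f) f = \sum_i lam i * c ord0 i ^+ 2.
  rewrite T_sum; apply: eq_bigr => i _.
  by rewrite T_scale (Te i).1 (ipC H) fe expr2 mulrCA.
have fl j : ip f (l j) = 0.
  have /rowP/(_ j) := cA; rewrite !mxE => cAj; rewrite ip_suml -[RHS]cAj.
  by apply: eq_bigr => i _; rewrite (ipZl H) mxE.
have := Tl f; rewrite big1 ?mulr0 ?addr0 => [|i _]; last by rewrite fl expr0n.
rewrite ff fT -sumrB mulr_sumr -subr_ge0 -sumrB leNgt => /negP; apply.
have /rV0Pn[i ci] := c0.
rewrite (bigD1 i)//= -[ltRHS]addr0 ltr_leD//.
  have -> : c ord0 i ^+ 2 - lam i * c ord0 i ^+ 2 - a * c ord0 i ^+ 2 =
    - ((lam i - (1 - a)) * c ord0 i ^+ 2) by ring.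
  by rewrite oppr_lt0 mulr_gt0 ?subr_gt0 ?(Te i).2// lt_neqAle sqr_ge0 eq_sym sqrf_eq0 ci.
apply: sumr_le0 => j _.
have -> : c ord0 j ^+ 2 - lam j * c ord0 j ^+ 2 - a * c ord0 j ^+ 2 =
    - ((lam j - (1 - a)) * c ord0 j ^+ 2) by ring.
by rewrite oppr_le0 mulr_ge0 ?sqr_ge0// ltW// subr_gt0 (Te j).2.
Qed.

(** If no family exhausted the spectrum above [1 - a], [next_eigenvector] would extend every family,
    and one of length [N.+1] would contradict [eigenfamily_card]. *)
Theorem spectral_decomposition N (l : 'I_N -> V) a B : 0 <= B ->
  coercive_mod a B l ->
  exists k (e : 'I_k -> V) (lam : 'I_k -> R), eigenfamily a e lam /\
    forall f, (forall i, ip f (e i) = 0) -> ip (T f) f <= (1 - a) * ip f f.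
Proof.
move=> B0 Tl.
have [//|noext] := pselect (exists k (e : 'I_k -> V) (lam : 'I_k -> R), eigenfamily a e lam /\
    forall f, (forall i, ip f (e i) = 0) -> ip (T f) f <= (1 - a) * ip f f).
have : forall k, exists (e : 'I_k -> V) (lam : 'I_k -> R), eigenfamily a e lam.
  elim=> [|k [e [lam Te]]].
    by exists (fun=> 0), (fun=> 0); split=> -[].
  have [f0 [Df0 f0a]] : exists f0, (forall i, ip f0 (e i) = 0) /\
      (1 - a) * ip f0 f0 < ip (T f0) f0.
    apply: contrapT => nf; apply: noext; exists k, e, lam; split=> // f Df.
    by rewrite leNgt; apply/negP => fa; apply: nf; exists f.
  have [f [L [Df f1 fL La]]] := next_eigenvector B0 Tl Te Df0 f0a.
  exists (fun i => if unlift ord0 i is Some j then e j else f),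
    (fun i => if unlift ord0 i is Some j then lam j else L); split.
    move=> i j; case: (unliftP ord0 i) => [i' ->|->]; case: (unliftP ord0 j) => [j' ->|->].
    - by rewrite (inj_eq lift_inj) Te.1.
    - by rewrite (ipC H) Df.
    - by rewrite Df.
    - by rewrite f1 eqxx.
  by move=> i; case: (unliftP ord0 i) => [i' _|_] //; exact: Te.2.
move=> /(_ N.+1)[e [lam /(eigenfamily_card Tl)]].
by rewrite ltnn.
Qed.

End top.
End theory.
End semi_hilbert.
Arguments orthonormal {R V} ip {k} e.
Arguments eigen_at {R V} ip T f lam.
Arguments eigenfamily {R V} ip T a {k} e lam.
Arguments coercive_mod {R V} ip T a B {N} l.

(** * Resolvent estimates on pairs of vectors, and eigenvalue counting *)

Section pair.
Context {R : realType} {V : lmodType R} {ip : V -> V -> R} (H : semi_hilbert ip).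

(** [V * V] is the complexification of [V], seen as a real space: a pair holds the real and
    imaginary parts. *)
Definition ip_pair (p q : V * V) : R := ip p.1 q.1 + ip p.2 q.2.

Lemma semi_hilbert_pair : semi_hilbert ip_pair.
Proof.
split.
- by move=> f g; rewrite /ip_pair !(ipC H f.1, ipC H f.2).
- by move=> f g k; rewrite /ip_pair /= !(ipDl H); ring.
- by move=> a f g; rewrite /ip_pair /= !(ipZl H); ring.
- by move=> f; rewrite addr_ge0// (ip_ge0 H).
- move=> u uC.
  have [e e0|f1 f1u] := ip_complete H (u := fst \o u).
    have [N hN] := uC _ e0; exists N => m n Nm Nn.
    by apply: le_lt_trans (hN _ _ Nm Nn); rewrite /ip_pair lerDl (ip_ge0 H).
  have [e e0|f2 f2u] := ip_complete H (u := snd \o u).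
    have [N hN] := uC _ e0; exists N => m n Nm Nn.
    by apply: le_lt_trans (hN _ _ Nm Nn); rewrite /ip_pair lerDr (ip_ge0 H).
  exists (f1, f2) => e e0; have e20 : 0 < e / 2 by rewrite divr_gt0.
  have [N1 h1] := f1u _ e20; have [N2 h2] := f2u _ e20.
  exists (maxn N1 N2) => n; rewrite geq_max => /andP[n1 n2].
  rewrite [e]splitr /ip_pair /=; apply: ltrD; [exact: h1|exact: h2].
Qed.

Variable T : V -> V.
Hypothesis Tsym : forall f g, ip (T f) g = ip f (T g).
Hypothesis Tb : forall f, ip (T f) (T f) <= ip f f.

(* The real and imaginary parts of (T - (x + iy)) (u + iv). *)
Definition shift_re x y (u v : V) := T u - x *: u + y *: v.
Definition shift_im x y (u v : V) := T v - x *: v - y *: u.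

Let shift_b x u : ip (T u - x *: u) (T u - x *: u) <= (2 + 2 * x ^+ 2) * ip u u.
Proof.
apply: le_trans (ip_sqrB_le H _ _) _; rewrite (ipZl H) (ipZr H).
have := Tb u; rewrite mulrDl mulrA -expr2; lra.
Qed.

(** The adjoint of T - (x + iy) is T - (x - iy), which becomes the original operator when the two
    components are swapped; one lower bound therefore serves both in [bounded_below_surjective]. *)
Lemma resolvent_solve (x y k : R) (g1 g2 : V) : 0 < k ->
  (forall u v, k * (ip u u + ip v v) <=
     ip (shift_re x y u v) (shift_re x y u v) + ip (shift_im x y u v) (shift_im x y u v)) ->
  exists u v, ip (shift_re x y u v - g1) (shift_re x y u v - g1) = 0 /\
              ip (shift_im x y u v - g2) (shift_im x y u v - g2) = 0.
Proof.
move=> k0 hk.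
pose S p := (shift_re x y p.1 p.2, shift_im x y p.1 p.2).
pose S' p := (shift_re x (- y) p.1 p.2, shift_im x (- y) p.1 p.2).
have S'E p : S' p = ((S (p.2, p.1)).2, (S (p.2, p.1)).1).
  by rewrite /S' /S /shift_re /shift_im /= !scaleNr opprK.
have Sb p : ip_pair (S p) (S p) <= (4 + 4 * x ^+ 2 + 2 * y ^+ 2) * ip_pair p p.
  rewrite /ip_pair /S /= /shift_re /shift_im.
  have h1 := ip_sqrD_le H (T p.1 - x *: p.1) (y *: p.2).
  have h2 := ip_sqrB_le H (T p.2 - x *: p.2) (y *: p.1).
  move: h1 h2; rewrite !(ipZl H) !(ipZr H) ![y * (y * _)]mulrA -!expr2 => h1 h2.
  apply: le_trans (lerD h1 h2) _.
  have := shift_b x p.1; have := shift_b x p.2.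
  by rewrite !mulrDl !mulrDr -!mulrA; lra.
have [||||||[u v] uv] := @bounded_below_surjective R _ _ semi_hilbert_pair S S'
    (4 + 4 * x ^+ 2 + 2 * y ^+ 2) k (g1, g2).
- move=> [u v] [u' v']; rewrite /ip_pair /S /S' /shift_re /shift_im /= !scaleNr opprK.
  rewrite !(ipBl H, ipDl H, ipNl H) !(ipDr H, ipBr H, ipNr H) !(ipZl H, ipZr H) !Tsym; ring.
- exact: k0.
- by have := sqr_ge0 x; have := sqr_ge0 y; lra.
- move=> p; rewrite S'E; have := Sb (p.2, p.1); rewrite /ip_pair /=; lra.
- by move=> p; exact: hk.
- move=> p; rewrite S'E; have := hk p.2 p.1.
  by rewrite /ip_pair /=; lra.
exists u, v; move: uv; rewrite /ip_pair /=.
by move=> /eqP; rewrite paddr_eq0 ?(ip_ge0 H)// => /andP[/eqP ? /eqP ?].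
Qed.

Lemma ip_null_eq f g : ip (f - g) (f - g) = 0 -> forall w, ip f w = ip g w.
Proof.
move=> fg w; have := ip_null H w fg.
by rewrite (ipBl H) => /eqP; rewrite subr_eq0 => /eqP.
Qed.

Lemma resolvent_unique (x y k : R) (g1 g2 u v u' v' : V) : 0 < k ->
  (forall u v, k * (ip u u + ip v v) <=
     ip (shift_re x y u v) (shift_re x y u v) + ip (shift_im x y u v) (shift_im x y u v)) ->
  ip (shift_re x y u v - g1) (shift_re x y u v - g1) = 0 ->
  ip (shift_im x y u v - g2) (shift_im x y u v - g2) = 0 ->
  ip (shift_re x y u' v' - g1) (shift_re x y u' v' - g1) = 0 ->
  ip (shift_im x y u' v' - g2) (shift_im x y u' v' - g2) = 0 ->
  ip (u' - u) (u' - u) = 0 /\ ip (v' - v) (v' - v) = 0.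
Proof.
move=> k0 hk hu hv hu' hv'.
have z1 w : ip (shift_re x y (u' - u) (v' - v)) w = 0.
  have := ip_null_eq hu w; have := ip_null_eq hu' w.
  by rewrite /shift_re !(ipBl H, ipDl H, ipZl H, T_sub H Tsym); lra.
have z2 w : ip (shift_im x y (u' - u) (v' - v)) w = 0.
  have := ip_null_eq hv w; have := ip_null_eq hv' w.
  by rewrite /shift_im !(ipBl H, ipDl H, ipZl H, T_sub H Tsym); lra.
have := hk (u' - u) (v' - v); rewrite z1 z2 addr0 pmulr_rle0// => h.
have := ip_ge0 H (u' - u); have := ip_ge0 H (v' - v).
by split; lra.
Qed.

(** By symmetry of [T] the cross terms cancel, and the right side is |(T - x)(u + iv)|^2 + y^2 |u +
    iv|^2. *)
Lemma shift_nonreal x y u v : y ^+ 2 * (ip u u + ip v v) <=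
     ip (shift_re x y u v) (shift_re x y u v) + ip (shift_im x y u v) (shift_im x y u v).
Proof.
have := ip_ge0 H (T u - x *: u); have := ip_ge0 H (T v - x *: v).
rewrite /shift_re /shift_im.
have E1 : ip (T u - x *: u) v = ip (T v - x *: v) u.
  by rewrite !(ipBl H) !(ipZl H) (ipC H u v) Tsym (ipC H u).
move: (T u - x *: u) (T v - x *: v) E1 => a b E1 a0 b0.
rewrite !(ipBl H, ipDl H) !(ipBr H, ipDr H) !(ipZl H, ipZr H).
rewrite (ipC H v a) (ipC H u b) E1 ![y * (y * _)]mulrA -!expr2.
rewrite mulrDr; lra.
Qed.

Lemma shift_real x k u v : (forall f, k * ip f f <= ip (T f - x *: f) (T f - x *: f)) ->
  k * (ip u u + ip v v) <=
     ip (shift_re x 0 u v) (shift_re x 0 u v) + ip (shift_im x 0 u v) (shift_im x 0 u v).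
Proof.
by move=> hk; rewrite /shift_re /shift_im !scale0r addr0 subr0 mulrDr lerD.
Qed.

Lemma below_of_form x c (f : V) : 0 <= c ->
  c * ip f f <= `|ip (T f - x *: f) f| ->
  c ^+ 2 * ip f f <= ip (T f - x *: f) (T f - x *: f).
Proof.
move=> c0 hc; have [f0|f0] := eqVneq (ip f f) 0; first by rewrite f0 mulr0 (ip_ge0 H).
have qf : 0 < ip f f by rewrite lt_neqAle eq_sym f0 (ip_ge0 H).
rewrite -(ler_pM2r qf); apply: le_trans (ip_cauchy_schwarz H _ _).
rewrite -(real_normK (num_real (ip _ f))) -mulrA -expr2 -exprMn.
by rewrite ler_pXn2r// nnegrE mulr_ge0// ltW.
Qed.

Section decomposition.
Variables (a : R) (k : nat) (e : 'I_k -> V) (lam : 'I_k -> R).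
Hypothesis Te : eigenfamily ip T a e lam.
Hypothesis Tperp : forall f, (forall i, ip f (e i) = 0) -> ip (T f) f <= (1 - a) * ip f f.

Definition residual f := f - \sum_i ip f (e i) *: e i.

Lemma residual_perp f i : ip (residual f) (e i) = 0.
Proof.
rewrite (ipBl H) (ip_suml H) (bigD1 i)//= big1 => [|j ji].
  by rewrite (ipZl H) Te.1 eqxx mulr1 addr0 subrr.
by rewrite (ipZl H) Te.1 (negbTE ji) mulr0.
Qed.

Lemma residual_perp_r f g : (forall i, ip g (e i) = 0) -> ip (residual f) g = ip f g.
Proof.
move=> ge; rewrite (ipBl H) (ip_suml H) big1 ?subr0// => i _.
by rewrite (ipZl H) (ipC H (e i)) ge mulr0.
Qed.

Lemma pythagoras f : ip f f = \sum_i ip f (e i) ^+ 2 + ip (residual f) (residual f).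
Proof.
rewrite (residual_perp_r f (residual_perp f)) /residual (ipBr H) (ip_sumr H).
under [X in _ - X]eq_bigr do rewrite (ipZr H) -expr2.
by rewrite addrC subrK.
Qed.

Lemma eigen_coef f i : ip (T f) (e i) = lam i * ip f (e i).
Proof. by rewrite Tsym (ipC H) (Te.2 i).1 (ipC H). Qed.

Lemma form_decomposition f :
  ip (T f) f = \sum_i lam i * ip f (e i) ^+ 2 + ip (T (residual f)) (residual f).
Proof.
have ap g : (forall i, ip g (e i) = 0) -> forall i, ip (T g) (e i) = 0.
  by move=> ge i; rewrite eigen_coef ge mulr0.
have -> : ip (T (residual f)) (residual f) = ip (T f) (residual f).
  rewrite (T_sub H Tsym) (T_sum H Tsym) big1 ?subr0// => i _.
  by rewrite (T_scale H Tsym) (Te.2 i).1 (ipC H (e i)) residual_perp !mulr0.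
rewrite /residual (ipBr H) (ip_sumr H) addrCA -[LHS]addr0; congr (_ + _).
apply/esym/eqP; rewrite subr_eq0; apply/eqP/eq_bigr => i _.
by rewrite (ipZr H) eigen_coef expr2 mulrCA.
Qed.

(** [T - x] respects the splitting into the span of the [e i], where it multiplies by [lam i - x],
    and its complement, where the form of [x - T] is at least [x - 1 + a]. The constant is the least
    of these squared. *)
Lemma below_gap x : 1 - a < x -> (forall i, lam i != x) ->
  exists2 c, 0 < c & forall f, c * ip f f <= ip (T f - x *: f) (T f - x *: f).
Proof.
move=> ax lx.
pose c := \big[Order.min/(x - 1 + a) ^+ 2]_(i < k) (lam i - x) ^+ 2.
have c0 : 0 < c.
  apply: lt_bigmin => [|i _]; first by rewrite exprn_gt0//; lra.
  by rewrite lt_neqAle sqr_ge0 eq_sym sqrf_eq0 subr_eq0 lx.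
exists c => // f; set g := T f - x *: f.
rewrite (pythagoras f) (pythagoras g) mulrDr; apply: lerD.
  rewrite mulr_sumr; apply: ler_sum => i _.
  rewrite /g (ipBl H) eigen_coef (ipZl H) -mulrBl exprMn ler_wpM2r ?sqr_ge0//.
  exact: bigmin_le_cond.
set w := residual f; have wp := residual_perp f.
have gw : ip (residual g) w = ip (T w) w - x * ip w w.
  rewrite (residual_perp_r _ wp) (ipBl H) (ipZl H).
  rewrite -(residual_perp_r f wp) -/w; congr (_ - _).
  have Twp i : ip (T w) (e i) = 0 by rewrite eigen_coef wp mulr0.
  by rewrite !Tsym -(residual_perp_r f Twp).
have [w0|w0] := eqVneq (ip w w) 0; first by rewrite w0 mulr0 (ip_ge0 H).
have qw : 0 < ip w w by rewrite lt_neqAle eq_sym w0 (ip_ge0 H).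
apply: (@le_trans _ _ ((x - 1 + a) ^+ 2 * ip w w)).
  by rewrite ler_wpM2r ?(ltW qw)//; exact: bigmin_le_id.
rewrite -(ler_pM2r qw); apply: le_trans (ip_cauchy_schwarz H _ _).
rewrite -(sqrrN (ip _ w)) -mulrA -expr2 -exprMn ler_pXn2r// ?nnegrE.
- by rewrite gw; have := Tperp wp; rewrite !mulrBl !mulrDl; lra.
- by rewrite mulr_ge0 ?(ltW qw)//; lra.
- rewrite gw; have := Tperp wp => h.
  have : (1 - a) * ip w w <= x * ip w w by rewrite ler_pM2r// ltW.
  lra.
Qed.

(** The residual [w] still satisfies [ip (T w) w = x * ip w w], which is impossible on the
    complement unless [w] is null. *)
Lemma eigen_expansion f x : 1 - a < x -> eigen_at ip T f x ->
  let g := f - \sum_(i | lam i == x) ip f (e i) *: e i in ip g g = 0.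
Proof.
move=> ax fx g.
have coef i : lam i != x -> ip f (e i) = 0.
  move=> lx; have := eigen_coef f i; rewrite fx => /eqP.
  by rewrite eq_sym -subr_eq0 -mulrBl mulf_eq0 subr_eq0 (negbTE lx) => /eqP.
have -> : g = residual f.
  rewrite /g /residual; congr (_ - _); rewrite [RHS](bigID (fun i => lam i == x))/=.
  rewrite [X in _ = _ + X]big1 ?addr0// => i lx.
  by rewrite coef// scale0r.
set w := residual f; have wp := residual_perp f; rewrite -/w in wp.
have Twp i : ip (T w) (e i) = 0 by rewrite eigen_coef wp mulr0.
have : ip (T w) w = x * ip w w.
  rewrite Tsym (residual_perp_r f Twp) -Tsym fx.
  by rewrite -(residual_perp_r f wp).
move=> Tw; have := Tperp wp; rewrite Tw -subr_ge0 -mulrBl => h.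
apply/eqP; rewrite eq_le (ip_ge0 H) andbT.
by rewrite -oppr_ge0 -(@pmulr_rge0 _ (x - (1 - a))) ?subr_gt0// mulrN -mulNr opprB.
Qed.

(* If fewer than n eigenvalues were at least 1 - s, some combination of the
   chi j would be orthogonal to all their eigenvectors. *)
Lemma many_eigenvalues n (chi : 'I_n -> V) (s t : R) : t < s -> s <= a ->
  (forall c : 'rV[R]_n, c != 0 -> let f := \sum_j c ord0 j *: chi j in
     0 < ip f f /\ (1 - t) * ip f f <= ip (T f) f) ->
  (n <= #|[pred i | (1 - s <= lam i)%R]|)%N.
Proof.
move=> ts sa hchi; rewrite leqNgt; apply/negP => kn.
set P := [pred i | _] in kn.
pose A := \matrix_(j < n, i < #|P|) ip (chi j) (e (enum_val i)).
have : kermx A != 0.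
  rewrite kermx_eq0; apply/negP => /eqP rA.
  by have := rank_leq_col A; rewrite rA leqNgt kn.
move=> /rowV0Pn[c /sub_kermxP cA c0].
have [] := hchi c c0; set f := \sum_j _ => qf fT.
have fe i : 1 - s <= lam i -> ip f (e i) = 0.
  move=> si; have Pi : i \in P by [].
  have /rowP/(_ (enum_rank_in Pi i)) := cA; rewrite !mxE => cAj; rewrite (ip_suml H) -[RHS]cAj.
  by apply: eq_bigr => j _; rewrite (ipZl H) mxE enum_rankK_in.
move: fT; rewrite leNgt => /negP; apply.
apply: (@le_lt_trans _ _ ((1 - s) * ip f f)); last by rewrite ltr_pM2r//; lra.
rewrite form_decomposition (pythagoras f) mulrDr; apply: lerD.
  rewrite mulr_sumr; apply: ler_sum => i _.
  have [si|si] := leP (1 - s) (lam i); first by rewrite (fe i si) expr0n /= !mulr0.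
  by rewrite ler_wpM2r ?sqr_ge0// ltW.
apply: le_trans (Tperp (residual_perp f)) _.
by rewrite ler_wpM2r ?(ip_ge0 H)//; lra.
Qed.

Lemma few_eigenvalues N (l : 'I_N -> V) b B : coercive_mod ip T b B l ->
  (#|[pred i | (1 - b < lam i)%R]| <= N)%N.
Proof.
move=> Tl; set P := [pred i | _].
apply: (eigenfamily_card H Tsym (e := fun i : 'I_#|P| => e (enum_val i))
  (lam := fun i => lam (enum_val i)) Tl).
split=> [i j|i]; first by rewrite Te.1 (inj_eq enum_val_inj).
by split; [exact: (Te.2 _).1|have := enum_valP i; rewrite inE].
Qed.

End decomposition.
End pair.

(** * The real L2 space of a probability measure *)

Section L2_space.
Context d (T : measurableType d) (R : realType) (mu : probability T R).
Local Notation V := (LfunType mu (lee1n 2)).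
Local Notation "f \in2" := (f \in Lfun mu 2%:E) (at level 70).

Lemma Lfun2P (f : T -> R) : f \in Lfun mu 2%:E <->
  measurable_fun setT f /\ (\int[mu]_x (f x ^+ 2)%:E < +oo)%E.
Proof.
split=> [fL|[mf fi]].
  have := Lfun2_integrable_sqr fL => /integrableP[_].
  under eq_integral do rewrite /= ger0_norm ?sqr_ge0//.
  by split=> //; move: fL; rewrite inE => /andP[/[!inE]].
rewrite inE; apply/andP; split; rewrite inE//= /finite_norm unlock.
apply: poweR_lty; under eq_integral do rewrite /= powR_mulrn// real_normK ?num_real//.
exact: fi.
Qed.

Lemma Lfun2_measurable (f : T -> R) : f \in Lfun mu 2%:E -> measurable_fun setT f.
Proof. by move=> /Lfun2P[]. Qed.

Lemma V_Lfun (f : V) : (f : T -> R) \in Lfun mu 2%:E.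
Proof. exact: LfunP. Qed.

Definition to_V (f : T -> R) (fL : f \in Lfun mu 2%:E) : V := Lfun_Sub (lee1n 2) fL.

Lemma to_VE (f : T -> R) (fL : f \in Lfun mu 2%:E) : to_V fL = f :> (T -> R).
Proof. by []. Qed.

Definition ipL (f g : V) : R := \int[mu]_x (f x * g x).

Lemma ipL_integrable (f g : V) : mu.-integrable setT (EFin \o (fun x => f x * g x)).
Proof.
by apply/Lfun1_integrable; apply: Lfun2_mul_Lfun1; exact: V_Lfun.
Qed.

Lemma ipL_sqrE (f : V) : (ipL f f)%:E = (\int[mu]_x (f x ^+ 2)%:E)%E.
Proof.
rewrite /ipL /Rintegral fineK; last exact: integrable_fin_num (ipL_integrable f f).
by apply: eq_integral => x _; rewrite expr2.
Qed.

Lemma ipL_null (f : V) : ipL f f = 0 <-> (f : T -> R) = cst 0 %[ae mu].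
Proof.
have mf2 : measurable_fun setT (fun x => (f x ^+ 2)%:E).
  by apply/measurable_EFinP; apply: measurable_funX; exact: Lfun2_measurable (V_Lfun f).
have [h1 h2] := ae_eq_integral_abs mu measurableT mf2.
have E : (ipL f f)%:E = (\int[mu]_x `|(f x ^+ 2)%:E|)%E.
  by rewrite ipL_sqrE; apply: eq_integral => x _; rewrite gee0_abs// lee_fin sqr_ge0.
split=> [f0|f0].
  have := h1; rewrite -E f0 => /(_ erefl); apply: filterS => x /(_ I)/= [/eqP].
  by rewrite sqrf_eq0 => /eqP.
apply: EFin_inj; rewrite E h2//; apply: filterS f0 => x /(_ I) /= ->.
by rewrite expr0n.
Qed.

Lemma ae_eq_null (f g : V) : (f : T -> R) = g %[ae mu] <-> ipL (f - g) (f - g) = 0.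
Proof.
rewrite ipL_null; split; apply: filterS => x /(_ I) fg _ /=.
  by rewrite -[LHS]/(f x - g x) fg subrr.
by apply/eqP; rewrite -subr_eq0; apply/eqP.
Qed.

Lemma integral_prob_cst (c : R) : (\int[mu]_x c%:E = c%:E)%E.
Proof.
rewrite integral_cst// -[RHS]mule1; congr (_ * _)%E; exact: probability_setT.
Qed.

(** Young's inequality |f| <= e/2 + f^2/(2e), integrated against a probability. *)
Lemma prob_abs_le (f : T -> R) (e : R) : 0 < e -> measurable_fun setT f ->
  (\int[mu]_x (f x ^+ 2)%:E <= (e ^+ 2)%:E)%E -> (\int[mu]_x `|f x|%:E <= e%:E)%E.
Proof.
move=> e0 mf fe.
have c0 : 0 <= (2 * e)^-1 by rewrite invr_ge0 mulr_ge0// ltW.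
apply: (@le_trans _ _ (\int[mu]_x ((e / 2)%:E + (2 * e)^-1%:E * (f x ^+ 2)%:E)))%E.
  apply: ge0_le_integral => //.
  - by apply/measurable_EFinP; apply: measurableT_comp.
  - by apply: emeasurable_funD => //; apply: emeasurable_funM => //;
      apply/measurable_EFinP; apply: measurable_funX.
  - move=> x _; rewrite -EFinM -EFinD lee_fin.
    have := sqr_ge0 (e - `|f x|); rewrite sqrrB real_normK ?num_real// => h.
    have e2 : 0 < 2 * e by rewrite mulr_gt0.
    rewrite -(ler_pM2l e2).
    rewrite mulrDr mulrA divff ?gt_eqF ?mulr_gt0// mul1r.
    have -> : 2 * e * (e / 2) = e ^+ 2 by field.
    by lra.
rewrite ge0_integralD//; last 3 first.
- by move=> x _; rewrite lee_fin divr_ge0// ltW.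
- by move=> x _; rewrite -EFinM lee_fin mulr_ge0// sqr_ge0.
- by apply: emeasurable_funM => //; apply/measurable_EFinP; apply: measurable_funX.
rewrite integral_prob_cst ge0_integralZl_EFin//; last 2 first.
- by move=> x _; rewrite lee_fin sqr_ge0.
- by apply/measurable_EFinP; apply: measurable_funX.
apply: (@le_trans _ _ ((e / 2)%:E + (2 * e)^-1%:E * (e ^+ 2)%:E))%E.
  by rewrite leeD2l// lee_wpmul2l// lee_fin.
by rewrite -EFinM -EFinD lee_fin le_eqVlt; apply/orP; left; apply/eqP; field; rewrite gt_eqF.
Qed.

(** The sum of the absolute increments has integral at most the sum of the 2^-k, so it is finite
    almost everywhere. *)
Lemma fast_cauchy_cvg (v : nat -> T -> R) :
  (forall k, measurable_fun setT (v k)) ->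
  (forall k, (\int[mu]_x ((v k.+1 x - v k x) ^+ 2)%:E <= ((2^-1 ^+ k) ^+ 2)%:E)%E) ->
  \forall x \ae mu, cvgn (fun k => v k x).
Proof.
move=> mv vk.
pose g k x := `|v k.+1 x - v k x|%:E : \bar R.
have mg k : measurable_fun setT (g k).
  by apply/measurable_EFinP; apply: measurableT_comp => //; exact: measurable_funB.
have g0 k x : (0 <= g k x)%E by rewrite lee_fin.
have G : (\int[mu]_x (\sum_(k <oo) g k x) < +oo)%E.
  rewrite integral_nneseries//.
  apply: (@le_lt_trans _ _ (\sum_(k <oo) (2^-1 ^+ k : R)%:E)%E).
    apply: lee_nneseries => [k _ _|k _]; first exact: integral_ge0.
    by apply: prob_abs_le => //; exact: measurable_funB.
  have -> : (\sum_(k <oo) (2^-1 ^+ k : R)%:E = 2%:E)%E.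
    apply/cvg_lim => //.
    rewrite (_ : (fun n => _) = EFin \o series (geometric 1 2^-1)); last first.
      apply/funext => n /=; rewrite /series /= sumEFin; congr EFin.
      by apply: eq_bigr => i _; rewrite mul1r.
    apply/fine_cvgP; split; first by apply: nearW.
    have h : `|2^-1 : R| < 1 by rewrite ger0_norm ?invr_ge0// invf_lt1// ltr1n.
    have := @cvg_geometric_series R 1 2^-1 h.
    by have -> : 1 / (1 - 2^-1) = 2 :> R by field.
  by rewrite ltry.
have Gi : mu.-integrable setT (fun x => \sum_(k <oo) g k x)%E.
  apply/integrableP; split.
    by apply: ge0_emeasurable_sum.
  under eq_integral do rewrite gee0_abs ?nneseries_ge0//.
  exact: G.
apply: filterS (integrable_ae measurableT Gi) => x /(_ I) Gx.
have sc : cvgn (series (telescope (fun k => v k x))).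
  apply: normed_cvg; apply: nondecreasing_is_cvgn.
    apply: nondecreasing_series => *; exact: normr_ge0.
  exists (fine (\sum_(k <oo) g k x)%E) => _ [n _ <-].
  rewrite -lee_fin fineK//.
  apply: le_trans (nneseries_lim_ge n _); last by move=> *; exact: g0.
  by rewrite /series /= -sumEFin.
rewrite (_ : (fun k => v k x) = (fun k => v 0%N x + series (telescope (fun k => v k x)) k)).
  by apply: is_cvgD => //; exact: is_cvg_cst.
by apply/funext => k; rewrite -(@eq_sum_telescope _ (fun k => v k x)).
Qed.

Lemma limn_einf_sup_EFin (a : R^nat) l : a @ \oo --> l ->
  (limn_einf (fun k => (a k)%:E) = l%:E) /\ (limn_esup (fun k => (a k)%:E) = l%:E).
Proof.
move=> al; have al' : (fun k => (a k)%:E) @ \oo --> l%:E.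
  by apply/fine_cvgP; split; [exact: nearW|exact: al].
by have [-> ->] := cvg_limn_einf_sup al'.
Qed.

Lemma limn_einf_le (a : (\bar R)^nat) (b : \bar R) K :
  (forall k, (K <= k)%N -> (a k <= b)%E) -> (limn_einf a <= b)%E.
Proof.
move=> ab; rewrite limn_einf_lim; apply: lime_le; first exact: is_cvg_einfs.
apply: nearW => n; apply: le_trans (ab (maxn n K) (leq_maxr _ _)).
by apply: ereal_inf_lbound; exists (maxn n K) => //=; exact: leq_maxl.
Qed.

Lemma measurable_limn_einf (g : nat -> T -> \bar R) :
  (forall k, measurable_fun setT (g k)) ->
  measurable_fun setT (fun x => limn_einf (g ^~ x)).
Proof.
move=> mg; apply: measurableT_comp => //.
by apply: measurable_fun_limn_esup => k; exact: measurableT_comp.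
Qed.

(** Riesz-Fischer: a rapidly converging subsequence gives the pointwise limit, and Fatou's lemma
    turns pointwise into mean square convergence. *)
Lemma L2_complete (u : nat -> V) :
  (forall e, 0 < e -> exists N, forall m n, (N <= m)%N -> (N <= n)%N ->
     ipL (u m - u n) (u m - u n) < e) ->
  exists f : V, forall e, 0 < e -> exists N, forall n, (N <= n)%N ->
     ipL (u n - f) (u n - f) < e.
Proof.
move=> uC.
have p0 k : 0 < (2^-1 ^+ k) ^+ 2 :> R by rewrite !exprn_gt0.
have /choice[N hN] : forall k, exists N, forall m n, (N <= m)%N -> (N <= n)%N ->
     ipL (u m - u n) (u m - u n) < (2^-1 ^+ k) ^+ 2.
  by move=> k; exact: uC.
(* Summing makes [s] nondecreasing, with both [N k <= s k] and [k <= s k]. *)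
pose s k := (k + \sum_(i < k.+1) N i)%N.
have sN k : (N k <= s k)%N.
  by rewrite /s big_ord_recr /= addnA leq_addl.
have sS k : (s k <= s k.+1)%N.
  by rewrite /s [in leqRHS]big_ord_recr /= leq_add// leq_addr.
pose v k : T -> R := u (s k).
have mu_ n : measurable_fun setT (u n) by exact: Lfun2_measurable (V_Lfun _).
have sqrE (f g : V) : (\int[mu]_x ((f x - g x) ^+ 2)%:E = (ipL (f - g) (f - g))%:E)%E.
  by rewrite ipL_sqrE.
have vcvg : \forall x \ae mu, cvgn (fun k => v k x).
  apply: fast_cauchy_cvg => k; first exact: mu_.
  rewrite /v sqrE lee_fin ltW//; apply: hN => //.
  exact: leq_trans (sN k) (sS k).
(* An upper limit is defined and measurable everywhere, and is the limit wherever there is one. *)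
pose f x := fine (limn_esup (fun k => (v k x)%:E)).
have mf : measurable_fun setT f.
  apply: measurableT_comp => //; apply: measurable_fun_limn_esup => k.
  by apply/measurable_EFinP; exact: mu_.
have msq (g : T -> R) : measurable_fun setT g ->
    forall m, measurable_fun setT (fun x => ((g x - u m x) ^+ 2)%:E).
  by move=> mg m; apply/measurable_EFinP; apply: measurable_funX;
    exact: measurable_funB.
(* Fatou's lemma. It is used twice: once to place [f] in L2, once for the convergence. *)
have close m e K : (forall k, (K <= k)%N -> ipL (u (s k) - u m) (u (s k) - u m) <= e) ->
    (\int[mu]_x ((f x - u m x) ^+ 2)%:E <= e%:E)%E.
  move=> He.
  apply: (@le_trans _ _ (\int[mu]_x limn_einf (fun k => ((v k x - u m x) ^+ 2)%:E))%E).
    apply: ae_ge0_le_integral => //.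
    - by move=> x _; rewrite lee_fin sqr_ge0.
    - exact: msq.
    - move=> x _; rewrite limn_einf_lim; apply: lime_ge; first exact: is_cvg_einfs.
      apply: nearW => n; apply: le_ereal_inf_tmp => _ [k _ <-] /=.
      by rewrite lee_fin sqr_ge0.
    - by apply: measurable_limn_einf => k; apply: msq; exact: mu_.
    - apply: filterS vcvg => x vx _.
      have vf : (fun k => v k x) @ \oo --> f x.
        move: vx => /cvg_ex[l vl].
        by rewrite /f (limn_einf_sup_EFin vl).2.
      suff -> : limn_einf (fun k => ((v k x - u m x) ^+ 2)%:E) = ((f x - u m x) ^+ 2)%:E by [].
      have h : (fun k => v k x - u m x) @ \oo --> f x - u m x.
        by apply: cvgB => //; exact: cvg_cst.
      exact: (limn_einf_sup_EFin (cvgM h h)).1.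
  apply: le_trans (fatou _ _ _ _) _ => //.
  - by move=> k; apply: msq; exact: mu_.
  - by move=> k x _; rewrite lee_fin sqr_ge0.
  apply: (@limn_einf_le _ _ K) => k Kk; rewrite sqrE lee_fin; exact: He.
have sk k : (k <= s k)%N by rewrite /s leq_addr.
have fL : f \in Lfun mu 2%:E.
  have [K hK] := uC 1 ltr01.
  have h : (\int[mu]_x ((f x - u K x) ^+ 2)%:E <= 1%:E)%E.
    apply: (close _ _ K) => k Kk; apply/ltW/hK => //; exact: leq_trans Kk (sk k).
  have gL : (fun x => f x - u K x) \in Lfun mu 2%:E.
    apply/Lfun2P; split; first exact: measurable_funB.
    by apply: le_lt_trans h _; rewrite ltry.
  have := (Lfun_addr_closed mu (lee1n 2)).2 _ _ gL (V_Lfun (u K)).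
  by rewrite (_ : _ + _ = f)//; apply/funext => x; rewrite addrfctE subrK.
exists (to_V fL) => e e0; have e20 : 0 < e / 2 by rewrite divr_gt0.
have [K hK] := uC _ e20; exists K => n Kn.
rewrite -lte_fin ipL_sqrE.
apply: (@le_lt_trans _ _ (e / 2)%:E); last by rewrite lte_fin ltr_pdivrMr// ltr_pMr// ltr1n.
have -> : (\int[mu]_x ((u n - to_V fL) x ^+ 2)%:E = \int[mu]_x ((f x - u n x) ^+ 2)%:E)%E.
  by apply: eq_integral => x _; rewrite -sqrrN; congr ((_ ^+ 2)%:E); rewrite -[LHS]/(- (u n x - f x)) opprB.
apply: (close _ _ K) => k Kk; apply/ltW/hK => //; exact: leq_trans Kk (sk k).
Qed.

Lemma semi_hilbert_L2 : semi_hilbert ipL.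
Proof.
split.
- by move=> f g; apply: eq_Rintegral => x _; rewrite mulrC.
- move=> f g k; rewrite /ipL -RintegralD//; [|exact: ipL_integrable|exact: ipL_integrable].
  by apply: eq_Rintegral => x _; rewrite -mulrDl.
- move=> a f g; rewrite /ipL -RintegralZl//; last exact: ipL_integrable.
  by apply: eq_Rintegral => x _; rewrite mulrA.
- by move=> f; rewrite /ipL; apply: Rintegral_ge0 => x _; rewrite -expr2 sqr_ge0.
- exact: L2_complete.
Qed.

End L2_space.

(** * Complexification *)

Section complexification.
Context d (T : measurableType d) (R : realType) (mu : probability T R).
Local Notation V := (LfunType mu (lee1n 2)).
Local Notation ip := (@ipL d T R mu).
Local Notation H := (semi_hilbert_L2 mu).
Local Open Scope complex_scope.
Variables (A : (T -> R[i]) -> T -> R[i]) (K : (T -> R) -> T -> R).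
Hypothesis AE : forall f x,
  A f x = K (@complex.Re R \o f) x +i* K (@complex.Im R \o f) x.
Hypothesis KL : forall f, f \in Lfun mu 2%:E -> K f \in Lfun mu 2%:E.

Definition K_V (f : V) : V := to_V (KL (V_Lfun f)).

Hypothesis Ksym : forall f g, ip (K_V f) g = ip f (K_V g).
Hypothesis Kb : forall f, ip (K_V f) (K_V f) <= ip f f.

Definition cplx (u v : V) : T -> R[i] := fun x => u x +i* v x.

Lemma L2_cplx u v : L2 mu (cplx u v).
Proof. by split; exact: V_Lfun. Qed.

Lemma L2_cplxP f : L2 mu f -> exists u v, f = cplx u v.
Proof.
move=> [fr fi]; exists (to_V fr), (to_V fi); apply/funext => x.
by rewrite /cplx !to_VE /=; case: (f x).
Qed.

Lemma cplx_ae_eq u v u' v' : cplx u v = cplx u' v' %[ae mu] <->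
  ip (u - u') (u - u') = 0 /\ ip (v - v') (v - v') = 0.
Proof.
rewrite -!ae_eq_null; split=> [h|[h1 h2]].
  by split; apply: filterS h => x /(_ I) [].
apply: filterS2 h1 h2 => x /(_ I) h1 /(_ I) h2 _.
by rewrite /cplx h1 h2.
Qed.

Lemma shift_cplx (a b : R) u v x :
  A (cplx u v) x - (a +i* b) * cplx u v x =
  cplx (shift_re K_V a b u v) (shift_im K_V a b u v) x.
Proof.
rewrite AE /cplx.
rewrite -[shift_re K_V a b u v x]/(K u x - a * u x + b * v x).
rewrite -[shift_im K_V a b u v x]/(K v x - a * v x - b * u x).
by apply/eqP; rewrite eq_complex /=; apply/andP; split; apply/eqP; ring.
Qed.

Lemma shift_ae_eq (a b : R) u v g1 g2 :
  (fun x => A (cplx u v) x - (a +i* b) * cplx u v x) = cplx g1 g2 %[ae mu] <->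
  ip (shift_re K_V a b u v - g1) (shift_re K_V a b u v - g1) = 0 /\
  ip (shift_im K_V a b u v - g2) (shift_im K_V a b u v - g2) = 0.
Proof.
by rewrite -cplx_ae_eq; split; apply: filterS => x; rewrite shift_cplx.
Qed.

Lemma eigen_cplx (a b : R) u v :
  A (cplx u v) = (fun x => (a +i* b) * cplx u v x) %[ae mu] <->
  ip (shift_re K_V a b u v) (shift_re K_V a b u v) = 0 /\
  ip (shift_im K_V a b u v) (shift_im K_V a b u v) = 0.
Proof.
have := shift_ae_eq a b u v 0 0; rewrite !subr0 => <-.
have -> : cplx 0 0 = cst 0 by [].
split; apply: filterS => x /(_ I) h _; first by rewrite h subrr.
by apply/eqP; rewrite -subr_eq0 h.
Qed.

Lemma L2norm_cplx u v : L2norm mu (cplx u v) = (Num.sqrt (ip u u + ip v v))%:E.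
Proof.
have q0 w : 0 <= ip w w by exact: (ip_ge0 H).
rewrite /L2norm unlock -powR12_sqrt ?addr_ge0//.
rewrite -poweR_EFin EFinD !ipL_sqrE -ge0_integralD//=; last 4 first.
- by move=> x _; rewrite lee_fin sqr_ge0.
- by apply/measurable_EFinP; apply: measurable_funX; exact: Lfun2_measurable (V_Lfun _).
- by move=> x _; rewrite lee_fin sqr_ge0.
- by apply/measurable_EFinP; apply: measurable_funX; exact: Lfun2_measurable (V_Lfun _).
congr (_ `^ _)%E; apply: eq_integral => x _.
rewrite -EFinD; congr EFin; rewrite powR_mulrn// /modulus /cplx /=.
by rewrite real_normK ?num_real// sqr_sqrtr// addr_ge0// sqr_ge0.
Qed.

Lemma resolvent_of_lower_bound (a b k : R) : 0 < k ->
  (forall u v, k * (ip u u + ip v v) <=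
     ip (shift_re K_V a b u v) (shift_re K_V a b u v) +
     ip (shift_im K_V a b u v) (shift_im K_V a b u v)) ->
  resolvent_set mu A (a +i* b).
Proof.
move=> k0 hk; exists (Num.sqrt k^-1) => _ /L2_cplxP[g1 [g2 ->]].
have [u [v [hu hv]]] := resolvent_solve H Ksym Kb g1 g2 k0 hk.
have same := ip_null_eq H.
exists (cplx u v); split.
- exact: L2_cplx.
- exact/shift_ae_eq.
- rewrite !L2norm_cplx -EFinM lee_fin -sqrtrM ?invr_ge0 ?(ltW k0)// ler_sqrt; last first.
    by rewrite mulr_ge0 ?invr_ge0 ?(ltW k0)// addr_ge0// (ip_ge0 H).
  rewrite -(ler_pM2l k0) mulVKf ?gt_eqF//; apply: le_trans (hk u v) _.
  rewrite (same _ _ hu) (ipC H g1) (same _ _ hu).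
  by rewrite (same _ _ hv) (ipC H g2) (same _ _ hv).
- move=> _ /L2_cplxP[u' [v' ->]] /shift_ae_eq[hu' hv'].
  exact/cplx_ae_eq/(resolvent_unique H Ksym k0 hk hu hv hu' hv').
Qed.

(** For the right side 0 both 0 and the eigenvector are solutions, against the uniqueness clause of
    [resolvent_set]. *)
Lemma eigenvalue_spectrum z : op_eigenvalue mu A z -> op_spectrum mu A z.
Proof.
case: z => a b.
move=> [_ [[/L2_cplxP[u [v ->]] fE] f0]] [C /(_ (cplx 0 0) (L2_cplx 0 0))[f1 [_ _ _ uniq]]].
have h0 := uniq (cplx 0 0) (L2_cplx 0 0).
have h1 := uniq (cplx u v) (L2_cplx u v).
have K0 w : ip (K_V 0) w = 0 by rewrite Ksym (ip0l H).
apply: f0; have -> : cst 0 = cplx 0 0 by [].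
have e0 : cplx 0 0 = (cplx 0 0 : T -> R[i]) %[ae mu] by exact: aeW.
have E1 : (fun x => A (cplx u v) x - (a +i* b) * cplx u v x) = cplx 0 0 %[ae mu].
  by apply/shift_ae_eq; rewrite !subr0; apply/eigen_cplx.
have E0 : (fun x => A (cplx 0 0) x - (a +i* b) * cplx 0 0 x) = cplx 0 0 %[ae mu].
  apply/shift_ae_eq; rewrite !subr0 /shift_re /shift_im.
  by rewrite !scaler0 !subr0 addr0 K0.
apply: filterS2 (h1 E1) (h0 E0) => x /(_ I) -> /(_ I) -> //.
Qed.

Variables (delta : R) (k : nat) (e : 'I_k -> V) (lam : 'I_k -> R).
Hypothesis delta0 : 0 < delta.
Hypothesis K1 : forall f, ip (K_V f) f <= ip f f.
Hypothesis KN1 : forall f, - ((1 - delta) * ip f f) <= ip (K_V f) f.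
Hypothesis Ke : eigenfamily ip K_V delta e lam.
Hypothesis Kperp : forall f, (forall i, ip f (e i) = 0) ->
  ip (K_V f) f <= (1 - delta) * ip f f.

(** Elsewhere the shifted operator is bounded below: by |b| if the imaginary part [b] is not 0,
    otherwise by the distance from [a] to the segment, which bounds the form. *)
Lemma spectrum_real : op_spectrum mu A `<=` real_segment (-1 + delta) 1.
Proof.
move=> [a b] spec; apply: contrapT => ns; apply: spec.
have [b0|b0] := eqVneq b 0; last first.
  apply: (@resolvent_of_lower_bound a b (b ^+ 2)); first by rewrite exprn_even_gt0.
  by move=> u v; exact: (shift_nonreal H Ksym).
rewrite b0 in ns *.
have form f : ip (K_V f - a *: f) f = ip (K_V f) f - a * ip f f.
  by rewrite (ipBl H) (ipZl H).
have lower c : 0 < c -> (forall f, c * ip f f <= `|ip (K_V f) f - a * ip f f|) ->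
    resolvent_set mu A (a +i* 0).
  move=> c0 hc; apply: (@resolvent_of_lower_bound a 0 (c ^+ 2)); first by rewrite exprn_gt0.
  move=> u v; apply: shift_real => f.
  by apply: (below_of_form H) => //; [exact: ltW|rewrite form].
have [a1|a1] := ltP 1 a.
  apply: (lower (a - 1)) => [|f]; first by rewrite subr_gt0.
  rewrite distrC; apply: le_trans (ler_norm _).
  by have := K1 f; rewrite mulrBl mul1r; lra.
have [a2|a2] := ltP a (-1 + delta).
  apply: (lower (-1 + delta - a)) => [|f]; first by rewrite subr_gt0.
  apply: le_trans (ler_norm _).
  by have := KN1 f; rewrite !mulrBl !mulrDl !mulN1r mul1r; lra.
by case: ns; exists a => //; rewrite a2.
Qed.

Lemma spectrum_eigenvalue x : 1 - delta < x -> op_spectrum mu A x%:C ->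
  exists i, lam i = x.
Proof.
move=> dx spec; apply: contrapT => nl; apply: spec.
have [|c c0 hc] := below_gap H Ksym Ke Kperp dx.
  by move=> i; apply/eqP => li; apply: nl; exists i.
apply: (@resolvent_of_lower_bound x 0 c) => // u v.
exact: shift_real.
Qed.

Lemma eigenvector_family i : op_eigenvector mu A (lam i)%:C (cplx (e i) 0).
Proof.
have null w : (forall g, ip w g = 0) -> ip w w = 0 by [].
split; [split|]; first exact: L2_cplx.
  apply/eigen_cplx; rewrite /shift_re /shift_im !scale0r scaler0 subr0 addr0 subr0; split.
    by apply: null => g; rewrite (ipBl H) (ipZl H) (Ke.2 i).1 subrr.
  by rewrite Ksym (ip0l H).
have -> : cst 0 = cplx 0 0 by [].
by move=> /cplx_ae_eq[]; rewrite subr0 Ke.1 eqxx => /eqP; rewrite oner_eq0.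
Qed.

Lemma eigen_le1 i : lam i <= 1.
Proof. by have := K1 (e i); rewrite (Ke.2 i).1 Ke.1 eqxx mulr1. Qed.

(** The real and imaginary parts of a complex eigenvector are real eigenvectors, so the real
    orthonormal [e i] with [lam i = x] are also a complex basis. *)
Lemma eigenspace_dim x : 1 - delta < x ->
  has_dim mu (op_eigenspace mu A x%:C) #|[pred i | lam i == x]|.
Proof.
move=> dx; set P := [pred i | _].
pose b (j : 'I_#|P|) := cplx (e (enum_val j)) 0.
have sumE (c : 'I_#|P| -> R[i]) y : \sum_j c j * b j y =
    cplx (\sum_j complex.Re (c j) *: e (enum_val j))
         (\sum_j complex.Im (c j) *: e (enum_val j)) y.
  rewrite /cplx.
  have vs (F : 'I_#|P| -> V) : (\sum_j F j : V) y = \sum_j F j y.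
    by elim/big_rec2: _ => // j r s _ <-.
  rewrite !vs; transitivity (\sum_j ((complex.Re (c j) * e (enum_val j) y) +i*
     (complex.Im (c j) * e (enum_val j) y))).
    apply: eq_bigr => j _; have -> : b j y = e (enum_val j) y +i* 0 by [].
    case: (c j) => p q; move: (e (enum_val j) y) => t.
    by apply/eqP; rewrite eq_complex /=; apply/andP; split; apply/eqP; ring.
  by elim/big_rec3: _ => // j r s t _ ->.
have coef (F : 'I_#|P| -> R) j : ip (\sum_j F j *: e (enum_val j)) (e (enum_val j)) = F j.
  rewrite (ip_suml H) (bigD1 j)//= big1 => [|i ij].
    by rewrite (ipZl H) Ke.1 eqxx mulr1 addr0.
  by rewrite (ipZl H) Ke.1 (inj_eq enum_val_inj) (negbTE ij) mulr0.
exists b; split.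
- by move=> j; have := enum_valP j; rewrite inE => /eqP <-; have [] := eigenvector_family (enum_val j).
- move=> c c0.
  have : cplx (\sum_j complex.Re (c j) *: e (enum_val j))
      (\sum_j complex.Im (c j) *: e (enum_val j)) = cplx 0 0 %[ae mu].
    by apply: filterS c0 => y; rewrite sumE.
  move=> /cplx_ae_eq; rewrite !subr0 => -[c1 c2] j.
  have := ip_null H (e (enum_val j)) c1; have := ip_null H (e (enum_val j)) c2.
  by rewrite !coef; case: (c j) => p q /= -> ->.
- move=> _ [/L2_cplxP[u [v ->]] /eigen_cplx[hu hv]].
  have eu : eigen_at ip K_V u x.
    move=> g; have := ip_null H g hu.
    by rewrite /shift_re scale0r addr0 (ipBl H) (ipZl H) => /eqP; rewrite subr_eq0 => /eqP.
  have ev : eigen_at ip K_V v x.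
    move=> g; have := ip_null H g hv.
    by rewrite /shift_im scale0r subr0 (ipBl H) (ipZl H) => /eqP; rewrite subr_eq0 => /eqP.
  pose c (j : 'I_#|P|) := ip u (e (enum_val j)) +i* ip v (e (enum_val j)).
  exists c; suff : cplx u v = cplx (\sum_j complex.Re (c j) *: e (enum_val j))
      (\sum_j complex.Im (c j) *: e (enum_val j)) %[ae mu].
    by apply: filterS => y; rewrite sumE.
  apply/cplx_ae_eq => /=.
  have := eigen_expansion H Ksym Ke Kperp dx eu.
  have := eigen_expansion H Ksym Ke Kperp dx ev.
  have enumE (w : V) : \sum_(i | lam i == x) ip w (e i) *: e i =
      \sum_(j < #|P|) ip w (e (enum_val j)) *: e (enum_val j).
    by rewrite -(big_enum_val (fun i => ip w (e i) *: e i)); apply: eq_bigl => i; rewrite inE.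
  by rewrite /= (enumE u) (enumE v) => h1 h2; split; [exact: h2|exact: h1].
Qed.

Lemma essential_spectrum_real :
  essential_spectrum mu A `<=` real_segment (-1 + delta) (1 - delta).
Proof.
move=> z [spec nd]; have [x /andP[x1 x2] zx] := spectrum_real spec.
exists x => //; rewrite x1 /= leNgt; apply/negP => dx; apply: nd.
rewrite zx in spec *.
have [i li] := spectrum_eigenvalue dx spec.
split; last by exists #|[pred i | lam i == x]|; exact: eigenspace_dim.
- split => //.
  (* Within this distance of [x] the spectrum is still above [1 - delta], hence made of [lam j], and
     none of them differs from [x]. *)
  pose c := \big[Order.min/(x - (1 - delta))]_(j < k | lam j != x) `|lam j - x|.
  exists c; first by apply: lt_bigmin => [|j lj]; rewrite ?subr_gt0// normr_gt0 subr_eq0.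
  move=> w wspec; have [y /andP[y1 y2] wy] := spectrum_real wspec.
  rewrite wy in wspec *.
  have -> : modulus (y%:C - x%:C) = `|y - x|.
    by rewrite /modulus /= subr0 expr0n /= addr0 sqrtr_sqr.
  move=> yx; have dy : 1 - delta < y.
    have : `|y - x| < x - (1 - delta) by apply: lt_le_trans yx _; exact: bigmin_le_id.
    by rewrite ltr_norml => /andP[]; lra.
  have [j lj] := spectrum_eigenvalue dy wspec.
  have [lx|lx] := eqVneq (lam j) x; first by rewrite -lj lx.
  by move: yx; rewrite -lj ltNge => /negP[]; exact: bigmin_le_cond.
- by exists (cplx (e i) 0); rewrite -li; exact: eigenvector_family.
Qed.

(** As [s < delta], every eigenvalue in the segment is some [lam i], and its multiplicity is the
    number of such [i]. *)
Lemma eigenvalue_count_family s : s < delta ->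
  eigenvalue_count mu A (real_segment (1 - s) 1) #|[pred i | (1 - s <= lam i)%R]|.
Proof.
move=> sd; pose P := [pred i | (1 - s <= lam i)%R].
pose r := undup [seq (lam i)%:C | i <- enum P].
have rP z : reflect (exists2 i, 1 - s <= lam i & z = (lam i)%:C) (z \in r).
  rewrite mem_undup; apply: (iffP mapP) => -[i iP ->]; exists i => //.
    by move: iP; rewrite mem_enum.
  by rewrite mem_enum.
exists r, (fun z => #|[pred i | (lam i)%:C == z]|); split.
- exact: undup_uniq.
- move=> z; split=> [/rP[i si ->]|[ev [x /andP[x1 x2] zx]]].
    split; first by exists (cplx (e i) 0); exact: eigenvector_family.
    by exists (lam i) => //; rewrite si eigen_le1.
  have spec := eigenvalue_spectrum ev; rewrite zx in spec *.
  have [|i li] := @spectrum_eigenvalue x _ spec; first by lra.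
  by apply/rP; exists i; rewrite li.
- move=> z /rP[i si ->].
  have -> : #|[pred j | (lam j)%:C == (lam i)%:C]| = #|[pred j | lam j == lam i]|.
    by apply: eq_card => j; rewrite !inE eq_complex /= eqxx andbT.
  by apply: eigenspace_dim; lra.
(* Double counting: each index with [1 - s <= lam i] meets exactly one element of the duplicate-free
   list [r]. *)
- transitivity (\sum_(z <- r) \sum_i ((lam i)%:C == z : nat))%N.
    by apply: eq_bigr => z _; rewrite -sum1_card big_mkcond.
  rewrite exchange_big /= -sum1_card [RHS]big_mkcond /=; apply: eq_bigr => i _.
  rewrite -big_mkcond /= sum1_count.
  have -> : count (fun z => (lam i)%:C == z) r = count_mem (lam i)%:C r.
    by apply: eq_count => z; rewrite /= eq_sym.
  rewrite count_uniq_mem ?undup_uniq//; case: ifPn => iP.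
    by have -> : (lam i)%:C \in r by apply/rP; exists i.
  have -> // : ((lam i)%:C \in r) = false.
  apply/negP => /rP[j sj /eqP]; rewrite eq_complex /= eqxx andbT => /eqP lij.
  by move: iP; rewrite inE lij sj.
Qed.

End complexification.

(** * Taylor estimates *)

Section calculus.
Context {R : realType} {d : nat}.
Implicit Types (f : 'rV[R]_d -> R) (x v w p : 'rV[R]_d) (i j : 'I_d).

Definition unit_rV i : 'rV[R]_d := delta_mx ord0 i.

Definition l1 v : R := \sum_i `|v ord0 i|.

Definition C1 f := forall i, (forall x, derivable f x (unit_rV i)) /\ continuous (partial i f).

Lemma l1_ge0 v : 0 <= l1 v.
Proof. exact: sumr_ge0. Qed.

Lemma l1_coord v i : `|v ord0 i| <= l1 v.
Proof. by rewrite /l1 (bigD1 i)//= lerDl sumr_ge0. Qed.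

Lemma partial_line f x i (t : R) : derivable f (x + t *: unit_rV i) (unit_rV i) ->
  is_derive t (1 : R) (fun s : R => f (x + s *: unit_rV i)) (partial i f (x + t *: unit_rV i)).
Proof.
move=> df.
have E : (fun h : R => h^-1 *: (((fun s : R => f (x + s *: unit_rV i)) \o shift t) (h *: (1 : R)) -
      f (x + t *: unit_rV i))) =
    (fun h => h^-1 *: ((f \o shift (x + t *: unit_rV i)) (h *: unit_rV i) - f (x + t *: unit_rV i))).
  apply/funext => h /=; congr (_ *: (f _ - _)).
  by rewrite [h *: 1]mulr1 scalerDl addrCA.
apply: DeriveDef; first by rewrite /derivable E.
by rewrite /derive E.
Qed.

Lemma coordinate_mvt f x i (t : R) :
  (forall y, derivable f y (unit_rV i)) ->
  exists2 s, `|s| <= `|t| & f (x + t *: unit_rV i) - f x = partial i f (x + s *: unit_rV i) * t.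
Proof.
move=> df.
have cg : continuous (fun s : R => f (x + s *: unit_rV i)).
  move=> s; apply: differentiable_continuous; apply/derivable1_diffP.
  by have [] := partial_line (df (x + s *: unit_rV i)).
have wc (a b : R) : {within `[a, b], continuous (fun s : R => f (x + s *: unit_rV i))}.
  exact: continuous_subspaceT.
have [t0|t0] := leP 0 t.
  have [|s s0t E] := @MVT_segment R _ (fun s => partial i f (x + s *: unit_rV i)) 0 t t0 _ (wc 0 t).
    by move=> s _; exact: partial_line.
  exists s; last by move: E; rewrite scale0r addr0 subr0.
  by move: s0t; rewrite in_itv/= => /andP[s0 st]; rewrite !ger0_norm.
have [|s s0t E] := @MVT_segment R _ (fun s => partial i f (x + s *: unit_rV i)) t 0 (ltW t0) _ (wc t 0).
  by move=> s _; exact: partial_line.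
exists s.
  by move: s0t; rewrite in_itv/= => /andP[s0 st]; rewrite !ler0_norm ?lerN2// ltW.
by rewrite -opprB; move: E; rewrite scale0r addr0 sub0r mulrN => ->; rewrite opprK.
Qed.

(* Moving from x to x + w one coordinate at a time. *)
Lemma increment_estimate f x w (A : 'I_d -> R) (e : R) :
  (forall i y, derivable f y (unit_rV i)) ->
  (forall i p, (forall j, `|p ord0 j| <= `|w ord0 j|) -> `|partial i f (x + p) - A i| <= e) ->
  `|f (x + w) - f x - \sum_i A i * w ord0 i| <= e * l1 w.
Proof.
move=> df hA.
(* The displacement after the first [k] coordinates have been moved. *)
pose tr k : 'rV[R]_d := \row_i (if (i < k)%N then w ord0 i else 0).
suff H k : (k <= d)%N -> `|f (x + tr k) - f x - \sum_(i : 'I_d | (i < k)%N) A i * w ord0 i| <=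
    e * \sum_(i : 'I_d | (i < k)%N) `|w ord0 i|.
  have := H d (leqnn d).
  have -> : tr d = w by apply/rowP => i; rewrite mxE ltn_ord.
  have alld (F : 'I_d -> R) : \sum_(i : 'I_d | (i < d)%N) F i = \sum_i F i.
    by apply: eq_bigl => i; rewrite ltn_ord.
  by rewrite !alld.
elim: k => [_|k IH kd].
  rewrite !big_pred0 // mulr0 subr0.
  have -> : tr 0%N = 0 by apply/rowP => i; rewrite !mxE.
  by rewrite addr0 subrr normr0.
pose i := Ordinal kd.
have trS : tr k.+1 = tr k + w ord0 i *: unit_rV i.
  apply/rowP => j; rewrite !mxE eqxx /= ltnS leq_eqVlt.
  have [->|ji] := eqVneq j i; first by rewrite /= eqxx ltnn add0r mulr1.
  have -> : (j == k :> nat) = false.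
    by apply/negbTE; apply: contra ji => /eqP jk; apply/eqP/val_inj.
  by rewrite mulr0 addr0.
have bigS (F : 'I_d -> R) : \sum_(j : 'I_d | (j < k.+1)%N) F j = F i + \sum_(j : 'I_d | (j < k)%N) F j.
  rewrite (bigD1 i)/=; last exact: ltnSn.
  congr (_ + _); apply: eq_bigl => j; rewrite ltnS leq_eqVlt.
  have [->|ji] := eqVneq j i; first by rewrite /= ltnn andbF.
  have -> : (j == k :> nat) = false.
    by apply/negbTE; apply: contra ji => /eqP jk; apply/eqP/val_inj.
  by rewrite andbT.
rewrite !bigS.
have [s ss E] := coordinate_mvt (x + tr k) (w ord0 i) (df i).
rewrite trS addrA.
have -> : f (x + tr k + w ord0 i *: unit_rV i) - f x - (A i * w ord0 i + \sum_(j : 'I_d | (j < k)%N) A j * w ord0 j)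
  = (partial i f (x + (tr k + s *: unit_rV i)) - A i) * w ord0 i +
    (f (x + tr k) - f x - \sum_(j : 'I_d | (j < k)%N) A j * w ord0 j).
  by rewrite mulrBl (addrA x) -E; ring.
apply: le_trans (ler_normD _ _) _; rewrite mulrDr; apply: lerD; last exact: IH (ltnW kd).
rewrite normrM ler_wpM2r//; apply: hA => j; rewrite !mxE eqxx /=.
have [->|ji] := eqVneq j i; first by rewrite /= ltnn add0r mulr1.
by rewrite mulr0 addr0; case: ifP; rewrite // normr0.
Qed.

Lemma continuous_near_rV (g : 'rV[R]_d -> R) x (e : R) : continuous g -> 0 < e ->
  exists2 r, 0 < r & forall p, (forall j, `|p ord0 j| <= r) -> `|g (x + p) - g x| <= e.
Proof.
move=> gc e0; have /cvgrPdist_le/(_ e e0) := gc x.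
move=> /nbhs_ballP[r /= r0 hr]; exists (r / 2); first by rewrite divr_gt0.
move=> p hp; rewrite distrC; apply: hr; rewrite -ball_normE /= opprD addrA subrr add0r normrN.
apply: (@le_lt_trans _ _ (r / 2)); first by apply: rV_norm_le => //; rewrite divr_ge0// ltW.
by rewrite ltr_pdivrMr// ltr_pMr// ltr1n.
Qed.

Lemma C1_near f x (e : R) : C1 f -> 0 < e ->
  exists2 r, 0 < r & forall i p, (forall j, `|p ord0 j| <= r) ->
    `|partial i f (x + p) - partial i f x| <= e.
Proof.
move=> fC e0.
have /choice[r hr] : forall i, exists r, 0 < r /\ forall p, (forall j, `|p ord0 j| <= r) ->
    `|partial i f (x + p) - partial i f x| <= e.
  by move=> i; have [r r0 h] := continuous_near_rV x (fC i).2 e0; exists r.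
exists (\big[Order.min/1]_i r i).
  by apply: lt_bigmin => // i _; exact: (hr i).1.
move=> i p hp; apply: (hr i).2 => j; apply: le_trans (hp j) _.
exact: bigmin_le_cond.
Qed.

(** The chain rule from continuous partial derivatives alone; [increment_estimate] supplies the
    first order expansion. *)
Lemma line_derive f x v (t : R) : C1 f ->
  is_derive t (1 : R) (fun s : R => f (x + s *: v)) (\sum_i v ord0 i * partial i f (x + t *: v)).
Proof.
move=> fC; set y := x + t *: v; set D := \sum_i _.
have cv : (fun h : R => h^-1 *: (((fun s : R => f (x + s *: v)) \o shift t) (h *: (1 : R)) - f y))
    @ (0 : R)^' --> D.
  apply/cvgrPdist_le => e e0.
  have e1 : 0 < e / (l1 v + 1) by rewrite divr_gt0// ltr_wpDl// l1_ge0.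
  have [r r0 hr] := C1_near y fC e1.
  have r1 : 0 < r / (l1 v + 1) by rewrite divr_gt0// ltr_wpDl// l1_ge0.
  near=> h.
  have h0 : h != 0 by near: h; exact: nbhs_dnbhs_neq.
  have hr1 : `|h| <= r / (l1 v + 1) by near: h; exact: dnbhs0_le.
  rewrite /= [h *: 1]mulr1 scalerDl [h *: v + _]addrC addrA -/y.
  have := @increment_estimate f y (h *: v) (fun i => partial i f y) (e / (l1 v + 1)).
  move=> /(_ (fun i y => (fC i).1 y)) => H.
  have {}H : `|f (y + h *: v) - f y - \sum_i partial i f y * (h *: v) ord0 i| <= e / (l1 v + 1) * l1 (h *: v).
    apply: H => i p hp; apply: hr => j; apply: le_trans (hp j) _.
    rewrite mxE normrM; apply: (@le_trans _ _ (r / (l1 v + 1) * (l1 v + 1))).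
      by rewrite ler_pM// (le_trans (l1_coord _ _))// lerDl.
    by rewrite divfK// gt_eqF// ltr_wpDl// l1_ge0.
  have -> : D - h^-1 *: (f (y + h *: v) - f y) =
     - (h^-1 * (f (y + h *: v) - f y - \sum_i partial i f y * (h *: v) ord0 i)).
    rewrite mulrBr opprB; congr (_ - _).
    rewrite mulr_sumr; apply: eq_bigr => i _; rewrite mxE; field.
    by rewrite h0.
  rewrite normrN normrM normfV; have nh : 0 < `|h| by rewrite normr_gt0.
  rewrite mulrC ler_pdivrMr//; apply: le_trans H _.
  have -> : l1 (h *: v) = `|h| * l1 v.
    by rewrite /l1 mulr_sumr; apply: eq_bigr => i _; rewrite mxE normrM.
  have -> : e / (l1 v + 1) * (`|h| * l1 v) = e * `|h| * (l1 v / (l1 v + 1)) by ring.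
  apply: ler_piMr; first by rewrite mulr_ge0// ltW.
  by rewrite ler_pdivrMr ?ltr_wpDl ?l1_ge0// mul1r lerDl.
apply: DeriveDef; first by apply/cvg_ex; exists D.
exact/cvg_lim.
Unshelve. all: by end_near. Qed.

(** Schwarz's theorem. The second difference over a square of side [r0] does not depend on the
    order, and each order brings it within (e/2) r0^2 of the corresponding mixed derivative times
    r0^2. *)
Lemma mixed_partials f i j : C1 f -> (forall k, C1 (partial k f)) ->
  partial i (partial j f) = partial j (partial i f).
Proof.
move=> fC fC2; apply/funext => x.
apply/eqP; rewrite -subr_eq0 -normr_eq0 eq_le normr_ge0 andbT.
apply/ler_addgt0Pl => e e0; rewrite addr0.
have e20 : 0 < e / 2 by rewrite divr_gt0.
have /choice[r hr] : forall k, exists r, 0 < r /\ forall l p, (forall j, `|p ord0 j| <= r) ->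
    `|partial l (partial k f) (x + p) - partial l (partial k f) x| <= e / 2.
  by move=> k; have [r r0 h] := C1_near x (fC2 k) e20; exists r.
(* Halved, because two displacements of size [r0] are added. *)
pose r0 := (\big[Order.min/1]_k r k) / 2.
have rgt : 0 < r0 by rewrite divr_gt0// lt_bigmin// => k _; exact: (hr k).1.
have rle k : r0 + r0 <= r k.
  by rewrite -splitr; exact: bigmin_le_cond.
have nd l m : `|(r0 *: unit_rV l) ord0 m| = r0 * (m == l)%:R.
  by rewrite !mxE eqxx /= normrM gtr0_norm// ger0_norm.
have ndle l m : `|(r0 *: unit_rV l) ord0 m| <= r0.
  by rewrite nd; case: (_ == _); rewrite ?mulr1 ?mulr0// ltW.
have l1u l : l1 (r0 *: unit_rV l) = r0.
  rewrite /l1 (bigD1 l)//= big1 => [|m ml]; first by rewrite nd eqxx mulr1 addr0.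
  by rewrite nd (negbTE ml) mulr0.
have sumu (A : 'I_d -> R) l : \sum_i A i * (r0 *: unit_rV l) ord0 i = A l * r0.
  rewrite (bigD1 l)//= big1 => [|m ml].
    by rewrite !mxE eqxx /= eqxx mulr1 addr0.
  by rewrite !mxE eqxx /= (negbTE ml) !mulr0.
have second a b : `|(f (x + r0 *: unit_rV a + r0 *: unit_rV b) - f (x + r0 *: unit_rV a) -
    (f (x + r0 *: unit_rV b) - f x)) - partial b (partial a f) x * r0 * r0| <= e / 2 * r0 * r0.
  pose F y := f (y + r0 *: unit_rV b) - f y.
  have dsh k y : is_derive y (unit_rV k) (fun z => f (z + r0 *: unit_rV b)) (partial k f (y + r0 *: unit_rV b)).
    have E : (fun h : R => h^-1 *: (((fun z => f (z + r0 *: unit_rV b)) \o shift y) (h *: unit_rV k) - f (y + r0 *: unit_rV b)))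
      = (fun h : R => h^-1 *: ((f \o shift (y + r0 *: unit_rV b)) (h *: unit_rV k) - f (y + r0 *: unit_rV b))).
      by apply/funext => h /=; rewrite addrA.
    apply: DeriveDef; first by rewrite /derivable E; exact: (fC k).1.
    by rewrite /derive E.
  have dF k y : is_derive y (unit_rV k) F (partial k f (y + r0 *: unit_rV b) - partial k f y).
    have h1 := dsh k y; have h2 := derivableP ((fC k).1 y).
    exact: is_deriveB.
  have := @increment_estimate F x (r0 *: unit_rV a) (fun k => partial b (partial k f) x * r0) (e / 2 * r0).
  rewrite l1u sumu; apply=> [k y|k p hp]; first by have [] := dF k y.
  have -> : partial k F (x + p) = partial k f (x + p + r0 *: unit_rV b) - partial k f (x + p).
    by rewrite /partial; have [_ ->] := dF k (x + p).
  have := @increment_estimate (partial k f) (x + p) (r0 *: unit_rV b) (fun l => partial l (partial k f) x) (e / 2).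
  rewrite l1u sumu; apply=> [l y|l q hq]; first exact: (fC2 k l).1.
  rewrite -addrA; apply: (hr k).2 => m; rewrite mxE; apply: le_trans (ler_normD _ _) _.
  by apply: le_trans (rle k); apply: lerD; [exact: le_trans (hp m) (ndle _ _)|exact: le_trans (hq m) (ndle _ _)].
have h1 := second j i; have h2 := second i j.
have rr : 0 < r0 * r0 by exact: mulr_gt0.
move: h1 h2; rewrite (addrAC x (r0 *: unit_rV i)).
move: (f (x + _ + _)) (f (x + _)) (f (x + _)) (f x) => X Y Z W.
move: (partial i _ x) (partial j _ x) => a b h1 h2.
rewrite -(ler_pM2r rr) -[X in _ * X <= _](gtr0_norm rr) -normrM.
move: h1 h2; rewrite !ler_norml => /andP[h1 h2] /andP[h3 h4]; apply/andP; split; lra.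
Qed.

End calculus.

(** * Euclidean norm, commuting derivatives and global Taylor remainders *)

Section taylor.
Context {R : realType} {d : nat}.
Implicit Types (f phi : 'rV[R]_d -> R) (x v w p : 'rV[R]_d) (i j : 'I_d).

Lemma enorm_ge0 x : 0 <= enorm x.
Proof. exact: sqrtr_ge0. Qed.

Lemma sqr_enorm x : enorm x ^+ 2 = \sum_i x ord0 i ^+ 2.
Proof. by rewrite sqr_sqrtr// sumr_ge0// => i _; exact: sqr_ge0. Qed.

Lemma enorm_coord x i : `|x ord0 i| <= enorm x.
Proof.
rewrite -(@ler_pXn2r _ 2)// ?nnegrE ?enorm_ge0// sqr_enorm real_normK ?num_real//.
by rewrite (bigD1 i)//= lerDl sumr_ge0// => j _; exact: sqr_ge0.
Qed.

Lemma enorm_le_l1 x : enorm x <= l1 x.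
Proof.
rewrite -(@ler_pXn2r _ 2)// ?nnegrE ?enorm_ge0 ?l1_ge0// sqr_enorm expr2 {1}/l1 mulr_suml.
apply: ler_sum => i _; rewrite -real_normK ?num_real// expr2.
by rewrite ler_wpM2l// l1_coord.
Qed.

Lemma l1_le_enorm x : l1 x <= d%:R * enorm x.
Proof.
rewrite /l1; apply: (@le_trans _ _ (\sum_(i < d) enorm x)).
  by apply: ler_sum => i _; exact: enorm_coord.
by rewrite sumr_const card_ord mulr_natl.
Qed.

Lemma l1Z (a : R) v : l1 (a *: v) = `|a| * l1 v.
Proof. by rewrite /l1 mulr_sumr; apply: eq_bigr => i _; rewrite mxE normrM. Qed.

Lemma partials_cat s t f : partials (s ++ t) f = partials s (partials t f).
Proof. exact: foldr_cat. Qed.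

Lemma smooth_partials s f : smooth f -> smooth (partials s f).
Proof. by move=> fS t; rewrite -partials_cat; exact: fS. Qed.

Lemma smooth_C1 f : smooth f -> C1 f.
Proof.
by move=> fS i; split=> [x|]; [exact: (fS [::]).2|exact: (fS [:: i]).1].
Qed.

Lemma smooth_mixed f i j : smooth f -> partial i (partial j f) = partial j (partial i f).
Proof.
move=> fS; apply: mixed_partials; first exact: smooth_C1.
by move=> k; apply/smooth_C1/(@smooth_partials [:: k]).
Qed.

(** [smooth_mixed] moves one derivative through a word, hence exchanges two words; such block
    exchanges generate all permutations. *)
Lemma partials_perm s t f : smooth f -> perm_eq s t -> partials s f = partials t f.
Proof.
move=> fS.
have swap1 i u (g : 'rV[R]_d -> R) : smooth g -> partials (i :: u) g = partials u (partial i g).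
  elim: u i => [//|j u IH] i gS.
  rewrite -[RHS]/(partial j (partials u (partial i g))) -(IH i gS).
  exact: (smooth_mixed i j (smooth_partials u gS)).
have swap u1 u2 (g : 'rV[R]_d -> R) : smooth g ->
    partials (u1 ++ u2) g = partials (u2 ++ u1) g.
  elim: u1 u2 g => [|i u1 IH] u2 g gS; first by rewrite cats0.
  rewrite -[LHS]/(partial i (partials (u1 ++ u2) g)) (IH u2 g gS) partials_cat.
  rewrite -[LHS]/(partials (i :: u2) (partials u1 g)) (swap1 i u2 _ (smooth_partials u1 gS)).
  by rewrite partials_cat.
move=> st; apply/esym; apply: (catCA_perm_ind (P := fun u => partials u f = partials s f) _ st) => //.
move=> s1 s2 s3 <-; rewrite !catA !partials_cat.
rewrite -[LHS]partials_cat -[RHS]partials_cat.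
by apply: swap; exact: smooth_partials.
Qed.

(** The growth hypothesis only concerns derivatives taken in the order of [multi_partial]; this
    carries it over to any order. *)
Lemma multi_partial_count s f : smooth f ->
  partials s f = multi_partial (fun i => count_mem i s) f.
Proof.
move=> fS; apply: partials_perm => //; apply/seq.permP => a.
have cm b : count_mem b (flatten [seq nseq (count_mem i s) i | i <- enum 'I_d]) = count_mem b s.
  rewrite count_flatten -map_comp sumnE big_map big_enum /= (bigD1 b)//= big1 => [|i ib].
    by rewrite count_nseq /= eqxx mul1n addn0.
  by rewrite count_nseq /= (negbTE ib) mul0n.
by apply/seq.permP: a; rewrite /perm_eq; apply/allP => b _ /=; rewrite cm.
Qed.

Lemma rV_ball_compact (r : R) : compact [set x : 'rV[R]_d | `|x| <= r].
Proof.
apply: bounded_closed_compact.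
  by exists r; split; [exact: num_real|move=> t rt v /= /le_trans; apply; exact: ltW].
rewrite (_ : mkset _ = (fun v : 'rV[R]_d => `|v|) @^-1` [set x | x <= r])//.
by apply: closed_comp => [v _|]; [exact: norm_continuous|exact: closed_le].
Qed.

Lemma continuous_bounded_ball (g : 'rV[R]_d -> R) (r : R) : continuous g -> 0 < r ->
  exists2 C, 0 < C & forall x, `|x| <= r -> `|g x| <= C.
Proof.
move=> gc r0; have [||c _ cm] := @EVT_max_rV R d (fun x => `|g x|) [set x | `|x| <= r] _ (@rV_ball_compact r).
- by exists 0; rewrite /= normr0 ltW.
- apply: continuous_subspaceT => x; apply: continuous_comp; first exact: gc.
  exact: norm_continuous.
exists (`|g c| + 1); first by rewrite ltr_wpDl.
move=> x xr; apply: le_trans (cm x _) _; first by rewrite inE.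
by rewrite lerDl.
Qed.

(** The hypothesis gives the bound outside a ball, compactness inside. The empty list is excluded
    because [phi] itself grows. *)
Lemma partials_bounded phi s : hypothesis1 phi -> s != [::] ->
  exists2 C, 0 < C & forall x, `|partials s phi x| <= C.
Proof.
move=> [sm _ [c [r [C [c0 r0 C0 hC]]]]] s0.
have [C1 C10 hC1] := continuous_bounded_ball (sm s).1 r0.
pose a i := count_mem i s.
have aE : exists i, a i != 0%N.
  by case: s s0 @a {C10 hC1} => // i s _ a; exists i; rewrite /a /= eqxx.
exists (C1 + C a); first by rewrite addr_gt0.
move=> x; have [rx|rx] := leP r (enorm x).
  have [h _ _] := hC x rx; rewrite (multi_partial_count _ sm).
  by apply: le_trans (h a aE) _; rewrite lerDr ltW.
apply: le_trans (hC1 x _) _; last by rewrite lerDl ltW// C0.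
apply: rV_norm_le => [|i]; first exact: ltW.
by apply: le_trans (enorm_coord x i) _; exact: ltW.
Qed.

Lemma lipschitz_bound f (C : R) : C1 f -> (forall i x, `|partial i f x| <= C) ->
  forall x v, `|f (x + v) - f x| <= C * l1 v.
Proof.
move=> fC hC x v.
have := @increment_estimate _ _ f x v (fun=> 0) C.
rewrite (eq_bigr (fun=> 0)) ?big1_eq => [|i _]; last by rewrite mul0r.
by rewrite subr0; apply=> [i y|i p _]; [exact: (fC i).1|rewrite subr0].
Qed.

Lemma taylor1 f (C : R) : C1 f -> (forall i, C1 (partial i f)) ->
  (forall i j x, `|partial j (partial i f) x| <= C) ->
  forall x v, `|f (x + v) - f x - \sum_i partial i f x * v ord0 i| <= C * l1 v ^+ 2.
Proof.
move=> fC fC2 hC x v.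
have := @increment_estimate _ _ f x v (fun i => partial i f x) (C * l1 v).
rewrite expr2 mulrA; apply=> [i y|i p pv]; first exact: (fC i).1.
have C0 : 0 <= C by apply: le_trans (hC i i x).
apply: le_trans (lipschitz_bound (fC2 i) (hC i) x p) _.
by rewrite ler_wpM2l//; apply: ler_sum.
Qed.

(** The mean value theorem for the remainder along the segment: its derivative at [t] combines the
    first order remainders of the partial derivatives, to which [taylor1] applies. *)
Lemma taylor2 f (C : R) : smooth f ->
  (forall i j k x, `|partials [:: k; j; i] f x| <= C) -> 0 <= C ->
  forall x v, `|f (x + v) - f x - \sum_i partial i f x * v ord0 i
     - 2^-1 * \sum_i \sum_j partials [:: j; i] f x * v ord0 i * v ord0 j| <= C * l1 v ^+ 3.
Proof.
move=> fS hC C0 x v.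
have fC := smooth_C1 fS.
have pS s : smooth (partials s f) by exact: smooth_partials.
pose G (t : R) := \sum_i v ord0 i * partial i f (x + t *: v).
pose Q := \sum_i \sum_j partials [:: j; i] f x * v ord0 i * v ord0 j.
pose r t := f (x + t *: v) - t * G 0 - t * t * (2^-1 * Q).
have dr t : is_derive t (1 : R) r (G t - G 0 - t * Q).
  have h1 := line_derive x v t fC.
  have h2 : is_derive t (1 : R) (fun s : R => s * G 0) (G 0).
    apply: (is_derive_eq (@is_deriveM _ _ id (cst (G 0)) t 1 1 0 _ _)).
    by rewrite /GRing.scale /=; ring.
  have h4 : is_derive t (1 : R) (fun s : R => s * s) (t + t).
    apply: (is_derive_eq (@is_deriveM _ _ id id t 1 1 1 _ _)).
    by rewrite /GRing.scale /=; ring.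
  have h3 : is_derive t (1 : R) (fun s : R => (s * s) * (2^-1 * Q)) (t * Q).
    apply: (is_derive_eq (@is_deriveM _ _ (fun s : R => s * s) (cst (2^-1 * Q)) t 1 (t + t) 0 _ _)).
    by rewrite /GRing.scale /=; field.
  have h5 := is_deriveB h1 h2.
  exact: is_deriveB h5 h3.
have rc : continuous r.
  by move=> t; apply: differentiable_continuous; apply/derivable1_diffP; have [] := dr t.
have rcw : {within `[0, 1 : R], continuous r} by exact: continuous_subspaceT.
have [t t01 E] := @MVT_segment R r _ 0 1 ler01 (fun t _ => dr t) rcw.
have {E} : r 1 - r 0 = G t - G 0 - t * Q by rewrite E subr0 mulr1.
have -> : r 1 - r 0 = f (x + v) - f x - \sum_i partial i f x * v ord0 i - 2^-1 * Q.
  rewrite /r scale1r scale0r addr0 !mul0r !subr0 !mul1r.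
  have -> : G 0 = \sum_i partial i f x * v ord0 i.
    by apply: eq_bigr => i _; rewrite scale0r addr0 mulrC.
  ring.
rewrite -/Q => ->.
move: t01; rewrite in_itv /= => /andP[t0 t1].
have -> : G t - G 0 - t * Q = \sum_i v ord0 i * (partial i f (x + t *: v) - partial i f x -
    \sum_j partial j (partial i f) x * (t *: v) ord0 j).
  rewrite /G /Q mulr_sumr -!sumrB; apply: eq_bigr => i _.
  rewrite scale0r addr0 !mulrBr; congr (_ - _); rewrite mulr_sumr [RHS]mulr_sumr.
  apply: eq_bigr => j _; rewrite mxE /=; ring.
apply: le_trans (ler_norm_sum _ _ _) _.
have -> : C * l1 v ^+ 3 = \sum_i `|v ord0 i| * (C * l1 v ^+ 2).
  by rewrite -mulr_suml -/(l1 v); ring.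
apply: ler_sum => i _; rewrite normrM ler_wpM2l//.
have piS := pS [:: i].
apply: le_trans (taylor1 (C := C) (smooth_C1 piS) _ _ _ _) _.
- by move=> j; apply: smooth_C1; exact: (pS [:: j; i]).
- by move=> j k y; exact: (hC i j k y).
rewrite ler_wpM2l// ler_pXn2r// ?nnegrE ?l1_ge0// l1Z ger0_norm//.
by rewrite ler_piMl// l1_ge0.
Qed.

Lemma calculus_bounds phi : hypothesis1 phi -> exists2 C, 0 < C &
  [/\ (forall x v, `|phi (x + v) - phi x| <= C * l1 v),
      (forall x v, `|phi (x + v) - phi x - \sum_i partial i phi x * v ord0 i
         - 2^-1 * \sum_i \sum_j partials [:: i; j] phi x * v ord0 i * v ord0 j| <= C * l1 v ^+ 3),
      (forall i x v, `|partial i phi (x + v) - partial i phi x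
         - \sum_j partials [:: i; j] phi x * v ord0 j| <= C * l1 v ^+ 2),
      (forall i j x v, `|partials [:: i; j] phi (x + v) - partials [:: i; j] phi x| <= C * l1 v) &
      (forall i j x, `|partials [:: i; j] phi x| <= C)].
Proof.
move=> Hphi; have fS := hyp_smooth Hphi.
have bnd (I : finType) (s : I -> seq 'I_d) : (forall k, s k != [::]) ->
    exists2 C, 0 < C & forall k x, `|partials (s k) phi x| <= C.
  move=> s0; have /choice[c hc] : forall k, exists C, 0 < C /\ forall x, `|partials (s k) phi x| <= C.
    by move=> k; have [C C0 h] := partials_bounded Hphi (s0 k); exists C.
  exists (1 + \sum_k c k); first by rewrite ltr_wpDr// sumr_ge0// => k _; exact/ltW/(hc k).1.
  move=> k x; apply: le_trans ((hc k).2 x) _.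
  rewrite (bigD1 k)//= addrCA lerDl addr_ge0// sumr_ge0// => l _; exact/ltW/(hc l).1.
have [Ca Ca0 ha] := @bnd 'I_d (fun i => [:: i]) (fun=> isT).
have [Cb Cb0 hb] := @bnd ('I_d * 'I_d)%type (fun k => [:: k.1; k.2]) (fun=> isT).
have [Cc Cc0 hc] := @bnd ('I_d * 'I_d * 'I_d)%type (fun k => [:: k.1.1; k.1.2; k.2]) (fun=> isT).
have pS s : smooth (partials s phi) by exact: smooth_partials.
have wk (Ck u : R) n w : Ck <= Ca + Cb + Cc -> u <= Ck * l1 w ^+ n -> u <= (Ca + Cb + Cc) * l1 w ^+ n.
  by move=> CkC /le_trans; apply; rewrite ler_wpM2r// exprn_ge0// l1_ge0.
have sw i j : partials [:: i; j] phi = partials [:: j; i] phi.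
  exact: smooth_mixed.
exists (Ca + Cb + Cc); first by rewrite !addr_gt0.
split.
- move=> x v; rewrite -[l1 v]expr1; apply: (wk Ca); first by lra.
  by rewrite expr1; apply: lipschitz_bound => [|i y]; [exact: smooth_C1|exact: (ha i y)].
- move=> x v; apply: (wk Cc); first by lra.
  have -> : \sum_i \sum_j partials [:: i; j] phi x * v ord0 i * v ord0 j =
      \sum_i \sum_j partials [:: j; i] phi x * v ord0 i * v ord0 j.
    by apply: eq_bigr => i _; apply: eq_bigr => j _; rewrite sw.
  apply: taylor2 => //; last exact: ltW.
  by move=> i j k y; exact: (hc (k, j, i) y).
- move=> i x v; apply: (wk Cc); first by lra.
  have -> : \sum_j partials [:: i; j] phi x * v ord0 j = \sum_j partial j (partial i phi) x * v ord0 j.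
    by apply: eq_bigr => j _; rewrite sw.
  apply: (taylor1 (f := partial i phi)).
  + by apply: smooth_C1; exact: (pS [:: i]).
  + by move=> j; apply: smooth_C1; exact: (pS [:: j; i]).
  + by move=> j k y; exact: (hc (k, j, i) y).
- move=> i j x v; rewrite -[l1 v]expr1; apply: (wk Cc); first by lra.
  rewrite expr1; apply: lipschitz_bound => [|k y]; first exact/smooth_C1/(pS [:: i; j]).
  exact: (hc (k, i, j) y).
- by move=> i j x; apply: le_trans (hb (i, j) x) _; lra.
Qed.

End taylor.

(** * Absolute value of a symmetric matrix *)

Section abs_form.
Local Open Scope sesquilinear_scope.
Context {R : realType} {d : nat}.
Implicit Types (u v w : 'rV[R]_d) (H : 'M[R]_d).

Definition dotv u v : R := \sum_i u ord0 i * v ord0 i.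

Lemma dotvC u v : dotv u v = dotv v u.
Proof. by apply: eq_bigr => i _; rewrite mulrC. Qed.

Lemma dotvDl u v w : dotv (u + v) w = dotv u w + dotv v w.
Proof. by rewrite /dotv -big_split; apply: eq_bigr => i _; rewrite mxE mulrDl. Qed.

Lemma dotvZl (a : R) u v : dotv (a *: u) v = a * dotv u v.
Proof. by rewrite /dotv mulr_sumr; apply: eq_bigr => i _; rewrite mxE mulrA. Qed.

Lemma dotv_suml I (r : seq I) (P : pred I) (F : I -> 'rV[R]_d) v :
  dotv (\sum_(k <- r | P k) F k) v = \sum_(k <- r | P k) dotv (F k) v.
Proof.
apply: (big_morph (fun u => dotv u v)) => [x y|]; first exact: dotvDl.
by rewrite /dotv big1// => i _; rewrite mxE mul0r.
Qed.

Lemma dotv_mulmx H u v : H^T = H -> dotv (u *m H) v = dotv u (v *m H).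
Proof.
move=> Hs; rewrite /dotv.
under eq_bigr do rewrite mxE mulr_suml.
under [RHS]eq_bigr do rewrite mxE mulr_sumr.
rewrite exchange_big; apply: eq_bigr => i _; apply: eq_bigr => j _ /=.
by rewrite -[in LHS]Hs mxE -!mulrA [H _ _ * _]mulrC.
Qed.

Lemma dotvv_ge0 v : 0 <= dotv v v.
Proof. by apply: sumr_ge0 => i _; rewrite -expr2 sqr_ge0. Qed.

Lemma dotv_enorm v : dotv v v = enorm v ^+ 2.
Proof. by rewrite sqr_enorm; apply: eq_bigr => i _; rewrite expr2. Qed.

(* The real and imaginary parts of a unitary eigenbasis of H form a real tight
   frame of eigenvectors. *)
Lemma eigenframe H : H^T = H -> exists (q : 'I_d * bool -> 'rV[R]_d) (s : 'I_d * bool -> R),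
  (forall k, q k *m H = s k *: q k) /\ (forall v, v = \sum_k dotv v (q k) *: q k).
Proof.
move=> Hsym.
pose HC : 'M[R[i]]_d := map_mx (fun x : R => x%:C%C) H.
have HCh : HC \is hermsymmx.
  apply/is_hermitianmxP; rewrite expr0 scale1r; apply/matrixP => i j.
  by rewrite !mxE -[in LHS]Hsym mxE; exact: (esym (conjc_real _)).
have spE := orthomx_spectralP (hermitian_normalmx HCh).
have spR := hermitian_spectral_diag_real HCh.
set P := spectralmx HC in spE; set sp := spectral_diag HC in spE spR.
have PU : P \is unitarymx by exact: spectral_unitarymx.
pose re (z : R[i]) := complex.Re z; pose im (z : R[i]) := complex.Im z.
have reD : {morph re : x y / x + y} by case=> ? ? [].
have imD : {morph im : x y / x + y} by case=> ? ? [].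
have re_sum (F : 'I_d -> R[i]) : re (\sum_i F i) = \sum_i re (F i).
  exact: (big_morph re reD).
have im_sum (F : 'I_d -> R[i]) : im (\sum_i F i) = \sum_i im (F i).
  exact: (big_morph im imD).
pose s (k : 'I_d * bool) := re (sp ord0 k.1).
pose q (k : 'I_d * bool) : 'rV[R]_d :=
  \row_i (if k.2 then re (P k.1 i) else im (P k.1 i)).
have spC j : sp ord0 j = (re (sp ord0 j))%:C%C.
  have /mxOverP/(_ ord0 j) := spR; case: (sp ord0 j) => a b /CrealP/(congr1 im) /= E.
  by have -> : b = 0 by lra.
exists q, s; split=> [[j b]|v].
  have PH : P *m HC = diag_mx sp *m P.
    by rewrite spE !mulmxA mulmxV ?mul1mx ?spectral_unit.
  apply/rowP => l; rewrite !mxE /=.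
  have /matrixP/(_ j l) := PH; rewrite mul_diag_mx !mxE spC.
  under eq_bigr do rewrite mxE.
  move=> E; case: b => /=.
    have := congr1 re E; rewrite re_sum /s /=.
    case: (P j l) => x y /=; rewrite mul0r subr0 => <-.
    by apply: eq_bigr => i _; rewrite !mxE /=; case: (P j i) => x' y' /=; rewrite mulr0 subr0.
  have := congr1 im E; rewrite im_sum /s /=.
  case: (P j l) => x y /=; rewrite mul0r addr0 => <-.
  by apply: eq_bigr => i _; rewrite !mxE /=; case: (P j i) => x' y' /=; rewrite mulr0 add0r.
have PP : P^t* *m P = 1%:M by rewrite -invmx_unitary// mulVmx// spectral_unit.
apply/rowP => l; rewrite summxE.
transitivity (\sum_i v ord0 i * \sum_k q k ord0 i * q k ord0 l); last first.
  under [RHS]eq_bigr do rewrite mxE /dotv mulr_suml.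
  rewrite [RHS]exchange_big /=; apply: eq_bigr => i _; rewrite mulr_sumr.
  by apply: eq_bigr => k _; rewrite mulrA.
(* The real part of the entry (i, l) of P^* P = 1; the boolean in [k] splits a product of complex
   entries into its two real contributions. *)
have qq i : \sum_k q k ord0 i * q k ord0 l = (i == l)%:R.
  have /matrixP/(_ i l) := PP; rewrite !mxE => /(congr1 re).
  rewrite re_sum; have -> : re (i == l)%:R = (i == l)%:R by case: (i == l).
  move=> <-; rewrite -(pair_bigA _ (fun j b => q (j, b) ord0 i * q (j, b) ord0 l)) /=.
  apply: eq_bigr => j _; rewrite big_bool /= !mxE /=.
  case: (P j i) => x y; case: (P j l) => x' y' /=.
  by rewrite mulNr opprK.
rewrite (bigD1 l)//= qq eqxx mulr1 big1 ?addr0// => i il.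
by rewrite qq (negbTE il) mulr0.
Qed.

(* M is the absolute value of H in the sense of functional calculus. *)
Lemma abs_form H : H^T = H -> H \in unitmx -> exists (M : 'M[R]_d) (m : R), [/\ 0 < m /\ M^T = M,
  (forall v, m * dotv v v <= dotv (v *m M) v),
  (forall v, m ^+ 2 * dotv v v <= dotv (v *m H) (v *m H)),
  (forall v, dotv (v *m M) (v *m M) = dotv (v *m H) (v *m H)) &
  (forall v, m * dotv v v <= dotv (v *m H) v) \/ \tr H < \tr M].
Proof.
move=> Hsym Hunit; have [q [s [qH frame]]] := eigenframe Hsym.
have frame2 u v : dotv u v = \sum_k dotv u (q k) * dotv v (q k).
  rewrite {1}(frame u) dotv_suml; apply: eq_bigr => k _.
  by rewrite dotvZl (dotvC (q k)).
have s0 k : q k != 0 -> s k != 0.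
  apply: contra => /eqP sk; have := qH k; rewrite sk scale0r => /(congr1 (mulmx^~ (invmx H))).
  by rewrite mulmxK// mul0mx => ->.
(* Functional calculus through the frame: the choice [s] gives back H, and |s| gives |H|. *)
pose op (t : 'I_d * bool -> R) : 'M[R]_d := \sum_k t k *: ((q k)^T *m q k).
have opE t v : v *m op t = \sum_k (t k * dotv v (q k)) *: q k.
  rewrite mulmx_sumr; apply: eq_bigr => k _; rewrite -scalemxAr mulmxA -scalerA; congr (_ *: _).
  apply/rowP => j; rewrite !mxE big_ord1; congr (_ * _).
  by rewrite mxE; apply: eq_bigr => i _; rewrite mxE.
have orth k l : s k != s l -> dotv (q k) (q l) = 0.
  move=> kl; have := dotv_mulmx (q k) (q l) Hsym; rewrite !qH dotvZl (dotvC (q k) (s l *: _)) dotvZl (dotvC (q l)).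
  by move=> /eqP; rewrite -subr_eq0 -mulrBl mulf_eq0 subr_eq0 (negbTE kl) => /eqP.
have form t v : dotv (v *m op t) v = \sum_k t k * dotv v (q k) ^+ 2.
  rewrite opE dotv_suml; apply: eq_bigr => k _.
  by rewrite dotvZl (dotvC (q k)) -mulrA -expr2.
(* Frame vectors with the same eigenvalue need not be orthogonal, so [t] must depend on the
   eigenvalue only; those with distinct eigenvalues are orthogonal by [orth]. *)
have sqform (t : 'I_d * bool -> R) v : (forall k l, s k = s l -> t k = t l) ->
    dotv (v *m op t) (v *m op t) = \sum_k t k ^+ 2 * dotv v (q k) ^+ 2.
  move=> tE; rewrite frame2; apply: eq_bigr => k _.
  suff -> : dotv (v *m op t) (q k) = t k * dotv v (q k) by rewrite -expr2 exprMn.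
  rewrite opE dotv_suml (frame2 v) mulr_sumr; apply: eq_bigr => l _; rewrite dotvZl.
  have [sl|sl] := eqVneq (s l) (s k); first by rewrite (tE _ _ sl) mulrA (dotvC (q k)).
  by rewrite (dotvC (q k)) (orth _ _ sl) !mulr0.
have opH : op s = H.
  apply/row_matrixP => i; rewrite !rowE opE {2}(frame (delta_mx 0 i)) mulmx_suml.
  by apply: eq_bigr => k _; rewrite -scalemxAl qH scalerA mulrC.
have optr t : \tr (op t) = \sum_k t k * dotv (q k) (q k).
  rewrite /op raddf_sum /=; apply: eq_bigr => k _; rewrite mxtraceZ; congr (_ * _).
  by rewrite mxtrace_mulC /mxtrace big_ord1 mxE; apply: eq_bigr => i _; rewrite mxE.
pose t k := `|s k|.
(* Frame vectors may vanish, and their eigenvalues are then meaningless; for the others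
   invertibility of H gives [s k != 0]. *)
pose m := \big[Order.min/1]_(k | q k != 0) `|s k|.
have m0 : 0 < m by apply: lt_bigmin => // k qk; rewrite normr_gt0 s0.
have msk k : q k != 0 -> m <= `|s k| by move=> qk; exact: bigmin_le_cond.
have dq0 v k : q k = 0 -> dotv v (q k) = 0.
  by move=> ->; rewrite /dotv big1// => i _; rewrite mxE mulr0.
have ge_m (c : 'I_d * bool -> R) e v : (forall k, q k != 0 -> e <= c k) ->
    e * dotv v v <= \sum_k c k * dotv v (q k) ^+ 2.
  move=> ec; rewrite frame2 mulr_sumr; apply: ler_sum => k _; rewrite -expr2.
  have [q0|q0] := eqVneq (q k) 0; first by rewrite dq0// expr0n /= !mulr0.
  by rewrite ler_wpM2r ?sqr_ge0// ec.
exists (op t), m; split.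
- split=> //; rewrite /op raddf_sum; apply: eq_bigr => k _.
  apply/matrixP => i j; rewrite !mxE; congr (_ * _).
  by apply: eq_bigr => l _; rewrite !mxE mulrC.
- by move=> v; rewrite form; apply: ge_m => k; exact: msk.
- move=> v; rewrite -opH sqform//; apply: ge_m => k qk.
  rewrite -[leRHS]real_normK ?num_real//; have mk := msk k qk.
  by rewrite !expr2; apply: ler_pM => //; exact: ltW.
- move=> v; rewrite -[in RHS]opH !sqform//.
    by apply: eq_bigr => k _; rewrite /t real_normK ?num_real.
  by move=> k l; rewrite /t => ->.
(* Either H is positive definite, or a nonzero frame vector has a negative eigenvalue, whose
   absolute value strictly raises the trace. *)
have [pos|/existsNP[k hk]] := pselect (forall k, q k != 0 -> 0 < s k); [left|right].
  move=> v; rewrite -opH form; apply: ge_m => k qk.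
  by apply: le_trans (msk k qk) _; rewrite gtr0_norm// pos.
move: hk => /not_implyP[qk /negP]; rewrite -leNgt => sk.
have skl : s k < 0 by rewrite lt_neqAle s0.
rewrite -[in ltLHS]opH !optr (bigD1 k)//= [ltRHS](bigD1 k)//=.
apply: ltr_leD.
  rewrite ltr_pM2r; first by rewrite /t ltr0_norm//; lra.
  rewrite lt_neqAle dotvv_ge0 andbT eq_sym; apply: contra qk => /eqP qq.
  apply/eqP/rowP => i; rewrite mxE; apply/eqP; rewrite -sqrf_eq0 eq_le sqr_ge0 andbT.
  rewrite -qq /dotv (bigD1 i)//= -expr2 lerDl sumr_ge0// => j _.
  by rewrite -expr2 sqr_ge0.
apply: ler_sum => l _; rewrite ler_wpM2r ?dotvv_ge0// /t; exact: ler_norm.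
Qed.

End abs_form.

(** * Integration over boxes *)

Section lebesgue.
Context {R : realType}.

Definition box n (a b : 'rV[R]_n) : set 'rV[R]_n :=
  [set x | forall i, a ord0 i <= x ord0 i <= b ord0 i].

Lemma measurable_box n (a b : 'rV[R]_n) : measurable (box a b).
Proof.
rewrite (_ : box a b = \bigcap_(i in [set: 'I_n])
   (fun x : 'rV[R]_n => x ord0 i) @^-1` `[a ord0 i, b ord0 i]).
  apply: fin_bigcap_measurable => [|i _]; first exact: finite_finset.
  by rewrite -[X in measurable X]setTI; apply: measurable_coord.
apply/seteqP; split=> [x xab i _ /=|x xab i].
  by rewrite in_itv/=; exact: xab.
by have := xab i I; rewrite /= in_itv.
Qed.

Lemma box_empty n (a b : 'rV[R]_n) i : b ord0 i < a ord0 i -> box a b = set0.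
Proof.
move=> ba; apply/seteqP; split=> // x /(_ i) /andP[h1 h2].
by have := le_trans h1 h2; rewrite leNgt ba.
Qed.

Lemma boxI n (a b a' b' : 'rV[R]_n) : box a b `&` box a' b' =
  box (\row_i Order.max (a ord0 i) (a' ord0 i)) (\row_i Order.min (b ord0 i) (b' ord0 i)).
Proof.
apply/seteqP; split=> [x [h1 h2] i|x h].
  have /andP[? ?] := h1 i; have /andP[? ?] := h2 i.
  by rewrite !mxE ge_max le_min; apply/andP; split; apply/andP.
by split=> i; have := h i; rewrite !mxE ge_max le_min => /andP[/andP[h1 h2] /andP[h3 h4]];
  apply/andP.
Qed.

Definition boxes n : set (set 'rV[R]_n) := [set A | exists a b, A = box a b].

Lemma open_bigcup_boxes n (U : set 'rV[R]_n) : open U ->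
  exists F : nat -> set 'rV[R]_n, (forall k, boxes (F k) \/ F k = set0) /\ U = \bigcup_k F k.
Proof.
move=> oU.
pose bx (p : 'rV[rat]_n * nat) : set 'rV[R]_n :=
  box (\row_i (ratr (p.1 ord0 i) - p.2.+1%:R^-1)) (\row_i (ratr (p.1 ord0 i) + p.2.+1%:R^-1)).
pose F k : set 'rV[R]_n := if @choice.unpickle ('rV[rat]_n * nat)%type k is Some p then
  (if `[< bx p `<=` U >] then bx p else set0) else set0.
exists F; split.
  move=> k; rewrite /F; case: choice.unpickle => [p|]; last by right.
  by case: asboolP => _; [left; eexists; eexists|right].
apply/seteqP; split; last first.
  move=> x [k _]; rewrite /F; case: choice.unpickle => [p|//].
  by case: asboolP => // + xp; exact.
move=> x Ux.
have /nbhs_ballP[e /= e0 xeU] : nbhs x U by exact: open_nbhs_nbhs.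
have [k ke] : exists k : nat, k.+1%:R^-1 < e / 2 :> R.
  have e20 : 0 < e / 2 by rewrite divr_gt0.
  have [k _ /(_ k (leqnn k))/= ?] := near_infty_natSinv_lt (PosNum e20).
  by exists k.
have k0 : 0 < k.+1%:R^-1 :> R by rewrite invr_gt0.
have /choice[q xq] : forall i, exists q : rat,
    x ord0 i - k.+1%:R^-1 < ratr q < x ord0 i.
  move=> i; have /rat_in_itvoo[q] : x ord0 i - k.+1%:R^-1 < x ord0 i by rewrite gtrBl.
  by rewrite in_itv/= => ?; exists q.
move: ke k0 xq; set z : R := k.+1%:R^-1 => ke z0 xq.
exists (choice.pickle (\row_i q i, k)) => //; rewrite /F choice.pickleK.
case: asboolP => [_ i|[]].
  by rewrite !mxE; have /andP[h1 h2] := xq i; apply/andP; split; rewrite -/z; lra.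
move=> y yb; apply: xeU; rewrite -ball_normE /=.
apply: (@le_lt_trans _ _ (z + z)); last by lra.
apply: rV_norm_le => [|i]; first by lra.
have := yb i; rewrite !mxE -/z => /andP[h1 h2]; have /andP[h3 h4] := xq i.
by rewrite ler_norml; apply/andP; split; lra.
Qed.

Lemma measurable_boxes n : @measurable _ 'rV[R]_n = <<s @boxes n >>.
Proof.
apply/seteqP; split; last first.
  apply: smallest_sub; first exact: sigma_algebra_measurable.
  by move=> _ [a [b ->]]; exact: measurable_box.
apply: smallest_sub; first exact: smallest_sigma_algebra.
move=> U /open_bigcup_boxes[F [Fb ->]].
apply: sigma_algebra_bigcup => k; have [bk|->] := Fb k.
  exact: sub_sigma_algebra.
exact: sigma_algebra0.
Qed.

Lemma bigcup_boxes n : \bigcup_k (box (const_mx (- k%:R)) (const_mx k%:R)) = [set: 'rV[R]_n].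
Proof.
apply/seteqP; split=> // x _.
have [k xk] : exists k : nat, `|x| <= k%:R.
  by exists (Num.bound `|x|); apply: ltW; exact: archi_boundP.
exists k => // i; rewrite !mxE -ler_norml; apply: le_trans xk; exact: rV_norm_ge.
Qed.

(** Boxes are stable under intersection, generate the Borel sets and exhaust the space. This
    characterization yields the change of variables below. *)
Lemma leb_unique n (m : {measure set 'rV[R]_n -> \bar R}) :
  (forall a b : 'rV[R]_n, (forall i, a ord0 i <= b ord0 i) ->
     m (box a b) = (\prod_i (b ord0 i - a ord0 i))%:E) ->
  forall A, measurable A -> m A = leb n A.
Proof.
move=> mb A mA.
apply: (@measure_unique _ _ _ (@boxes n) (fun k => box (const_mx (- k%:R)) (const_mx k%:R))) => //.
- exact: measurable_boxes.
- by move=> _ _ [a [b ->]] [a' [b' ->]]; rewrite boxI; do 2 eexists.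
- by move=> k; do 2 eexists.
- exact: bigcup_boxes.
- move=> _ [a [b ->]].
  have [ab|/existsNP[i /negP]] := pselect (forall i, a ord0 i <= b ord0 i).
    by rewrite mb// [RHS]leb_box.
  by rewrite -ltNge => /box_empty ->; rewrite !measure0.
- by move=> k; rewrite mb ?ltry// => i; rewrite !mxE ge0_cp.
Qed.

(** Translations, dilations, reflections and coordinate permutations in one map: they send boxes to
    boxes, so their Jacobian can be read off [leb_box]. *)
Definition affine n (x : 'rV[R]_n) (c : 'I_n -> R) (s : {perm 'I_n}) (u : 'rV[R]_n) : 'rV[R]_n :=
  \row_i (x ord0 i + c i * u ord0 (s i)).

Lemma measurable_affine n x c s : measurable_fun setT (@affine n x c s).
Proof.
apply: measurable_fun_rV => i.
rewrite (_ : (fun _ => _) = (fun u : 'rV[R]_n => x ord0 i + c i * u ord0 (s i))); last first.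
  by apply/funext => u; rewrite mxE.
by apply: measurable_funD => //; apply: measurable_funM => //; exact: measurable_coord.
Qed.

Lemma affine_box n x c s (a b : 'rV[R]_n) : (forall i, c i != 0) ->
  (forall i, a ord0 i <= b ord0 i) ->
  exists a' b' : 'rV[R]_n, [/\ affine x c s @^-1` box a b = box a' b',
    (forall i, a' ord0 i <= b' ord0 i) &
    forall i, b' ord0 (s i) - a' ord0 (s i) = (b ord0 i - a ord0 i) / `|c i|].
Proof.
move=> c0 ab.
pose lo i := ((if 0 < c i then a ord0 i else b ord0 i) - x ord0 i) / c i.
pose hi i := ((if 0 < c i then b ord0 i else a ord0 i) - x ord0 i) / c i.
have lohi i (y : R) : (lo i <= y <= hi i) = (a ord0 i <= x ord0 i + c i * y <= b ord0 i).
  rewrite /lo /hi; have [ci|ci] := ltP 0 (c i).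
    by rewrite ler_pdivrMr// ler_pdivlMr// lerBlDl lerBrDl (mulrC y).
  have cn : c i < 0 by rewrite lt_neqAle c0.
  by rewrite ler_ndivrMr// ler_ndivlMr// lerBrDl lerBlDl (mulrC y) andbC.
have diff i : hi i - lo i = (b ord0 i - a ord0 i) / `|c i|.
  rewrite /lo /hi; have [ci|ci] := ltP 0 (c i).
    by rewrite gtr0_norm//; field; rewrite c0.
  have cn : c i < 0 by rewrite lt_neqAle c0.
  by rewrite ltr0_norm//; field; rewrite c0.
exists (\row_j lo (s^-1%g j)), (\row_j hi (s^-1%g j)); split.
- apply/seteqP; split=> [u h j|u h i].
    by rewrite !mxE lohi; have := h (s^-1%g j); rewrite !mxE permKV.
  by have := h (s i); rewrite !mxE permK lohi.
- by move=> i; rewrite !mxE -subr_ge0 diff divr_ge0// subr_ge0 ab.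
- by move=> i; rewrite !mxE !permK diff.
Qed.

Lemma leb_affine n x c s (A : set 'rV[R]_n) : (forall i, c i != 0) -> measurable A ->
  ((\prod_i `|c i|)%:E * leb n (affine x c s @^-1` A))%E = leb n A.
Proof.
move=> c0 mA.
have P0 : 0 <= \prod_i `|c i| by apply: prodr_ge0.
pose m0 : {measure set 'rV[R]_n -> \bar R} :=
  mscale (NngNum P0) (pushforward (leb n) (affine x c s)).
pose m := m0 (measurable_affine x c s).
rewrite -[RHS](@leb_unique n m)// => a b ab.
have [a' [b' [E ab' dab]]] := affine_box x s c0 ab.
rewrite [LHS](_ : _ = ((\prod_i `|c i|)%:E * leb n (affine x c s @^-1` box a b))%E)//.
rewrite E [X in (_ * X)%E](leb_box ab') -EFinM; congr EFin.
rewrite [X in _ * X](reindex_inj (@perm_inj _ s))/= -big_split /=; apply: eq_bigr => i _.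
by rewrite dab mulrCA divff ?mulr1// normr_eq0.
Qed.

Lemma integral_affine n x c s (D : set 'rV[R]_n) (f : 'rV[R]_n -> \bar R) :
  (forall i, c i != 0) -> measurable D -> measurable_fun setT f -> (forall y, 0 <= f y)%E ->
  (\int[leb n]_(y in D) f y =
   (\prod_i `|c i|)%:E * \int[leb n]_(u in affine x c s @^-1` D) f (affine x c s u))%E.
Proof.
move=> c0 mD mf f0.
have P0 : 0 <= \prod_i `|c i| by apply: prodr_ge0.
pose m0 : {measure set 'rV[R]_n -> \bar R} :=
  mscale (NngNum P0) (pushforward (leb n) (affine x c s)).
pose m := m0 (measurable_affine x c s).
rewrite (@eq_measure_integral _ _ _ D m (leb n)); last first.
  by move=> A mA _; apply/esym; exact: leb_affine.
rewrite ge0_integral_mscale//; last exact: measurable_funTS.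
congr (_ * _)%E; rewrite ge0_integral_pushforward//; [exact: measurable_affine|exact: measurable_funTS].
Qed.

Lemma leb_bounded n (A : set 'rV[R]_n) (r : R) : measurable A ->
  (forall x, A x -> forall i, `|x ord0 i| <= r) -> (leb n A < +oo)%E.
Proof.
move=> mA Ar; have [r0|r0] := leP 0 r.
  apply: (@le_lt_trans _ _ (leb n (box (const_mx (- r)) (const_mx r)))).
    apply: le_measure; rewrite ?inE//; first exact: measurable_box.
    by move=> x /Ar h i; rewrite !mxE -ler_norml.
  by rewrite [X in (X < _)%E]leb_box ?ltry// => i; rewrite !mxE ge0_cp.
(* A negative [r] forces [A] to be empty, except in dimension 0, where there is no coordinate to
   test. *)
case: n => [|n] in A mA Ar *.
  apply: (@le_lt_trans _ _ (leb 0 (box 0 0))).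
    apply: le_measure; rewrite ?inE//; first exact: measurable_box.
    by move=> x _ [].
  by rewrite [X in (X < _)%E]leb_box ?ltry// => -[].
rewrite (_ : A = set0) ?measure0//; apply/seteqP; split=> // x /Ar/(_ ord0) h.
by have := le_lt_trans h r0; rewrite ltNge normr_ge0.
Qed.

Lemma leb_sigma_finite n : sigma_finite setT (leb n : set 'rV[R]_n -> \bar R).
Proof.
exists (fun k => box (const_mx (- k%:R)) (const_mx k%:R)); first by rewrite bigcup_boxes.
move=> k; split; first exact: measurable_box.
by rewrite [X in (X < _)%E]leb_box ?ltry// => i; rewrite !mxE ge0_cp.
Qed.

Lemma measurable_eball n (x : 'rV[R]_n) r : measurable (eball x r).
Proof.
have mA : measurable [set p : 'rV[R]_n * 'rV[R]_n | enorm (p.1 - p.2) < r].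
  have := @measurable_enorm_sub R n measurableT _ (measurable_itv `]-oo, r[).
  by rewrite setTI set_itvE.
have := measurable_xsection x mA.
rewrite (_ : xsection _ _ = eball x r)//.
by apply/seteqP; split => y; rewrite /xsection/= inE.
Qed.

Lemma eball_coord n (x y : 'rV[R]_n) r : eball x r y -> forall i, `|y ord0 i - x ord0 i| < r.
Proof.
move=> xy i; apply: le_lt_trans xy; apply: le_trans (enorm_coord _ i).
by rewrite !mxE distrC.
Qed.

(** With half-side r/(n+1) the l1 norm is at most n r/(n+1) < r, also for n = 0. *)
Lemma box_eball n (x : 'rV[R]_n) r : 0 < r ->
  box (\row_i (x ord0 i - r / n.+1%:R)) (\row_i (x ord0 i + r / n.+1%:R)) `<=` eball x r.
Proof.
move=> r0 y yb; rewrite /eball /=; apply: le_lt_trans (enorm_le_l1 _) _.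
apply: (@le_lt_trans _ _ (\sum_(i < n) r / n.+1%:R)).
  apply: ler_sum => i _; have := yb i; rewrite !mxE => /andP[h1 h2].
  by rewrite ler_norml; move: h1 h2; set z := r / _; move=> h1 h2; apply/andP; split; lra.
rewrite sumr_const card_ord -[ltLHS]mulr_natr -mulrA gtr_pMr// mulrC.
by rewrite ltr_pdivrMr// mul1r ltr_nat.
Qed.

Lemma leb_eball_lb n (x : 'rV[R]_n) r : 0 < r -> (((2 * r / n.+1%:R) ^+ n)%:E <= leb n (eball x r))%E.
Proof.
move=> r0; pose a : 'rV[R]_n := \row_i (x ord0 i - r / n.+1%:R).
pose b : 'rV[R]_n := \row_i (x ord0 i + r / n.+1%:R).
apply: (@le_trans _ _ (leb n (box a b))); last first.
  apply: le_measure; rewrite ?inE; [exact: measurable_box|exact: measurable_eball|].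
  exact: box_eball.
have ab i : a ord0 i <= b ord0 i.
  by rewrite !mxE lerD2l ge0_cp// divr_ge0// ltW.
rewrite [leRHS]leb_box// lee_fin (eq_bigr (fun=> 2 * r / n.+1%:R)) => [|i _].
  by rewrite prodr_const card_ord.
by rewrite !mxE; ring.
Qed.

Lemma leb_eball_ub n (x : 'rV[R]_n) r : 0 < r -> (leb n (eball x r) <= ((2 * r) ^+ n)%:E)%E.
Proof.
move=> r0; pose a : 'rV[R]_n := \row_i (x ord0 i - r); pose b : 'rV[R]_n := \row_i (x ord0 i + r).
have ab i : a ord0 i <= b ord0 i by rewrite !mxE lerD2l ge0_cp// ltW.
apply: (@le_trans _ _ (leb n (box a b))).
  apply: le_measure; rewrite ?inE; [exact: measurable_eball|exact: measurable_box|].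
  move=> y /eball_coord h i; have := ltW (h i); rewrite !mxE ler_norml => /andP[h1 h2].
  by apply/andP; split; lra.
rewrite [leLHS]leb_box// lee_fin (eq_bigr (fun=> 2 * r)) => [|i _].
  by rewrite prodr_const card_ord.
by rewrite !mxE; ring.
Qed.

End lebesgue.

(** * Elementary bounds for the exponential and hyperbolic functions *)

Section exp_bounds.
Context {R : realType}.
Implicit Types s t x : R.

Definition cosh x : R := (expR x + expR (- x)) / 2.
Definition sinh x : R := (expR x - expR (- x)) / 2.

(** From exp s <= 1/(1 - s), and (1 - s)(1 + s + 2 s^2) = 1 + s^2 (1 - 2 s) >= 1. *)
Lemma expR_le_quadratic s : s <= 2^-1 -> expR s <= 1 + s + 2 * s ^+ 2.
Proof.
move=> s2; have h1 : 0 < 1 - s by lra.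
have : expR (- s) >= 1 - s by have := expR_ge1Dx (- s).
rewrite expRN => h; have e0 := expR_gt0 s.
have h2 : (1 - s) * expR s <= 1 by rewrite -ler_pdivlMr// div1r.
rewrite -(ler_pM2l h1); apply: le_trans h2 _.
have -> : (1 - s) * (1 + s + 2 * s ^+ 2) = 1 + s ^+ 2 * (1 - 2 * s) by ring.
by rewrite lerDl mulr_ge0 ?sqr_ge0//; lra.
Qed.

Lemma cosh_ge1 x : 1 <= cosh x.
Proof. by rewrite /cosh; have := expR_ge1Dx x; have := expR_ge1Dx (- x); lra. Qed.

Lemma sinhN x : sinh (- x) = - sinh x.
Proof. by rewrite /sinh opprK; lra. Qed.

Lemma cosh_le_expR x : cosh x <= expR `|x|.
Proof.
rewrite /cosh; have : expR x <= expR `|x| by rewrite ler_expR ler_norm.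
have : expR (- x) <= expR `|x| by rewrite ler_expR -normrN ler_norm.
lra.
Qed.

(** With cosh x = 1 + 2 sinh(x/2)^2 this reduces every bound on cosh to a bound on the factor cosh
    t. *)
Lemma sinh_mvt x : exists2 t, `|t| <= `|x| & sinh x = cosh t * x.
Proof.
wlog x0 : x / 0 <= x.
  move=> H; have [|x0] := leP 0 x; first exact: H.
  have [|t tx E] := H (- x); first by rewrite oppr_ge0 ltW.
  by exists t; [rewrite -(normrN x)|apply: oppr_inj; rewrite -sinhN E mulrN].
have ds (y : R) : is_derive y (1 : R) sinh (cosh y).
  have h2 : is_derive y (1 : R) (fun z : R => expR (- z)) (expR (- y) * -1).
    exact: is_derive1_comp.
  have h3 := is_deriveB (is_derive_expR y) h2.
  have h4 := is_deriveZ 2^-1 h3.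
  have E : sinh = 2^-1 \*: (expR - (fun z : R => expR (- z))).
    by apply/funext => z; rewrite /sinh mulrC.
  rewrite E; apply: is_derive_eq; rewrite /cosh /GRing.scale /=; lra.
have cs : continuous sinh.
  by move=> y; apply: differentiable_continuous; apply/derivable1_diffP; have [] := ds y.
have csw : {within `[0, x], continuous sinh} by exact: continuous_subspaceT.
have [t] := @MVT_segment R sinh cosh 0 x x0 (fun y _ => ds y) csw.
rewrite in_itv /= => /andP[t0 tx]; rewrite subr0 {2}/sinh oppr0 subrr mul0r subr0 => E.
by exists t => //; rewrite !ger0_norm.
Qed.

Lemma cosh_half x : cosh x = 1 + 2 * sinh (x / 2) ^+ 2.
Proof.
rewrite /cosh /sinh.
have E : expR (x / 2) * expR (- (x / 2)) = 1 by rewrite -expRD subrr expR0.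
have E1 : expR x = expR (x / 2) ^+ 2 by rewrite expr2 -expRD -splitr.
have E2 : expR (- x) = expR (- (x / 2)) ^+ 2.
  by rewrite expr2 -expRD -opprD -splitr.
rewrite E1 E2; move: (expR (x / 2)) (expR (- (x / 2))) E => a b E.
have -> : 1 + 2 * ((a - b) / 2) ^+ 2 = 1 + (a ^+ 2 + b ^+ 2 - 2 * (a * b)) / 2 by field.
by rewrite E; field.
Qed.

Lemma cosh_lower x : 1 + x ^+ 2 / 2 <= cosh x.
Proof.
rewrite cosh_half lerD2l; have [t _ ->] := sinh_mvt (x / 2).
have h := cosh_ge1 t; have : 1 <= cosh t ^+ 2 by rewrite expr_ge1// (le_trans ler01).
have -> : 2 * (cosh t * (x / 2)) ^+ 2 = cosh t ^+ 2 * (x ^+ 2 / 2) by field.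
by move=> h2; rewrite ler_peMl// divr_ge0// sqr_ge0.
Qed.

Lemma cosh_sqr_half t : cosh t ^+ 2 = (1 + cosh (2 * t)) / 2.
Proof.
rewrite (cosh_half (2 * t)); have -> : 2 * t / 2 = t by field.
rewrite /sinh /cosh.
have E : expR t * expR (- t) = 1 by rewrite -expRD subrr expR0.
have -> : ((expR t - expR (- t)) / 2) ^+ 2 =
   (expR t ^+ 2 + expR (- t) ^+ 2 - 2 * (expR t * expR (- t))) / 4 by field.
have -> : ((expR t + expR (- t)) / 2) ^+ 2 =
   (expR t ^+ 2 + expR (- t) ^+ 2 + 2 * (expR t * expR (- t))) / 4 by field.
by rewrite E; field.
Qed.

Lemma cosh_upper x (C : R) : `|x| <= C -> cosh x <= 1 + (1 + expR C) / 4 * x ^+ 2.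
Proof.
move=> xC; rewrite cosh_half lerD2l; have [t tx ->] := sinh_mvt (x / 2).
have -> : 2 * (cosh t * (x / 2)) ^+ 2 = cosh t ^+ 2 * (x ^+ 2 / 2) by field.
rewrite cosh_sqr_half.
have : cosh (2 * t) <= expR C.
  apply: le_trans (cosh_le_expR _) _; rewrite ler_expR; apply: le_trans xC.
  by rewrite normrM (ger0_norm (ler0n _ 2)); move: tx; rewrite normrM normfV (ger0_norm (ler0n _ 2)); lra.
have := sqr_ge0 x => x2 h.
have -> : (1 + expR C) / 4 * x ^+ 2 = (1 + expR C) / 2 * (x ^+ 2 / 2) by field.
by apply: ler_wpM2r; lra.
Qed.

Lemma expR1_le4 : expR 1 <= 4 :> R.
Proof.
have := @expR_le_quadratic 2^-1 (lexx _).
have -> : expR 1 = expR 2^-1 ^+ 2 :> R by rewrite expr2 -expRD; congr expR; lra.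
have e0 := expR_gt0 (2^-1 : R) => h.
have h2 : expR 2^-1 <= 2 :> R by apply: le_trans h _; lra.
have -> : 4 = 2 ^+ 2 :> R by lra.
by rewrite ler_pXn2r// nnegrE ltW.
Qed.

(** Bootstrap: the crude bound 1 + 5/4 x^2 is reinserted for cosh 2t, which restores the exact
    coefficient 1/2, needed to compare with [cosh_lower]. *)
Lemma cosh_upper2 x : `|x| <= 1 -> cosh x <= 1 + x ^+ 2 / 2 + x ^+ 4.
Proof.
move=> x1; have h := cosh_upper x1; have e4 := expR1_le4.
have x2 := sqr_ge0 x.
have h1 : cosh x <= 1 + 5 / 4 * x ^+ 2.
  by apply: le_trans h _; rewrite lerD2l ler_wpM2r//; lra.
rewrite cosh_half; have [t tx ->] := sinh_mvt (x / 2).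
have -> : 2 * (cosh t * (x / 2)) ^+ 2 = cosh t ^+ 2 * (x ^+ 2 / 2) by field.
have tx2 : `|2 * t| <= `|x|.
  by rewrite normrM (ger0_norm (ler0n _ 2)); move: tx; rewrite normrM normfV (ger0_norm (ler0n _ 2)); lra.
have h2 : cosh (2 * t) <= 1 + 5 / 4 * x ^+ 2.
  apply: le_trans (cosh_upper (le_trans tx2 x1)) _; rewrite lerD2l.
  have sq : (2 * t) ^+ 2 <= x ^+ 2.
    by rewrite -(real_normK (num_real (2 * t))) -(real_normK (num_real x)) ler_pXn2r// nnegrE.
  apply: (@le_trans _ _ ((1 + expR 1) / 4 * x ^+ 2)).
    by rewrite ler_wpM2l//; have := expR_ge0 (1 : R); lra.
  by rewrite ler_wpM2r//; lra.
rewrite cosh_sqr_half -addrA lerD2l.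
apply: (@le_trans _ _ ((1 + 5 / 8 * x ^+ 2) * (x ^+ 2 / 2))).
  by apply: ler_wpM2r; lra.
have -> : x ^+ 4 = x ^+ 2 * x ^+ 2 by rewrite -exprD.
have := mulr_ge0 x2 x2; lra.
Qed.

End exp_bounds.

(** * Averages over the unit ball and their symmetries *)

Section ball_average.
Context {R : realType} {d : nat}.
Implicit Types (u v b : 'rV[R]_d) (F G : 'rV[R]_d -> R).

Local Notation B1 := (eball (0 : 'rV[R]_d) 1).

Definition J F : R := \int[leb d]_(u in B1) F u.

Lemma B1_coord u : B1 u -> forall i, `|u ord0 i| <= 1.
Proof. by move=> /eball_coord h i; have := ltW (h i); rewrite mxE subr0. Qed.

Lemma B1_norm u : B1 u -> `|u| <= 1.
Proof. by move=> /B1_coord h; apply: rV_norm_le. Qed.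

Lemma leb_B1 : (leb d B1 < +oo)%E.
Proof. by apply: (leb_bounded (r := 1)); [exact: measurable_eball|move=> u; exact: B1_coord]. Qed.

Lemma J_integrable F : continuous F -> (leb d).-integrable B1 (EFin \o F).
Proof.
move=> Fc; have [C C0 hC] := continuous_bounded_ball Fc ltr01.
apply: measurable_bounded_integrable; [exact: measurable_eball|exact: leb_B1| |].
  by apply: measurable_funTS; exact: continuous_measurable_rV.
exists C; split; first exact: num_real.
by move=> t Ct u /= /B1_norm /hC /le_trans; apply; exact: ltW.
Qed.

Lemma JD F G : continuous F -> continuous G -> J (fun u => F u + G u) = J F + J G.
Proof.
move=> Fc Gc; apply: RintegralD; [exact: measurable_eball|exact: J_integrable|exact: J_integrable].
Qed.

Lemma JZ a F : continuous F -> J (fun u => a * F u) = a * J F.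
Proof. by move=> Fc; apply: RintegralZl; [exact: measurable_eball|exact: J_integrable]. Qed.

Lemma J_le F G : continuous F -> continuous G -> (forall u, B1 u -> F u <= G u) -> J F <= J G.
Proof.
by move=> Fc Gc; apply: le_Rintegral; [exact: measurable_eball|exact: J_integrable|exact: J_integrable].
Qed.

Lemma J_eq F G : (forall u, F u = G u) -> J F = J G.
Proof. by move=> FG; congr J; apply/funext. Qed.

Lemma continuous_sum (I : Type) (r : seq I) (F : I -> 'rV[R]_d -> R) :
  (forall i, continuous (F i)) -> continuous (fun u => \sum_(i <- r) F i u).
Proof.
move=> Fc; elim: r => [|i r IH].
  rewrite (_ : (fun _ => _) = cst 0); first by move=> x; exact: cst_continuous.
  by apply/funext => u; rewrite big_nil.
rewrite (_ : (fun _ => _) = (fun u => F i u + \sum_(j <- r) F j u)).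
  by move=> x; apply: continuousD; [exact: Fc|exact: IH].
by apply/funext => u; rewrite big_cons.
Qed.

Lemma continuous_scale (a : R) F : continuous F -> continuous (fun u => a * F u).
Proof.
by move=> Fc u; apply: (@continuousM _ _ (cst a) F u); [exact: cst_continuous|exact: Fc].
Qed.

Lemma continuous_add F G : continuous F -> continuous G -> continuous (fun u => F u + G u).
Proof. by move=> Fc Gc u; exact: (cvgD (Fc u) (Gc u)). Qed.

Lemma continuous_mul F G : continuous F -> continuous G -> continuous (fun u => F u * G u).
Proof. by move=> Fc Gc u; exact: (cvgM (Fc u) (Gc u)). Qed.

Lemma continuous_exp F : continuous F -> continuous (fun u => expR (F u)).
Proof.
by move=> Fc u; apply: (@continuous_comp _ _ _ F expR); [exact: Fc|exact: continuous_expR].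
Qed.

Lemma J_sum (I : Type) (r : seq I) (F : I -> 'rV[R]_d -> R) : (forall i, continuous (F i)) ->
  J (fun u => \sum_(i <- r) F i u) = \sum_(i <- r) J (F i).
Proof.
move=> Fc; elim: r => [|i r IH].
  rewrite big_nil -[RHS](mul0r (J (cst 0))) -JZ; last by move=> x; exact: cst_continuous.
  by apply: J_eq => u; rewrite big_nil mul0r.
rewrite big_cons -IH -JD//; last exact: continuous_sum.
by apply: J_eq => u; rewrite big_cons.
Qed.

Definition omega : R := J (cst 1).

Lemma J_cst a : J (cst a) = a * omega.
Proof.
rewrite -JZ; last by move=> x; exact: cst_continuous.
by apply: J_eq => u; rewrite mulr1.
Qed.

Lemma omegaE : (omega%:E = leb d B1)%E.
Proof.
rewrite /omega /J Rintegral_cst; last exact: measurable_eball.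
rewrite mul1r fineK// ge0_fin_numE//; exact: leb_B1.
Qed.

Lemma omega_gt0 : 0 < omega.
Proof.
rewrite -lte_fin omegaE; apply: lt_le_trans (leb_eball_lb 0 ltr01).
by rewrite lte_fin exprn_gt0// divr_gt0// mulr1.
Qed.

(** Signed coordinate permutations preserve the ball and the measure. The change of variables is
    stated for nonnegative functions, hence the split into positive and negative parts. *)
Lemma J_affine (c : 'I_d -> R) (s : {perm 'I_d}) F : (forall i, `|c i| = 1) -> continuous F ->
  J (F \o affine 0 c s) = J F.
Proof.
move=> c1 Fc.
have c0 i : c i != 0 by rewrite -normr_gt0 c1.
have mF : measurable_fun setT (EFin \o F) by apply/measurable_EFinP; exact: continuous_measurable_rV.
have pB : affine 0 c s @^-1` B1 = B1.
  have en u : enorm (0 - affine 0 c s u) = enorm (0 - u).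
    rewrite /enorm [in RHS](reindex_inj (@perm_inj _ s)); congr Num.sqrt.
    apply: eq_bigr => i _; rewrite !mxE !sub0r add0r !sqrrN exprMn.
    by rewrite -[c i ^+ 2]real_normK ?num_real// c1 expr1n mul1r.
  by apply/seteqP; split => u; rewrite /eball /= en.
have E (g : 'rV[R]_d -> \bar R) : measurable_fun setT g -> (forall y, 0 <= g y)%E ->
    (\int[leb d]_(u in B1) g (affine 0 c s u) = \int[leb d]_(u in B1) g u)%E.
  move=> mg g0; rewrite [RHS](integral_affine 0 s c0)//; last exact: measurable_eball.
  by rewrite pB big1 ?mul1e.
rewrite /J /Rintegral; congr fine; rewrite integralE [RHS]integralE; congr (_ - _)%E.
  under eq_integral do rewrite funeposE.
  under [RHS]eq_integral do rewrite funeposE.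
  apply: (E (fun x => maxe (F x)%:E 0%E)); last by move=> y; rewrite le_max lexx orbT.
  by apply: measurable_maxe.
under eq_integral do rewrite funenegE.
under [RHS]eq_integral do rewrite funenegE.
apply: (E (fun x => maxe (- (F x)%:E)%E 0%E)); last by move=> y; rewrite le_max lexx orbT.
by apply: measurable_maxe => //; exact: measurableT_comp.
Qed.

Lemma coord_cont i : continuous (fun u : 'rV[R]_d => u ord0 i).
Proof. exact: coord_continuous. Qed.

Lemma coord2_cont i j : continuous (fun u : 'rV[R]_d => u ord0 i * u ord0 j).
Proof. by move=> u; apply: continuousM; exact: coord_cont. Qed.

(** Reflecting coordinate [i] changes the sign of the integrand. *)
Lemma J_offdiag i j : i != j -> J (fun u => u ord0 i * u ord0 j) = 0.
Proof.
move=> ij; pose c k : R := if k == i then -1 else 1.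
have := @J_affine c 1%g _ _ (@coord2_cont i j).
have -> : (fun u : 'rV[R]_d => u ord0 i * u ord0 j) \o affine 0 c 1%g = (fun u => -1 * (u ord0 i * u ord0 j)).
  apply/funext => u; rewrite /= !mxE !perm1 /c eqxx eq_sym (negbTE ij); ring.
rewrite JZ; last exact: coord2_cont.
move=> H; have : -1 * J (fun u => u ord0 i * u ord0 j) = J (fun u => u ord0 i * u ord0 j).
  by apply: H => k; rewrite /c; case: ifP; rewrite ?normrN normr1.
lra.
Qed.

Lemma J_diag i j : J (fun u => u ord0 i * u ord0 i) = J (fun u => u ord0 j * u ord0 j).
Proof.
rewrite -(@J_affine (fun=> 1) (tperm i j) _ _ (@coord2_cont j j)); last by move=> k; rewrite normr1.
by apply: J_eq => u; rewrite /= !mxE tpermR !add0r !mul1r.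
Qed.

(** The ball contains a box of positive volume on which coordinate [i] is at least [z / 2]. *)
Lemma J_diag_gt0 i : 0 < J (fun u => u ord0 i * u ord0 i).
Proof.
pose z : R := d.+1%:R^-1.
have z0 : 0 < z by rewrite invr_gt0.
pose a : 'rV[R]_d := \row_j (if j == i then z / 2 else 0).
pose b : 'rV[R]_d := \row_j z.
have aE j : a ord0 j = (if j == i then z / 2 else 0) by rewrite mxE.
have bE j : b ord0 j = z by rewrite mxE.
have ab j : a ord0 j < b ord0 j by rewrite aE bE; case: ifP => _; lra.
have sub : box a b `<=` B1.
  apply: subset_trans (box_eball (x := 0) ltr01) => u h j.
  have := h j; rewrite !mxE div1r -/z !add0r => /andP[h1 h2].
  apply/andP; split => //; apply: le_trans h1; case: ifP => _; lra.
have key : (((z / 2) ^+ 2)%:E * leb d (box a b) <= (J (fun u => u ord0 i * u ord0 i))%:E)%E.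
  rewrite /J /Rintegral fineK; last first.
    apply: integrable_fin_num; first exact: measurable_eball.
    exact: (J_integrable (@coord2_cont i i)).
  have mu2 : measurable_fun setT (fun u : 'rV[R]_d => (u ord0 i * u ord0 i)%:E).
    by apply/measurable_EFinP; exact: (continuous_measurable_rV (@coord2_cont i i)).
  apply: le_trans (ge0_subset_integral _ _ _ _ _ sub); last first.
  - by move=> u _; rewrite lee_fin -expr2 sqr_ge0.
  - exact: measurable_funTS.
  - exact: measurable_eball.
  - exact: measurable_box.
  rewrite -integral_cst; last exact: measurable_box.
  apply: ge0_le_integral => //.
  - exact: measurable_box.
  - by move=> u _; rewrite lee_fin sqr_ge0.
  - exact: measurable_funTS.
  - move=> u /(_ i); rewrite aE eqxx => /andP[h1 _]; rewrite lee_fin expr2.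
    by apply: ler_pM => //; lra.
rewrite -lte_fin; apply: lt_le_trans key.
rewrite [X in (_ < _ * X)%E]leb_box => [|j]; last exact: ltW.
rewrite -EFinM lte_fin mulr_gt0//; first by rewrite exprn_gt0// divr_gt0.
by apply: prodr_gt0 => j _; rewrite subr_gt0.
Qed.

(* kappa is the common value of the second moments of the coordinates. *)
Lemma second_moment : exists2 kappa : R, 0 < kappa &
  forall A : 'M[R]_d, J (fun u => \sum_i \sum_j A i j * u ord0 i * u ord0 j) = kappa * \tr A.
Proof.
have [kappa [k0 hk]] : exists kappa : R, 0 < kappa /\ forall i, J (fun u => u ord0 i * u ord0 i) = kappa.
  (* In dimension 0 there is no coordinate, and any positive [kappa] will do. *)
  have [i|noI] := pickP (fun i : 'I_d => true); last by exists 1; split=> // i; have := noI i.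
  by exists (J (fun u => u ord0 i * u ord0 i)); split=> [|j]; [exact: J_diag_gt0|exact: J_diag].
exists kappa => // A.
have c1 i j : continuous (fun u : 'rV[R]_d => A i j * u ord0 i * u ord0 j).
  rewrite (_ : (fun _ => _) = (fun u => A i j * (u ord0 i * u ord0 j))).
    exact: continuous_scale (@coord2_cont i j).
  by apply/funext => u; rewrite mulrA.
rewrite J_sum; last by move=> i; apply: continuous_sum.
rewrite /mxtrace mulr_sumr; apply: eq_bigr => i _.
rewrite J_sum// (bigD1 i)//= big1 ?addr0.
  rewrite (J_eq (G := fun u => A i i * (u ord0 i * u ord0 i))) => [|u]; last by rewrite mulrA.
  by rewrite JZ ?hk 1?mulrC//; exact: coord2_cont.
move=> j ji; rewrite (J_eq (G := fun u => A i j * (u ord0 i * u ord0 j))) => [|u]; last by rewrite mulrA.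
by rewrite JZ ?J_offdiag ?mulr0 1?eq_sym//; exact: coord2_cont.
Qed.

End ball_average.

(** * Lyapunov function *)

Section lyapunov_core.
Context {R : realType} {d : nat}.
Implicit Types (u v b : 'rV[R]_d) (H : 'M[R]_d).

Local Notation B1 := (eball (0 : 'rV[R]_d) 1).

Definition quad H u : R := \sum_i \sum_j H i j * u ord0 i * u ord0 j.

Lemma quadE H u : quad H u = dotv (u *m H) u.
Proof.
rewrite /quad /dotv exchange_big /=; apply: eq_bigr => j _.
by rewrite mxE mulr_suml; apply: eq_bigr => i _; rewrite [_ * H i j]mulrC.
Qed.

Lemma quadN H u : quad H (- u) = quad H u.
Proof. by apply: eq_bigr => i _; apply: eq_bigr => j _; rewrite !mxE; ring. Qed.

Lemma dotvN b u : dotv b (- u) = - dotv b u.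
Proof. by rewrite /dotv -sumrN; apply: eq_bigr => i _; rewrite mxE mulrN. Qed.

Lemma quad_cont H : continuous (quad H).
Proof.
apply: continuous_sum => i; apply: continuous_sum => j.
rewrite (_ : (fun _ => _) = (fun u => H i j * (u ord0 i * u ord0 j))).
  exact: continuous_scale (@coord2_cont R d i j).
by apply/funext => u; rewrite mulrA.
Qed.

Lemma dotv_cont b : continuous (dotv b).
Proof. by apply: continuous_sum => i; exact: continuous_scale (@coord_cont R d i). Qed.

(** Averaging over [u] and [- u] removes the odd part, so the linear term enters only through its
    square. *)
Lemma J_even F (w : 'rV[R]_d -> R) b : continuous w -> (forall u, w (- u) = w u) ->
  (forall u, F u = expR (- dotv b u) * w u) -> J F = J (fun u => cosh (dotv b u) * w u).
Proof.
move=> wc we FE.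
have ec (s : R) : continuous (fun u => expR (s * dotv b u)).
  by apply: continuous_exp; exact: continuous_scale (@dotv_cont b).
have Fc : continuous F.
  rewrite (_ : F = (fun u => expR (-1 * dotv b u) * w u)).
    by apply: continuous_mul.
  by apply/funext => u; rewrite FE mulN1r.
have Ec : continuous (fun u => expR (1 * dotv b u) * w u) by exact: continuous_mul.
have Gc : continuous (fun u => F u + (expR (1 * dotv b u) * w u)) by exact: continuous_add.
have E1 : J (fun u => expR (1 * dotv b u) * w u) = J F.
  rewrite -(J_affine (c := fun=> -1) 1%g _ Fc); last by move=> i; rewrite normrN normr1.
  apply: J_eq => u /=; have -> : affine 0 (fun=> -1) 1%g u = - u.
    by apply/rowP => i; rewrite !mxE perm1 add0r mulN1r.
  by rewrite FE dotvN opprK we mul1r.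
have h : J (fun u => 2^-1 * (F u + expR (1 * dotv b u) * w u)) = J F.
  by rewrite JZ// JD// E1; lra.
rewrite -h; apply: J_eq => u; rewrite FE /cosh mul1r; ring.
Qed.

Variable kappa : R.
Hypothesis kappa0 : 0 < kappa.
Hypothesis kappaE : forall A : 'M[R]_d, J (quad A) = kappa * \tr A.

Lemma J_sqr_dotv b : J (fun u => dotv b u ^+ 2) = kappa * dotv b b.
Proof.
have -> : dotv b b = \tr (b^T *m b).
  by rewrite mxtrace_mulC /mxtrace big_ord1 mxE; apply: eq_bigr => i _; rewrite mxE.
rewrite -kappaE; apply: J_eq => u; rewrite /quad /dotv expr2 mulr_suml.
apply: eq_bigr => i _; rewrite mulr_sumr; apply: eq_bigr => j _.
by rewrite !mxE big_ord1 !mxE; ring.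
Qed.

(** The linear parts have order 1 and the quadratic parts order h. By evenness the averages are
    omega + kappa |b|^2 / 2 - h kappa tr H / 2, with errors of order h |b|^2 and h^2. For [f] a
    lower bound suffices, and cosh x >= 1 + x^2/2 holds for all x. For [g] the upper bound has an
    extra x^4 <= eps^2 x^2, which [eps ^+ 2 <= eta / 4] absorbs into the deficit [eta] of |b'|^2. *)
Lemma lyapunov_core (C h eta eps : R) (f g : 'rV[R]_d -> R) b b' (H H' : 'M[R]_d) :
  1 <= C -> 0 < h -> 4 * C * h <= 1 -> 0 <= eta -> eta <= 1 -> 0 <= eps -> eps <= 1 -> eps ^+ 2 <= eta / 4 ->
  continuous f -> continuous g ->
  (forall u, B1 u -> [/\ `|f u - dotv b u - h / 2 * quad H u| <= C * h ^+ 2,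
     `|g u - dotv b' u - h / 2 * quad H' u| <= C * h ^+ 2, `|dotv b u| <= C & `|dotv b' u| <= eps]) ->
  (forall u, B1 u -> `|quad H u| <= C /\ `|quad H' u| <= C) ->
  dotv b' b' <= (1 - eta) * dotv b b ->
  kappa * (eta / 4 - C * (1 + expR C) / 4 * h) * dotv b b + h * kappa / 2 * (\tr H' - \tr H)
    - 2 * (expR C * (C + 8 * C ^+ 2)) * omega (d := d) * h ^+ 2 <=
  J (fun u => expR (- f u)) - J (fun u => expR (- g u)).
Proof.
move=> C1 h0 Ch eta0 eta1 eps0 eps1 epseta fc gc taylor qC bb.
have C0 : 0 <= C by lra.
have h1 : h <= 1 by have : 4 * h <= 4 * C * h by [rewrite ler_wpM2r ?ler_peMr//; lra]; lra.
have h2h : h ^+ 2 <= h by rewrite expr2 ger_pMl.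
have h20 : 0 <= h ^+ 2 by exact: sqr_ge0.
set K1 := C * (1 + expR C) / 8; set K2 := expR C * (C + 8 * C ^+ 2).
have eC := expR_gt0 C.
have eC1 : 1 <= expR C by have := expR_ge1Dx C; lra.
have K10 : 0 <= K1 by rewrite /K1 divr_ge0// mulr_ge0//; lra.
have ecn (F : 'rV[R]_d -> R) : continuous F -> continuous (fun u : 'rV[R]_d => expR (- F u)).
  move=> Fc; apply: (@continuous_exp R d (fun u => - F u)).
  by move=> u; exact: cvgN (Fc u).
have cst_c (c : R) : continuous (fun _ : 'rV[R]_d => c) by move=> u; exact: cst_continuous.
have D_c (F G : 'rV[R]_d -> R) : continuous F -> continuous G -> continuous (fun u => F u + G u).
  exact: continuous_add.
have M_c (F G : 'rV[R]_d -> R) : continuous F -> continuous G -> continuous (fun u => F u * G u).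
  exact: continuous_mul.
have qc A (c : R) : continuous (fun u : 'rV[R]_d => c * quad A u).
  exact: continuous_scale (@quad_cont A).
have dc (v : 'rV[R]_d) (c : R) : continuous (fun u : 'rV[R]_d => c * dotv v u ^+ 2).
  apply: continuous_scale; rewrite (_ : (fun _ => _) = (fun u => dotv v u * dotv v u)).
    by apply: (M_c); exact: dotv_cont.
  by apply/funext => u; rewrite expr2.
have cosh_c (v : 'rV[R]_d) : continuous (fun u : 'rV[R]_d => cosh (dotv v u)).
  rewrite (_ : (fun _ => _) = (fun u => 2^-1 * (expR (- (- dotv v u)) + expR (- dotv v u)))).
    apply: continuous_scale; apply: (D_c); apply: (ecn); last exact: dotv_cont.
    by move=> u; exact: cvgN (@dotv_cont v u).
  by apply/funext => u; rewrite opprK /cosh mulrC.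
(* [w] minorizes and [w'] majorizes the exponential of the nonlinear part, by 1 + s <= exp s and by
   [expR_le_quadratic]. Both are even, as [J_even] requires. *)
pose w u := 1 + (- (C * h ^+ 2) + - (h / 2) * quad H u).
pose w' u := 1 + ((C + 8 * C ^+ 2) * h ^+ 2 + - (h / 2) * quad H' u).
have wc : continuous w by apply: (D_c) => //; apply: (D_c).
have wc' : continuous w' by apply: (D_c) => //; apply: (D_c).
have poly_c (c1 c2 c3 : R) (v : 'rV[R]_d) A :
    continuous (fun u => c1 + (c2 * dotv v u ^+ 2 + c3 * quad A u)) by apply: (D_c) => //; apply: (D_c).
have Jpoly (c1 c2 c3 : R) (v : 'rV[R]_d) A :
    J (fun u => c1 + (c2 * dotv v u ^+ 2 + c3 * quad A u)) =
    c1 * omega (d := d) + (c2 * (kappa * dotv v v) + c3 * (kappa * \tr A)).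
  have sq_c : continuous (fun u => dotv v u ^+ 2).
    rewrite (_ : (fun _ => _) = (fun u => 1 * dotv v u ^+ 2)); first exact: dc.
    by apply/funext => u; rewrite mul1r.
  rewrite (@JD _ _ (fun=> c1))//; last by apply: (D_c).
  rewrite (@JD _ _ (fun u => c2 * dotv v u ^+ 2))//.
  rewrite (@JZ _ _ c2 (fun u => dotv v u ^+ 2))// (@JZ _ _ c3 (quad A)); last exact: quad_cont.
  by rewrite J_sqr_dotv kappaE; congr (_ + _); exact: J_cst.
have lower : omega (d := d) - K2 * h ^+ 2 * omega (d := d) + ((1 / 2 - K1 * h) * (kappa * dotv b b)
    + - (h / 2) * (kappa * \tr H)) <= J (fun u => expR (- f u)).
  apply: (@le_trans _ _ (J (fun u => expR (- dotv b u) * w u))); last first.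
    apply: J_le; [|exact: ecn|].
      by apply: (M_c) => //; apply: (ecn); exact: dotv_cont.
    move=> u u1; have [t1 _ _ _] := taylor u u1.
    have -> : - f u = - dotv b u + (- f u + dotv b u) by ring.
    rewrite expRD ler_wpM2l ?expR_ge0//; apply: le_trans (expR_ge1Dx _).
    by rewrite /w lerD2l; move: t1; rewrite ler_norml => /andP[_]; lra.
  rewrite (@J_even _ w b)//; last by move=> u; rewrite /w quadN.
  have -> : omega (d := d) - K2 * h ^+ 2 * omega (d := d) = (1 - K2 * h ^+ 2) * omega (d := d) by ring.
  rewrite -Jpoly; apply: J_le => //; first exact: M_c.
  move=> u u1; have [_ _ bC _] := taylor u u1; have [qH _] := qC u u1.
  have cu := cosh_upper bC; have cl := cosh_lower (dotv b u).
  have ce : cosh (dotv b u) <= expR C by apply: le_trans (cosh_le_expR _) _; rewrite ler_expR.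
  have c1 := cosh_ge1 (dotv b u).
  rewrite /w.
  move: (dotv b u) (quad H u) (cosh (dotv b u)) qH cu cl ce c1 => X q c qH cu cl ce c1.
  (* The product of the quadratic term with cosh - 1 is of order h |b|^2; this is the source of
     [K1]. *)
  have qle : q * (c - 1) <= C * ((1 + expR C) / 4 * X ^+ 2).
    apply: (@le_trans _ _ (C * (c - 1))).
      by rewrite ler_wpM2r ?subr_ge0// (le_trans (ler_norm _)).
    by rewrite ler_wpM2l//; lra.
  have e1 : h / 2 * (q * (c - 1)) <= h / 2 * (C * ((1 + expR C) / 4 * X ^+ 2)).
    by rewrite ler_wpM2l//; lra.
  have e2 : C * h ^+ 2 * c <= K2 * h ^+ 2.
    have -> : C * h ^+ 2 * c = c * C * h ^+ 2 by ring.
    rewrite ler_wpM2r// /K2; apply: ler_pM => //; first by lra.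
    by rewrite lerDl mulr_ge0// sqr_ge0.
  have -> : c * (1 + (- (C * h ^+ 2) + - (h / 2) * q)) =
    c - C * h ^+ 2 * c - h / 2 * q - h / 2 * (q * (c - 1)) by ring.
  have -> : (1 / 2 - K1 * h) * X ^+ 2 = X ^+ 2 / 2 - h / 2 * (C * ((1 + expR C) / 4 * X ^+ 2)).
    by rewrite /K1; field.
  by lra.
have upper : J (fun u => expR (- g u)) <= omega (d := d) + K2 * h ^+ 2 * omega (d := d) +
    ((1 / 2 + eps ^+ 2 + K1 * h) * (kappa * dotv b' b') + - (h / 2) * (kappa * \tr H')).
  apply: (@le_trans _ _ (J (fun u => expR (- dotv b' u) * w' u))).
    apply: J_le; [exact: ecn| |].
      by apply: (M_c) => //; apply: (ecn); exact: dotv_cont.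
    move=> u u1; have [_ t1 _ _] := taylor u u1; have [_ qH] := qC u u1.
    have -> : - g u = - dotv b' u + (- g u + dotv b' u) by ring.
    rewrite expRD ler_wpM2l ?expR_ge0//.
    pose s := - (h / 2) * quad H' u + C * h ^+ 2.
    apply: (@le_trans _ _ (expR s)).
      by rewrite ler_expR /s; move: t1; rewrite ler_norml => /andP[+ _]; lra.
    have hq : `|h / 2 * quad H' u| <= C * h / 2.
      rewrite normrM ger0_norm; last by lra.
      have : h / 2 * `|quad H' u| <= h / 2 * C by rewrite ler_wpM2l//; lra.
      by lra.
    have Ch2 : C * h ^+ 2 <= C * h by rewrite ler_wpM2l.
    have Ch20 : 0 <= C * h ^+ 2 by rewrite mulr_ge0.
    have s2 : `|s| <= 2 * (C * h).
      move: hq; rewrite /s !ler_norml => /andP[p1 p2]; apply/andP; split; lra.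
    have ss : s ^+ 2 <= 4 * C ^+ 2 * h ^+ 2.
      have -> : 4 * C ^+ 2 * h ^+ 2 = (2 * (C * h)) ^+ 2 by ring.
      by rewrite -(real_normK (num_real s)) ler_pXn2r// nnegrE mulr_ge0// mulr_ge0// ltW.
    apply: le_trans (expR_le_quadratic _) _.
      by move: s2; rewrite ler_norml => /andP[_]; lra.
    by rewrite /w' /s; move: ss; rewrite /s; lra.
  rewrite (@J_even _ w' b')//; last by move=> u; rewrite /w' quadN.
  have -> : omega (d := d) + K2 * h ^+ 2 * omega (d := d) = (1 + K2 * h ^+ 2) * omega (d := d) by ring.
  rewrite -Jpoly; apply: J_le => //; first exact: M_c.
  move=> u u1; have [_ _ _ bC] := taylor u u1; have [_ qH] := qC u u1.
  have b1 : `|dotv b' u| <= 1 by exact: le_trans bC eps1.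
  have bC' : `|dotv b' u| <= C by exact: le_trans b1 C1.
  have cu := cosh_upper bC'; have cu2 := cosh_upper2 b1.
  have ce : cosh (dotv b' u) <= expR C by apply: le_trans (cosh_le_expR _) _; rewrite ler_expR.
  have c1 := cosh_ge1 (dotv b' u).
  have X4 : dotv b' u ^+ 4 <= eps ^+ 2 * dotv b' u ^+ 2.
    have -> : dotv b' u ^+ 4 = dotv b' u ^+ 2 * dotv b' u ^+ 2 by rewrite -exprD.
    rewrite ler_wpM2r ?sqr_ge0// -(real_normK (num_real (dotv b' u))).
    by rewrite ler_pXn2r// nnegrE.
  rewrite /w'.
  move: (dotv b' u) (quad H' u) (cosh (dotv b' u)) qH cu cu2 ce c1 X4 => X q c qH cu cu2 ce c1 X4.
  have qle : - (q * (c - 1)) <= C * ((1 + expR C) / 4 * X ^+ 2).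
    apply: (@le_trans _ _ (C * (c - 1))).
      rewrite -mulNr ler_wpM2r ?subr_ge0//; apply: le_trans qH.
      by rewrite -normrN ler_norm.
    by rewrite ler_wpM2l//; lra.
  have e1 : h / 2 * - (q * (c - 1)) <= h / 2 * (C * ((1 + expR C) / 4 * X ^+ 2)).
    by rewrite ler_wpM2l//; lra.
  have e2 : (C + 8 * C ^+ 2) * h ^+ 2 * c <= K2 * h ^+ 2.
    rewrite /K2 [_ * c]mulrC mulrA ler_wpM2r// ler_wpM2r//.
    by rewrite addr_ge0// mulr_ge0// sqr_ge0.
  have -> : c * (1 + ((C + 8 * C ^+ 2) * h ^+ 2 + - (h / 2) * q)) =
    c + (C + 8 * C ^+ 2) * h ^+ 2 * c - h / 2 * q + h / 2 * - (q * (c - 1)) by ring.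
  have -> : (1 / 2 + eps ^+ 2 + K1 * h) * X ^+ 2 =
      X ^+ 2 / 2 + eps ^+ 2 * X ^+ 2 + h / 2 * (C * ((1 + expR C) / 4 * X ^+ 2)).
    by rewrite /K1; field.
  by lra.
have B0 : 0 <= kappa * dotv b b by rewrite mulr_ge0 ?(ltW kappa0) ?dotvv_ge0.
have B0' : 0 <= kappa * dotv b' b' by rewrite mulr_ge0 ?(ltW kappa0) ?dotvv_ge0.
have bb' : kappa * dotv b' b' <= (1 - eta) * (kappa * dotv b b).
  by rewrite mulrCA ler_wpM2l// ltW.
have K1h : 0 <= K1 * h by rewrite mulr_ge0// ltW.
have e3 : (1 / 2 + eps ^+ 2 + K1 * h) * (kappa * dotv b' b') <=
    (1 / 2 + eps ^+ 2 + K1 * h) * ((1 - eta) * (kappa * dotv b b)).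
  by rewrite ler_wpM2l//; have := sqr_ge0 eps; lra.
have e4 : (1 / 2 + eps ^+ 2 + K1 * h) * ((1 - eta) * (kappa * dotv b b)) <=
    (1 / 2 - eta / 4 + K1 * h) * (kappa * dotv b b).
  rewrite mulrA ler_wpM2r//.
  have : 0 <= eta * (eps ^+ 2 + K1 * h) by rewrite mulr_ge0// addr_ge0// sqr_ge0.
  by rewrite !mulrBr !mulrDr mulr1; lra.
have -> : kappa * (eta / 4 - C * (1 + expR C) / 4 * h) * dotv b b =
    eta / 4 * (kappa * dotv b b) - 2 * (K1 * h) * (kappa * dotv b b) by rewrite /K1; field.
rewrite -/K2.
have -> : 2 * K2 * omega (d := d) * h ^+ 2 = 2 * (K2 * h ^+ 2 * omega (d := d)) by ring.
have -> : h * kappa / 2 * (\tr H' - \tr H) = h / 2 * (kappa * \tr H') - h / 2 * (kappa * \tr H) by ring.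
move: lower upper; move: (kappa * dotv b b) e3 e4 => B e3 e4.
move: (kappa * dotv b' b') e3 => B' e3.
move: (kappa * \tr H) (kappa * \tr H') (J _) (J _) => t t' Jf Jg lower upper.
move: (eps ^+ 2) (K1 * h) (K2 * h ^+ 2) e3 e4 lower upper => E k1 k2 e3 e4 lower upper.
lra.
Qed.

End lyapunov_core.

(** * Euclidean inequalities and Taylor bounds in terms of gradient and Hessian *)

Section euclidean_calculus.
Context {R : realType} {d : nat}.
Implicit Types (u v w x : 'rV[R]_d) (H : 'M[R]_d).

Lemma dotvDr u v w : dotv u (v + w) = dotv u v + dotv u w.
Proof. by rewrite dotvC dotvDl ![dotv _ u]dotvC. Qed.

Lemma dotvZr (a : R) u v : dotv u (a *: v) = a * dotv u v.
Proof. by rewrite dotvC dotvZl dotvC. Qed.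

Lemma dotv_cauchy v w : `|dotv v w| <= enorm v * enorm w.
Proof.
rewrite -(@ler_pXn2r _ 2)// ?nnegrE ?mulr_ge0 ?enorm_ge0// exprMn -!dotv_enorm real_normK ?num_real//.
have [w0|] := eqVneq (dotv w w) 0; last first.
  rewrite neq_lt ltNge dotvv_ge0 /= => w0.
  rewrite -(ler_pM2r w0).
  have := dotvv_ge0 (dotv w w *: v + (- dotv v w) *: w).
  rewrite !(dotvDl, dotvDr, dotvZl, dotvZr) (dotvC w v).
  by move: (dotv v v) (dotv v w) (dotv w w) => a b c; lra.
rewrite w0 mulr0; have wz : w = 0.
  apply/rowP => i; rewrite mxE; apply/eqP; rewrite -normr_le0; apply: le_trans (enorm_coord w i) _.
  by move: w0; rewrite dotv_enorm => /eqP; rewrite sqrf_eq0 => /eqP ->.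
by rewrite wz -[X in dotv v X](scale0r (0 : 'rV[R]_d)) dotvZr mul0r expr0n.
Qed.

Lemma enormD v w : enorm (v + w) <= enorm v + enorm w.
Proof.
rewrite -(@ler_pXn2r _ 2)// ?nnegrE ?addr_ge0 ?enorm_ge0// sqrrD -!dotv_enorm.
rewrite !(dotvDl, dotvDr) (dotvC w v).
have := le_trans (ler_norm _) (dotv_cauchy v w).
by move: (dotv v v) (dotv v w) (dotv w w) (enorm v * enorm w) => a b c e; lra.
Qed.

Lemma enormZ (a : R) v : enorm (a *: v) = `|a| * enorm v.
Proof.
apply: (@pexpIrn _ 2); rewrite ?nnegrE ?mulr_ge0 ?enorm_ge0//.
by rewrite exprMn -!dotv_enorm dotvZl dotvZr mulrA real_normK ?num_real// expr2.
Qed.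

Lemma enormN v : enorm (- v) = enorm v.
Proof. by rewrite -scaleN1r enormZ normrN normr1 mul1r. Qed.

Lemma enormB v w : enorm v - enorm w <= enorm (v + w).
Proof. by have := enormD (v + w) (- w); rewrite addrK enormN; lra. Qed.

Lemma enorm0 : enorm (0 : 'rV[R]_d) = 0.
Proof. by rewrite -(scale0r (0 : 'rV[R]_d)) enormZ normr0 mul0r. Qed.

Lemma quad_bound H (C : R) : (forall v, enorm (v *m H) <= C * enorm v) ->
  forall v, `|quad H v| <= C * enorm v ^+ 2.
Proof.
move=> HC v; rewrite quadE; apply: le_trans (dotv_cauchy _ _) _.
by rewrite expr2 mulrA ler_wpM2r// enorm_ge0.
Qed.

Lemma mulmx_bound H (C : R) : 0 <= C -> (forall i j, `|H i j| <= C) ->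
  forall v, enorm (v *m H) <= d%:R * (C * d%:R) * enorm v.
Proof.
move=> C0 HC v; apply: le_trans (enorm_le_l1 _) _; rewrite /l1.
apply: (@le_trans _ _ (\sum_(i < d) (C * d%:R * enorm v))); last first.
  by rewrite sumr_const card_ord -[(_ * _) *+ _]mulr_natl !mulrA.
apply: ler_sum => j _; rewrite mxE; apply: le_trans (ler_norm_sum _ _ _) _.
apply: (@le_trans _ _ (\sum_i C * `|v ord0 i|)).
  by apply: ler_sum => i _; rewrite normrM mulrC ler_wpM2r.
by rewrite -mulr_sumr -mulrA ler_wpM2l// l1_le_enorm.
Qed.

Lemma hessian_sym f x : smooth f -> (hessian f x)^T = hessian f x.
Proof. by move=> fS; apply/matrixP => i j; rewrite !mxE /partials /= smooth_mixed. Qed.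

Lemma dotv_gradient f x v : dotv (gradient f x) v = \sum_i partial i f x * v ord0 i.
Proof. by apply: eq_bigr => i _; rewrite mxE. Qed.

Lemma quad_hessian f x v :
  quad (hessian f x) v = \sum_i \sum_j partials [:: i; j] f x * v ord0 i * v ord0 j.
Proof. by apply: eq_bigr => i _; apply: eq_bigr => j _; rewrite mxE. Qed.

Lemma euclidean_bounds phi : hypothesis1 phi -> exists2 C, 1 <= C &
  [/\ (forall x v, `|phi (x + v) - phi x| <= C * enorm v),
      (forall x v, `|phi (x + v) - phi x - dotv (gradient phi x) v - 2^-1 * quad (hessian phi x) v|
         <= C * enorm v ^+ 3),
      (forall x v, enorm (gradient phi (x + v) - gradient phi x - v *m hessian phi x) <= C * enorm v ^+ 2),
      (forall x v, `|\tr (hessian phi (x + v)) - \tr (hessian phi x)| <= C * enorm v) &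
      (forall x, [/\ enorm (gradient phi x) <= C, `|\tr (hessian phi x)| <= C &
         forall v, enorm (v *m hessian phi x) <= C * enorm v])].
Proof.
move=> hp; have [C C0 [lip tay grad hes hesb]] := calculus_bounds hp.
have /choice[Cg hCg] (i : 'I_d) : exists Ci, forall x, `|partial i phi x| <= Ci.
  by have [Ci _ hCi] := @partials_bounded R d phi [:: i] hp isT; exists Ci.
pose n : R := d%:R; have n0 : 0 <= n by rewrite ler0n.
pose C' := 1 + \sum_i `|Cg i| + C * n + C * n ^+ 2 + C * n ^+ 3.
have C2 : 0 <= C * n ^+ 2 by rewrite mulr_ge0 ?sqr_ge0// ltW.
have C3 : 0 <= C * n ^+ 3 by rewrite mulr_ge0 ?exprn_ge0// ltW.
have C1 : 0 <= C * n by rewrite mulr_ge0// ltW.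
have S0 : 0 <= \sum_i `|Cg i| by exact: sumr_ge0.
have powb k v : l1 v ^+ k <= n ^+ k * enorm v ^+ k.
  by rewrite -exprMn; apply: lerXn2r; rewrite ?nnegrE ?mulr_ge0 ?l1_ge0 ?enorm_ge0// l1_le_enorm.
have Cp k (c : R) v : C * n ^+ k <= c -> C * l1 v ^+ k <= c * enorm v ^+ k.
  move=> cC; apply: (@le_trans _ _ (C * n ^+ k * enorm v ^+ k)).
    by rewrite -mulrA ler_wpM2l// ltW.
  by rewrite ler_wpM2r// exprn_ge0// enorm_ge0.
exists C'; first by rewrite /C'; lra.
split.
- move=> x v; apply: le_trans (lip x v) _; have := @Cp 1%N C' v.
  by rewrite !expr1; apply; rewrite /C'; lra.
- move=> x v; rewrite dotv_gradient quad_hessian; apply: le_trans (tay x v) _.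
  by apply: Cp; rewrite /C'; lra.
- move=> x v; apply: le_trans (enorm_le_l1 _) _.
  apply: (@le_trans _ _ (\sum_(i < d) C * l1 v ^+ 2)).
    apply: ler_sum => i _; apply: le_trans (grad i x v).
    have -> : (gradient phi (x + v) - gradient phi x - v *m hessian phi x) ord0 i =
        partial i phi (x + v) - partial i phi x - \sum_j v ord0 j * hessian phi x j i by rewrite !mxE.
    rewrite (eq_bigr (fun j => partials [:: i; j] phi x * v ord0 j))// => j _.
    have sw : partials [:: j; i] phi x = partials [:: i; j] phi x.
      by rewrite (partials_perm (hyp_smooth hp) (t := [:: i; j]))// (perm_catC [:: j]).
    by rewrite mxE sw mulrC.
  rewrite sumr_const card_ord -[(_ * _) *+ _]mulr_natl.
  apply: (@le_trans _ _ (n * (C * n ^+ 2 * enorm v ^+ 2))).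
    by rewrite ler_wpM2l// -mulrA ler_wpM2l// ltW.
  have -> : n * (C * n ^+ 2 * enorm v ^+ 2) = C * n ^+ 3 * enorm v ^+ 2 by ring.
  by rewrite ler_wpM2r ?sqr_ge0// /C'; lra.
- move=> x v; have hE y i : hessian phi y i i = partials [:: i; i] phi y by rewrite mxE.
  rewrite /mxtrace -sumrB; apply: le_trans (ler_norm_sum _ _ _) _.
  apply: (@le_trans _ _ (\sum_(i < d) C * l1 v)).
    apply: ler_sum => i _.
    rewrite (_ : _ - _ = partials [:: i; i] phi (x + v) - partials [:: i; i] phi x); first exact: hes.
    by congr (_ - _); exact: hE.
  rewrite sumr_const card_ord -[(_ * _) *+ _]mulr_natl.
  apply: (@le_trans _ _ (n * (C * (n * enorm v)))).
    by rewrite ler_wpM2l// ler_wpM2l ?l1_le_enorm// ltW.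
  have -> : n * (C * (n * enorm v)) = C * n ^+ 2 * enorm v by ring.
  by rewrite ler_wpM2r ?enorm_ge0// /C'; lra.
- move=> x; split.
  + apply: le_trans (enorm_le_l1 _) _; apply: (@le_trans _ _ (\sum_i `|Cg i|)).
      by apply: ler_sum => i _; rewrite mxE; apply: le_trans (hCg i x) (ler_norm _).
    by rewrite /C'; lra.
  + apply: le_trans (ler_norm_sum _ _ _) _; apply: (@le_trans _ _ (\sum_(i < d) C)).
      by apply: ler_sum => i _; rewrite mxE; exact: hesb.
    by rewrite sumr_const card_ord -[C *+ _]mulr_natl mulrC -/n /C'; lra.
  + move=> v; apply: (@le_trans _ _ (d%:R * (C * d%:R) * enorm v)).
      apply: mulmx_bound; first exact: ltW.
      by move=> i j; rewrite mxE; exact: hesb.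
    rewrite ler_wpM2r ?enorm_ge0// -/n; have -> : n * (C * n) = C * n ^+ 2 by ring.
    by rewrite /C'; lra.
Qed.

End euclidean_calculus.

(** * Critical points: isolation, finiteness and local minima *)

Section critical_points.
Context {R : realType} {d : nat} (phi : 'rV[R]_d -> R).
Hypothesis Hphi : hypothesis1 phi.
Implicit Types (u v w x y : 'rV[R]_d) (s : 'rV[R]_d).

Lemma near_enorm x (P : 'rV[R]_d -> Prop) :
  (\forall y \near x, P y) <-> exists2 r : R, 0 < r & forall v, enorm v < r -> P (x + v).
Proof.
split=> [/nbhs_ballP[r /= r0 hr]|[r r0 hr]].
  exists r => // v vr; apply: hr; split => //= i j; rewrite (ord1 i) /ball /= mxE opprD addrA subrr sub0r normrN.
  exact: le_lt_trans (enorm_coord v j) vr.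
have d0 : 0 < (d.+1%:R : R) by rewrite ltr0n.
have n0 : (d%:R : R) < d.+1%:R by rewrite ltr_nat.
apply/nbhs_ballP; exists (r / d.+1%:R) => /=; first by rewrite divr_gt0.
move=> y [_ xy]; have -> : y = x + (y - x) by rewrite addrC subrK.
apply: hr; apply: le_lt_trans (enorm_le_l1 _) _; rewrite /l1.
apply: (@le_lt_trans _ _ (\sum_(i < d) r / d.+1%:R)).
  by apply: ler_sum => i _; have := xy ord0 i; rewrite /ball /= !mxE distrC; exact: ltW.
rewrite sumr_const card_ord -[(_ / _) *+ _]mulr_natl mulrCA gtr_pMr// ltr_pdivrMr// mul1r.
by [].
Qed.

Lemma le0_small (t0 K a : R) : 0 < t0 -> (forall t, 0 < t -> t < t0 -> a <= K * t) -> a <= 0.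
Proof.
move=> t00 h; rewrite leNgt; apply/negP => a0.
have k0 : 0 < 2 * (`|K| + 1) by rewrite mulr_gt0// ltr_wpDl.
pose t := Num.min (t0 / 2) (a / (2 * (`|K| + 1))).
have t_gt0 : 0 < t by rewrite lt_min !divr_gt0.
have t1 : t < t0 by rewrite gt_min; apply/orP; left; lra.
have t2 : t <= a / (2 * (`|K| + 1)) by rewrite ge_min lexx orbT.
have := h t t_gt0 t1; have : K * t <= (`|K| + 1) * t.
  by rewrite ler_wpM2r ?(ltW t_gt0)//; have := ler_norm K; lra.
move: t2; rewrite ler_pdivlMr//; lra.
Qed.

Lemma gradient_near_critical : exists2 C, 0 < C & forall x v, enorm v <= 1 ->
  `|enorm (gradient phi (x + v)) - enorm (gradient phi x)| <= C * enorm v.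
Proof.
have [C C1 [_ _ gr _ bd]] := euclidean_bounds Hphi; exists (C + C); first by lra.
move=> x v v1; have [_ _ hb] := bd x; have := hb v; have := gr x v.
set w := gradient phi (x + v); set z := gradient phi x.
move=> h1 h2.
have v2 : C * enorm v ^+ 2 <= C * enorm v.
  rewrite ler_wpM2l//; first by lra.
    by rewrite expr2 ler_piMl// enorm_ge0.
have h3 : enorm (w - z) <= (C + C) * enorm v.
  have -> : w - z = w - z - v *m hessian phi x + v *m hessian phi x by rewrite subrK.
  by apply: le_trans (enormD _ _) _; lra.
have := enormD (w - z) z; have := enormD (z - w) w; rewrite !subrK -[z - w]opprB enormN => e1 e2.
move: (enorm (w - z)) (enorm w) (enorm z) h3 e1 e2 => a b c h3 e1 e2.
by rewrite ler_norml; apply/andP; split; lra.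
Qed.

(** Nondegeneracy gives m |v| <= |v Hess phi(s)|; within radius m/(2C) the quadratic remainder uses
    at most half of it. *)
Lemma gradient_critical s : gradient phi s = 0 -> exists m r : R, [/\ 0 < m, 0 < r &
  forall v, enorm v <= r -> m * enorm v <= enorm (gradient phi (s + v))].
Proof.
move=> gs; have [C C1 [_ _ gr _ _]] := euclidean_bounds Hphi.
have [M [m [[m0 _] _ hm _ _]]] := abs_form (hessian_sym s (hyp_smooth Hphi)) (hyp_morse Hphi gs).
exists (m / 2), (m / (2 * C)); split; [by rewrite divr_gt0|by rewrite divr_gt0//; lra|].
move=> v; rewrite ler_pdivlMr; last by lra.
move=> vr; have := gr s v; rewrite gs subr0.
set w := gradient phi (s + v) => h1.
have h2 : m * enorm v <= enorm (v *m hessian phi s).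
  rewrite -(@ler_pXn2r _ 2)// ?nnegrE ?enorm_ge0 ?mulr_ge0 ?enorm_ge0 ?(ltW m0)//.
  by rewrite exprMn -!dotv_enorm.
have := enormD (v *m hessian phi s - w) w; rewrite subrK => h3.
have {}h1 : enorm (v *m hessian phi s - w) <= C * enorm v ^+ 2 by rewrite -enormN opprB.
have h4 : C * enorm v ^+ 2 <= m / 2 * enorm v.
  by rewrite expr2 mulrA ler_wpM2r ?enorm_ge0//; lra.
by lra.
Qed.

Lemma critical_isolated x : \forall y \near x, gradient phi y = 0 -> y = x.
Proof.
apply/near_enorm; have [gx|gx] := eqVneq (gradient phi x) 0.
  have [m [r [m0 r0 hm]]] := gradient_critical gx; exists r => // v vr gv.
  have := hm v (ltW vr); rewrite gv enorm0 pmulr_rle0// => v0.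
  have -> : v = 0; last by rewrite addr0.
  by apply/rowP => i; rewrite mxE; apply/eqP; rewrite -normr_le0 (le_trans (enorm_coord v i)).
have g0 : 0 < enorm (gradient phi x).
  rewrite lt_def enorm_ge0 andbT; apply: contra_neq gx => g0.
  by apply/rowP => i; rewrite [RHS]mxE; apply/eqP; rewrite -normr_le0 -g0 enorm_coord.
have [C C0 hC] := gradient_near_critical.
exists (Num.min 1 (enorm (gradient phi x) / C)); first by rewrite lt_min ltr01 divr_gt0.
move=> v; rewrite lt_min ltr_pdivlMr// => /andP[/ltW v1 v2] gv; exfalso.
by have := hC x v v1; rewrite gv enorm0 sub0r normrN ger0_norm ?enorm_ge0//; lra.
Qed.

Lemma critical_bounded : exists2 r : R, 0 < r & forall x, gradient phi x = 0 -> enorm x < r.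
Proof.
have [c [r [C [c0 r0 _ hr]]]] := hyp_growth Hphi; exists r => // x gx.
rewrite ltNge; apply/negP => /hr[_ + _]; rewrite gx enorm0; lra.
Qed.

(** Every point has an open neighbourhood without other critical points; finitely many of them cover
    the ball containing all critical points. *)
Lemma critical_finite : exists S : seq 'rV[R]_d, uniq S /\ forall x, gradient phi x = 0 <-> x \in S.
Proof.
have [r r0 hr] := critical_bounded.
have := @rV_ball_compact R d r; rewrite compact_cover => cc.
have [|x _|D _ cD] := cc 'rV[R]_d setT (fun x => interior [set y | gradient phi y = 0 -> y = x]).
- by move=> i _; exact: open_interior.
- by exists x => //; exact: critical_isolated.
exists [seq x <- enum_fset D | `[< gradient phi x = 0 >]]; split.
  by rewrite filter_uniq// fset_uniq.
move=> x; rewrite mem_filter; split=> [gx|/andP[/asboolP//]].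
rewrite asboolT//=; have [|y yD /interior_subset/= /(_ gx) ->//] := cD x.
apply: rV_norm_le => [|i]; first exact: ltW.
by apply: le_trans (enorm_coord x i) (ltW (hr x gx)).
Qed.

(** One constant for all points: the growth hypothesis serves outside a ball. Inside, each point has
    a neighbourhood on which all small [g] work, and compactness makes this uniform. *)
Lemma gradient_lower : exists2 g : R, 0 < g & forall x, g <= enorm (gradient phi x) \/
  exists2 s, gradient phi s = 0 & g * enorm (x - s) <= enorm (gradient phi x).
Proof.
have [c [r [C [c0 r0 _ hr]]]] := hyp_growth Hphi.
pose P (g : R) x := g <= enorm (gradient phi x) \/
  exists2 s, gradient phi s = 0 & g * enorm (x - s) <= enorm (gradient phi x).
have := @rV_ball_compact R d r; rewrite compact_near_coveringP => /(_ R (0^'+) P _) cov.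
suff : forall x : 'rV[R]_d, `|x| <= r -> \forall x' \near x & g \near 0^'+, P g x'.
  move=> /cov hg; have /filter_ex[g [[g0 gc] hg']] : \forall g \near 0^'+, (0 < g /\ g < c) /\
      [set x : 'rV[R]_d | `|x| <= r] `<=` P g.
    have e1 := @nbhs_right_gt R 0; have e2 := nbhs_right_lt c0.
        near=> g; split; [split; near: g; [exact: e1|exact: e2]|near: g; exact: hg].

  exists g => // x; have [xr|xr] := leP r (enorm x).
    by left; have [_ cx _] := hr x xr; lra.
  apply: hg'; apply: rV_norm_le => [|i]; first exact: ltW.
  exact: le_trans (enorm_coord x i) (ltW xr).
move=> x _; have [gx|gx] := eqVneq (gradient phi x) 0.
  have [m [q [m0 q0 hm]]] := gradient_critical gx.
  exists ([set y | enorm (y - x) <= q], [set g | g < m]) => /=.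
    split; last exact: nbhs_right_lt.
    by apply/near_enorm; exists q => // v /ltW; rewrite /= addrAC subrr add0r.
  case=> y g /= [yq gm]; right; exists x => //.
  have := hm _ yq; rewrite addrCA subrr addr0; apply: le_trans.
  by rewrite ler_wpM2r ?enorm_ge0// ltW.
have g0 : 0 < enorm (gradient phi x).
  rewrite lt_def enorm_ge0 andbT; apply: contra_neq gx => g0.
  by apply/rowP => i; rewrite [RHS]mxE; apply/eqP; rewrite -normr_le0 -g0 enorm_coord.
have [K K0 hK] := gradient_near_critical.
set G := enorm (gradient phi x) in g0 *.
exists ([set y | enorm (gradient phi y) >= G / 2], [set g | g < G / 2]) => /=.
  split; last by apply: nbhs_right_lt; lra.
  apply/near_enorm; exists (Num.min 1 (G / (2 * K))).
    by rewrite lt_min ltr01 divr_gt0// mulr_gt0.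
  move=> v; rewrite lt_min ltr_pdivlMr ?mulr_gt0// => /andP[/ltW v1 v2] /=.
  by have := hK x v v1; rewrite -/G ler_norml => /andP[+ _]; lra.
by case=> y g /= [h1 h2]; left; exact: le_trans (ltW h2) h1.
Unshelve. all: by end_near.
Qed.

Lemma local_minimum_critical x : local_minima phi x -> gradient phi x = 0 /\
  forall v, 0 <= quad (hessian phi x) v.
Proof.
move=> /near_enorm[r r0 hr].
have [C C1 [_ tay _ _ bd]] := euclidean_bounds Hphi; have [_ _ hb] := bd x.
have small v : exists2 t0, 0 < t0 & forall t, 0 < t -> t < t0 -> enorm (t *: v) < r /\ enorm (t *: v) <= 1.
  have e0 := enorm_ge0 v; have e1 : 0 < enorm v + 1 by lra.
  exists (Num.min r 1 / (enorm v + 1)); first by rewrite divr_gt0// lt_min r0 ltr01.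
  move=> t t0; rewrite ltr_pdivlMr// lt_min => /andP[h1 h2].
  by rewrite enormZ gtr0_norm//; split; lra.
have qZ (t : R) v : quad (hessian phi x) (t *: v) = t ^+ 2 * quad (hessian phi x) v.
  by rewrite !quadE -scalemxAl dotvZl dotvZr mulrA expr2.
have gx : gradient phi x = 0.
  set g := gradient phi x; have [t0 t00 ht0] := small (- g).
  have : dotv g g <= 0.
    apply: (@le0_small t0 (2 * C * enorm g ^+ 2)) => // t tp tt.
    have [tr t1] := ht0 t tp tt.
    have := hr _ tr; have := tay x (t *: - g); rewrite -/g qZ dotvZr dotvN.
    have := quad_bound hb (- g); rewrite enormN => qb.
    have e3 : C * enorm (t *: - g) ^+ 3 <= C * t ^+ 2 * enorm g ^+ 2.
      rewrite -mulrA ler_wpM2l//; first by lra.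
      rewrite exprS; apply: le_trans (ler_piMl _ t1) _; first exact: sqr_ge0.
      by rewrite enormZ enormN exprMn real_normK ?num_real.
    rewrite ler_norml => /andP[_ h1] h2.
    have h3 : 2^-1 * (t ^+ 2 * quad (hessian phi x) (- g)) <= t ^+ 2 * (C * enorm g ^+ 2) / 2.
      have : t ^+ 2 * quad (hessian phi x) (- g) <= t ^+ 2 * (C * enorm g ^+ 2).
        by rewrite ler_wpM2l ?sqr_ge0//; apply: le_trans qb; exact: ler_norm.
      by lra.
    have h4 : t * dotv g g <= t * (2 * C * enorm g ^+ 2 * t).
      have -> : t * (2 * C * enorm g ^+ 2 * t) = 2 * (C * t ^+ 2 * enorm g ^+ 2) by ring.
      have z0 : 0 <= C * t ^+ 2 * enorm g ^+ 2 by rewrite mulr_ge0 ?sqr_ge0// mulr_ge0 ?sqr_ge0//; lra.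
      by move: h3; rewrite [t ^+ 2 * (C * _)]mulrCA [C * (t ^+ 2 * _)]mulrA; lra.
    by rewrite -(ler_pM2l tp).
  move=> gg; apply/rowP => i; rewrite [RHS]mxE; apply/eqP; rewrite -normr_le0.
  apply: le_trans (enorm_coord _ _) _; rewrite -(@ler_pXn2r _ 2) ?nnegrE ?enorm_ge0//.
  by rewrite expr0n -dotv_enorm.
split=> // v; have [t0 t00 ht0] := small v.
have : - quad (hessian phi x) v <= 0; last by lra.
apply: (@le0_small t0 (2 * C * enorm v ^+ 3)) => // t tp tt.
have [tr t1] := ht0 t tp tt.
have := hr _ tr; have := tay x (t *: v); rewrite gx qZ.
have -> : dotv 0 (t *: v) = 0 by rewrite -(scale0r (0 : 'rV[R]_d)) dotvZl mul0r.
rewrite subr0 enormZ exprMn (gtr0_norm tp) ler_norml => /andP[_ h1] h2.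
have t2 : 0 < t ^+ 2 by rewrite exprn_gt0.
rewrite -(ler_pM2l t2); have -> : t ^+ 2 * (2 * C * enorm v ^+ 3 * t) = 2 * (C * (t ^+ 3 * enorm v ^+ 3)) by ring.
by rewrite mulrN; lra.
Qed.

(** A semidefinite H with |H| <= C satisfies <Hv, v> >= |Hv|^2 / C, and nondegeneracy bounds |Hv|
    from below. *)
Lemma local_minimum_coercive x : local_minima phi x ->
  exists2 m, 0 < m & forall v, m * dotv v v <= quad (hessian phi x) v.
Proof.
move=> /local_minimum_critical[gx psd]; have hs := hessian_sym x (hyp_smooth Hphi).
have [C C1 [_ _ _ _ bd]] := euclidean_bounds Hphi; have [_ _ hb] := bd x.
have [M [m [[m0 _] _ hm _ _]]] := abs_form hs (hyp_morse Hphi gx).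
have C0 : 0 < C by lra.
exists (m ^+ 2 / C) => [|v]; first by rewrite divr_gt0// exprn_gt0.
set H := hessian phi x in hs hb hm psd *.
(* nonnegativity of the form at v - C^-1 Hv *)
have := psd (v + (- C^-1) *: (v *m H)).
rewrite !quadE mulmxDl -scalemxAl !(dotvDl, dotvDr, dotvZl, dotvZr).
have -> : dotv (v *m H *m H) v = dotv (v *m H) (v *m H) by rewrite dotv_mulmx.
have h1 : dotv (v *m H *m H) (v *m H) <= C * dotv (v *m H) (v *m H).
  rewrite -quadE; apply: le_trans (ler_norm _) _; apply: le_trans (quad_bound hb _) _.
  by rewrite dotv_enorm.
have h2 := hm v.
rewrite [m ^+ 2 / C * _]mulrAC ler_pdivrMr//.
move: (dotv (v *m H) v) (dotv (v *m H *m H) (v *m H)) (dotv (v *m H) (v *m H)) h1 h2 => a b e h1 h2.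
have Ci : 0 < C^-1 by rewrite invr_gt0.
have CC : C^-1 * C = 1 by rewrite mulVf// gt_eqF.
move: C^-1 Ci CC => I I0 IC h3.
have : 0 <= C * (a - I * e).
  rewrite mulr_ge0 ?(ltW C0)//; have : I * (I * b) <= I * (I * (C * e)).
    by rewrite ler_pM2l// ler_pM2l.
  by rewrite !mulrA -[I * I * C]mulrA IC mulr1; lra.
by rewrite mulrBr mulrA [C * I]mulrC IC mul1r; lra.
Qed.

Lemma coercive_local_minimum x : gradient phi x = 0 ->
  (exists2 m, 0 < m & forall v, m * dotv v v <= quad (hessian phi x) v) ->
  exists r m : R, [/\ 0 < r, 0 < m & forall v, enorm v <= r -> phi x + m * enorm v ^+ 2 <= phi (x + v)].
Proof.
move=> gx [m m0 hm]; have [C C1 [_ tay _ _ _]] := euclidean_bounds Hphi.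
exists (m / (4 * C)), (m / 4); split; [by rewrite divr_gt0//; lra|lra|].
move=> v; rewrite ler_pdivlMr; last by lra.
move=> vr; have := tay x v; rewrite gx.
have -> : dotv 0 v = 0 by rewrite -(scale0r (0 : 'rV[R]_d)) dotvZl mul0r.
rewrite subr0 ler_norml => /andP[h1 _]; have := hm v; rewrite dotv_enorm => h2.
have h3 : C * enorm v ^+ 3 <= m / 4 * enorm v ^+ 2.
  by rewrite exprS mulrA ler_wpM2r ?sqr_ge0//; lra.
by lra.
Qed.

End critical_points.

(** * A compactly supported well with prescribed Hessian at its bottom *)

Section bump.
Context {R : realType} {d : nat}.
Implicit Types (u v y : 'rV[R]_d).
Variables (M : 'M[R]_d) (m L q2 : R).
Hypotheses (Msym : M^T = M) (m0 : 0 < m) (L1 : 1 <= L) (q20 : 0 < q2).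
Hypotheses (Mpos : forall v, m * enorm v ^+ 2 <= dotv (v *m M) v).
Hypotheses (Mbound : forall v, enorm (v *m M) <= L * enorm v).

Let L0 : 0 <= L. Proof. exact: le_trans ler01 L1. Qed.
Let q20' : 0 <= q2. Proof. exact: ltW. Qed.

Let iq0 : 0 <= 2 / q2. Proof. exact: divr_ge0. Qed.
Let qm0 : 0 <= 2 * q2 / m. Proof. by rewrite divr_ge0 ?mulr_ge0// ltW. Qed.

Definition bump_level y : R := 1 - dotv (y *m M) y / (2 * q2).
(** The depth [q2 / 3] makes [bump_grad] and [bump_hess] the gradient and Hessian of [cap], with
    Hessian exactly [M] at the origin. The cube is the lowest power of the positive part whose
    second order Taylor remainder is cubic. *)
Definition cap y : R := - (q2 / 3) * Num.max 0 (bump_level y) ^+ 3.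
Definition bump_grad y : 'rV[R]_d := Num.max 0 (bump_level y) ^+ 2 *: (y *m M).
Definition bump_hess y : 'M[R]_d := Num.max 0 (bump_level y) ^+ 2 *: M -
  (2 / q2 * Num.max 0 (bump_level y)) *: ((y *m M)^T *m (y *m M)).

(** The second derivative of the cube of the positive part is Lipschitz with constant 6; the four
    sign patterns are checked directly. *)
Lemma cube_pos_taylor (a z : R) :
  `|Num.max 0 (a + z) ^+ 3 - Num.max 0 a ^+ 3 - 3 * Num.max 0 a ^+ 2 * z - 3 * Num.max 0 a * z ^+ 2|
  <= `|z| ^+ 3.
Proof.
have n3 : `|z| ^+ 3 = `|z ^+ 3| by rewrite normrX.
have [a0|a0] := leP 0 a; have [az|az] := leP 0 (a + z).
- have -> : (a + z) ^+ 3 - a ^+ 3 - 3 * a ^+ 2 * z - 3 * a * z ^+ 2 = z ^+ 3 by ring.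
  by rewrite n3.
- have z0 : z < 0 by lra.
  have -> : 0 ^+ 3 - a ^+ 3 - 3 * a ^+ 2 * z - 3 * a * z ^+ 2 = z ^+ 3 - (a + z) ^+ 3 by ring.
  have n3' : `|z| ^+ 3 = - z ^+ 3 by rewrite (ltr0_norm z0); ring.
  have w0 : 0 <= (- (a + z)) ^+ 3 by rewrite exprn_ge0//; lra.
  have w1 : 0 <= a * ((a + z) ^+ 2 + (- (a + z)) * (- z) + z ^+ 2).
    by rewrite mulr_ge0// !addr_ge0 ?sqr_ge0// mulr_ge0//; lra.
  have e0 : (- (a + z)) ^+ 3 = - (a + z) ^+ 3 by ring.
  have e1 : a * ((a + z) ^+ 2 + (- (a + z)) * (- z) + z ^+ 2) = (a + z) ^+ 3 - z ^+ 3 by ring.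
  move: w0 w1; rewrite e0 e1 n3' ler_norml => w0 w1; apply/andP; split; lra.
- have -> : (a + z) ^+ 3 - 0 ^+ 3 - 3 * 0 ^+ 2 * z - 3 * 0 * z ^+ 2 = (a + z) ^+ 3 by ring.
  rewrite ger0_norm ?exprn_ge0//; apply: lerXn2r; rewrite ?nnegrE//.
  by apply: le_trans (ler_norm z); lra.
- by rewrite !expr0n/= !mulr0 !mul0r !subr0 normr0 exprn_ge0.
Qed.

Lemma bump_pos_le1 y : 0 <= Num.max 0 (bump_level y) <= 1.
Proof.
rewrite le_max lexx /= ge_max ler01 /= /bump_level lerBlDr lerDl divr_ge0//.
  by apply: le_trans (Mpos y); rewrite mulr_ge0 ?sqr_ge0// ltW.
by rewrite mulr_ge0// ltW.
Qed.

Lemma bump_outside y : 2 * q2 <= m * enorm y ^+ 2 -> Num.max 0 (bump_level y) = 0.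
Proof.
move=> hy; apply/max_idPl; rewrite /bump_level subr_le0 ler_pdivlMr ?mulr_gt0// mul1r.
exact: le_trans hy (Mpos y).
Qed.

Lemma bump_continuous : continuous cap.
Proof.
have lc : continuous bump_level.
  rewrite (_ : bump_level = (fun y => 1 + - (2 * q2)^-1 * quad M y)).
    apply: continuous_add; first by move=> y; exact: cst_continuous.
    exact: continuous_scale (@quad_cont _ _ M).
  by apply/funext => v; rewrite /bump_level quadE mulNr mulrC.
have pc : continuous (fun y => Num.max 0 (bump_level y)).
  by move=> y; apply: (@continuous_max _ _ (fun=> 0) bump_level); [exact: cst_continuous|exact: lc].
rewrite (_ : cap = (fun y => - (q2 / 3) * (Num.max 0 (bump_level y) * (Num.max 0 (bump_level y) * Num.max 0 (bump_level y))))).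
  by apply: continuous_scale; apply: continuous_mul => //; apply: continuous_mul.
by apply/funext => y; rewrite /cap !exprS expr0 mulr1.
Qed.

Lemma quad_bump_hess y u : quad (bump_hess y) u = Num.max 0 (bump_level y) ^+ 2 * dotv (u *m M) u -
  2 / q2 * Num.max 0 (bump_level y) * dotv (y *m M) u ^+ 2.
Proof.
rewrite quadE /bump_hess mulmxDr mulmxN -!scalemxAr dotvDl dotvZl; congr (_ + _).
rewrite -scaleN1r dotvZl dotvZl mulN1r; congr (- (_ * _)).
have -> : u *m ((y *m M)^T *m (y *m M)) = dotv (y *m M) u *: (y *m M).
  rewrite mulmxA; have -> : u *m (y *m M)^T = (dotv (y *m M) u)%:M.
    by apply/matrixP => i j; rewrite !ord1 !mxE eqxx mulr1n; apply: eq_bigr => k _; rewrite mxE mulrC.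
  by rewrite mul_scalar_mx.
by rewrite dotvZl expr2.
Qed.

Lemma trace_bump_hess y : \tr (bump_hess y) = Num.max 0 (bump_level y) ^+ 2 * \tr M -
  2 / q2 * Num.max 0 (bump_level y) * enorm (y *m M) ^+ 2.
Proof.
rewrite /bump_hess mxtraceD !mxtraceZ; congr (_ + _).
rewrite -scaleN1r !mxtraceZ mulN1r; congr (- (_ * _)).
rewrite mxtrace_mulC /mxtrace big_ord1 mxE -dotv_enorm.
by apply: eq_bigr => i _; rewrite [_^T _ _]mxE.
Qed.

Lemma bump_levelD y u (h : R) :
  bump_level (y + h *: u) = bump_level y + - (h * dotv (y *m M) u / q2 + h ^+ 2 * dotv (u *m M) u / (2 * q2)).
Proof.
rewrite /bump_level mulmxDl -scalemxAl !(dotvDl, dotvDr, dotvZl, dotvZr).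
have -> : dotv (u *m M) y = dotv (y *m M) u by rewrite dotv_mulmx// dotvC.
by field; rewrite gt_eqF.
Qed.

Lemma bump_taylor : exists2 C, 0 <= C & forall y u (h : R), 0 < h -> h <= 1 -> enorm u <= 1 ->
  `|cap (y + h *: u) - cap y - h * dotv (bump_grad y) u - h ^+ 2 / 2 * quad (bump_hess y) u| <= C * h ^+ 3.
Proof.
(* If |y| > Y, both [y] and [y + h *: u] have norm at least 2 q2/m + 1, hence lie outside the
   support and all terms vanish. *)
pose Y := 2 * q2 / m + 2; have Y2 : 2 <= Y by rewrite /Y lerDr divr_ge0 ?mulr_ge0// ltW.
pose Z := (L * Y + L) / q2.
have Y0 : 0 <= Y by exact: le_trans Y2.
have LY : 0 <= L * Y by rewrite mulr_ge0.
have Z0 : 0 <= Z by rewrite divr_ge0// addr_ge0.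
pose C := (L * Y * L + L * L / 4) / q2 + q2 / 3 * Z ^+ 3.
have C0 : 0 <= C.
  rewrite addr_ge0//; last by rewrite mulr_ge0 ?exprn_ge0// divr_ge0// ltW.
  rewrite divr_ge0 ?(ltW q20)// addr_ge0//; last by rewrite divr_ge0// mulr_ge0.
  by rewrite mulr_ge0.
exists C => // y u h h0 h1 u1.
have e0 := enorm_ge0 u; have y0 := enorm_ge0 y.
have qE : dotv (bump_grad y) u = Num.max 0 (bump_level y) ^+ 2 * dotv (y *m M) u.
  by rewrite /bump_grad dotvZl.
rewrite qE quad_bump_hess.
have [yY|yY] := leP (enorm y) Y; last first.
  have far w : Y - 1 <= enorm w -> Num.max 0 (bump_level w) = 0.
    move=> wY; apply: bump_outside; have : 2 * q2 / m + 1 <= enorm w by move: wY; rewrite /Y; lra.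
    have qm : 0 <= 2 * q2 / m by rewrite divr_ge0 ?mulr_ge0// ltW.
    move=> w1; have : 2 * q2 / m <= enorm w ^+ 2.
      have : 1 * enorm w <= enorm w * enorm w by rewrite ler_wpM2r ?enorm_ge0//; move: qm w1; set t := (_ / m); lra.
      by rewrite expr2 mul1r; move: qm w1; set t := (_ / m); lra.
    by rewrite ler_pdivrMr// [_ * m]mulrC.
  rewrite /cap far; last first.
    have := enormB y (h *: u); rewrite enormZ gtr0_norm// => e1.
    apply: le_trans e1; have : h * enorm u <= 1 * 1 by apply: ler_pM => //; exact: ltW.
    by move: yY; set Y' := Y; lra.
  rewrite far; last by move: yY; set Y' := Y; lra.
  by rewrite !expr0n /= !(mulr0, mul0r, subr0, normr0) mulr_ge0// exprn_ge0// ltW.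
have qb : `|dotv (y *m M) u| <= L * Y.
  apply: le_trans (dotv_cauchy _ _) _; apply: le_trans (ler_piMr (enorm_ge0 _) u1) _.
  by apply: le_trans (Mbound y) _; rewrite ler_wpM2l.
have kb : `|dotv (u *m M) u| <= L.
  apply: le_trans (dotv_cauchy _ _) _; apply: le_trans (ler_piMr (enorm_ge0 _) u1) _.
  by apply: le_trans (Mbound u) _; rewrite ler_piMr.
have := bump_pos_le1 y; rewrite /cap bump_levelD.
move: (dotv (y *m M) u) (dotv (u *m M) u) (bump_level y) qb kb {qE} => q k a qb kb.
set z := - (h * q / q2 + h ^+ 2 * k / (2 * q2)); have := cube_pos_taylor a z.
have h00 := ltW h0.
have zb : `|z| <= h * Z.
  have -> : z = - (h * ((q + h * k / 2) / q2)) by rewrite /z; field; rewrite gt_eqF.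
  rewrite normrN normrM (gtr0_norm h0) ler_wpM2l// normrM [X in _ * X]gtr0_norm ?invr_gt0//.
  rewrite /Z ler_wpM2r ?invr_ge0 ?(ltW q20)//; apply: le_trans (ler_normD _ _) _; apply: lerD => //.
  rewrite normrM normrM (gtr0_norm h0) [X in _ * X <= _]ger0_norm//.
  by apply: le_trans kb; rewrite mulrAC ler_piMl//; lra.
have z3 : `|z| ^+ 3 <= h ^+ 3 * Z ^+ 3.
  have hZ : 0 <= h * Z by exact: mulr_ge0.
  by rewrite -exprMn; apply: lerXn2r; rewrite ?nnegrE.
move: (Num.max 0 a) (Num.max 0 (a + z)) => a' b'; set rho := (X in `|X| <= _) => hrho /andP[a0 a1].
have -> : - (q2 / 3) * b' ^+ 3 - - (q2 / 3) * a' ^+ 3 - h * (a' ^+ 2 * q) -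
   h ^+ 2 / 2 * (a' ^+ 2 * k - 2 / q2 * a' * q ^+ 2) =
   - (a' * (h ^+ 3 * (q * k + h * k ^+ 2 / 4)) / q2) - q2 / 3 * rho.
  by rewrite /rho /z; field; rewrite gt_eqF.
apply: le_trans (ler_normB _ _) _; rewrite normrN.
have -> : C * h ^+ 3 = (h ^+ 3 * (L * Y * L + L * L / 4)) / q2 + q2 / 3 * (h ^+ 3 * Z ^+ 3).
  by rewrite /C; field; rewrite gt_eqF.
apply: lerD; last first.
  rewrite normrM ger0_norm; last by rewrite divr_ge0// ltW.
  by rewrite ler_wpM2l//; [rewrite divr_ge0// ltW|lra].
rewrite normrM [X in _ * X]gtr0_norm ?invr_gt0// ler_wpM2r ?invr_ge0 ?(ltW q20)//.
rewrite normrM (ger0_norm a0); apply: le_trans (ler_piMl _ a1) _ => //.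
rewrite normrM ger0_norm ?exprn_ge0// ler_wpM2l ?exprn_ge0//.
apply: le_trans (ler_normD _ _) _; apply: lerD; first by rewrite normrM ler_pM.
rewrite normrM normrM (gtr0_norm h0) [X in _ * X <= _]ger0_norm// ler_wpM2r// normrX.
apply: le_trans (ler_piMl _ h1) _; first exact: sqr_ge0.
by rewrite expr2 ler_pM.
Qed.

Lemma bump_grad_bound y u (eps : R) : enorm u <= 1 -> 0 <= eps -> 2 * q2 * L ^+ 2 <= m * eps ^+ 2 ->
  `|dotv (bump_grad y) u| <= eps.
Proof.
move=> u1 e0 qe; have [hy|hy] := leP (2 * q2) (m * enorm y ^+ 2).
  by rewrite /bump_grad bump_outside// expr0n scale0r -(scale0r (0 : 'rV[R]_d)) dotvZl mul0r normr0.
apply: le_trans (dotv_cauchy _ _) _; apply: le_trans (ler_piMr (enorm_ge0 _) u1) _.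
have /andP[a0 a1] := bump_pos_le1 y.
rewrite /bump_grad enormZ ger0_norm ?exprn_ge0//.
apply: le_trans (ler_piMl (enorm_ge0 _) (exprn_ile1 _ a0 a1)) _.
apply: le_trans (Mbound y) _.
rewrite -(@ler_pXn2r _ 2) ?nnegrE ?mulr_ge0 ?enorm_ge0//.
rewrite -(ler_pM2l m0) exprMn mulrCA; apply: le_trans qe; rewrite mulrC ler_wpM2r ?sqr_ge0//.
exact: ltW.
Qed.

Lemma bump_hess_bound : exists2 C, 0 <= C & forall y u, enorm u <= 1 -> `|quad (bump_hess y) u| <= C.
Proof.
exists (L + 2 / q2 * (L ^+ 2 * (2 * q2 / m))).
  by rewrite addr_ge0// mulr_ge0// mulr_ge0// sqr_ge0.
move=> y u u1; rewrite quad_bump_hess.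
have [hy|hy] := leP (2 * q2) (m * enorm y ^+ 2).
  rewrite bump_outside// expr0n /= !(mulr0, mul0r, subr0) normr0.
  by rewrite addr_ge0// mulr_ge0// mulr_ge0// sqr_ge0.
have /andP[a0 a1] := bump_pos_le1 y.
apply: le_trans (ler_normB _ _) _; apply: lerD.
  rewrite normrM ger0_norm ?exprn_ge0//; apply: le_trans (ler_piMl _ (exprn_ile1 _ a0 a1)) _ => //.
  apply: le_trans (dotv_cauchy _ _) _; apply: le_trans (ler_piMr (enorm_ge0 _) u1) _.
  by apply: le_trans (Mbound u) _; rewrite ler_piMr.
rewrite normrM normrM (ger0_norm iq0) (ger0_norm a0) -mulrA ler_wpM2l//.
apply: le_trans (ler_piMl _ a1) _ => //.
rewrite normrX; apply: (@le_trans _ _ ((L * enorm y) ^+ 2)).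
  apply: lerXn2r; rewrite ?nnegrE ?mulr_ge0 ?enorm_ge0//.
  apply: le_trans (dotv_cauchy _ _) _; apply: le_trans (ler_piMr (enorm_ge0 _) u1) _; exact: Mbound.
rewrite exprMn ler_wpM2l ?sqr_ge0// ler_pdivlMr// mulrC; exact: ltW.
Qed.

(** Two bounds for two uses: close to the bottom the trace must stay near [\tr M]; on the flank,
    where the well bends the other way, it only must not fall below a constant. *)
Lemma trace_bump_lower : exists2 C, 0 <= C & forall y,
  \tr M - C * enorm y ^+ 2 <= \tr (bump_hess y) /\ - C <= \tr (bump_hess y).
Proof.
pose K := `|\tr M| * (L / q2) + 2 / q2 * L ^+ 2.
have K0 : 0 <= K by rewrite addr_ge0// mulr_ge0 ?divr_ge0 ?sqr_ge0.
have near y : \tr M - K * enorm y ^+ 2 <= \tr (bump_hess y).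
  rewrite trace_bump_hess; have /andP[a0 a1] := bump_pos_le1 y.
  have la : bump_level y <= Num.max 0 (bump_level y) by rewrite le_max lexx orbT.
  have t1 : 1 - L / q2 * enorm y ^+ 2 / 2 <= bump_level y.
    rewrite /bump_level lerD2l lerN2.
    have -> : L / q2 * enorm y ^+ 2 / 2 = L * enorm y ^+ 2 / (2 * q2) by field; rewrite gt_eqF.
    rewrite ler_wpM2r ?invr_ge0 ?mulr_ge0 ?(ltW q20)//; apply: le_trans (ler_norm _) _.
    apply: le_trans (dotv_cauchy _ _) _; rewrite expr2 mulrA ler_wpM2r ?enorm_ge0//.
  have w2 : enorm (y *m M) ^+ 2 <= L ^+ 2 * enorm y ^+ 2.
    rewrite -exprMn; apply: lerXn2r; rewrite ?nnegrE ?mulr_ge0 ?enorm_ge0//.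
  have w0 := sqr_ge0 (enorm (y *m M)).
  move: (bump_level y) (Num.max 0 (bump_level y)) la t1 a0 a1 => l a la t1 a0 a1.
  have a21 : a ^+ 2 <= 1 by apply: exprn_ile1.
  have a2 : `|(1 - a ^+ 2) * \tr M| <= L / q2 * enorm y ^+ 2 * `|\tr M|.
    rewrite normrM ler_wpM2r// ger0_norm ?subr_ge0//.
    by have := sqr_ge0 (1 - a); move: t1; set e := (L / q2 * _); lra.
  have i0 : 0 <= 2 / q2 by rewrite divr_ge0// ltW.
  have w3 : 2 / q2 * a * enorm (y *m M) ^+ 2 <= 2 / q2 * (L ^+ 2 * enorm y ^+ 2).
    by rewrite -mulrA ler_wpM2l//; apply: le_trans w2; rewrite ler_piMl.
  have := le_trans (ler_norm _) a2; rewrite mulrBl mul1r => a3.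
  have -> : \tr M - K * enorm y ^+ 2 = \tr M - L / q2 * enorm y ^+ 2 * `|\tr M| - 2 / q2 * (L ^+ 2 * enorm y ^+ 2).
    by rewrite /K; ring.
  by move: a3 w3; move: (a ^+ 2 * _) (2 / q2 * a * _) (2 / q2 * (L ^+ 2 * _)) => ? ? ?; lra.
have Q0 : 0 <= 2 * q2 / m by rewrite divr_ge0 ?mulr_ge0// ltW.
have KQ : 0 <= K * (2 * q2 / m) by exact: mulr_ge0.
have n0 := normr_ge0 (\tr M).
exists (K + `|\tr M| + K * (2 * q2 / m)); first by lra.
move=> y; split.
  apply: le_trans (near y); rewrite lerD2l lerN2 ler_wpM2r ?sqr_ge0//; lra.
have [hy|hy] := leP (2 * q2) (m * enorm y ^+ 2).
  rewrite trace_bump_hess bump_outside// expr0n /= !(mulr0, mul0r, subr0); lra.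
apply: le_trans (near y); have : K * enorm y ^+ 2 <= K * (2 * q2 / m).
  by rewrite ler_wpM2l// ler_pdivlMr// mulrC ltW.
by have := ler_norm (- \tr M); rewrite normrN; lra.
Qed.

End bump.

(** * Flattening of saddles and maxima, and the Lyapunov estimate *)

Section perturbation.
Context {R : realType} {d : nat} (phi : 'rV[R]_d -> R).
Hypothesis Hphi : hypothesis1 phi.
Implicit Types (u v x y : 'rV[R]_d) (p : 'rV[R]_d -> R) (b : 'rV[R]_d -> 'rV[R]_d)
  (H : 'rV[R]_d -> 'M[R]_d).

(** [b] and [H] play the gradient and Hessian of [p], but are tied to it only by a Taylor estimate,
    which is all the averages see. The factor [1 - eta] is the gain over the gradient of [phi]. *)
Definition perturbation (eps eta C : R) p b H : Prop :=
  [/\ continuous p /\ 0 <= C,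
      forall y u (h : R), 0 < h -> h <= 1 -> enorm u <= 1 ->
        `|p (y + h *: u) - p y - h * dotv (b y) u - h ^+ 2 / 2 * quad (H y) u| <= C * h ^+ 3,
      forall y u, enorm u <= 1 -> `|dotv (b y) u| <= eps /\ `|quad (H y) u| <= C,
      forall y, - C <= \tr (H y) &
      forall y, dotv (b y) (b y) <= (1 - eta) * dotv (gradient phi y) (gradient phi y)].

Lemma dotv0l v : dotv 0 v = 0.
Proof. by rewrite -(scale0r (0 : 'rV[R]_d)) dotvZl mul0r. Qed.

Lemma quad0 u : quad (0 : 'M[R]_d) u = 0.
Proof. by rewrite quadE mulmx0 dotv0l. Qed.

Lemma quadD (A B : 'M[R]_d) u : quad (A + B) u = quad A u + quad B u.
Proof. by rewrite !quadE mulmxDr dotvDl. Qed.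

Lemma perturbation0 (eps eta : R) : 0 <= eps -> eta <= 1 ->
  perturbation eps eta 0 (fun=> 0) (fun=> 0) (fun=> 0).
Proof.
move=> e0 e1; split.
- by split=> // x; exact: cst_continuous.
- by move=> y u h _ _ _; rewrite dotv0l quad0 !mulr0 !subr0 normr0 mul0r.
- by move=> y u _; rewrite dotv0l quad0 normr0.
- by move=> y; rewrite mxtrace0 oppr0.
- by move=> y; rewrite dotv0l mulr_ge0 ?dotvv_ge0 ?subr_ge0.
Qed.

(** The bounds on [b] would not survive addition; since at each point one summand has zero [b] and
    [H], they need not add up. *)
Lemma perturbationD (eps eta C1 C2 : R) p1 p2 b1 b2 H1 H2 :
  perturbation eps eta C1 p1 b1 H1 -> perturbation eps eta C2 p2 b2 H2 ->
  (forall y, (b1 y = 0 /\ H1 y = 0) \/ (b2 y = 0 /\ H2 y = 0)) ->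
  perturbation eps eta (C1 + C2) (fun y => p1 y + p2 y) (fun y => b1 y + b2 y) (fun y => H1 y + H2 y).
Proof.
move=> [[c1 C10] t1 q1 tr1 g1] [[c2 C20] t2 q2 tr2 g2] alt; split.
- by split; [exact: continuous_add|exact: addr_ge0].
- move=> y u h h0 h1 u1; rewrite dotvDl quadD mulrDl.
  apply: le_trans (lerD (t1 y u h h0 h1 u1) (t2 y u h h0 h1 u1)); apply: le_trans (ler_normD _ _).
  rewrite le_eqVlt; apply/orP; left; apply/eqP; congr (`|_|).
  by move: (p1 _) (p2 _) (p1 y) (p2 y) (dotv _ _) (dotv _ _) (quad _ _) (quad _ _) => *; ring.
- move=> y u u1; have [e1 k1] := q1 y u u1; have [e2 k2] := q2 y u u1.
  have [[-> ->]|[-> ->]] := alt y; rewrite ?add0r ?addr0; split=> //.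
    by apply: le_trans k2 _; rewrite lerDr.
  by apply: le_trans k1 _; rewrite lerDl.
- move=> y; rewrite mxtraceD opprD; exact: lerD.
- by move=> y; have [[-> _]|[-> _]] := alt y; rewrite ?add0r ?addr0.
Qed.

(** Linear arithmetic isolated from the large contexts in which it is needed. *)
Lemma trace_combine (e t s N : R) : e * (2 * (N + 1)) <= t - s -> e * t <= e * N -> 0 <= e ->
  (t - s) / 2 <= (1 - e) * t - s.
Proof. lra. Qed.

Lemma trace_near_combine (t s g C1 C2 e2 e T H : R) : t - C1 * e2 <= T -> H - s <= C2 * e ->
  C1 * e2 <= C1 * e -> g / 2 <= t - s -> e * (C1 + C2) < g / 2 / 2 -> g / 2 / 2 <= T - H.
Proof. lra. Qed.

(** The well is built on (1 - eta) M with M = |Hess phi(s)|. As |vM| = |v Hess phi(s)|, its gradient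
    is at most 1 - eta times the linearized gradient of [phi], while for small eta its trace still
    exceeds that of the Hessian. *)
Lemma saddle_perturbation s : gradient phi s = 0 ->
  (forall M (m : R), 0 < m -> M^T = M -> (forall v, m * dotv v v <= dotv (v *m M) v) ->
     (forall v, dotv (v *m M) (v *m M) = dotv (v *m hessian phi s) (v *m hessian phi s)) ->
     \tr (hessian phi s) < \tr M ->
  exists eta0 : R, 0 < eta0 /\ forall eta, 0 < eta -> eta <= eta0 -> forall eps rho : R, 0 < eps -> 0 < rho ->
  exists p b H (C a rho' : R), [/\ 0 < a, 0 < rho', perturbation eps eta C p b H,
    (forall y, rho <= enorm (y - s) -> b y = 0 /\ H y = 0) &
    (forall y, enorm (y - s) < rho' -> a <= \tr (H y) - \tr (hessian phi y))]).
Proof.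
move=> gs M m m0 Msym Mpos MH trM.
have [C C1 [_ _ gr trh bd]] := euclidean_bounds Hphi; have [_ _ hb] := bd s.
have C0 : 0 < C by exact: lt_le_trans ltr01 C1.
set Hs := hessian phi s in hb MH trM gr.
pose g := \tr M - \tr Hs; have g0 : 0 < g by rewrite subr_gt0.
have t1 : 0 < 2 * (`|\tr M| + 1) by rewrite mulr_gt0// ltr_wpDl.
(* The second bound makes [eta] times the trace of [M] cost at most half of the trace gap [g]. *)
exists (Num.min (1 / 2) (g / (2 * (`|\tr M| + 1)))); split.
  by rewrite lt_min divr_gt0//= divr_gt0.
move=> eta eta0; rewrite le_min => /andP[eta1 eta2] eps rho eps0 rho0.
pose M' := (1 - eta) *: M; pose m' := m / 2.
have m'0 : 0 < m' by rewrite divr_gt0.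
have M'sym : M'^T = M' by rewrite /M' linearZ /= Msym.
have vM' v : v *m M' = (1 - eta) *: (v *m M) by rewrite -scalemxAr.
have M'pos v : m' * enorm v ^+ 2 <= dotv (v *m M') v.
  rewrite vM' dotvZl -dotv_enorm; have := Mpos v; have := dotvv_ge0 v.
  have k0 : 0 <= dotv (v *m M) v by apply: le_trans (Mpos v); rewrite mulr_ge0 ?dotvv_ge0// ltW.
  have : (1 - eta) * dotv (v *m M) v >= 1 / 2 * dotv (v *m M) v by rewrite ler_wpM2r//; lra.
  rewrite /m' [m / 2 * _]mulrAC; move: (m * dotv v v) (dotv (v *m M) v) k0 (1 - eta) => *; lra.
have MHn v : enorm (v *m M) = enorm (v *m Hs).
  by apply: (@pexpIrn _ 2); rewrite ?nnegrE ?enorm_ge0// -!dotv_enorm.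
have e01 : 0 <= 1 - eta <= 1 by apply/andP; split; lra.
have [e10 e11] := andP e01.
have M'n v : enorm (v *m M') = (1 - eta) * enorm (v *m Hs).
  by rewrite vM' enormZ ger0_norm// MHn.
have M'bound v : enorm (v *m M') <= C * enorm v.
  rewrite M'n; apply: le_trans (hb v); exact: ler_piMl (enorm_ge0 _) e11.
have Hlow v : m * enorm v <= enorm (v *m Hs).
  rewrite -MHn; have [/eqP v0|v0] := boolP (enorm v == 0); first by rewrite v0 mulr0 enorm_ge0.
  have v1 : 0 < enorm v by rewrite lt_def v0 enorm_ge0.
  rewrite -(ler_pM2r v1) -mulrA -expr2 -dotv_enorm; apply: le_trans (Mpos v) _.
  by apply: le_trans (ler_norm _) _; exact: dotv_cauchy.
(* The radius of the well: inside the allowed ball; so small that the quadratic error of grad phi is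
   at most eta/2 of its linear part; and so small that the gradient of the well is at most [eps]. *)
pose rho1 := Num.min rho (Num.min (eta * m / (2 * C)) (eps / C)).
have r10 : 0 < rho1 by rewrite !lt_min rho0 !divr_gt0 ?mulr_gt0.
have [r1a r1b r1c] : [/\ rho1 <= rho, rho1 <= eta * m / (2 * C) & rho1 <= eps / C].
  by rewrite /rho1; split; rewrite !ge_min lexx ?orbT.
pose q2 := m' * rho1 ^+ 2 / 2.
have q20 : 0 < q2 by rewrite divr_gt0// mulr_gt0// exprn_gt0.
have q2E : 2 * q2 = m' * rho1 ^+ 2 by rewrite /q2; field.
have [Ct Ct0 tay] := bump_taylor M'sym m'0 C1 q20 M'pos M'bound.
have [Cq Cq0 hq] := bump_hess_bound m'0 C1 q20 M'pos M'bound.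
have [Cr Cr0 htr] := trace_bump_lower m'0 C1 q20 M'pos M'bound.
have outside y : rho1 <= enorm y -> Num.max 0 (bump_level M' q2 y) = 0.
  move=> ry; apply: (bump_outside q20 M'pos); rewrite q2E ler_pM2l//.
  by apply: lerXn2r; rewrite ?nnegrE ?enorm_ge0// ltW.
pose a := (g / 2) / 2; have a0 : 0 < a by rewrite !divr_gt0.
pose rho' := Num.min 1 (a / (Cr + C)).
have CC0 : 0 < Cr + C by exact: ltr_wpDl.
have rho'P (E : R) : E < rho' -> E < 1 /\ E * (Cr + C) < a.
  by rewrite /rho' lt_min => /andP[E1 E2]; split=> //; rewrite -ltr_pdivlMr.
have shiftE y u (h : R) : y + h *: u - s = y - s + h *: u by rewrite addrAC.
exists (fun y : 'rV[R]_d => cap M' q2 (y - s)), (fun y : 'rV[R]_d => bump_grad M' q2 (y - s)), (fun y : 'rV[R]_d => bump_hess M' q2 (y - s)).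
exists (Ct + Cq + Cr), a, rho'; split.
- exact: a0.
- by rewrite lt_min ltr01 divr_gt0.
- split.
  + split; last by rewrite !addr_ge0.
    move=> y; apply: (@continuous_comp _ _ _ (fun y => y - s) (cap M' q2)).
      by apply: (@cvgB _ _ _ (nbhs y) _ (fun z => z) (fun=> s) y s); [exact: cvg_id|exact: cvg_cst].
    exact: bump_continuous.
  + move=> y u h h0 h1 u1; rewrite shiftE; apply: le_trans (tay _ _ _ h0 h1 u1) _.
    by rewrite ler_wpM2r ?exprn_ge0 ?(ltW h0)// -addrA lerDl addr_ge0.
  + move=> y u u1; split; last first.
      by apply: le_trans (hq _ _ u1) _; rewrite addrAC lerDr addr_ge0.
    apply: (bump_grad_bound m'0 C1 q20 M'pos M'bound (y - s) u1 (ltW eps0) _).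
    rewrite q2E -mulrA ler_pM2l// -exprMn; apply: lerXn2r; rewrite ?nnegrE ?mulr_ge0 ?(ltW r10) ?(ltW C0) ?(ltW eps0)//.
    by rewrite -ler_pdivlMr.
  + move=> y; have [_] := htr (y - s); apply: le_trans; rewrite lerN2 lerDr addr_ge0//.
  + move=> y; have [ry|ry] := leP rho1 (enorm (y - s)).
      rewrite /bump_grad outside// expr0n scale0r dotv0l mulr_ge0 ?dotvv_ge0//.
    rewrite !dotv_enorm.
    have /andP[b0 b1] := bump_pos_le1 m'0 q20 M'pos (y - s).
    have gE : enorm (bump_grad M' q2 (y - s)) <= (1 - eta) * enorm ((y - s) *m Hs).
      rewrite /bump_grad enormZ ger0_norm ?exprn_ge0// M'n.
      by apply: ler_piMl (exprn_ile1 _ b0 b1); rewrite mulr_ge0 ?enorm_ge0.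
    have := gr s (y - s); rewrite gs subr0 addrCA subrr addr0 -enormN opprB => h1.
    have := enormD ((y - s) *m Hs - gradient phi y) (gradient phi y); rewrite subrK => h2.
    have h3 : C * enorm (y - s) ^+ 2 <= eta / 2 * enorm ((y - s) *m Hs).
      apply: (@le_trans _ _ (eta / 2 * (m * enorm (y - s)))); last by rewrite ler_wpM2l//; lra.
      rewrite expr2 !mulrA ler_wpM2r ?enorm_ge0//.
      have := le_trans (ltW ry) r1b; rewrite ler_pdivlMr ?mulr_gt0// => h4.
      by lra.
    have h5 : (1 - eta / 2) * enorm ((y - s) *m Hs) <= enorm (gradient phi y) by lra.
    have n0 := enorm_ge0 ((y - s) *m Hs).
    have h6 : ((1 - eta / 2) * enorm ((y - s) *m Hs)) ^+ 2 <= enorm (gradient phi y) ^+ 2.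
      by apply: lerXn2r; rewrite ?nnegrE ?enorm_ge0// mulr_ge0//; lra.
    have h7 : enorm (bump_grad M' q2 (y - s)) ^+ 2 <= ((1 - eta) * enorm ((y - s) *m Hs)) ^+ 2.
      by apply: lerXn2r; rewrite ?nnegrE ?enorm_ge0// mulr_ge0.
    apply: le_trans h7 _; apply: le_trans (ler_wpM2l e10 h6).
    move: (enorm ((y - s) *m Hs)) => X.
    have -> : (1 - eta) * ((1 - eta / 2) * X) ^+ 2 = (1 - eta) * (1 - eta / 2) ^+ 2 * X ^+ 2 by ring.
    have -> : ((1 - eta) * X) ^+ 2 = (1 - eta) * (1 - eta) * X ^+ 2 by ring.
    rewrite ler_wpM2r ?sqr_ge0// ler_wpM2l//.
    have -> : (1 - eta / 2) ^+ 2 = 1 - eta + (eta / 2) ^+ 2 by field.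
    by rewrite lerDl sqr_ge0.
- move=> y ry; have o := outside _ (le_trans r1a ry).
  by rewrite /bump_grad /bump_hess o expr0n mulr0 !scale0r subr0.
- move=> y /rho'P[y1 y2].
  have [h1 _] := htr (y - s); have := trh s (y - s).
  have -> : s + (y - s) = y by rewrite addrC subrK.
  rewrite -/Hs ler_norml => /andP[_ h2].
  have h3 : Cr * enorm (y - s) ^+ 2 <= Cr * enorm (y - s).
    by rewrite ler_wpM2l// expr2 ler_piMl ?enorm_ge0// ltW.
  have h4 : \tr M' - \tr Hs >= g / 2.
    rewrite /M' mxtraceZ; move: eta2; rewrite ler_pdivlMr// => k1.
    have k4 : eta * \tr M <= eta * `|\tr M| by apply: ler_wpM2l; [exact: ltW|exact: ler_norm].
    exact: trace_combine k1 k4 (ltW eta0).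
  exact: trace_near_combine h1 h2 h3 h4 y2.
Qed.

Lemma saddles_perturbation (S : seq 'rV[R]_d) (eta eps rho : R) : uniq S -> 0 < rho ->
  0 < eps -> 0 <= eta -> eta <= 1 ->
  (forall s, s \in S -> exists p b H (C a rho' : R), [/\ 0 < a, 0 < rho', perturbation eps eta C p b H,
    (forall y, rho <= enorm (y - s) -> b y = 0 /\ H y = 0) &
    (forall y, enorm (y - s) < rho' -> a <= \tr (H y) - \tr (hessian phi y))]) ->
  (forall s t, s \in S -> t \in S -> s != t -> 2 * rho <= enorm (s - t)) ->
  exists p b H (C a rho' : R), [/\ 0 < a, 0 < rho', perturbation eps eta C p b H,
    (forall y, (forall s, s \in S -> rho <= enorm (y - s)) -> b y = 0 /\ H y = 0) &
    (forall s y, s \in S -> enorm (y - s) < rho' -> a <= \tr (H y) - \tr (hessian phi y))].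
Proof.
move=> + rho0 eps0 eta0 eta1; elim: S => [_ _ _|s S IH /= /andP[sS uS] hS sep].
  exists (fun=> 0), (fun=> 0), (fun=> 0), 0, 1, 1; split => //.
  by apply: perturbation0 => //; exact: ltW.
have [||p2 [b2 [H2 [C2 [a2 [r2 [a20 r20 P2 z2 t2]]]]]]] := IH uS.
- by move=> t tS; apply: hS; rewrite inE tS orbT.
- by move=> t t' tS tS'; apply: sep; rewrite inE ?tS ?tS' orbT.
have [p1 [b1 [H1 [C1 [a1 [r1 [a10 r10 P1 z1 t1]]]]]]] := hS s (mem_head _ _).
have sepS t : t \in S -> 2 * rho <= enorm (s - t).
  move=> tS; apply: sep; rewrite ?mem_head// ?inE ?tS ?orbT//.
  by apply: contraNneq sS => ->.
have tri y t : enorm (s - t) <= enorm (y - s) + enorm (y - t).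
  have := enormD (s - y) (y - t); rewrite addrA subrK.
  by have -> : enorm (s - y) = enorm (y - s) by rewrite -enormN opprB.
have far y t : t \in S -> enorm (y - s) < rho -> rho <= enorm (y - t).
  by move=> /sepS h1 h2; have := tri y t; lra.
have alt y : (b1 y = 0 /\ H1 y = 0) \/ (b2 y = 0 /\ H2 y = 0).
  have [ry|ry] := leP rho (enorm (y - s)); first by left; exact: z1.
  by right; apply: z2 => t tS; exact: far.
exists (fun y => p1 y + p2 y), (fun y => b1 y + b2 y), (fun y => H1 y + H2 y), (C1 + C2).
exists (Num.min a1 a2), (Num.min rho (Num.min r1 r2)); split.
- by rewrite lt_min a10.
- by rewrite !lt_min rho0 r10.
- exact: perturbationD.
- move=> y hy; have [-> ->] := z1 y (hy s (mem_head _ _)).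
  have [|-> ->] := z2 y; last by rewrite !addr0.
  by move=> t tS; apply: hy; rewrite inE tS orbT.
- move=> t y; rewrite inE !lt_min => /orP[/eqP ->|tS] /and3P[y1 y2 y3].
    have [_ ->] := z2 y (fun t tS => far y t tS y1).
    by rewrite addr0; apply: le_trans (t1 y y2); rewrite ge_min lexx.
  have [|_ ->] := z1 y.
    by have := sepS t tS; have := tri y t; lra.
  by rewrite add0r; apply: le_trans (t2 t y tS y3); rewrite ge_min lexx orbT.
Qed.

Lemma common_bound (S : seq 'rV[R]_d) (P : 'rV[R]_d -> R -> Prop) :
  (forall s, s \in S -> exists e, 0 < e /\ forall t, 0 < t -> t <= e -> P s t) ->
  exists e, [/\ 0 < e, e <= 1 & forall s, s \in S -> forall t, 0 < t -> t <= e -> P s t].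
Proof.
elim: S => [_|s S IH hS]; first by exists 1.
have [|e [e0 e1 he]] := IH; first by move=> t tS; apply: hS; rewrite inE tS orbT.
have [e' [e'0 he']] := hS s (mem_head _ _).
exists (Num.min e e'); split; rewrite ?lt_min ?e0// ?ge_min ?e1// => t.
rewrite inE => /orP[/eqP ->|tS] r r0; rewrite le_min => /andP[r1 r2]; first exact: he'.
exact: he.
Qed.

(** All smallness conditions on h have the form k.1 h <= k.2 and are collected in one list. *)
Lemma small_parameter (l : seq (R * R)) : (forall k, k \in l -> 0 < k.2) ->
  exists h0 : R, [/\ 0 < h0, h0 <= 1 & forall h, 0 < h -> h <= h0 -> forall k, k \in l -> k.1 * h <= k.2].
Proof.
elim: l => [_|k l IH hl]; first by exists 1.
have [|h0 [h00 h01 hh]] := IH; first by move=> t tS; apply: hl; rewrite inE tS orbT.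
have k0 : 0 < k.2 := hl k (mem_head _ _).
have k1 : 0 < `|k.1| + 1 by rewrite ltr_wpDl.
exists (Num.min h0 (k.2 / (`|k.1| + 1))); split.
- by rewrite lt_min h00 divr_gt0.
- by rewrite ge_min h01.
move=> h hp; rewrite le_min => /andP[h1 h2] t; rewrite inE => /orP[/eqP ->|tS]; last exact: hh.
move: h2; rewrite ler_pdivlMr// mulrC; apply: le_trans; rewrite ler_wpM2r ?(ltW hp)//.
by apply: le_trans (ler_norm _) _; rewrite lerDl.
Qed.

Lemma enorm_gt0 v : v != 0 -> 0 < enorm v.
Proof.
move=> v0; rewrite lt_def enorm_ge0 andbT; apply: contra_neq v0 => v0.
by apply/rowP => i; rewrite [RHS]mxE; apply/eqP; rewrite -normr_le0 -v0 enorm_coord.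
Qed.

(** Up to the factor h^d exp(-f(x)/h), the integral of exp(-f/h) over the ball of radius h at x,
    after substituting y = x + h u. *)
Definition local_average (f : 'rV[R]_d -> R) (h : R) x : R :=
  J (fun u => expR (- ((f (x + h *: u) - f x) / h))).

Lemma lower_combine (X Y P Q w1 w2 h D : R) : X + Q - w2 <= D -> Y <= X -> - P <= Q -> w2 <= w1 ->
  0 <= h -> Y - (P + w1 + h) <= D.
Proof. lra. Qed.

Lemma far_combine (X w c c1 D : R) : X - w <= D -> w <= c1 -> c <= c1 -> 2 * c1 <= X -> c <= D.
Proof. lra. Qed.

Lemma grad_combine (X w h ch D : R) : X - w <= D -> ch <= h -> w + h <= X -> ch <= D.
Proof. lra. Qed.

Lemma saddle_combine (X Y k1 k2 Kh ch q D : R) : X + k2 - Kh <= D -> 0 <= Y -> Y <= X -> ch <= q ->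
  k1 <= k2 -> Kh <= q -> k1 = 2 * q -> ch <= D.
Proof. lra. Qed.

Lemma le_of_sqr (x y : R) : 0 <= y -> x ^+ 2 <= y ^+ 2 -> x <= y.
Proof.
move=> y0 xy; have [x0|x0] := leP 0 x; last exact: le_trans (ltW x0) y0.
by rewrite -(@ler_pXn2r _ 2).
Qed.

(** Three regimes: where |grad phi|^2 is at least K h, the gradient term beats every loss of order
    h; near the remaining critical points that are not minima, the trace gains order h; within A
    sqrt h of a minimum, only a loss of at most v h is claimed. Far out the gradient gains a
    constant. *)
Lemma lyapunov : exists2 p : 'rV[R]_d -> R, continuous p &
  exists c v A h0 r : R, [/\ 0 < c /\ 0 < v, 0 < A, 0 < h0, h0 <= 1 &
    forall (h : R) x, 0 < h -> h <= h0 ->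
    [/\ - (v * h) <= local_average phi h x - local_average p h x,
        r <= enorm x -> c <= local_average phi h x - local_average p h x &
        (exists2 s, local_minima phi s & enorm (x - s) <= A * Num.sqrt h) \/
        c * h <= local_average phi h x - local_average p h x]].
Proof.
have [kappa kappa0 kappaE] := @second_moment R d.
have [C0 C01 [_ tay _ _ bd]] := euclidean_bounds Hphi.
have [S [uS hS]] := critical_finite Hphi.
have [gam gam0 hgam] := gradient_lower Hphi.
have [cg [rg [Cal [cg0 _ _ hfar]]]] := hyp_growth Hphi.
pose PD s := exists2 m : R, 0 < m & forall v, m * dotv v v <= quad (hessian phi s) v.
(* The critical points with Hessian not positive definite, where [p] has to act. *)
pose Sb := [seq s <- S | ~~ `[< PD s >]].
have SbS s : s \in Sb -> s \in S by rewrite mem_filter => /andP[].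
have [rho [rho0 _ hrho]] : exists rho : R, [/\ 0 < rho, rho <= 1 &
    forall s, s \in S -> forall t, 0 < t -> t <= rho -> forall s', s' \in S -> s != s' -> 2 * t <= enorm (s - s')].
  apply: common_bound => s sS.
  have [|e [e0 _ he]] := @common_bound S (fun s' t => s != s' -> 2 * t <= enorm (s - s')).
    move=> s' _; have [->|ss] := eqVneq s s'; first by exists 1.
    exists (enorm (s - s') / 2); rewrite divr_gt0 ?enorm_gt0 ?subr_eq0//; split=> // t _ ht _; lra.
  by exists e; split=> // t t0 te s' s'S ss; exact: he s'S t t0 te ss.
have [|eta [eta0 eta1 heta]] := @common_bound Sb (fun s eta => forall eps rho : R, 0 < eps -> 0 < rho ->
  exists p b H (C a rho' : R), [/\ 0 < a, 0 < rho', perturbation eps eta C p b H,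
    (forall y, rho <= enorm (y - s) -> b y = 0 /\ H y = 0) &
    (forall y, enorm (y - s) < rho' -> a <= \tr (H y) - \tr (hessian phi y))]).
  move=> s; rewrite mem_filter => /andP[/asboolPn nPD sS].
  have gs : gradient phi s = 0 by apply/hS.
  have [M [m [[m0 Ms] Mp _ MH alt]]] := abs_form (hessian_sym s (hyp_smooth Hphi)) (hyp_morse Hphi gs).
  case: alt => [pd|tr]; last exact: (saddle_perturbation gs m0 Ms Mp MH tr).
  by case: nPD; exists m => // v; rewrite quadE; exact: pd.
(* The gradient bound [eta / 2] satisfies the requirement eps^2 <= eta/4 of [lyapunov_core], since
   eta <= 1. *)
have [||||p [b [H [Cp [a [rho' [a0 rho'0 [[pc Cp0] ptay pq ptr pg] _ hsad]]]]]]] :=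
    @saddles_perturbation Sb eta (eta / 2) rho _ rho0 _ (ltW eta0) eta1.
- by rewrite filter_uniq.
- by rewrite divr_gt0.
- by move=> s sb; apply: (heta s sb eta) => //; rewrite divr_gt0.
- by move=> s t sb tb; apply: (hrho s _ rho) => //; exact: SbS.
exists p => //.
pose C := C0 + Cp; have C1 : 1 <= C by apply: le_trans C01 _; rewrite lerDl.
pose K1 := C * (1 + expR C) / 4; pose K2 := 2 * (expR C * (C + 8 * C ^+ 2)) * omega (R := R) (d := d).
have Cge0 : 0 <= C by exact: le_trans ler01 C1.
have K20 : 0 <= K2.
  apply: mulr_ge0; last exact: ltW omega_gt0.
  by apply: mulr_ge0 => //; apply: mulr_ge0; [exact: expR_ge0|apply: addr_ge0 => //; apply: mulr_ge0 => //; exact: sqr_ge0].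
pose v := kappa * C / 2 + K2 + 1.
have v0 : 0 < v by rewrite /v ltr_wpDl// addr_ge0// divr_ge0// mulr_ge0// ltW.
(* Chosen so that the gradient gain (kappa eta / 8) K h equals v h + h: it pays the loss and leaves
   h. *)
pose K := 8 * (v + 1) / (kappa * eta).
have ke0 : 0 < kappa * eta by exact: mulr_gt0.
have K0 : 0 < K by rewrite divr_gt0// mulr_gt0// addr_gt0.
(* Half of the gain from |grad phi| >= cg far out; the other half pays the loss v h. *)
pose c1 := kappa * eta * cg ^+ 2 / 16.
have c10 : 0 < c1 by rewrite divr_gt0// mulr_gt0// exprn_gt0.
have [|h0 [h00 h01 hh]] := @small_parameter [:: (4 * C, 1); (K1, eta / 8); (K2, kappa * a / 4);
   (v, c1); (K, gam ^+ 2); (K, (gam * rho') ^+ 2)].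
  move=> k; rewrite !inE => /or3P[/eqP ->|/eqP ->|/or4P[] /eqP ->] //=.
  - by rewrite divr_gt0.
  - by rewrite divr_gt0// mulr_gt0.
  - by rewrite exprn_gt0.
  - by rewrite exprn_gt0// mulr_gt0.
pose c := Num.min 1 (Num.min (kappa * a / 4) c1).
have c0 : 0 < c by rewrite !lt_min ltr01 divr_gt0// mulr_gt0.
exists c, v, (Num.sqrt K / gam), h0, rg; split => //; first by rewrite divr_gt0// sqrtr_gt0.
move=> h x hp hle.
have hS1 : 4 * C * h <= 1 by apply: (hh h hp hle (4 * C, 1)); rewrite !inE eqxx.
have hS2 : K1 * h <= eta / 8 by apply: (hh h hp hle (K1, eta / 8)); rewrite !inE eqxx ?orbT.
have hS3 : K2 * h <= kappa * a / 4 by apply: (hh h hp hle (K2, kappa * a / 4)); rewrite !inE eqxx ?orbT.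
have hS4 : v * h <= c1 by apply: (hh h hp hle (v, c1)); rewrite !inE eqxx ?orbT.
have hS5 : K * h <= gam ^+ 2 by apply: (hh h hp hle (K, gam ^+ 2)); rewrite !inE eqxx ?orbT.
have hS6 : K * h <= (gam * rho') ^+ 2 by apply: (hh h hp hle (K, (gam * rho') ^+ 2)); rewrite !inE eqxx ?orbT.
have h1 : h <= 1 by exact: le_trans hle h01.
have hh0 := ltW hp.
have fc (f : 'rV[R]_d -> R) : continuous f -> continuous (fun u : 'rV[R]_d => (f (x + h *: u) - f x) / h).
  move=> cf; rewrite (_ : (fun _ => _) = (fun u => h^-1 * (f (x + h *: u) + - f x))).
    apply: continuous_scale; apply: continuous_add; last by move=> u; exact: cst_continuous.
    move=> u; apply: (@continuous_comp _ _ _ (fun u => x + h *: u) f); last exact: cf.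
    by apply: (@cvgD _ _ _ (nbhs u) _ (fun=> x) (fun z => h *: z) x (h *: u)); [exact: cvg_cst|exact: scaler_continuous].
  by apply/funext => u; rewrite mulrC.
have e2 : (eta / 2) ^+ 2 <= eta / 4.
  have : eta * eta <= eta * 1 by rewrite ler_wpM2l// ltW.
  by rewrite exprMn expr2 expr2; lra.
have divE (f : 'rV[R]_d -> R) (g q Cf : R) (y : 'rV[R]_d) : `|f (x + h *: y) - f x - h * g - h ^+ 2 / 2 * q| <= Cf * h ^+ 3 ->
    `|(f (x + h *: y) - f x) / h - g - h / 2 * q| <= Cf * h ^+ 2.
  move=> hf; have -> : (f (x + h *: y) - f x) / h - g - h / 2 * q =
      (f (x + h *: y) - f x - h * g - h ^+ 2 / 2 * q) / h by field; rewrite gt_eqF.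
  by rewrite normrM [X in _ * X]gtr0_norm ?invr_gt0// ler_pdivrMr//; have -> : Cf * h ^+ 2 * h = Cf * h ^+ 3 by ring.
have h20 : 0 <= h ^+ 2 by exact: sqr_ge0.
have C0C : C0 <= C by rewrite lerDl.
have CpC : Cp <= C by rewrite lerDr; exact: le_trans ler01 C01.
have [gxb trb hessb] := bd x.
have C00 : 0 <= C0 by exact: le_trans ler01 C01.
have ball1 u : eball 0 1 u -> enorm u <= 1 by rewrite /eball /= sub0r enormN => /ltW.
have qphi u : enorm u <= 1 -> `|quad (hessian phi x) u| <= C.
  move=> u1; apply: le_trans (quad_bound hessb u) _; apply: le_trans C0C.
  by rewrite ler_piMr// exprn_ile1// enorm_ge0.
have e20 : 0 <= eta / 2 by lra.
have e21 : eta / 2 <= 1 by lra.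
have core := @lyapunov_core R d kappa kappa0 kappaE C h eta (eta / 2)
   (fun u => (phi (x + h *: u) - phi x) / h) (fun u => (p (x + h *: u) - p x) / h)
   (gradient phi x) (b x) (hessian phi x) (H x) C1 hp hS1 (ltW eta0) eta1 e20 e21 e2
   (fc _ (hypothesis1_continuous Hphi)) (fc _ pc) _ _ (pg x).
have {}core : kappa * (eta / 4 - K1 * h) * dotv (gradient phi x) (gradient phi x) +
    h * kappa / 2 * (\tr (H x) - \tr (hessian phi x)) - K2 * h ^+ 2 <=
    local_average phi h x - local_average p h x.
  apply: core => u /ball1 u1; last by split; [exact: qphi|exact: le_trans (pq x u u1).2 CpC].
  split.
  - apply: le_trans (ler_wpM2r h20 C0C); apply: divE.
    have := tay x (h *: u); rewrite dotvZr.
    have -> : quad (hessian phi x) (h *: u) = h ^+ 2 * quad (hessian phi x) u.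
      by rewrite !quadE -scalemxAl dotvZl dotvZr mulrA expr2.
    rewrite mulrA [2^-1 * _]mulrC => /le_trans; apply.
    rewrite ler_wpM2l// enormZ gtr0_norm//; apply: lerXn2r; rewrite ?nnegrE ?mulr_ge0 ?enorm_ge0//.
    by rewrite ler_piMr.
  - by apply: le_trans (ler_wpM2r h20 CpC); apply: divE; exact: ptay.
  - apply: le_trans (dotv_cauchy _ _) _; apply: le_trans (ler_piMr (enorm_ge0 _) u1) _.
    exact: le_trans gxb C0C.
  - exact: (pq x u u1).1.
have trd : - C <= \tr (H x) - \tr (hessian phi x).
  by have := ptr x; move: trb; rewrite ler_norml => /andP[_ t1] t2; rewrite /C; lra.
have G0 := dotvv_ge0 (gradient phi x).
have Genorm := dotv_enorm (gradient phi x).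
have hGs s := hsad s x.
move: core trd G0 Genorm hGs; move: (local_average phi h x - local_average p h x) => dif.
move: (dotv _ _) => G; move: (\tr (H x) - \tr (hessian phi x)) => tr core trd G0 Genorm hGs.
have A1 : kappa * eta / 8 * G <= kappa * (eta / 4 - K1 * h) * G.
  by rewrite ler_wpM2r// -mulrA ler_wpM2l ?(ltW kappa0)//; move: hS2; set z := K1 * h; lra.
have A2 : K2 * h ^+ 2 <= K2 * h by rewrite ler_wpM2l// expr2 ler_piMl.
have hk0 : 0 <= h * kappa / 2 by rewrite divr_ge0// mulr_ge0// ltW.
have star : kappa * eta / 8 * G - v * h <= dif.
  have P1 : h * kappa / 2 * (- C) <= h * kappa / 2 * tr by exact: (ler_wpM2l hk0 trd).
  rewrite [_ * - C]mulrN in P1.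
  have -> : v * h = h * kappa / 2 * C + K2 * h + h by rewrite /v; ring.
  exact: lower_combine core A1 P1 A2 hh0.
have k8 : 0 <= kappa * eta / 8 by apply: divr_ge0; [exact: ltW|exact: ler0n].
have keG : 0 <= kappa * eta / 8 * G by exact: mulr_ge0 k8 G0.
have cc1 : c <= c1 by rewrite /c !ge_min lexx !orbT.
have sq_le (z w : R) : 0 <= z -> 0 <= w -> z <= w -> z ^+ 2 <= w ^+ 2.
  by move=> z0 w0 zw; apply: lerXn2r zw.
have e0 := enorm_ge0 (gradient phi x).
have gam00 := ltW gam0.
split.
- by apply: le_trans star; rewrite -{1}[- (v * h)]add0r lerD2r.
- move=> xr; have [_ gx _] := hfar x xr.
  have cG : cg ^+ 2 <= G by rewrite Genorm; exact: sq_le (ltW cg0) e0 gx.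
  have : kappa * eta / 8 * cg ^+ 2 <= kappa * eta / 8 * G by exact: (ler_wpM2l k8 cG).
  have -> : kappa * eta / 8 * cg ^+ 2 = 2 * c1 by rewrite /c1; field.
  exact: far_combine star hS4 cc1.
have [KG|KG] := leP (K * h) G.
  right; have ch : c * h <= h.
    by apply: ler_piMl hh0 _; rewrite /c ge_min lexx.
  have : kappa * eta / 8 * (K * h) <= kappa * eta / 8 * G by exact: (ler_wpM2l k8 KG).
  have -> : kappa * eta / 8 * (K * h) = v * h + h.
    by rewrite /K; field; apply/andP; split; rewrite gt_eqF.
  exact: grad_combine star ch.
(* Here |grad phi|^2 < K h <= gam^2, so only the alternative with a critical point [s] remains, and
   |x - s| < sqrt(K h)/gam. *)
case: (hgam x) => [gg|[s gs sg]].
  have gG : gam ^+ 2 <= G by rewrite Genorm; exact: sq_le gam00 e0 gg.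
  by have := lt_le_trans KG (le_trans hS5 gG); rewrite ltxx.
have ge0 : 0 <= gam * enorm (x - s) by exact: mulr_ge0 gam00 (enorm_ge0 _).
have sG : (gam * enorm (x - s)) ^+ 2 <= G by rewrite Genorm; exact: sq_le ge0 e0 sg.
have [pd|npd] := pselect (PD s).
  left; exists s.
    have [r [m [r0 m0 hr]]] := coercive_local_minimum Hphi gs pd.
    apply/near_enorm; exists r; first exact: r0.
    move=> w /ltW /hr; apply: le_trans.
    by rewrite lerDl mulr_ge0 ?sqr_ge0// ltW.
  have Kh0 : 0 <= K * h by exact: mulr_ge0 (ltW K0) hh0.
  rewrite mulrAC ler_pdivlMr; last exact: gam0.
  rewrite mulrC -sqrtrM; last exact: ltW.
  apply: le_of_sqr; first exact: sqrtr_ge0.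
  by rewrite sqr_sqrtr; [exact: le_trans sG (ltW KG)|exact: Kh0].
have sSb : s \in Sb by rewrite mem_filter; apply/andP; split; [exact/asboolPn|exact/hS].
have /(hGs s sSb) at0 : enorm (x - s) < rho'.
  rewrite -(ltr_pM2l gam0) ltNge; apply/negP => gr.
  have := sq_le _ _ (ltW (mulr_gt0 gam0 rho'0)) ge0 gr => gr2.
  by have := lt_le_trans KG (le_trans hS6 (le_trans gr2 sG)); rewrite ltxx.
right; have ch : c * h <= kappa * a / 4 * h.
  by apply: (ler_wpM2r hh0); rewrite /c !ge_min lexx orbT.
have k1 : h * kappa / 2 * a <= h * kappa / 2 * tr by exact: (ler_wpM2l hk0 at0).
have k2 : K2 * h ^+ 2 <= kappa * a / 4 * h.
  by have -> : K2 * h ^+ 2 = K2 * h * h by [ring]; exact: (ler_wpM2r hh0 hS3).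
have k3 : h * kappa / 2 * a = 2 * (kappa * a / 4 * h) by field.
exact: saddle_combine core keG A1 ch k1 k2 k3.
Qed.

End perturbation.

(** * Averaging operators reversible for a probability measure *)

(** Polarization: the form bounds at f + Tf and f - Tf give 4 |Tf|^2 <= |f + Tf|^2 + |f - Tf|^2 = 2
    |f|^2 + 2 |Tf|^2. *)
Lemma symmetric_norm_bound (R : realType) (V : lmodType R) (ip : V -> V -> R) (H : semi_hilbert ip)
  (T : V -> V) : (forall f g, ip (T f) g = ip f (T g)) ->
  (forall f, ip (T f) f <= ip f f) -> (forall f, - ip f f <= ip (T f) f) ->
  forall f, ip (T f) (T f) <= ip f f.
Proof.
move=> Tsym T1 TN1 f; have := T1 (f + T f); have := TN1 (f - T f).
rewrite (T_sub H Tsym) (T_add H Tsym) !(ipBr H, ipBl H) !(ipDr H, ipDl H).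
by rewrite (Tsym (T f) f) (ipC H f (T f)); lra.
Qed.

Section reversible.
Context d (T : measurableType d) (R : realType) (pi nu : probability T R).
Variables (w : T * T -> R) (kap : R).
Hypotheses (mw : measurable_fun setT w) (w_ge0 : forall z, 0 <= w z) (w_le1 : forall z, w z <= 1).
Hypothesis wsym : forall x y, w (x, y) = w (y, x).

Definition weight (x : T) : R := \int[pi]_y w (x, y).

Hypothesis weight_gt0 : forall x, 0 < weight x.
Hypothesis kap0 : 0 < kap.
Hypothesis nuE : forall F : T -> \bar R, measurable_fun setT F -> (forall x, (0 <= F x)%E) ->
  (\int[nu]_x F x = kap%:E * \int[pi]_x (F x * (weight x)%:E))%E.

Local Notation V := (LfunType nu (lee1n 2)).
Local Notation ip := (@ipL d T R nu).
Local Notation H := (semi_hilbert_L2 nu).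
Local Notation PP := (pi \x pi)%E.

Lemma weightE x : (\int[pi]_y (w (x, y))%:E = (weight x)%:E)%E.
Proof.
rewrite /weight /Rintegral fineK// ge0_fin_numE; last by apply: integral_ge0 => y _; rewrite lee_fin.
apply: (@le_lt_trans _ _ (\int[pi]_y 1%:E)%E); last by rewrite integral_prob_cst ltry.
apply: ge0_le_integral => //.
- by move=> y _; rewrite lee_fin.
- by apply/measurable_EFinP; exact: measurable_fun_pair2.
- by move=> y _; rewrite lee_fin.
Qed.

Lemma measurable_weight : measurable_fun setT weight.
Proof.
apply/measurable_EFinP; rewrite (_ : EFin \o weight = fubini_F pi (EFin \o w)).
  apply: measurable_fun_fubini_tonelli_F => [|z]; first exact/measurable_EFinP.
  by rewrite lee_fin.
by apply/funext => x /=; rewrite -weightE.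
Qed.

Lemma tonelli_weight1 (F : T -> \bar R) : measurable_fun setT F -> (forall x, (0 <= F x)%E) ->
  (\int[PP]_z ((w z)%:E * F z.1) = \int[pi]_x (F x * (weight x)%:E))%E.
Proof.
move=> mF F0; rewrite fubini_tonelli1; last 2 first.
- apply: emeasurable_funM; first exact/measurable_EFinP.
  exact: (measurableT_comp mF).
- by move=> z; rewrite mule_ge0// lee_fin.
apply: eq_integral => x _; rewrite /fubini_F /= ge0_integralZr//.
- by rewrite muleC weightE.
- by apply/measurable_EFinP; exact: measurable_fun_pair2.
- by move=> y _; rewrite lee_fin.
Qed.

Lemma tonelli_weight2 (F : T -> \bar R) : measurable_fun setT F -> (forall x, (0 <= F x)%E) ->
  (\int[PP]_z ((w z)%:E * F z.2) = \int[pi]_x (F x * (weight x)%:E))%E.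
Proof.
move=> mF F0; rewrite fubini_tonelli2; last 2 first.
- apply: emeasurable_funM; first exact/measurable_EFinP.
  exact: (measurableT_comp mF).
- by move=> z; rewrite mule_ge0// lee_fin.
apply: eq_integral => x _; rewrite /fubini_G /= ge0_integralZr//.
- by rewrite muleC -weightE; congr (_ * _)%E; apply: eq_integral => y _; rewrite wsym.
- by apply/measurable_EFinP; exact: measurable_fun_pair1.
- by move=> y _; rewrite lee_fin.
Qed.

Lemma pi_weight_nu (F : T -> \bar R) : measurable_fun setT F -> (forall x, (0 <= F x)%E) ->
  (\int[pi]_x (F x * (weight x)%:E) = (kap^-1)%:E * \int[nu]_x F x)%E.
Proof.
by move=> mF F0; rewrite nuE// muleA -EFinM mulVf ?gt_eqF// mul1e.
Qed.

Lemma V_measurable (f : V) : measurable_fun setT (f : T -> R).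
Proof. exact: Lfun2_measurable (V_Lfun f). Qed.

Lemma measurable_sqr (f : V) : measurable_fun setT (fun x => (f x ^+ 2)%:E).
Proof. by apply/measurable_EFinP; apply: measurable_funX; exact: V_measurable. Qed.

Lemma square_integral1 (f : V) : (\int[PP]_z (w z * f z.1 ^+ 2)%:E = (kap^-1 * ip f f)%:E)%E.
Proof.
rewrite EFinM ipL_sqrE -pi_weight_nu; [|exact: measurable_sqr|by move=> x; rewrite lee_fin sqr_ge0].
rewrite -tonelli_weight1; [|exact: measurable_sqr|by move=> x; rewrite lee_fin sqr_ge0].
by apply: eq_integral => z _; rewrite EFinM.
Qed.

Lemma square_integral2 (f : V) : (\int[PP]_z (w z * f z.2 ^+ 2)%:E = (kap^-1 * ip f f)%:E)%E.
Proof.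
rewrite EFinM ipL_sqrE -pi_weight_nu; [|exact: measurable_sqr|by move=> x; rewrite lee_fin sqr_ge0].
rewrite -tonelli_weight2; [|exact: measurable_sqr|by move=> x; rewrite lee_fin sqr_ge0].
by apply: eq_integral => z _; rewrite EFinM.
Qed.

Lemma measurable_V1 (f : V) : measurable_fun setT (fun z : T * T => f z.1).
Proof. exact: (measurableT_comp (V_measurable f)). Qed.

Lemma measurable_V2 (f : V) : measurable_fun setT (fun z : T * T => f z.2).
Proof. exact: (measurableT_comp (V_measurable f)). Qed.

Lemma cross_integrable (f g : V) : PP.-integrable setT (fun z => (w z * f z.2 * g z.1)%:E).
Proof.
have mG : measurable_fun setT (fun z : T * T => (w z * f z.2 * g z.1)%:E).
  apply/measurable_EFinP; apply: measurable_funM; last exact: measurable_V1.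
  by apply: measurable_funM => //; exact: measurable_V2.
apply/integrableP; split => //.
have m1 : measurable_fun setT (fun z : T * T => (w z * g z.1 ^+ 2)%:E).
  by apply/measurable_EFinP; apply: measurable_funM => //; apply: measurable_funX; exact: measurable_V1.
have m2 : measurable_fun setT (fun z : T * T => (w z * f z.2 ^+ 2)%:E).
  by apply/measurable_EFinP; apply: measurable_funM => //; apply: measurable_funX; exact: measurable_V2.
apply: (@le_lt_trans _ _ (\int[PP]_z ((w z * g z.1 ^+ 2)%:E + (w z * f z.2 ^+ 2)%:E))%E).
  apply: ge0_le_integral => //.
  - exact: measurableT_comp.
  - exact: emeasurable_funD.
  - move=> z _; rewrite -EFinD /= lee_fin -mulrDr -mulrA normrM ger0_norm// ler_wpM2l// normrM.
    rewrite -(real_normK (num_real (g z.1))) -(real_normK (num_real (f z.2))).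
    by have := sqr_ge0 (`|f z.2| - `|g z.1|); have := sqr_ge0 (`|f z.2|); have := sqr_ge0 (`|g z.1|); nra.
rewrite ge0_integralD//.
- by rewrite square_integral1 square_integral2 -EFinD ltry.
- by move=> z _; rewrite lee_fin mulr_ge0// sqr_ge0.
- by move=> z _; rewrite lee_fin mulr_ge0// sqr_ge0.
Qed.

Definition cross (f g : V) : R := \int[PP]_z (w z * f z.2 * g z.1).

Lemma crossE (f g : V) : (\int[PP]_z (w z * f z.2 * g z.1)%:E = (cross f g)%:E)%E.
Proof. by rewrite /cross /Rintegral fineK//; exact: integrable_fin_num (cross_integrable f g). Qed.

Lemma cross_sym (f g : V) : cross f g = cross g f.
Proof.
apply: EFin_inj; rewrite -!crossE -integral12_prod_meas1; last exact: cross_integrable.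
rewrite -integral21_prod_meas1; last exact: cross_integrable.
rewrite /fubini_F /fubini_G; apply: eq_integral => x _; apply: eq_integral => y _ /=.
by rewrite wsym mulrAC.
Qed.

Lemma one_L2 : (cst 1 : T -> R) \in Lfun nu 2%:E.
Proof.
apply/Lfun2P; split; first exact: measurable_cst.
by under eq_integral do rewrite expr1n; rewrite integral_prob_cst ltry.
Qed.

Definition one_V : V := to_V one_L2.

Definition average (f : T -> R) (x : T) : R := (weight x)^-1 * \int[pi]_y (w (x, y) * f y).

Lemma row_integrable (f : V) : PP.-integrable setT (fun z => (w z * f z.2)%:E).
Proof.
have := cross_integrable f one_V; apply: eq_integrable => // z _.
by rewrite -[one_V z.1]/(1 : R) mulr1.
Qed.

Lemma measurable_average (f : V) : measurable_fun setT (average f).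
Proof.
apply: measurable_funM.
  rewrite (_ : (fun _ => _) = (@powR R ^~ (-1)) \o weight).
    by apply: measurableT_comp; [exact: measurable_powR|exact: measurable_weight].
  by apply/funext => x /=; rewrite powR_inv1// ltW.
apply: measurableT_comp; first exact: fine_measurable.
exact: (measurable_fubini_F (row_integrable f)).
Qed.

Lemma ae_row_integrable (f : V) :
  {ae pi, forall x, pi.-integrable setT (fun y => (w (x, y) * f y)%:E)}.
Proof. exact: (ae_integrable1 (row_integrable f)). Qed.

Lemma measurable_row x : measurable_fun setT (fun y => w (x, y)).
Proof. exact: measurable_fun_pair2. Qed.

(** Jensen's inequality, by expanding the nonnegative integral of w (f - t)^2 with [t] the weighted
    average. *)
Lemma average_sqr (f : V) x : pi.-integrable setT (fun y => (w (x, y) * f y)%:E) ->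
  ((average f x ^+ 2 * weight x)%:E <= \int[pi]_y (w (x, y) * f y ^+ 2)%:E)%E.
Proof.
move=> fi; set t := average f x.
have tw : \int[pi]_y (w (x, y) * f y) = t * weight x.
  by rewrite /t /average mulrC mulrA mulfV ?mul1r ?gt_eqF.
have mx := measurable_row x; have mf := V_measurable f.
have wi : pi.-integrable setT (fun y => (w (x, y))%:E).
  apply/integrableP; split; first exact/measurable_EFinP.
  by under eq_integral do rewrite /= ger0_norm//; rewrite weightE ltry.
have mS : measurable_fun setT (fun y => (w (x, y) * f y ^+ 2)%:E).
  by apply/measurable_EFinP; apply: measurable_funM => //; exact: measurable_funX.
have [S_oo|S_fin] := eqVneq (\int[pi]_y (w (x, y) * f y ^+ 2)%:E)%E +oo%E; first by rewrite S_oo leey.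
have Si : pi.-integrable setT (fun y => (w (x, y) * f y ^+ 2)%:E).
  apply/integrableP; split => //; rewrite (eq_integral (fun y => (w (x, y) * f y ^+ 2)%:E)).
    by rewrite ltey.
  by move=> y _; rewrite /= ger0_norm// mulr_ge0// sqr_ge0.
have := @Rintegral_ge0 _ _ _ pi setT (fun y => w (x, y) * (f y - t) ^+ 2).
have -> : \int[pi]_y (w (x, y) * (f y - t) ^+ 2) =
    \int[pi]_y ((w (x, y) * f y ^+ 2 + (- (2 * t)) * (w (x, y) * f y)) + t ^+ 2 * w (x, y)).
  by apply: eq_Rintegral => y _; ring.
have i1 : pi.-integrable setT (EFin \o (fun y => - (2 * t) * (w (x, y) * f y))).
  by apply: (eq_integrable _ (fun y => (- (2 * t))%:E * (w (x, y) * f y)%:E)%E) => //; exact: integrableZl.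
have i2 : pi.-integrable setT (EFin \o (fun y => t ^+ 2 * w (x, y))).
  by apply: (eq_integrable _ (fun y => (t ^+ 2)%:E * (w (x, y))%:E)%E) => //; exact: integrableZl.
rewrite RintegralD//; last by apply: (eq_integrable _ (fun y => (w (x, y) * f y ^+ 2)%:E + (- (2 * t) * (w (x, y) * f y))%:E)%E) => //; exact: integrableD.
rewrite RintegralD// !RintegralZl// tw -/(weight x) => h.
have {}h : 0 <= \int[pi]_y (w (x, y) * f y ^+ 2) + - (2 * t) * (t * weight x) + t ^+ 2 * weight x.
  by apply: h => // y _; rewrite mulr_ge0// sqr_ge0.
have -> : (\int[pi]_y (w (x, y) * f y ^+ 2)%:E = (\int[pi]_y (w (x, y) * f y ^+ 2))%:E)%E.
  by rewrite /Rintegral fineK//; exact: integrable_fin_num Si.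
by rewrite lee_fin; move: h; lra.
Qed.

Lemma average_L2 (f : T -> R) : f \in Lfun nu 2%:E -> average f \in Lfun nu 2%:E.
Proof.
move=> fL; pose g : V := to_V fL; rewrite -[f]/(g : T -> R); move: g => {}g {fL f}.
have mA := measurable_average g.
have mA2 : measurable_fun setT (fun x => (average g x ^+ 2)%:E).
  by apply/measurable_EFinP; exact: measurable_funX.
apply/Lfun2P; split => //.
rewrite nuE//; last by move=> x; rewrite lee_fin sqr_ge0.
have mw2 : measurable_fun setT (fun z : T * T => (w z * g z.2 ^+ 2)%:E).
  by apply/measurable_EFinP; apply: measurable_funM => //; apply: measurable_funX; exact: measurable_V2.
have w20 z : (0 <= (w z * g z.2 ^+ 2)%:E)%E by rewrite lee_fin mulr_ge0// sqr_ge0.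
apply: (@le_lt_trans _ _ (kap%:E * \int[PP]_z (w z * g z.2 ^+ 2)%:E)%E); last first.
  by rewrite square_integral2 -EFinM ltry.
rewrite lee_wpmul2l ?lee_fin ?(ltW kap0)// fubini_tonelli1//.
apply: ae_ge0_le_integral => //.
- by move=> x _; rewrite -EFinM lee_fin mulr_ge0 ?sqr_ge0// ltW.
- by apply: emeasurable_funM => //; apply/measurable_EFinP; exact: measurable_weight.
- by move=> x _; apply: integral_ge0 => y _; exact: w20.
- exact: (measurable_fun_fubini_tonelli_F (fun z : T * T => (w z * g z.2 ^+ 2)%:E)).
by apply: filterS (ae_row_integrable g) => x hx _; rewrite -EFinM; exact: average_sqr.
Qed.

Lemma nuE_signed (F : T -> R) : nu.-integrable setT (EFin \o F) ->
  (\int[nu]_x (F x)%:E = kap%:E * \int[pi]_x (F x * weight x)%:E)%E.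
Proof.
move=> Fi; have mF : measurable_fun setT (EFin \o F) by exact: measurable_int Fi.
have mp : measurable_fun setT (EFin \o F)^\+%E by exact: measurable_funepos.
have mn : measurable_fun setT (EFin \o F)^\-%E by exact: measurable_funeneg.
have wge x : 0 <= weight x by exact: ltW.
have e1 : (\int[pi]_x (EFin \o (fun x => (F x * weight x)%R))^\+ x = (kap^-1)%:E * \int[nu]_x (EFin \o F)^\+ x)%E.
  rewrite -pi_weight_nu//; apply: eq_integral => x _.
  by rewrite !funeposE /= -!EFin_max -EFinM maxr_pMl// mul0r.
have e2 : (\int[pi]_x (EFin \o (fun x => (F x * weight x)%R))^\- x = (kap^-1)%:E * \int[nu]_x (EFin \o F)^\- x)%E.
  rewrite -pi_weight_nu//; apply: eq_integral => x _.
  by rewrite !funenegE /= -?EFinN -!EFin_max -EFinM maxr_pMl// mul0r mulNr.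
rewrite [LHS]integralE [X in (_ = _ * X)%E]integralE e1 e2.
rewrite -(fineK (integrable_pos_fin_num measurableT Fi)) -(fineK (integrable_neg_fin_num measurableT Fi)).
move: (fine _) (fine _) => b a.
rewrite -[RHS]/((kap * (kap^-1 * a - kap^-1 * b))%:E) -[LHS]/((a - b)%:E).
by congr EFin; field; rewrite gt_eqF.
Qed.

Definition average_V (f : V) : V := to_V (average_L2 (V_Lfun f)).

Lemma average_cross (f g : V) : ip (average_V f) g = kap * cross f g.
Proof.
apply: EFin_inj; rewrite /ipL /Rintegral fineK; last exact: integrable_fin_num (ipL_integrable _ _).
rewrite (nuE_signed (ipL_integrable (average_V f) g)) EFinM -crossE.
rewrite -integral12_prod_meas1; last exact: cross_integrable.
congr (_ * _)%E; apply: ae_eq_integral => //.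
- apply/measurable_EFinP; apply: measurable_funM; last exact: measurable_weight.
  by apply: measurable_funM; exact: V_measurable.
- exact: measurable_fubini_F (cross_integrable f g).
apply: filterS (ae_row_integrable f) => x hx _.
rewrite /fubini_F (eq_integral (fun y => (g x)%:E * (w (x, y) * f y)%:E)%E); last first.
  by move=> y _; rewrite -EFinM /= mulrC.
rewrite integralZl//=; have -> : (average_V f x * g x * weight x)%:E = (average f x * g x * weight x)%:E by [].
rewrite /average.
have -> : (\int[pi]_y (w (x, y) * f y)%:E = (\int[pi]_y (w (x, y) * f y))%:E)%E.
  by rewrite /Rintegral fineK//; exact: integrable_fin_num hx.
rewrite -EFinM; congr EFin.
have w0 : weight x != 0 by rewrite gt_eqF.
by field.
Qed.

Lemma average_sym (f g : V) : ip (average_V f) g = ip f (average_V g).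
Proof. by rewrite (ipC H f) !average_cross cross_sym. Qed.

(* [eps] is 1 or -1: the forms of 1 - T and 1 + T *)
Lemma dirichlet_form (eps : R) (f : V) : eps ^+ 2 = 1 ->
  (\int[PP]_z (w z * (f z.1 - eps * f z.2) ^+ 2)%:E =
   (2 * kap^-1 * (ip f f - eps * ip (average_V f) f))%:E)%E.
Proof.
move=> e1; pose F1 (z : T * T) := w z * f z.1 ^+ 2; pose F2 (z : T * T) := w z * f z.2 ^+ 2.
pose F3 (z : T * T) := w z * f z.2 * f z.1.
have sqi (F : T * T -> R) : (forall z, 0 <= F z) -> measurable_fun setT F ->
    (\int[PP]_z (F z)%:E < +oo)%E -> PP.-integrable setT (EFin \o F).
  move=> F0 mF Foo; apply/integrableP; split; first exact/measurable_EFinP.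
  by rewrite (eq_integral (EFin \o F))// => z _; rewrite /= ger0_norm.
have i1 : PP.-integrable setT (EFin \o F1).
  apply: sqi => [z||]; [by rewrite mulr_ge0// sqr_ge0| |by rewrite square_integral1 ltry].
  by apply: measurable_funM => //; apply: measurable_funX; exact: measurable_V1.
have i2 : PP.-integrable setT (EFin \o F2).
  apply: sqi => [z||]; [by rewrite mulr_ge0// sqr_ge0| |by rewrite square_integral2 ltry].
  by apply: measurable_funM => //; apply: measurable_funX; exact: measurable_V2.
have i3 := cross_integrable f f.
rewrite (eq_integral (fun z => ((F1 z)%:E + (F2 z)%:E) + (- (2 * eps))%:E * (F3 z)%:E)%E); last first.
  move=> z _; rewrite -!EFinM -!EFinD; congr EFin; rewrite /F1 /F2 /F3.
  transitivity (w z * f z.1 ^+ 2 + eps ^+ 2 * (w z * f z.2 ^+ 2) - 2 * eps * (w z * f z.2 * f z.1)); first by ring.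
  by rewrite e1; ring.
rewrite integralD//; [|exact: integrableD|exact: integrableZl].
rewrite integralD// integralZl// square_integral1 square_integral2 crossE average_cross -!EFinM -!EFinD.
by congr EFin; field; rewrite gt_eqF.
Qed.

Lemma form_ge0 (eps : R) (f : V) : eps ^+ 2 = 1 -> 0 <= ip f f - eps * ip (average_V f) f.
Proof.
move=> e1; have : (0 <= \int[PP]_z (w z * (f z.1 - eps * f z.2) ^+ 2)%:E)%E.
  by apply: integral_ge0 => z _; rewrite lee_fin mulr_ge0// sqr_ge0.
by rewrite dirichlet_form// lee_fin pmulr_rge0// mulr_gt0// invr_gt0.
Qed.

Lemma average_le (f : V) : ip (average_V f) f <= ip f f.
Proof. by have := @form_ge0 1 f (expr1n _ _); rewrite mul1r subr_ge0. Qed.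

Lemma average_bounded (f : V) : ip (average_V f) (average_V f) <= ip f f.
Proof.
have hm (u : V) : - ip u u <= ip (average_V u) u.
  have e1 : (-1 : R) ^+ 2 = 1 by rewrite sqrrN expr1n.
  by have := @form_ge0 (-1) u e1; rewrite mulN1r opprK => h; rewrite -subr_ge0 opprK addrC.
exact: (symmetric_norm_bound H average_sym average_le hm).
Qed.

Lemma average_one (x : T) : average one_V x = 1.
Proof.
rewrite /average (_ : \int[pi]_y _ = weight x) ?mulVf ?gt_eqF//.
by apply: eq_Rintegral => y _; rewrite -[one_V y]/(1 : R) mulr1.
Qed.

Definition mass (G : set T) (f : V) : R := \int[nu]_x (\1_G x * f x ^+ 2).

Lemma measurable_indic_sqr (G : set T) (f : V) : measurable G ->
  measurable_fun setT (fun x => (\1_G x * f x ^+ 2)%:E).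
Proof.
move=> mG; apply/measurable_EFinP; apply: measurable_funM; first exact: measurable_indic.
by apply: measurable_funX; exact: V_measurable.
Qed.

Lemma indic_le1 (G : set T) x : 0 <= (\1_G x : R) <= 1.
Proof. by rewrite indicE; case: (_ \in _); rewrite ?lexx ler01. Qed.

Lemma massE (G : set T) (f : V) : measurable G ->
  (\int[nu]_x (\1_G x * f x ^+ 2)%:E = (mass G f)%:E)%E.
Proof.
move=> mG; rewrite /mass /Rintegral fineK// ge0_fin_numE; last first.
  by apply: integral_ge0 => x _; rewrite lee_fin mulr_ge0 ?sqr_ge0//; case/andP: (indic_le1 G x).
apply: (@le_lt_trans _ _ (\int[nu]_x (f x ^+ 2)%:E)%E); last by rewrite -ipL_sqrE ltry.
apply: ge0_le_integral => //.
- by move=> x _; rewrite lee_fin mulr_ge0 ?sqr_ge0//; case/andP: (indic_le1 G x).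
- exact: measurable_indic_sqr.
- exact: measurable_sqr.
by move=> x _; rewrite lee_fin ler_piMl ?sqr_ge0//; case/andP: (indic_le1 G x).
Qed.

(** The weighted inequality 2 eps f(x) f(y) <= f(x)^2 W(y)/W(x) + f(y)^2 W(x)/W(y), integrated
    against [w]. By symmetry both right-hand terms have the same integral, bounded by the drift
    condition; the sign of [eps] is irrelevant to the inequality. *)
Lemma form_lyapunov (W : T -> R) (G : set T) (v0 v1 eps : R) (f : V) : eps ^+ 2 = 1 ->
  measurable_fun setT W -> (forall x, 0 < W x) -> measurable G -> 0 <= v0 -> v0 <= 1 -> 0 <= v1 ->
  (forall x, (\int[pi]_y (w (x, y) * (W y / W x))%:E <=
     ((1 - v0 + (v0 + v1) * \1_G x) * weight x)%:E)%E) ->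
  v0 * ip f f <= ip f f - eps * ip (average_V f) f + (v0 + v1) * mass G f.
Proof.
move=> e1 mW W0 mG v00 v01 v10 hr.
have mWi : measurable_fun setT (fun x => (W x)^-1).
  rewrite (_ : (fun _ => _) = (@powR R ^~ (-1)) \o W).
    by apply: measurableT_comp; [exact: measurable_powR|exact: mW].
  by apply/funext => x /=; rewrite powR_inv1// ltW.
pose A1 z : R := w z * (f z.1 ^+ 2 * (W z.2 / W z.1)).
pose A2 z : R := w z * (f z.2 ^+ 2 * (W z.1 / W z.2)).
have mA1 : measurable_fun setT A1.
  apply: measurable_funM => //; apply: measurable_funM; first by apply: measurable_funX; exact: measurable_V1.
  by apply: measurable_funM; [exact: (measurableT_comp mW)|exact: (measurableT_comp mWi)].
have mA2 : measurable_fun setT A2.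
  apply: measurable_funM => //; apply: measurable_funM; first by apply: measurable_funX; exact: measurable_V2.
  by apply: measurable_funM; [exact: (measurableT_comp mW)|exact: (measurableT_comp mWi)].
have A10 z : 0 <= A1 z by rewrite mulr_ge0// mulr_ge0 ?sqr_ge0// divr_ge0// ltW.
have A20 z : 0 <= A2 z by rewrite mulr_ge0// mulr_ge0 ?sqr_ge0// divr_ge0// ltW.
have coef x : 0 <= 1 - v0 + (v0 + v1) * \1_G x.
  by have /andP[i0 _] := indic_le1 G x; rewrite addr_ge0 ?subr_ge0// mulr_ge0// addr_ge0.
have wge x : 0 <= weight x by exact: ltW.
pose S := kap^-1 * ((1 - v0) * ip f f + (v0 + v1) * mass G f).
have bound : (\int[pi]_x ((f x ^+ 2 * (1 - v0 + (v0 + v1) * \1_G x))%:E * (weight x)%:E) = S%:E)%E.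
  have mI : measurable_fun setT (\1_G : T -> R) by exact: measurable_indic.
  rewrite pi_weight_nu; last 2 first.
  - apply/measurable_EFinP; apply: measurable_funM; first by apply: measurable_funX; exact: V_measurable.
    by apply: measurable_funD => //; apply: measurable_funM.
  - by move=> x; rewrite lee_fin mulr_ge0// sqr_ge0.
  rewrite (eq_integral (fun x => (1 - v0)%:E * (f x ^+ 2)%:E + (v0 + v1)%:E * (\1_G x * f x ^+ 2)%:E)%E); last first.
    by move=> x _; rewrite -!EFinM -EFinD; congr EFin; ring.
  have s0 : 0 <= v0 + v1 by exact: addr_ge0.
  have t0 : 0 <= 1 - v0 by rewrite subr_ge0.
  have i0 x : 0 <= \1_G x * f x ^+ 2 by rewrite mulr_ge0 ?sqr_ge0//; case/andP: (indic_le1 G x).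
  rewrite ge0_integralD//; last 4 first.
  - by move=> x _; rewrite -EFinM lee_fin mulr_ge0// sqr_ge0.
  - by apply: emeasurable_funM => //; exact: measurable_sqr.
  - by move=> x _; rewrite -EFinM lee_fin mulr_ge0.
  - by apply: emeasurable_funM => //; exact: measurable_indic_sqr.
  rewrite ge0_integralZl_EFin//; [|by move=> x _; rewrite lee_fin sqr_ge0|exact: measurable_sqr].
  rewrite ge0_integralZl_EFin//; [|by move=> x _; rewrite lee_fin|exact: measurable_indic_sqr].
  by rewrite massE// -ipL_sqrE.
have I1 : (\int[PP]_z (A1 z)%:E <= S%:E)%E.
  rewrite -bound fubini_tonelli1; [|exact/measurable_EFinP|by move=> z; rewrite lee_fin].
  apply: ge0_le_integral => //.
  - by move=> x _; apply: integral_ge0 => y _; rewrite lee_fin.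
  - by apply: measurable_fun_fubini_tonelli_F => [|z]; [exact/measurable_EFinP|rewrite lee_fin].
  - apply: emeasurable_funM; last by apply/measurable_EFinP; exact: measurable_weight.
    apply/measurable_EFinP; apply: measurable_funM; first by apply: measurable_funX; exact: V_measurable.
    by apply: measurable_funD => //; apply: measurable_funM => //; exact: measurable_indic.
  move=> x _; rewrite /fubini_F (eq_integral (fun y => (f x ^+ 2)%:E * (w (x, y) * (W y / W x))%:E)%E); last first.
    by move=> y _; rewrite /A1 /= -EFinM; congr EFin; ring.
  rewrite ge0_integralZl_EFin ?sqr_ge0//.
  - have -> : ((f x ^+ 2 * (1 - v0 + (v0 + v1) * \1_G x))%:E * (weight x)%:E =
        (f x ^+ 2)%:E * ((1 - v0 + (v0 + v1) * \1_G x) * weight x)%:E)%E by rewrite -!EFinM mulrA.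
    by rewrite lee_wpmul2l ?lee_fin ?sqr_ge0//; exact: hr.
  - by move=> y _; rewrite lee_fin mulr_ge0// divr_ge0// ltW.
  - apply/measurable_EFinP; apply: measurable_funM; first exact: measurable_row.
    by apply: measurable_funM.
have I2 : (\int[PP]_z (A2 z)%:E <= S%:E)%E.
  rewrite fubini_tonelli2; [|exact/measurable_EFinP|by move=> z; rewrite lee_fin].
  move: I1; rewrite fubini_tonelli1; [|exact/measurable_EFinP|by move=> z; rewrite lee_fin].
  by rewrite /fubini_F /fubini_G; under eq_integral do under eq_integral do rewrite /A1 /= wsym.
have E0 := dirichlet_form f e1.
have P1 := square_integral1 f; have P2 := square_integral2 f.
have : (\int[PP]_z ((w z * f z.1 ^+ 2)%:E + (w z * f z.2 ^+ 2)%:E) <=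
  \int[PP]_z ((w z * (f z.1 - eps * f z.2) ^+ 2)%:E + ((A1 z)%:E + (A2 z)%:E)))%E.
  apply: ge0_le_integral => //.
  - by move=> z _; rewrite -EFinD lee_fin addr_ge0// mulr_ge0// sqr_ge0.
  - apply: emeasurable_funD; apply/measurable_EFinP; apply: measurable_funM => //; apply: measurable_funX.
      exact: measurable_V1.
    exact: measurable_V2.
  - apply: emeasurable_funD; last by apply: emeasurable_funD; exact/measurable_EFinP.
    apply/measurable_EFinP; apply: measurable_funM => //; apply: measurable_funX; apply: measurable_funB.
      exact: measurable_V1.
    by apply: measurable_funM => //; exact: measurable_V2.
  move=> z _; rewrite -!EFinD lee_fin /A1 /A2 -!mulrDr ler_wpM2l//.
  have := W0 z.1; have := W0 z.2; move: (f z.1) (f z.2) (W z.1) (W z.2) => a b p q q0 p0.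
  (* The completed square behind the weighted inequality, with p = W(x) and q = W(y). *)
  have : 0 <= (a * q - eps * b * p) ^+ 2 / (p * q) by rewrite divr_ge0 ?sqr_ge0// mulr_ge0// ltW.
  have -> : (a * q - eps * b * p) ^+ 2 / (p * q) = a ^+ 2 * (q / p) - 2 * eps * a * b + eps ^+ 2 * (b ^+ 2 * (p / q)).
    by field; rewrite !gt_eqF.
  have -> : (a - eps * b) ^+ 2 = a ^+ 2 - 2 * eps * a * b + eps ^+ 2 * b ^+ 2 by ring.
  by rewrite e1; lra.
rewrite ge0_integralD//; last 4 first.
- by move=> z _; rewrite lee_fin mulr_ge0// sqr_ge0.
- by apply/measurable_EFinP; apply: measurable_funM => //; apply: measurable_funX; exact: measurable_V1.
- by move=> z _; rewrite lee_fin mulr_ge0// sqr_ge0.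
- by apply/measurable_EFinP; apply: measurable_funM => //; apply: measurable_funX; exact: measurable_V2.
rewrite ge0_integralD//; last 4 first.
- by move=> z _; rewrite lee_fin mulr_ge0// sqr_ge0.
- apply/measurable_EFinP; apply: measurable_funM => //; apply: measurable_funX; apply: measurable_funB.
    exact: measurable_V1.
  by apply: measurable_funM => //; exact: measurable_V2.
- by move=> z _; rewrite -EFinD lee_fin addr_ge0.
- by apply: emeasurable_funD; exact/measurable_EFinP.
rewrite ge0_integralD//; [|by move=> z _; rewrite lee_fin|exact/measurable_EFinP|by move=> z _; rewrite lee_fin|exact/measurable_EFinP].
rewrite P1 P2 E0 => le1.
have {le1} : ((kap^-1 * ip f f)%:E + (kap^-1 * ip f f)%:E <=
   (2 * kap^-1 * (ip f f - eps * ip (average_V f) f))%:E + (S%:E + S%:E))%E.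
  by apply: le_trans le1 _; apply: leeD2l; exact: leeD.
rewrite -!EFinD lee_fin /S; move: (ip f f) (ip (average_V f) f) (mass G f) => X Y Z.
have k0 : 0 < kap^-1 by rewrite invr_gt0.
have -> : kap^-1 * X + kap^-1 * X = 2 * kap^-1 * X by ring.
have -> : 2 * kap^-1 * (X - eps * Y) + (kap^-1 * ((1 - v0) * X + (v0 + v1) * Z) +
   kap^-1 * ((1 - v0) * X + (v0 + v1) * Z)) = 2 * kap^-1 * (X - eps * Y + (1 - v0) * X + (v0 + v1) * Z) by ring.
by rewrite ler_pM2l ?mulr_gt0//; lra.
Qed.

(** * On one set: mass controlled by the form and the mean *)

Section boxes.
Variable (B : set T).
Hypotheses (mB : measurable B) (b0 : R) (b00 : 0 < b0) (wB : forall x, B x -> b0 <= weight x).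

Local Notation p := (fine (pi B)).

Lemma indic_integrable : pi.-integrable setT (EFin \o (\1_B : T -> R)).
Proof. exact: integrable_indic. Qed.

Lemma box_sqr_integrable (f : V) : pi.-integrable setT (EFin \o (fun x => \1_B x * f x ^+ 2)).
Proof.
apply/integrableP; split; first exact: measurable_indic_sqr.
have i0 x : 0 <= \1_B x * f x ^+ 2 by rewrite mulr_ge0 ?sqr_ge0//; case/andP: (indic_le1 B x).
rewrite (eq_integral (fun x => (\1_B x * f x ^+ 2)%:E)); last by move=> x _; rewrite /= ger0_norm.
apply: (@le_lt_trans _ _ (\int[pi]_x ((b0^-1 * f x ^+ 2)%:E * (weight x)%:E))%E).
  apply: ge0_le_integral => //.
  - by move=> x _; rewrite lee_fin.
  - exact: measurable_indic_sqr.
  - apply: emeasurable_funM; last by apply/measurable_EFinP; exact: measurable_weight.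
    by apply/measurable_EFinP; apply: measurable_funM => //; apply: measurable_funX; exact: V_measurable.
  move=> x _; rewrite -EFinM lee_fin indicE.
  case: (boolP (x \in B)) => xB /=; last first.
    by rewrite mulr0n mul0r; apply: mulr_ge0; [apply: mulr_ge0; [rewrite invr_ge0 ltW|exact: sqr_ge0]|exact: ltW].
  rewrite mulr1n mul1r mulrAC; apply: ler_peMl; first exact: sqr_ge0.
  by rewrite mulrC ler_pdivlMr// mul1r; apply: wB; rewrite inE in xB.
rewrite pi_weight_nu; last 2 first.
- by apply/measurable_EFinP; apply: measurable_funM => //; apply: measurable_funX; exact: V_measurable.
- by move=> x; rewrite lee_fin mulr_ge0 ?sqr_ge0// invr_ge0 ltW.
rewrite (eq_integral (fun x => (b0^-1)%:E * (f x ^+ 2)%:E)%E)//.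
rewrite ge0_integralZl_EFin//; last 3 first.
- by move=> x _; rewrite lee_fin sqr_ge0.
- exact: measurable_sqr.
- by rewrite invr_ge0 ltW.
by rewrite -ipL_sqrE -!EFinM ltry.
Qed.

Lemma box_integrable (f : V) : pi.-integrable setT (EFin \o (fun x => \1_B x * f x)).
Proof.
have mf := V_measurable f; have mI : measurable_fun setT (\1_B : T -> R) by exact: measurable_indic.
apply: (le_integrable measurableT _ _ (integrableD measurableT indic_integrable (box_sqr_integrable f))).
  by apply/measurable_EFinP; exact: measurable_funM.
move=> x _; rewrite /= lee_fin.
have /andP[i0 i1] := indic_le1 B x.
rewrite [X in _ <= X]ger0_norm; last by rewrite addr_ge0// mulr_ge0// sqr_ge0.
rewrite normrM ger0_norm// -[X in X + _]mulr1 -mulrDr ler_wpM2l// -(real_normK (num_real (f x))).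
by have := sqr_ge0 (`|f x| - 1); have := sqr_ge0 `|f x|; nra.
Qed.

Definition box_mean (f : V) : R := \int[pi]_x (\1_B x * f x).
Definition box_sqr (f : V) : R := \int[pi]_x (\1_B x * f x ^+ 2).

Lemma box_linear (f : V) (a b c : R) :
  (\int[pi]_x (a * \1_B x + b * (\1_B x * f x) + c * (\1_B x * f x ^+ 2))%:E =
   (a * p + b * box_mean f + c * box_sqr f)%:E)%E.
Proof.
have Z (k : R) (F : T -> R) : pi.-integrable setT (EFin \o F) ->
    pi.-integrable setT (EFin \o (fun x => k * F x)).
  move=> Fi; apply: (eq_integrable measurableT (fun x => k%:E * (F x)%:E)%E); first by move=> x _ /=; rewrite EFinM.
  exact: integrableZl.
have ZE (k : R) (F : T -> R) : pi.-integrable setT (EFin \o F) ->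
    (\int[pi]_x (k * F x)%:E = (k * \int[pi]_x F x)%:E)%E.
  move=> Fi; rewrite (eq_integral (fun x => k%:E * (F x)%:E)%E)//.
  rewrite integralZl// EFinM; congr (_ * _)%E.
  by rewrite /Rintegral fineK//; exact: integrable_fin_num Fi.
have i0 := indic_integrable; have i1 := box_integrable f; have i2 := box_sqr_integrable f.
rewrite (eq_integral (fun x => ((a * \1_B x)%:E + (b * (\1_B x * f x))%:E) + (c * (\1_B x * f x ^+ 2))%:E)%E)//.
rewrite integralD//; [|by apply: integrableD => //; exact: Z|exact: Z].
rewrite integralD//; [|exact: Z|exact: Z].
rewrite !ZE// -!EFinD; congr (_ * _ + _ + _)%:E.
by rewrite /Rintegral integral_indic// setIT.
Qed.

Lemma box_form (eps : R) (f : V) : eps ^+ 2 = 1 ->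
  (\int[PP]_z (\1_B z.1 * \1_B z.2 * (f z.1 - eps * f z.2) ^+ 2)%:E =
   (2 * (p * box_sqr f) - 2 * eps * box_mean f ^+ 2)%:E)%E.
Proof.
move=> e1; have mI : measurable_fun setT (\1_B : T -> R) by exact: measurable_indic.
rewrite fubini_tonelli1; last 2 first.
- apply/measurable_EFinP; apply: measurable_funM.
    by apply: measurable_funM; exact: (measurableT_comp mI).
  apply: measurable_funX; apply: measurable_funB; first exact: measurable_V1.
  by apply: measurable_funM => //; exact: measurable_V2.
- by move=> z; rewrite lee_fin mulr_ge0 ?sqr_ge0// mulr_ge0.
rewrite (eq_integral (fun x => (box_sqr f * \1_B x + (- 2 * eps * box_mean f) * (\1_B x * f x) + p * (\1_B x * f x ^+ 2))%:E)).
  by rewrite box_linear; congr EFin; ring.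
move=> x _; rewrite /fubini_F.
rewrite (eq_integral (fun y => (\1_B x * f x ^+ 2 * \1_B y + (- 2 * eps * (\1_B x * f x)) * (\1_B y * f y) + \1_B x * (\1_B y * f y ^+ 2))%:E)).
  by rewrite box_linear; congr EFin; ring.
move=> y _ /=; congr EFin.
transitivity (\1_B x * f x ^+ 2 * \1_B y + -2 * eps * (\1_B x * f x) * (\1_B y * f y) +
   eps ^+ 2 * (\1_B x * (\1_B y * f y ^+ 2))); first by ring.
by rewrite e1 mul1r.
Qed.

(** The density of [pi] with respect to [nu], cut off to [B]: paired in L2(nu), it represents the
    mean over [B]. The lower bound [b0] on the weight makes it bounded. *)
Lemma box_test_L2 : (fun x => \1_B x / (kap * weight x)) \in Lfun nu 2%:E.
Proof.
have mWi : measurable_fun setT (fun x => (weight x)^-1).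
  rewrite (_ : (fun _ => _) = (@powR R ^~ (-1)) \o weight).
    by apply: measurableT_comp; [exact: measurable_powR|exact: measurable_weight].
  by apply/funext => x /=; rewrite powR_inv1// ltW.
have mI : measurable_fun setT (\1_B : T -> R) by exact: measurable_indic.
have mF : measurable_fun setT (fun x => \1_B x / (kap * weight x)).
  rewrite (_ : (fun _ => _) = (fun x => kap^-1 * (\1_B x * (weight x)^-1))).
    by apply: measurable_funM => //; exact: measurable_funM.
  by apply/funext => x; rewrite invfM; ring.
apply/Lfun2P; split => //.
apply: (@le_lt_trans _ _ (\int[nu]_x ((1 / (kap * b0)) ^+ 2)%:E)%E); last by rewrite integral_prob_cst ltry.
apply: ge0_le_integral => //.
- by move=> x _; rewrite lee_fin sqr_ge0.
- by apply/measurable_EFinP; exact: measurable_funX.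
move=> x _; rewrite lee_fin indicE.
have kb : 0 < kap * b0 by exact: mulr_gt0.
case: (boolP (x \in B)) => xB /=; last by rewrite mulr0n mul0r expr0n sqr_ge0.
rewrite mulr1n; apply: lerXn2r; rewrite ?nnegrE ?divr_ge0 ?(ltW kb)//; first by rewrite mulr_ge0// ltW.
rewrite ler_pM2l// lef_pV2 ?posrE ?mulr_gt0//.
by rewrite ler_pM2l//; apply: wB; rewrite inE in xB.
Qed.

Definition box_test : V := to_V box_test_L2.

Lemma box_meanE (f : V) : box_mean f = ip f box_test.
Proof.
have e : ((ip f box_test)%:E = \int[nu]_x (f x * box_test x)%:E)%E.
  by rewrite /ipL /Rintegral fineK//; exact: integrable_fin_num (ipL_integrable _ _).
apply: EFin_inj; rewrite e (nuE_signed (ipL_integrable f box_test)).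
have i1 := box_integrable f.
have -> : ((box_mean f)%:E = \int[pi]_x (\1_B x * f x)%:E)%E.
  by rewrite /box_mean /Rintegral fineK//; exact: integrable_fin_num i1.
rewrite [in RHS](eq_integral (fun x => (kap^-1)%:E * (\1_B x * f x)%:E)%E); last first.
  move=> x _; have -> : (f x * box_test x * weight x)%:E = (f x * (\1_B x / (kap * weight x)) * weight x)%:E by [].
  rewrite -EFinM; congr EFin; have w0 : weight x != 0 by rewrite gt_eqF.
  by field; rewrite w0 gt_eqF.
by rewrite integralZl// muleA -EFinM mulfV ?gt_eqF// mul1e.
Qed.

(** [mass] refers to [nu] and [box_sqr] to [pi]; the density of [nu] is kap times the weight, which
    on [B] is at most p/beta. *)
Lemma box_mass (beta : R) (f : V) : (forall x, B x -> beta * weight x <= p) -> 0 <= beta ->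
  beta * (kap^-1 * mass B f) <= p * box_sqr f.
Proof.
move=> hb be0; rewrite -lee_fin EFinM [((kap^-1 * _)%:E)%E]EFinM -massE//.
have i0 x : 0 <= \1_B x * f x ^+ 2 by rewrite mulr_ge0 ?sqr_ge0//; case/andP: (indic_le1 B x).
rewrite -pi_weight_nu; [|exact: measurable_indic_sqr|by move=> x; rewrite lee_fin].
have p0 : 0 <= p by exact: fine_ge0.
rewrite -ge0_integralZl_EFin//; last 2 first.
- by move=> x _; rewrite mule_ge0 ?lee_fin// ltW.
- apply: emeasurable_funM; first exact: measurable_indic_sqr.
  by apply/measurable_EFinP; exact: measurable_weight.
rewrite EFinM.
have -> : ((box_sqr f)%:E = \int[pi]_x (\1_B x * f x ^+ 2)%:E)%E.
  by rewrite /box_sqr /Rintegral fineK//; exact: integrable_fin_num (box_sqr_integrable f).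
rewrite -ge0_integralZl_EFin//; [|by move=> x _; rewrite lee_fin|exact: measurable_indic_sqr].
apply: ge0_le_integral => //.
- by move=> x _; rewrite !mule_ge0 ?lee_fin// ltW.
- apply: emeasurable_funM => //; apply: emeasurable_funM; first exact: measurable_indic_sqr.
  by apply/measurable_EFinP; exact: measurable_weight.
- by apply: emeasurable_funM => //; exact: measurable_indic_sqr.
move=> x _; rewrite -!EFinM lee_fin mulrCA mulrC ; have [xB|xB] := pselect (B x); last first.
  by rewrite indicE memNset// !(mul0r, mulr0).
by apply: ler_wpM2r => //; exact: hb.
Qed.

Lemma box_lower (eps tau beta : R) (f : V) : eps ^+ 2 = 1 -> 0 <= tau -> 0 <= beta ->
  (forall x, B x -> beta * weight x <= p) ->
  (tau%:E * \int[PP]_z (\1_B z.1 * \1_B z.2 * (f z.1 - eps * f z.2) ^+ 2)%:E <=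
     \int[PP]_z (w z * (\1_B z.1 * \1_B z.2 * (f z.1 - eps * f z.2) ^+ 2))%:E)%E ->
  ((2 * (tau * (beta * (kap^-1 * mass B f))) - 2 * eps * tau * ip f box_test ^+ 2)%:E <=
     \int[PP]_z (w z * (\1_B z.1 * \1_B z.2 * (f z.1 - eps * f z.2) ^+ 2))%:E)%E.
Proof.
move=> e1 t0 be0 hb; apply: le_trans; rewrite box_form// -EFinM lee_fin -box_meanE.
have : tau * (beta * (kap^-1 * mass B f)) <= tau * (p * box_sqr f) by rewrite ler_wpM2l// box_mass.
by move: (tau * (beta * _)) (p * box_sqr f) (box_mean f ^+ 2) => X Y Z; lra.
Qed.

End boxes.

(** The mass on [G] left over by [form_lyapunov] is distributed over the [B i]; on each it is
    controlled by the form up to the square of a mean, and overlaps cost the factor [k]. For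
    [eps = -1] the squared means enter with the favourable sign, so the bound for 1 + T holds
    without functionals. *)
Theorem coercive_boxes (n : nat) (B : 'I_n -> set T) (b0 : 'I_n -> R) (W : T -> R) (G : set T)
    (k tau beta v0 v1 eps : R) :
  eps ^+ 2 = 1 -> (forall i, measurable (B i)) -> (forall i, 0 < b0 i) ->
  (forall i x, B i x -> b0 i <= weight x) ->
  measurable_fun setT W -> (forall x, 0 < W x) -> measurable G -> 0 < v0 -> v0 <= 1 -> 0 <= v1 ->
  (forall x, (\int[pi]_y (w (x, y) * (W y / W x))%:E <=
     ((1 - v0 + (v0 + v1) * \1_G x) * weight x)%:E)%E) ->
  0 < tau -> 0 < beta -> 0 <= k ->
  (forall i x, B i x -> beta * weight x <= fine (pi (B i))) ->
  (forall x, \sum_i \1_(B i) x <= k) -> (forall x, \1_G x <= \sum_i (\1_(B i) x : R)) ->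
  (forall (f : V) i,
     tau%:E * \int[PP]_z (\1_(B i) z.1 * \1_(B i) z.2 * (f z.1 - eps * f z.2) ^+ 2)%:E <=
     \int[PP]_z (w z * (\1_(B i) z.1 * \1_(B i) z.2 * (f z.1 - eps * f z.2) ^+ 2))%:E)%E ->
  exists Bc (l : 'I_n -> V), 0 <= Bc /\ forall f,
    v0 / (1 + (v0 + v1) * k / (tau * beta)) * ip f f <=
    ip f f - eps * ip (average_V f) f + eps * (Bc * \sum_i ip f (l i) ^+ 2).
Proof.
move=> e1 mB b00 wB mW W0 mG v00 v01 v10 hr t0 be0 k0 hb hk hG hP.
have s0 : 0 <= v0 + v1 by rewrite addr_ge0// ltW.
have tb0 : 0 < tau * beta by exact: mulr_gt0.
pose D := 1 + (v0 + v1) * k / (tau * beta).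
have D0 : 0 < D by rewrite /D ltr_pwDl// divr_ge0 ?(ltW tb0)// mulr_ge0.
exists ((v0 + v1) * kap / (beta * D)), (fun i => box_test (mB i) (b00 i) (wB i)).
split; first by rewrite divr_ge0// mulr_ge0// ltW.
move=> f; set S2 := \sum_i _.
have i0 i x : 0 <= (\1_(B i) x : R) by case/andP: (indic_le1 (B i) x).
have ly := form_lyapunov f e1 mW W0 mG (ltW v00) v01 v10 hr.
pose S1 := \sum_i mass (B i) f.
have gS : mass G f <= S1.
  rewrite -lee_fin -massE// -sumEFin; under [leRHS]eq_bigr do rewrite -massE//.
  rewrite -ge0_integral_sum//; last 2 first.
  - by move=> i; exact: measurable_indic_sqr.
  - by move=> i x _; rewrite lee_fin mulr_ge0// sqr_ge0.
  apply: ge0_le_integral => //.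
  - by move=> x _; rewrite lee_fin mulr_ge0 ?sqr_ge0//; case/andP: (indic_le1 G x).
  - exact: measurable_indic_sqr.
  - by apply: emeasurable_sum => i; exact: measurable_indic_sqr.
  - by move=> x _; rewrite sumEFin lee_fin -mulr_suml ler_wpM2r ?sqr_ge0.
have mE i : measurable_fun setT (fun z : T * T => (w z * (\1_(B i) z.1 * \1_(B i) z.2 * (f z.1 - eps * f z.2) ^+ 2))%:E).
  have mI : measurable_fun setT (\1_(B i) : T -> R) by exact: measurable_indic.
  apply/measurable_EFinP; apply: measurable_funM => //; apply: measurable_funM.
    by apply: measurable_funM; exact: (measurableT_comp mI).
  apply: measurable_funX; apply: measurable_funB; first exact: measurable_V1.
  by apply: measurable_funM => //; exact: measurable_V2.
have E0 i z : 0 <= w z * (\1_(B i) z.1 * \1_(B i) z.2 * (f z.1 - eps * f z.2) ^+ 2).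
  by rewrite mulr_ge0// mulr_ge0 ?sqr_ge0// mulr_ge0.
have main : 2 * (tau * (beta * (kap^-1 * S1))) - 2 * eps * tau * S2 <=
    k * (2 * kap^-1 * (ip f f - eps * ip (average_V f) f)).
  rewrite -lee_fin [leRHS]EFinM -dirichlet_form//.
  have -> : ((2 * (tau * (beta * (kap^-1 * S1))) - 2 * eps * tau * S2)%:E =
     \sum_i (2 * (tau * (beta * (kap^-1 * mass (B i) f))) - 2 * eps * tau * ip f (box_test (mB i) (b00 i) (wB i)) ^+ 2)%:E)%E.
    by rewrite sumEFin; congr EFin; rewrite sumrB /S1 /S2 !mulr_sumr.
  apply: (@le_trans _ _ (\sum_i \int[PP]_z (w z * (\1_(B i) z.1 * \1_(B i) z.2 * (f z.1 - eps * f z.2) ^+ 2))%:E)%E).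
    apply: lee_sum => i _; apply: box_lower => //; [exact: ltW|exact: ltW|exact: hb].
  rewrite -ge0_integral_sum//; last by move=> i z _; rewrite lee_fin.
  rewrite -ge0_integralZl_EFin//; last 2 first.
  - by move=> z _; rewrite lee_fin mulr_ge0// sqr_ge0.
  - apply/measurable_EFinP; apply: measurable_funM => //; apply: measurable_funX; apply: measurable_funB.
      exact: measurable_V1.
    by apply: measurable_funM => //; exact: measurable_V2.
  apply: ge0_le_integral => //.
  - by move=> z _; apply: sume_ge0 => i _; rewrite lee_fin.
  - exact: emeasurable_sum.
  - apply: emeasurable_funM => //; apply/measurable_EFinP; apply: measurable_funM => //; apply: measurable_funX; apply: measurable_funB.
      exact: measurable_V1.
    by apply: measurable_funM => //; exact: measurable_V2.
  move=> z _; rewrite sumEFin -EFinM lee_fin -mulr_sumr mulrCA ler_wpM2l// -mulr_suml.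
  rewrite ler_wpM2r ?sqr_ge0//; apply: le_trans (hk z.1); apply: ler_sum => i _.
  by apply: ler_piMr => //; case/andP: (indic_le1 (B i) z.2).
move: (ip f f) (ip (average_V f) f) (mass G f) S1 S2 main ly gS => X Y g S1' S2' main ly gS.
(* The form occurs both in the Lyapunov bound and in the bound for the mass on [G]; collecting its
   coefficients produces the denominator [D]. *)
set F := X - eps * Y in main ly *.
have kS : S1' <= k / (tau * beta) * F + eps * (kap / beta) * S2'.
  have -> : k / (tau * beta) * F + eps * (kap / beta) * S2' =
     kap / (tau * beta) / 2 * (k * (2 * kap^-1 * F) + 2 * eps * tau * S2').
    by field; rewrite !gt_eqF.
  have -> : S1' = kap / (tau * beta) / 2 * (2 * (tau * (beta * (kap^-1 * S1')))) by field; rewrite !gt_eqF.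
  by rewrite ler_wpM2l ?divr_ge0 ?(ltW kap0) ?(ltW tb0)//; move: main; lra.
have : (v0 + v1) * g <= (v0 + v1) * (k / (tau * beta) * F + eps * (kap / beta) * S2').
  by rewrite ler_wpM2l//; exact: le_trans gS kS.
move=> h1; rewrite mulrAC ler_pdivrMr//.
have -> : (F + eps * ((v0 + v1) * kap / (beta * D) * S2')) * D =
    F + (v0 + v1) * (k / (tau * beta) * F + eps * (kap / beta) * S2').
  transitivity (F * D + eps * ((v0 + v1) * kap / beta * S2')).
    by field; rewrite !gt_eqF.
  by rewrite /D; field; rewrite !gt_eqF.
exact: le_trans ly (lerD (lexx _) h1).
Qed.

End reversible.

(** * Gibbs measures *)

Section density_integral.
Import HBNNSimple.
Local Open Scope ereal_scope.
Context d (T : measurableType d) (R : realType) (mu : {measure set T -> \bar R}).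
Variable g : T -> R.
Hypotheses (mf : measurable_fun setT (EFin \o g)) (f0 : forall x, 0 <= (EFin \o g) x).

Let g_ge0 x : 0 <= (g x)%:E. Proof. exact: f0. Qed.

(** For simple functions this is the definition of the density; monotone convergence does the
    rest. *)
Lemma integral_density (F : T -> \bar R) : measurable_fun setT F -> (forall x, 0 <= F x) ->
  \int[density mu mf f0]_x F x = \int[mu]_x (F x * (g x)%:E).
Proof.
move=> mF F0; pose h_ := nnsfun_approx measurableT mF.
transitivity (limn (fun n => \int[density mu mf f0]_x (h_ n x)%:E)).
  rewrite -monotone_convergence//.
  - apply: eq_integral => y _; apply/esym/cvg_lim => //.
    by apply: cvg_nnsfun_approx.
  - by move=> n; exact/measurable_EFinP/measurable_funP.
  - by move=> n y _; rewrite lee_fin.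
  - by move=> y _ m n mn; rewrite lee_fin; exact/lefP/nd_nnsfun_approx.
rewrite [X in limn X](_ : _ = (fun n => \int[mu]_x ((h_ n x)%:E * (g x)%:E))).
  rewrite -monotone_convergence//; last 3 first.
  - by move=> n; apply: emeasurable_funM => //; exact/measurable_EFinP/measurable_funP.
  - by move=> n x _; rewrite mule_ge0// lee_fin.
  - by move=> x _ m n mn; rewrite lee_wpmul2r// lee_fin; exact/lefP/nd_nnsfun_approx.
  apply: eq_integral => x _; apply/cvg_lim => //.
  by apply: cvgeZr => //; apply: cvg_nnsfun_approx.
apply/funext => n; rewrite integralT_nnsfun sintegralE.
transitivity (\int[mu]_x (\sum_(k \in range (h_ n)) ((k * \1_(h_ n @^-1` [set k]) x)%:E * (g x)%:E))).
  rewrite ge0_integral_fsum//; last 2 first.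
  - move=> r; apply: emeasurable_funM => //; apply/measurable_EFinP; apply: measurable_funM => //.
  - by move=> r x _; apply: mule_ge0 => //; rewrite EFinM nnfun_muleindic_ge0.
  apply: eq_fsbigr => r rn.
  have r0 : (0 <= r)%R by move: rn; rewrite inE => -[x _ <-].
  rewrite -[LHS]/(r%:E * \int[mu]_(x in h_ n @^-1` [set r]) (g x)%:E) integral_mkcond.
  rewrite [in RHS](eq_integral (fun x => r%:E * ((\1_(h_ n @^-1` [set r]) x)%:E * (g x)%:E))); last first.
    by move=> x _; rewrite muleA -EFinM.
  rewrite ge0_integralZl_EFin//.
  - congr (_ * _); apply: eq_integral => x _; rewrite patchE indicE.
    by case: ifPn => _; rewrite ?mul1e ?mul0e.
  - by move=> x _; rewrite mule_ge0// lee_fin.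
  - by apply: emeasurable_funM => //; apply/measurable_EFinP.
apply: eq_integral => x _; rewrite -ge0_mule_fsuml.
  by rewrite fsumEFin// -fimfunE.
by move=> r; rewrite EFinM nnfun_muleindic_ge0.
Qed.

Lemma integral_normalized (P : probability T R) (F : T -> \bar R) :
  0 < \int[mu]_x (g x)%:E -> \int[mu]_x (g x)%:E < +oo ->
  measurable_fun setT F -> (forall x, 0 <= F x) ->
  \int[mnormalize (density mu mf f0) P]_x F x =
  (fine (\int[mu]_x (g x)%:E))^-1%:E * \int[mu]_x (F x * (g x)%:E).
Proof.
move=> g0 goo mF F0; set Z := \int[mu]_x (g x)%:E in g0 goo *.
have Z0 : (0 <= (fine Z)^-1)%R by rewrite invr_ge0 fine_ge0// ltW.
rewrite -integral_density// -(ge0_integral_mscale _ measurableT (NngNum Z0))//.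
apply: eq_measure_integral => A mA _.
rewrite -[LHS]/((if (Z == 0) || (Z == +oo) then fun U => P U else
  fun U => density mu mf f0 U * ((fine Z)^-1)%:E) A).
by rewrite gt_eqF//= lt_eqF//= muleC.
Qed.

End density_integral.

(** * Integrability of exponentials of the Euclidean norm *)

Section exponential_integrals.
Context {R : realType} {d : nat}.
Implicit Types (x y : 'rV[R]_d).

Lemma measurable_enorm : measurable_fun setT (@enorm R d).
Proof.
apply: (@measurableT_comp _ _ _ _ _ _ (@Num.sqrt R)).
  by apply: continuous_measurable_fun; exact: sqrt_continuous.
by apply: measurable_sum => i; apply: measurable_funX; exact: measurable_coord.
Qed.

(** A dilation argument without polar coordinates. Since F(2u) = F(u)^2, doubling the radius gives I
    <= 2^d times the integral of F^2 over the same ball, and F <= exp(-a rho) off the ball of radius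
    rho. With 2^d exp(-a rho) <= 1/2 the integral I is absorbed, leaving a bound independent of the
    radius. *)
Lemma integral_expR_enorm (a : R) : 0 < a -> (\int[leb d]_x (expR (- (a * enorm x)))%:E < +oo)%E.
Proof.
move=> a0; pose F x := (expR (- (a * enorm x)))%:E : \bar R.
have mF : measurable_fun setT F.
  apply/measurable_EFinP; apply: measurableT_comp => //; apply: measurableT_comp => //.
  by apply: measurable_funM => //; exact: measurable_enorm.
have F0 x : (0 <= F x)%E by rewrite lee_fin expR_ge0.
pose D (L : R) : set 'rV[R]_d := eball 0 L.
have mD L : measurable (D L) by exact: measurable_eball.
have vol L : 0 < L -> (\int[leb d]_(x in D L) F x < +oo)%E.
  move=> L0; apply: (@le_lt_trans _ _ (\int[leb d]_(x in D L) 1%:E)%E); last first.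
    by rewrite integral_cst// mul1e; exact: le_lt_trans (leb_eball_ub 0 L0) (ltry _).
  apply: ge0_le_integral => //; first exact: measurable_funTS.
  by move=> x _; rewrite lee_fin -expR0 ler_expR oppr_le0 mulr_ge0 ?enorm_ge0// ltW.
have [rho [rho0 hrho]] : exists rho : R, 0 < rho /\ 2 ^+ d * expR (- (a * rho)) <= 1 / 2.
  (* Then exp(a rho) >= 1 + 2 2^d. *)
  exists (2 * 2 ^+ d / a); have p0 : 0 < 2 ^+ d :> R by rewrite exprn_gt0.
  split; first by rewrite divr_gt0// mulr_gt0.
  rewrite mulrCA mulfV ?gt_eqF// mulr1 expRN ler_pdivrMr ?expR_gt0//.
  by have := expR_ge1Dx (2 * 2 ^+ d : R); lra.
have D_rho : (leb d (D rho) < +oo)%E by exact: le_lt_trans (leb_eball_ub 0 rho0) (ltry _).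
pose M : R := 2 * (2 ^+ d * fine (leb d (D rho))).
have step L : 0 < L -> (\int[leb d]_(x in D L) F x <= M%:E)%E.
  move=> L0; set I := (\int[leb d]_(x in D L) F x)%E.
  have Ifin : I \is a fin_num by rewrite ge0_fin_numE ?vol// integral_ge0.
  have L2 : 0 < 2 * L by rewrite mulr_gt0.
  have h1 : (I <= \int[leb d]_(x in D (2 * L)%R) F x)%E.
    apply: ge0_subset_integral => //; first exact: measurable_funTS.
    by move=> x; rewrite /D /eball /= => /lt_trans; apply; rewrite ltr_pMl// ltr1n.
  have h2 : (\int[leb d]_(x in D (2 * L)%R) F x =
      (2 ^+ d)%:E * \int[leb d]_(x in D L) (F x * F x))%E.
    rewrite (@integral_affine R d 0 (fun=> 2) 1%g)//.
    rewrite prodr_const card_ord normr_nat; congr (_ * _)%E.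
    have aE u : affine 0 (fun=> 2) 1%g u = 2 *: u :> 'rV[R]_d.
      by apply/rowP => i; rewrite !mxE perm1 add0r.
    have -> : affine 0 (fun=> 2) 1%g @^-1` D (2 * L)%R = D L.
      apply/seteqP; split=> u; rewrite /D /eball /= aE !sub0r !enormN enormZ ger0_norm// ltr_pM2l//.
    apply: eq_integral => u _; rewrite aE /F enormZ ger0_norm// -EFinM -expRD; congr (expR _)%:E.
    by ring.
  have h3 : (\int[leb d]_(x in D L) (F x * F x) <=
      leb d (D rho) + (expR (- (a * rho)))%:E * I)%E.
    have mi : measurable_fun setT (fun x => (\1_(D rho) x)%:E : \bar R).
      by apply/measurable_EFinP; exact: measurable_indic.
    have -> : (leb d (D rho) = \int[leb d]_x (\1_(D rho) x)%:E)%E by rewrite integral_indic// setIT.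
    apply: (@le_trans _ _ (\int[leb d]_(x in D L) ((\1_(D rho) x)%:E + (expR (- (a * rho)))%:E * F x))%E).
      apply: ge0_le_integral => //.
      - by move=> x _; rewrite mule_ge0.
      - by apply: measurable_funTS; exact: emeasurable_funM.
      - by apply: measurable_funTS; apply: emeasurable_funD => //; exact: emeasurable_funM.
      move=> x _; have [xr|xr] := ltP (enorm x) rho.
        have xD : x \in D rho by rewrite inE /D /eball /= sub0r enormN.
        rewrite indicE xD; apply: (@le_trans _ _ 1%:E); last by rewrite leeDl// mule_ge0// lee_fin expR_ge0.
        by rewrite -EFinM lee_fin -expRD -expR0 ler_expR -opprD oppr_le0 addr_ge0// mulr_ge0 ?enorm_ge0// ltW.
      apply: (@le_trans _ _ ((expR (- (a * rho)))%:E * F x)%E); last by rewrite leeDr// lee_fin.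
      by rewrite lee_wpmul2r// lee_fin ler_expR lerN2 ler_pM2l.
    rewrite ge0_integralD//; last 3 first.
    - exact: measurable_funTS.
    - by move=> x _; rewrite mule_ge0// lee_fin expR_ge0.
    - by apply: measurable_funTS; exact: emeasurable_funM.
    rewrite ge0_integralZl_EFin ?expR_ge0//; last exact: measurable_funTS.
    by apply: leeD => //; apply: ge0_subset_integral.
  have : (I <= (2 ^+ d)%:E * (leb d (D rho) + (expR (- (a * rho)))%:E * I))%E.
    by apply: le_trans h1 _; rewrite h2 lee_wpmul2l// lee_fin exprn_ge0.
  rewrite -[I]fineK// -[leb d (D rho)]fineK; last by rewrite ge0_fin_numE.
  have I0 : 0 <= fine I by rewrite fine_ge0// integral_ge0.
  move=> h4; rewrite lee_fin /M; move: h4 I0; move: (fine I) (fine (leb d (D rho))) => i v h4 I0.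
  have {}h4 : i <= 2 ^+ d * (v + expR (- (a * rho)) * i) by rewrite -lee_fin.
  have : 2 ^+ d * expR (- (a * rho)) * i <= 1 / 2 * i by rewrite ler_wpM2r.
  move: h4; rewrite mulrDr [2 ^+ d * (_ * i)]mulrA; move: (2 ^+ d * v) (2 ^+ d * expR _ * i) => X Y; lra.
apply: (@le_lt_trans _ _ M%:E); last exact: ltry.
have cov : \bigcup_n D n.+1%:R = setT.
  apply/seteqP; split=> // x _; exists (Num.bound (enorm x)) => //.
  rewrite /D /eball /= sub0r enormN; apply: lt_trans (archi_boundP (enorm_ge0 x)) _.
  by rewrite ltr_nat.
have nd : nondecreasing_seq (fun n => D n.+1%:R).
  move=> m n mn; apply/subsetPset => x; rewrite /D /eball /= => /lt_le_trans; apply.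
  by rewrite ler_nat ltnS.
have cv : (\int[leb d]_(x in D i.+1%:R) F x @[i --> \oo] --> \int[leb d]_(x in \bigcup_n D n.+1%:R) F x)%E.
  by apply: ge0_nondecreasing_set_cvg_integral => // n; exact: measurable_funTS.
rewrite cov in cv.
rewrite -(cvg_lim _ cv)//; apply: lime_le; first by apply/cvg_ex; eexists; exact: cv.
by apply: nearW => n; exact: step.
Qed.

End exponential_integrals.

(** * Gibbs measures through local averages *)

Section gibbs_facts.
Context {R : realType} {d : nat} (phi : 'rV[R]_d -> R) (Hphi : hypothesis1 phi) (h : R).
Hypotheses (h_gt0 : 0 < h) (h_le1 : h <= 1).
Implicit Types (x y : 'rV[R]_d).

Local Notation cphi := (hypothesis1_continuous Hphi).
Local Notation mu := (gibbs cphi h).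

Definition bfactor x : R := expR (- (phi x / h)).

Lemma measurable_bfactor : measurable_fun setT bfactor.
Proof. by apply/measurable_EFinP; exact: measurable_boltzmann cphi h. Qed.

Lemma bfactor_gt0 x : 0 < bfactor x. Proof. exact: expR_gt0. Qed.

Lemma partition_lty : (\int[leb d]_x (bfactor x)%:E < +oo)%E.
Proof.
have [c [r [Cal [c0 r0 _ hr]]]] := hyp_growth Hphi.
have [C C0 hC] := continuous_bounded_ball cphi r0.
pose a := c / h; have a0 : 0 < a by rewrite divr_gt0.
pose K := expR (C / h + a * r); have K0 : 0 <= K by exact: expR_ge0.
have mE : measurable_fun setT (fun x => (expR (- (a * enorm x)))%:E : \bar R).
  apply/measurable_EFinP; apply: measurableT_comp => //; apply: measurableT_comp => //.
  by apply: measurable_funM => //; exact: measurable_enorm.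
apply: (@le_lt_trans _ _ (\int[leb d]_x (K%:E * (expR (- (a * enorm x)))%:E))%E).
  apply: ge0_le_integral => //.
  - by move=> x _; rewrite lee_fin expR_ge0.
  - by apply/measurable_EFinP; exact: measurable_bfactor.
  - exact: emeasurable_funM.
  move=> x _; rewrite -EFinM lee_fin -expRD ler_expR.
  have Ch : 0 <= C / h by rewrite divr_ge0// ltW.
  have ar : 0 <= a * r by rewrite mulr_ge0// ltW.
  have [xr|xr] := leP r (enorm x).
    have [_ _ px] := hr x xr.
    have : a * enorm x <= phi x / h by rewrite /a mulrAC ler_wpM2r// invr_ge0 ltW.
    by move: (a * enorm x) (phi x / h) (C / h) (a * r) Ch ar => *; lra.
  have xr' : `|x| <= r by apply: rV_norm_le => [|i]; [exact: ltW|exact: le_trans (enorm_coord x i) (ltW xr)].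
  have : - (phi x / h) <= C / h.
    rewrite -mulNr ler_wpM2r ?invr_ge0 ?(ltW h_gt0)//; apply: le_trans (hC x xr').
    by rewrite -normrN ler_norm.
  have : a * enorm x <= a * r by rewrite ler_wpM2l// ltW.
  by move: (a * enorm x) (phi x / h) (C / h) (a * r) => *; lra.
rewrite ge0_integralZl_EFin//; apply: lte_mul_pinfty => //; exact: integral_expR_enorm.
Qed.

Lemma partition_gt0 : (0 < \int[leb d]_x (bfactor x)%:E)%E.
Proof.
have [C C0 hC] := continuous_bounded_ball cphi ltr01.
apply: (@lt_le_trans _ _ (\int[leb d]_(x in eball 0 1) (expR (- (C / h)))%:E)%E).
  rewrite integral_cst; last exact: measurable_eball.
  by rewrite mule_gt0 ?lte_fin ?expR_gt0// -omegaE lte_fin omega_gt0.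
apply: (@le_trans _ _ (\int[leb d]_(x in eball 0 1) (bfactor x)%:E)%E).
  apply: ge0_le_integral => //.
  - exact: measurable_eball.
  - by apply: measurable_funTS; apply/measurable_EFinP; exact: measurable_bfactor.
  move=> x xB; rewrite lee_fin ler_expR lerN2 ler_wpM2r ?invr_ge0 ?(ltW h_gt0)//.
  by apply: le_trans (ler_norm _) _; apply: hC; exact: B1_norm.
apply: ge0_subset_integral => //; first exact: measurable_eball.
  by apply/measurable_EFinP; exact: measurable_bfactor.
by move=> x _; rewrite lee_fin expR_ge0.
Qed.

Definition Zinv : R := (fine (\int[leb d]_x (bfactor x)%:E)%E)^-1.

Lemma Zinv_gt0 : 0 < Zinv.
Proof. by rewrite invr_gt0 fine_gt0// partition_gt0 partition_lty. Qed.

Lemma gibbs_integral (F : 'rV[R]_d -> \bar R) : measurable_fun setT F -> (forall x, (0 <= F x)%E) ->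
  (\int[mu]_x F x = Zinv%:E * \int[leb d]_x (F x * (bfactor x)%:E))%E.
Proof.
by move=> mF F0; exact: (@integral_normalized _ _ _ (leb d) bfactor (measurable_boltzmann cphi h)
  (boltzmann_ge0 phi h) _ F partition_gt0 partition_lty mF F0).
Qed.

Lemma continuous_local_factor (p : 'rV[R]_d -> R) (k : R) x : continuous p ->
  continuous (fun u : 'rV[R]_d => expR (- ((p (x + k *: u) - p x) / k)) : R).
Proof.
move=> pc; apply: (@continuous_exp R d (fun u => - ((p (x + k *: u) - p x) / k))).
rewrite (_ : (fun _ => _) = (fun u : 'rV[R]_d => - k^-1 * (p (x + k *: u) + - p x))).
  apply: continuous_scale; apply: continuous_add; last by move=> u; exact: cst_continuous.
  move=> u; apply: (@continuous_comp _ _ _ (fun u : 'rV[R]_d => x + k *: u) p); last exact: pc.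
  by apply: (@cvgD _ _ _ (nbhs u) _ (fun=> x) (fun z : 'rV[R]_d => k *: z) x (k *: u)); [exact: cvg_cst|exact: scaler_continuous].
by apply/funext => u; ring.
Qed.

Lemma ball_integral (p : 'rV[R]_d -> R) x : continuous p ->
  (\int[leb d]_y (\1_(eball x h) y * expR (- (p y / h)))%:E =
   (h ^+ d * expR (- (p x / h)) * local_average p h x)%:E)%E.
Proof.
move=> pc; have mE : measurable_fun setT (fun y => expR (- (p y / h)) : R).
  apply: measurableT_comp => //; apply: measurableT_comp => //; apply: measurable_funM => //.
  exact: continuous_measurable_rV.
have mB := @measurable_eball R d x h.
transitivity (\int[leb d]_(y in eball x h) (expR (- (p y / h)))%:E)%E.
  rewrite [in RHS]integral_mkcond; apply: eq_integral => y _; rewrite patchE indicE.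
  by case: ifPn => _; rewrite ?mul1r ?mul0r.
rewrite (@integral_affine R d x (fun=> h) 1%g)//; last 2 first.
- by move=> i; rewrite gt_eqF.
- exact/measurable_EFinP.
have aE u : affine x (fun=> h) 1%g u = x + h *: u.
  by apply/rowP => i; rewrite !mxE perm1.
have -> : affine x (fun=> h) 1%g @^-1` eball x h = eball 0 1.
  apply/seteqP; split=> u; rewrite /eball /= aE opprD addrA subrr !sub0r !enormN enormZ gtr0_norm//.
    by rewrite -ltr_pdivlMl// mulVf ?gt_eqF.
  by rewrite -{2}[h]mulr1 ltr_pM2l.
have lc := @continuous_local_factor p h x pc.
rewrite prodr_const card_ord gtr0_norm//.
rewrite (eq_integral (fun u : 'rV[R]_d => (expR (- (p x / h)))%:E * (expR (- ((p (x + h *: u) - p x) / h)))%:E)%E); last first.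
  by move=> u _; rewrite aE -EFinM -expRD; congr (expR _)%:E; rewrite mulrBl; ring.
rewrite integralZl//; last by apply: J_integrable.
  have -> : (\int[leb d]_(u in eball 0 1) (expR (- ((p (x + h *: u) - p x) / h)))%:E = (local_average p h x)%:E)%E.
    rewrite /local_average /J /Rintegral fineK//.
    by apply: integrable_fin_num; [exact: measurable_eball|exact: J_integrable lc].
  by rewrite -!EFinM mulrA.
exact: measurable_eball.
Qed.

Definition close_pair : set ('rV[R]_d * 'rV[R]_d) := [set z | enorm (z.1 - z.2) < h].

Lemma measurable_close_pair : measurable close_pair.
Proof.
have := @measurable_enorm_sub R d measurableT _ (measurable_itv `]-oo, h[).
by rewrite setTI set_itvE.
Qed.

Definition near_kernel (z : 'rV[R]_d * 'rV[R]_d) : R := \1_close_pair z.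

Lemma measurable_near_kernel : measurable_fun setT near_kernel.
Proof. by apply: measurable_indic; exact: measurable_close_pair. Qed.

Lemma near_kernel_ge0 z : 0 <= near_kernel z.
Proof. by rewrite /near_kernel indicE; case: (_ \in _). Qed.

Lemma near_kernel_le1 z : near_kernel z <= 1.
Proof. by rewrite /near_kernel indicE; case: (_ \in _). Qed.

Lemma near_kernelE x y : near_kernel (x, y) = \1_(eball x h) y.
Proof. by rewrite /near_kernel !indicE; congr (nat_of_bool _)%:R; apply/idP/idP; rewrite !inE. Qed.

Lemma near_kernel_sym x y : near_kernel (x, y) = near_kernel (y, x).
Proof.
rewrite /near_kernel !indicE; congr (nat_of_bool _)%:R.
by apply/idP/idP; rewrite !inE /close_pair /= -enormN opprB.
Qed.

Local Notation wt := (weight mu near_kernel).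

(** Multiplying the Boltzmann factor of [phi] by W gives that of [p]. Thus TW/W at x is the ratio of
    the local averages of [p] and [phi], the bridge to [lyapunov]. *)
Lemma ball_ratio_integral (p : 'rV[R]_d -> R) x : continuous p ->
  let W y := expR ((phi y - p y) / h) in
  (\int[mu]_y (near_kernel (x, y) * (W y / W x))%:E =
    (Zinv * h ^+ d * bfactor x * local_average p h x)%:E)%E.
Proof.
move=> pc W; have mp : measurable_fun setT p by exact: continuous_measurable_rV.
have mphi : measurable_fun setT phi by apply: continuous_measurable_rV; exact: cphi.
have mW : measurable_fun setT W.
  by apply: measurableT_comp => //; apply: measurable_funM => //; exact: measurable_funB.
have mk : measurable_fun setT (fun y => near_kernel (x, y)) by exact: (measurable_row measurable_near_kernel).
have mE : measurable_fun setT (fun y => (\1_(eball x h) y * expR (- (p y / h)))%:E : \bar R).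
  apply/measurable_EFinP; apply: measurable_funM; first by apply: measurable_indic; exact: measurable_eball.
  by apply: measurableT_comp => //; apply: measurableT_comp => //; exact: measurable_funM.
rewrite gibbs_integral; last 2 first.
- by apply/measurable_EFinP; apply: measurable_funM => //; exact: measurable_funM.
- by move=> y; rewrite lee_fin mulr_ge0 ?near_kernel_ge0// divr_ge0// expR_ge0.
rewrite (eq_integral (fun y => ((W x)^-1)%:E * (\1_(eball x h) y * expR (- (p y / h)))%:E)%E); last first.
  move=> y _; rewrite -!EFinM near_kernelE; congr EFin.
  have -> : expR (- (p y / h)) = W y * bfactor y.
    by rewrite /W /bfactor -expRD; congr expR; rewrite mulrBl; ring.
  by ring.
rewrite ge0_integralZl_EFin//; last by rewrite invr_ge0 expR_ge0.
rewrite ball_integral// -!EFinM; congr EFin.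
have -> : bfactor x = (W x)^-1 * expR (- (p x / h)).
  by rewrite /W /bfactor -expRN -expRD; congr expR; rewrite mulrBl; ring.
by ring.
Qed.

Lemma gibbs_weightE x : wt x = Zinv * h ^+ d * bfactor x * local_average phi h x.
Proof.
have := ball_ratio_integral x cphi; rewrite /= => e.
have e2 : (\int[mu]_y (near_kernel (x, y))%:E = (Zinv * h ^+ d * bfactor x * local_average phi h x)%:E)%E.
  rewrite -e; apply: eq_integral => y _; congr EFin.
  by rewrite !subrr !mul0r expR0 divr1 mulr1.
by rewrite /weight /Rintegral e2.
Qed.

(** Uniform in h: [phi] is Lipschitz, so on a ball of radius h it varies by O(h), which the division
    by h compensates. *)
Lemma local_average_bounds : exists2 C, 0 < C & forall (h : R) x, 0 < h -> h <= 1 ->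
  C^-1 <= local_average phi h x <= C.
Proof.
have [L L1 [lip _ _ _ _]] := euclidean_bounds Hphi.
pose C := expR L * omega (d := d) + (expR (- L) * omega (d := d))^-1.
have o0 := @omega_gt0 R d.
have p1 : 0 < expR L * omega (d := d) by rewrite mulr_gt0// expR_gt0.
have p2 : 0 < expR (- L) * omega (d := d) by rewrite mulr_gt0// expR_gt0.
have p3 : 0 < (expR (- L) * omega (d := d))^-1 by rewrite invr_gt0.
have C0 : 0 < C by exact: addr_gt0.
exists C => // k x k0 k1.
have lc := @continuous_local_factor phi k x cphi.
have bnd u : eball 0 1 u -> `|(phi (x + k *: u) - phi x) / k| <= L.
  move=> uB; rewrite normrM [X in _ * X]gtr0_norm ?invr_gt0// ler_pdivrMr//.
  apply: le_trans (lip x (k *: u)) _; rewrite ler_wpM2l//; first exact: le_trans ler01 L1.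
  rewrite enormZ gtr0_norm// ler_piMr ?(ltW k0)//.
  by move: uB; rewrite /eball /= sub0r enormN => /ltW.
apply/andP; split.
  apply: (@le_trans _ _ (expR (- L) * omega (d := d))).
    rewrite -[leRHS]invrK lef_pV2 ?posrE//; first by rewrite lerDr ltW.
  rewrite -J_cst; apply: J_le => //; first by move=> u; exact: cst_continuous.
  by move=> u /bnd; rewrite ler_norml ler_expR lerN2 => /andP[].
apply: (@le_trans _ _ (expR L * omega (d := d))); last by rewrite lerDl ltW.
rewrite -J_cst; apply: J_le => //; first by move=> u; exact: cst_continuous.
by move=> u /bnd; rewrite ler_norml ler_expR lerNl => /andP[].
Qed.

Lemma local_average_gt0 x : 0 < local_average phi h x.
Proof.
have [C C0 hC] := local_average_bounds; have /andP[h1 _] := hC h x h_gt0 h_le1.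
by apply: lt_le_trans h1; rewrite invr_gt0.
Qed.

Lemma gibbs_weight_gt0 x : 0 < wt x.
Proof.
by rewrite gibbs_weightE !mulr_gt0 ?Zinv_gt0 ?exprn_gt0 ?bfactor_gt0 ?local_average_gt0.
Qed.

Lemma ball_massE x : ball_mass cphi h x = (wt x)%:E.
Proof.
rewrite -(weightE mu measurable_near_kernel near_kernel_ge0 near_kernel_le1).
rewrite (eq_integral (fun y => (\1_(eball x h) y)%:E)); last by move=> y _; rewrite near_kernelE.
by rewrite integral_indic ?setIT//; exact: measurable_eball.
Qed.

Definition nu_factor : R := (fine (\int[mu]_x (wt x)%:E)%E)^-1.

Lemma weight_total : (0 < \int[mu]_x (wt x)%:E)%E /\ (\int[mu]_x (wt x)%:E < +oo)%E.
Proof.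
have mw : measurable_fun setT (fun x => (wt x)%:E).
  by apply/measurable_EFinP; exact: (measurable_weight mu measurable_near_kernel near_kernel_ge0 near_kernel_le1).
have w1 x : wt x <= 1.
  rewrite -lee_fin -ball_massE; by apply: probability_le1; exact: measurable_eball.
have w0 x : (0 <= (wt x)%:E)%E by rewrite lee_fin ltW// gibbs_weight_gt0.
split; last first.
  apply: (@le_lt_trans _ _ (\int[mu]_x 1%:E)%E); last by rewrite integral_prob_cst ltry.
  by apply: ge0_le_integral => // x _; rewrite lee_fin.
rewrite lt_def integral_ge0 ?andbT//; apply/eqP => i0.
have ae0 : ae_eq mu setT (fun x => (wt x)%:E) (cst 0%E).
  apply/(ae_eq_integral_abs mu measurableT mw).
  by rewrite -[RHS]i0; apply: eq_integral => x _; rewrite gee0_abs.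
(* The weight vanishes nowhere, so the exceptional null set would be the whole space. *)
have [A [mA A0 sA]] := ae0.
have AT : A = setT.
  apply/seteqP; split => // x _; apply: sA => /= e.
  by have := gibbs_weight_gt0 x; move: (e I) => [->]; rewrite ltxx.
have : mu A = 1%E by rewrite AT; exact: probability_setT.
by rewrite A0 => -[] e; have := oner_neq0 R; rewrite -e eqxx.
Qed.

Lemma nu_factor_gt0 : 0 < nu_factor.
Proof. by rewrite invr_gt0 fine_gt0//; apply/andP; exact: weight_total. Qed.

Lemma nu_integral (F : 'rV[R]_d -> \bar R) : measurable_fun setT F -> (forall x, (0 <= F x)%E) ->
  (\int[nu_infty cphi h]_x F x = nu_factor%:E * \int[mu]_x (F x * (wt x)%:E))%E.
Proof.
have [t0 too] := weight_total.
have bE : ball_mass cphi h = EFin \o wt by apply/funext => x; exact: ball_massE.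
move=> mF F0; rewrite /nu_infty.
move: (measurable_ball_mass cphi h) (ball_mass_ge0 cphi h); rewrite bE => m1 m2.
exact: (integral_normalized m1 m2 _ t0 too mF F0).
Qed.

Lemma TstarE (f : 'rV[R]_d -> R[i]) x : Tstar cphi h f x =
  (average mu near_kernel (@complex.Re R \o f) x +i* average mu near_kernel (@complex.Im R \o f) x)%C.
Proof.
have avE (g : 'rV[R]_d -> R) : average mu near_kernel g x = (wt x)^-1 * \int[mu]_(y in eball x h) g y.
  congr (_ * _); rewrite /Rintegral [in RHS]integral_mkcond; congr fine.
  apply: eq_integral => y _; rewrite patchE near_kernelE indicE.
  by case: ifPn => _; rewrite ?mul1r ?mul0r.
rewrite /Tstar ball_massE /= !avE.
by apply/eqP; rewrite eq_complex /= !mul0r subr0 addr0 !eqxx.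
Qed.

End gibbs_facts.

(** * Poincare inequality on boxes *)

(** A copy of [leb] that can carry the sigma-finite structure required by Fubini's theorem. *)
Definition leb_fun (R : realType) (n : nat) : set 'rV[R]_n -> \bar R := leb n.

HB.instance Definition _ (R : realType) n := isMeasure.Build _ _ _ (@leb_fun R n)
  (measure0 (leb n)) (measure_ge0 (leb n)) (@measure_semi_sigma_additive _ _ _ (leb n)).

HB.instance Definition _ (R : realType) n := Measure_isSigmaFinite.Build _ _ _ (@leb_fun R n) (leb_sigma_finite n).

Section poincare.
Context {R : realType} {d : nat}.
Implicit Types (x y w : 'rV[R]_d).

Lemma sum_sqr_le (n : nat) (a : 'I_n -> R) : (\sum_i a i) ^+ 2 <= n%:R * \sum_i a i ^+ 2.
Proof.
have := @dotv_cauchy R n (\row_i a i) (const_mx 1).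
rewrite -(@ler_pXn2r _ 2)// ?nnegrE ?mulr_ge0 ?enorm_ge0// exprMn -!dotv_enorm real_normK ?num_real//.
have -> : dotv (\row_i a i) (const_mx 1) = \sum_i a i by apply: eq_bigr => i _; rewrite !mxE mulr1.
have -> : dotv (\row_i a i) (\row_i a i) = \sum_i a i ^+ 2 by apply: eq_bigr => i _; rewrite !mxE expr2.
have -> : dotv (const_mx 1 : 'rV[R]_n) (const_mx 1) = n%:R.
  by rewrite /dotv (eq_bigr (fun=> 1)) ?sumr_const ?card_ord// => i _; rewrite !mxE mulr1.
by rewrite mulrC.
Qed.

Lemma box_convex (a b x y : 'rV[R]_d) (t : R) : box a b x -> box a b y -> 0 <= t -> t <= 1 ->
  box a b (x + t *: (y - x)).
Proof.
move=> hx hy t0 t1 i; rewrite !mxE; have := hx i; have := hy i.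
move: (a _ _) (b _ _) (x _ _) (y _ _) => p q u v /andP[h1 h2] /andP[h3 h4].
have -> : u + t * (v - u) = (1 - t) * u + t * v by ring.
have e : p = (1 - t) * p + t * p by ring.
have e' : q = (1 - t) * q + t * q by ring.
by apply/andP; split; [rewrite [leLHS]e|rewrite [leRHS]e']; rewrite lerD// ler_wpM2l// subr_ge0.
Qed.

Let lebs : {sigma_finite_measure set 'rV[R]_d -> \bar R} := @leb_fun R d.

Lemma leb_fubini (F : 'rV[R]_d * 'rV[R]_d -> \bar R) : measurable_fun setT F -> (forall z, (0 <= F z)%E) ->
  (\int[leb d]_x \int[leb d]_y F (x, y) = \int[leb d]_y \int[leb d]_x F (x, y))%E.
Proof. by move=> mF F0; exact: (@fubini_tonelli _ _ _ _ _ lebs lebs F mF F0). Qed.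

Lemma leb_row_measurable (F : 'rV[R]_d * 'rV[R]_d -> \bar R) : measurable_fun setT F -> (forall z, (0 <= F z)%E) ->
  measurable_fun setT (fun x => \int[leb d]_y F (x, y))%E.
Proof. by move=> mF F0; exact: (@measurable_fun_fubini_tonelli_F _ _ _ _ _ lebs F mF F0). Qed.

Section box.
Variables (a b : 'rV[R]_d) (h : R) (n : nat) (f : 'rV[R]_d -> R).
Hypotheses (n0 : (0 < n)%N) (diam : forall x y, box a b x -> box a b y -> enorm (x - y) < n%:R * h).
Hypothesis mf : measurable_fun setT f.

Local Notation K := (box a b).

Definition jump (z : 'rV[R]_d * 'rV[R]_d) : R :=
  near_kernel h z * (\1_K z.1 * \1_K z.2 * (f z.1 - f z.2) ^+ 2).

Lemma jump_ge0 z : 0 <= jump z.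
Proof. by rewrite mulr_ge0 ?near_kernel_ge0// mulr_ge0 ?sqr_ge0// mulr_ge0. Qed.

Let mI : measurable_fun setT (\1_K : 'rV[R]_d -> R).
Proof. by apply: measurable_indic; exact: measurable_box. Qed.

Lemma measurable_jump : measurable_fun setT jump.
Proof.
apply: measurable_funM; first exact: measurable_near_kernel.
apply: measurable_funM; first by apply: measurable_funM; exact: (measurableT_comp mI).
by apply: measurable_funX; apply: measurable_funB; exact: (measurableT_comp mf).
Qed.

Lemma measurable_lin (s t : R) :
  measurable_fun setT (fun z : 'rV[R]_d * 'rV[R]_d => z.1 + s *: z.2 : 'rV[R]_d).
Proof.
apply: measurable_fun_rV => i.
rewrite (_ : (fun _ => _) = (fun z : 'rV[R]_d * 'rV[R]_d => z.1 ord0 i + s * z.2 ord0 i)); last first.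
  by apply/funext => z; rewrite !mxE.
apply: measurable_funD; first exact: (measurableT_comp (measurable_coord i)).
by apply: measurable_funM => //; exact: (measurableT_comp (measurable_coord i)).
Qed.

Lemma measurable_shifted_jump (s t : R) :
  measurable_fun setT (fun z : 'rV[R]_d * 'rV[R]_d => (jump (z.1 + s *: z.2, z.1 + t *: z.2))%:E).
Proof.
apply/measurable_EFinP.
apply: (@measurableT_comp _ _ _ _ _ _ jump _ (fun z : 'rV[R]_d * 'rV[R]_d => (z.1 + s *: z.2, z.1 + t *: z.2))).
  exact: measurable_jump.
by apply/measurable_fun_pairP; split; exact: measurable_lin.
Qed.

Lemma integral_translate (F : 'rV[R]_d -> \bar R) (v : 'rV[R]_d) : measurable_fun setT F -> (forall y, (0 <= F y)%E) ->
  (\int[leb d]_x F (x + v)%R = \int[leb d]_x F x)%E.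
Proof.
move=> mF F0; rewrite [RHS](@integral_affine R d v (fun=> 1) 1%g)//.
rewrite prodr_const normr1 expr1n mul1e preimage_setT; apply: eq_integral => u _; congr F.
by apply/rowP => i; rewrite !mxE perm1 mul1r addrC.
Qed.

Lemma integral_dilate (F : 'rV[R]_d -> \bar R) (v : 'rV[R]_d) (c : R) : 0 < c -> measurable_fun setT F -> (forall y, (0 <= F y)%E) ->
  (\int[leb d]_x F x = (c ^+ d)%:E * \int[leb d]_x F (v + c *: x)%R)%E.
Proof.
move=> c0 mF F0; rewrite [LHS](@integral_affine R d v (fun=> c) 1%g)//; last by move=> i; rewrite gt_eqF.
rewrite prodr_const card_ord gtr0_norm// preimage_setT; congr (_ * _)%E; apply: eq_integral => u _; congr F.
by apply/rowP => i; rewrite !mxE perm1.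
Qed.

Lemma shifted_jump_swap (s t : R) :
  (\int[leb d]_(x in setT) \int[leb d]_(w in setT) (jump ((x : 'rV[R]_d) + s *: (w : 'rV[R]_d), x + t *: w)%R)%:E =
   \int[leb d]_(w in setT) \int[leb d]_(x in setT) (jump ((x : 'rV[R]_d) + s *: (w : 'rV[R]_d), x + t *: w)%R)%:E)%E.
Proof.
have j0 (z : 'rV[R]_d * 'rV[R]_d) : (0 <= (jump (z.1 + s *: z.2, z.1 + t *: z.2)%R)%:E)%E.
  by rewrite lee_fin jump_ge0.
exact: (leb_fubini (measurable_shifted_jump s t) j0).
Qed.

(** The substitution (x, w) -> (x + s w, x + (s + 1) w) has determinant 1; it is carried out as two
    translations with exchanges of the integrals. *)
Lemma shifted_jump_integral (s : R) :
  (\int[leb d]_(x in setT) \int[leb d]_(w in setT) (jump ((x : 'rV[R]_d) + s *: (w : 'rV[R]_d), x + (s + 1) *: w)%R)%:E =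
   \int[leb d]_x \int[leb d]_y (jump (x, y))%:E)%E.
Proof.
have j0 z : (0 <= (jump z)%:E)%E by rewrite lee_fin jump_ge0.
rewrite shifted_jump_swap.
transitivity (\int[leb d]_w \int[leb d]_x (jump ((x : 'rV[R]_d) + 0 *: (w : 'rV[R]_d), x + 1 *: w)%R)%:E)%E.
  apply: eq_integral => w _ /=.
  rewrite -[RHS](@integral_translate (fun x : 'rV[R]_d => (jump (x + 0 *: w, x + 1 *: w))%:E) (s *: w))//.
    by apply: eq_integral => x _; rewrite scale0r addr0 scalerDl addrA.
  have := measurable_shifted_jump 0 1; move=> /measurable_fun_pair1; exact.
rewrite -shifted_jump_swap.
apply: eq_integral => x _ /=.
have mj : measurable_fun setT (fun y => (jump (x, y))%:E).
  by apply/measurable_EFinP; exact: (measurable_row measurable_jump).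
rewrite -[RHS](@integral_translate (fun y => (jump (x, y))%:E) x)//.
by apply: eq_integral => w _; rewrite scale0r addr0 scale1r addrC.
Qed.

(** Telescoping over [n] steps of length |w| < h and Cauchy-Schwarz. Convexity keeps the
    intermediate points in the box, and the diameter bound makes each step admissible for the
    kernel. *)
Lemma segment_bound x w : \1_K x * \1_K (x + n%:R *: w) * (f x - f (x + n%:R *: w)) ^+ 2 <=
  n%:R * \sum_(j < n) jump (x + j%:R *: w, x + (j%:R + 1) *: w).
Proof.
have S0 : 0 <= n%:R * \sum_(j < n) jump (x + j%:R *: w, x + (j%:R + 1) *: w).
  by rewrite mulr_ge0// sumr_ge0// => j _; exact: jump_ge0.
have [xK|xK] := pselect (K x); last by rewrite indicE memNset// !mul0r.
have [yK|yK] := pselect (K (x + n%:R *: w)); last first.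
  have -> : \1_K (x + n%:R *: w) = 0 :> R by rewrite indicE memNset.
  by rewrite mulr0 mul0r.
have nR : 0 < n%:R :> R by rewrite ltr0n.
have inK (j : nat) : (j <= n)%N -> K (x + j%:R *: w).
  move=> jn; have -> : x + j%:R *: w = x + (j%:R / n%:R) *: (x + n%:R *: w - x).
    by rewrite [x + _ - x]addrC addrA addNr add0r scalerA mulfVK// gt_eqF.
  by apply: box_convex => //; rewrite ler_pdivrMr// mul1r ler_nat.
have wh : enorm w < h.
  have := diam yK xK; rewrite [x + _ - x]addrC addrA addNr add0r enormZ ger0_norm//.
  by rewrite ltr_pM2l.
have jE (j : 'I_n) : jump (x + j%:R *: w, x + (j%:R + 1) *: w) =
    (f (x + j%:R *: w) - f (x + (j%:R + 1) *: w)) ^+ 2.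
  rewrite /jump /=; have k1 := inK j (ltnW (ltn_ord j)); have := inK j.+1 (ltn_ord j).
  rewrite -natr1 => k2.
  have nk : close_pair h (x + j%:R *: w, x + (j%:R + 1) *: w).
    have e : x + j%:R *: w - (x + (j%:R + 1) *: w) = - w.
      by apply/rowP => i; rewrite !mxE; ring.
    by rewrite /close_pair /= e enormN.
  by rewrite /near_kernel !indicE !mem_set// !mul1r.
under eq_bigr do rewrite jE.
rewrite !indicE !mem_set// !mul1r.
have -> : f x - f (x + n%:R *: w) = \sum_(j < n) (f (x + j%:R *: w) - f (x + (j%:R + 1) *: w)).
  have tel (m : nat) : \sum_(j < m) (f (x + j%:R *: w) - f (x + (j%:R + 1) *: w)) = f x - f (x + m%:R *: w).
    elim: m => [|m IH]; first by rewrite big_ord0 scale0r addr0 subrr.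
    by rewrite big_ord_recr /= IH natr1 addrA subrK.
  by rewrite tel.
exact: sum_sqr_le.
Qed.

(** Substitute y = x + n w. The exponent d + 2 collects n^d from the dilation, n from
    Cauchy-Schwarz, and n from the number of steps, whose integrals are all equal. *)
Lemma poincare_box :
  (\int[leb d]_x \int[leb d]_y (\1_K x * \1_K y * (f x - f y) ^+ 2)%:E <=
   (n%:R ^+ (d + 2))%:E * \int[leb d]_x \int[leb d]_y (jump (x, y))%:E)%E.
Proof.
have nR : 0 < n%:R :> R by rewrite ltr0n.
pose Q (z : 'rV[R]_d * 'rV[R]_d) : R := \1_K z.1 * \1_K z.2 * (f z.1 - f z.2) ^+ 2.
have Q0 z : (0 <= (Q z)%:E)%E by rewrite lee_fin mulr_ge0 ?sqr_ge0// mulr_ge0.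
have mQ : measurable_fun setT (fun z => (Q z)%:E).
  apply/measurable_EFinP; apply: measurable_funM; first by apply: measurable_funM; exact: (measurableT_comp mI).
  by apply: measurable_funX; apply: measurable_funB; exact: (measurableT_comp mf).
pose Sj (z : 'rV[R]_d * 'rV[R]_d) : \bar R := (\sum_(j < n) (jump (z.1 + j%:R *: z.2, z.1 + (j%:R + 1) *: z.2))%:E)%E.
have j0 z : (0 <= (jump z)%:E)%E by rewrite lee_fin jump_ge0.
have mSj : measurable_fun setT Sj.
  by apply: emeasurable_sum => j; exact: measurable_shifted_jump.
have Sj0 z : (0 <= Sj z)%E by apply: sume_ge0.
have cn0 : 0 <= n%:R ^+ d * n%:R :> R by rewrite mulr_ge0// exprn_ge0.
apply: (@le_trans _ _ (\int[leb d]_x ((n%:R ^+ d * n%:R)%:E * \int[leb d]_w Sj (x, w)))%E).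
  apply: ge0_le_integral => //.
  - by move=> x _; apply: integral_ge0 => y _; exact: (Q0 (x, y)).
  - exact: (leb_row_measurable mQ Q0).
  - by apply: emeasurable_funM => //; exact: (leb_row_measurable mSj Sj0).
  move=> x _; have mQx : measurable_fun setT (fun y => (Q (x, y))%:E).
    by move: mQ => /measurable_fun_pair2; exact.
  rewrite (@integral_dilate (fun y => (Q (x, y))%:E) x n%:R)//.
  rewrite EFinM -muleA lee_wpmul2l ?lee_fin ?exprn_ge0//.
  have mSx : measurable_fun setT (fun w => Sj (x, w)) by move: mSj => /measurable_fun_pair2; exact.
  rewrite -ge0_integralZl_EFin//.
  apply: ge0_le_integral => //.
  - have := @measurable_affine R d x (fun=> n%:R) 1%g => ma.
    rewrite (_ : (fun _ => _) = (fun y => (Q (x, y))%:E) \o affine x (fun=> n%:R) 1%g); first exact: measurableT_comp.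
    by apply/funext => u /=; congr (Q (_, _))%:E; apply/rowP => i; rewrite !mxE perm1.
  - exact: emeasurable_funM.
  by move=> w _; rewrite /Sj sumEFin -EFinM lee_fin; exact: segment_bound.
rewrite ge0_integralZl_EFin//; last 2 first.
- by move=> x _; apply: integral_ge0 => w _; exact: Sj0.
- exact: (leb_row_measurable mSj Sj0).
rewrite addn2 exprSr exprSr [X in (_ <= X * _)%E]EFinM -muleA lee_wpmul2l ?lee_fin//.
rewrite (eq_integral (fun x : 'rV[R]_d => \sum_(j < n) \int[leb d]_(w in setT) (jump (x + j%:R *: (w : 'rV[R]_d), x + (j%:R + 1) *: w)%R)%:E)%E); last first.
  move=> x _; rewrite /Sj ge0_integral_sum// => j.
  by move: (measurable_shifted_jump j%:R (j%:R + 1)) => /measurable_fun_pair2; exact.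
have e1 (j : 'I_n) : measurable_fun setT (fun x : 'rV[R]_d =>
    \int[leb d]_(w in setT) (jump (x + j%:R *: (w : 'rV[R]_d), x + (j%:R + 1) *: w)%R)%:E)%E.
  apply: (@leb_row_measurable (fun z : 'rV[R]_d * 'rV[R]_d => (jump (z.1 + j%:R *: z.2, z.1 + (j%:R + 1) *: z.2))%:E)) => //.
  exact: measurable_shifted_jump.
have e2 (j : 'I_n) (x : 'rV[R]_d) : setT x ->
    (0 <= \int[leb d]_(w in setT) (jump (x + j%:R *: (w : 'rV[R]_d), x + (j%:R + 1) *: w)%R)%:E)%E.
  by move=> _; apply: integral_ge0.
rewrite (ge0_integral_sum _ measurableT e1)//.
rewrite (eq_bigr (fun=> (\int[leb d]_x \int[leb d]_y (jump (x, y))%:E)%E)); last first.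
  by move=> j _; exact: shifted_jump_integral.
by rewrite sumr_const card_ord mule_natl.
Qed.

End box.
End poincare.

(** * Poincare inequalities and mass bounds for Gibbs measures *)

Section gibbs_boxes.
Context {R : realType} {d : nat} (phi : 'rV[R]_d -> R) (Hphi : hypothesis1 phi) (h : R).
Hypotheses (h_gt0 : 0 < h) (h_le1 : h <= 1).
Implicit Types (x y : 'rV[R]_d).

Local Notation cphi := (hypothesis1_continuous Hphi).
Local Notation mu := (gibbs cphi h).
Local Notation g := (bfactor phi h).
Local Notation wt := (weight mu (near_kernel h)).
Local Notation Zi := (Zinv phi h).

Lemma gibbs_pair_integral (F : 'rV[R]_d * 'rV[R]_d -> \bar R) :
  measurable_fun setT F -> (forall z, (0 <= F z)%E) ->
  (\int[mu \x mu]_z F z =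
   (Zi ^+ 2)%:E * \int[leb d]_x \int[leb d]_y (F (x, y) * (g x * g y)%:E))%E.
Proof.
move=> mF F0; have mg := measurable_bfactor Hphi h; have g0 x : 0 <= g x by exact: ltW (bfactor_gt0 phi h x).
have Z0 : 0 <= Zi by exact: ltW (Zinv_gt0 Hphi h_gt0).
have mFx x : measurable_fun setT (fun y => F (x, y)) by move: mF => /measurable_fun_pair2; exact.
pose F2 (z : 'rV[R]_d * 'rV[R]_d) : \bar R := (F z * (g z.2)%:E)%E.
have mF2 : measurable_fun setT F2.
  by apply: emeasurable_funM => //; apply/measurable_EFinP; exact: (measurableT_comp mg).
have F20 z : (0 <= F2 z)%E by rewrite mule_ge0// lee_fin.
have mI := leb_row_measurable mF2 F20.
rewrite fubini_tonelli1// /fubini_F.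
rewrite (eq_integral (fun x => Zi%:E * \int[leb d]_y F2 (x, y))%E); last first.
  by move=> x _; rewrite gibbs_integral.
have I0 x : (0 <= \int[leb d]_y F2 (x, y))%E by apply: integral_ge0.
rewrite gibbs_integral//; last 2 first.
- exact: emeasurable_funM.
- by move=> x; rewrite mule_ge0// lee_fin.
rewrite expr2 EFinM -[RHS]muleA; congr (_ * _)%E.
rewrite -ge0_integralZl_EFin//; last 2 first.
- by move=> x _; apply: integral_ge0 => y _; rewrite mule_ge0// lee_fin mulr_ge0.
- rewrite (_ : (fun _ => _) = (fun x => \int[leb d]_y (fun z : 'rV[R]_d * 'rV[R]_d => F z * (g z.1 * g z.2)%:E) (x, y))%E)//.
  apply: (@leb_row_measurable R d (fun z : 'rV[R]_d * 'rV[R]_d => (F z * (g z.1 * g z.2)%:E)%E)) => [|z]; last by rewrite mule_ge0// lee_fin mulr_ge0.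
  apply: emeasurable_funM => //; apply/measurable_EFinP; apply: measurable_funM; exact: (measurableT_comp mg).
apply: eq_integral => x _; rewrite -muleA; congr (_ * _)%E.
have mF2x : measurable_fun setT (fun y => F2 (x, y)) by move: mF2 => /measurable_fun_pair2; exact.
rewrite -ge0_integralZr//; last by rewrite lee_fin.
by apply: eq_integral => y _; rewrite /F2 /= -muleA -EFinM mulrC.
Qed.

(** Comparison with Lebesgue measure: the density is bounded above by M on one side and below by m
    on the other, once per variable. *)
Lemma box_poincare_gibbs (a b : 'rV[R]_d) (n : nat) (m M : R) (f : 'rV[R]_d -> R) :
  (0 < n)%N -> 0 < m -> (forall x, box a b x -> m <= g x <= M) ->
  (forall x y, box a b x -> box a b y -> enorm (x - y) < n%:R * h) -> measurable_fun setT f ->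
  (((m / M) ^+ 2 / n%:R ^+ (d + 2))%:E *
    \int[mu \x mu]_z (\1_(box a b) z.1 * \1_(box a b) z.2 * (f z.1 - 1 * f z.2) ^+ 2)%:E <=
   \int[mu \x mu]_z (near_kernel h z * (\1_(box a b) z.1 * \1_(box a b) z.2 * (f z.1 - 1 * f z.2) ^+ 2))%:E)%E.
Proof.
move=> n0 m0 hm hd mf; have mI : measurable_fun setT (\1_(box a b) : 'rV[R]_d -> R).
  by apply: measurable_indic; exact: measurable_box.
pose Q (z : 'rV[R]_d * 'rV[R]_d) : R := \1_(box a b) z.1 * \1_(box a b) z.2 * (f z.1 - f z.2) ^+ 2.
have Q0 z : 0 <= Q z by rewrite mulr_ge0 ?sqr_ge0// mulr_ge0.
have mQ : measurable_fun setT (fun z => (Q z)%:E).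
  apply/measurable_EFinP; apply: measurable_funM; first by apply: measurable_funM; exact: (measurableT_comp mI).
  by apply: measurable_funX; apply: measurable_funB; exact: (measurableT_comp mf).
have mJ := measurable_jump a b h mf.
have mJ' : measurable_fun setT (fun z => (jump a b h f z)%:E) by exact/measurable_EFinP.
rewrite (eq_integral (fun z => (Q z)%:E)); last by move=> z _; rewrite mul1r.
rewrite [leRHS](eq_integral (fun z => (jump a b h f z)%:E)); last by move=> z _; rewrite mul1r.
have nR : 0 < n%:R ^+ (d + 2) :> R by rewrite exprn_gt0// ltr0n.
have [[x0 x0K]|noK] := pselect (exists x, box a b x); last first.
  rewrite integral0_eq ?mule0; first by apply: integral_ge0 => z _; rewrite lee_fin jump_ge0.
  move=> z _; rewrite /Q indicE memNset ?mul0r// => zK; apply: noK; by exists z.1.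
have M0 : 0 < M by have /andP[h1 h2] := hm x0 x0K; exact: lt_le_trans m0 (le_trans h1 h2).
have g0 x : 0 <= g x by exact: ltW (bfactor_gt0 phi h x).
have mg := measurable_bfactor Hphi h.
have mgg : measurable_fun setT (fun z : 'rV[R]_d * 'rV[R]_d => (g z.1 * g z.2)%:E).
  by apply/measurable_EFinP; apply: measurable_funM; exact: (measurableT_comp mg).
have gg0 (z : 'rV[R]_d * 'rV[R]_d) : 0 <= g z.1 * g z.2 by exact: mulr_ge0.
pose I2 (F : 'rV[R]_d * 'rV[R]_d -> R) := (\int[leb d]_x \int[leb d]_y (F (x, y))%:E)%E.
have mono (F G : 'rV[R]_d * 'rV[R]_d -> R) : measurable_fun setT F -> measurable_fun setT G ->
    (forall z, 0 <= F z) -> (forall z, F z <= G z) -> (I2 F <= I2 G)%E.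
  move=> mF mG F0 FG; have G0 z : 0 <= G z by exact: le_trans (FG z).
  have mF' : measurable_fun setT (fun z => (F z)%:E) by exact/measurable_EFinP.
  have mG' : measurable_fun setT (fun z => (G z)%:E) by exact/measurable_EFinP.
  apply: ge0_le_integral => //.
  - by move=> x _; apply: integral_ge0 => y _; rewrite lee_fin.
  - by apply: (leb_row_measurable mF') => z; rewrite lee_fin.
  - by apply: (leb_row_measurable mG') => z; rewrite lee_fin.
  move=> x _; apply: ge0_le_integral => //.
  - by move=> y _; rewrite lee_fin.
  - by move: mF' => /measurable_fun_pair2; exact.
  - by move: mG' => /measurable_fun_pair2; exact.
  - by move=> y _; rewrite lee_fin.
have scal (c : R) (F : 'rV[R]_d * 'rV[R]_d -> R) : 0 <= c -> measurable_fun setT F -> (forall z, 0 <= F z) ->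
    (I2 (fun z => c * F z)%R = c%:E * I2 F)%E.
  move=> c0 mF F0; have mF' : measurable_fun setT (fun z => (F z)%:E) by exact/measurable_EFinP.
  rewrite /I2 -ge0_integralZl_EFin//; last 2 first.
  - by move=> x _; apply: integral_ge0 => y _; rewrite lee_fin.
  - by apply: (leb_row_measurable mF') => z; rewrite lee_fin.
  apply: eq_integral => x _; rewrite -ge0_integralZl_EFin//.
  - by move=> y _; rewrite lee_fin.
  - by move: mF' => /measurable_fun_pair2; exact.
have mQr : measurable_fun setT Q by exact/measurable_EFinP.
have mggr : measurable_fun setT (fun z : 'rV[R]_d * 'rV[R]_d => g z.1 * g z.2) by exact/measurable_EFinP.
have up : (\int[mu \x mu]_z (Q z)%:E <= (Zi ^+ 2)%:E * ((M ^+ 2)%:E * I2 Q))%E.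
  rewrite gibbs_pair_integral//.
  rewrite lee_wpmul2l ?lee_fin ?sqr_ge0// -scal ?sqr_ge0//.
  rewrite (_ : (fun x => _) = (fun x => \int[leb d]_y (Q (x, y) * (g x * g y))%:E)%E)//.
  apply: (mono (fun z => Q z * (g z.1 * g z.2)) (fun z => M ^+ 2 * Q z)).
  - exact: measurable_funM.
  - exact: measurable_funM.
  - by move=> z; rewrite mulr_ge0.
  move=> z; have [z1|z1] := pselect (box a b z.1); last by rewrite /Q indicE memNset// !mul0r mulr0.
  have [z2|z2] := pselect (box a b z.2).
    rewrite mulrC ler_wpM2r// expr2; apply: ler_pM => //; [by case/andP: (hm _ z1)|by case/andP: (hm _ z2)].
  have -> : Q z = 0 by rewrite /Q [\1_(box a b) z.2]indicE memNset// mulr0 mul0r.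
  by rewrite mul0r mulr0.
have low : ((Zi ^+ 2)%:E * ((m ^+ 2)%:E * I2 (jump a b h f)) <= \int[mu \x mu]_z (jump a b h f z)%:E)%E.
  rewrite gibbs_pair_integral//; last by move=> z; rewrite lee_fin jump_ge0.
  rewrite lee_wpmul2l ?lee_fin ?sqr_ge0// -scal ?sqr_ge0//; last by move=> z; exact: jump_ge0.
  apply: (mono (fun z => m ^+ 2 * jump a b h f z) (fun z => jump a b h f z * (g z.1 * g z.2))).
  - exact: measurable_funM.
  - exact: measurable_funM.
  - by move=> z; rewrite mulr_ge0 ?sqr_ge0 ?jump_ge0.
  move=> z; have j0 := jump_ge0 a b h f z.
  have [z1|z1] := pselect (box a b z.1); last first.
    by have -> : jump a b h f z = 0; [rewrite /jump [\1_(box a b) z.1]indicE memNset// !(mul0r, mulr0)|rewrite mul0r mulr0].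
  have [z2|z2] := pselect (box a b z.2); last first.
    by have -> : jump a b h f z = 0; [rewrite /jump [\1_(box a b) z.2]indicE memNset// !(mul0r, mulr0)|rewrite mul0r mulr0].
  rewrite mulrC ler_wpM2l// expr2; apply: ler_pM; rewrite ?(ltW m0)//; [by case/andP: (hm _ z1)|by case/andP: (hm _ z2)].
have pb : (I2 Q <= (n%:R ^+ (d + 2))%:E * I2 (jump a b h f))%E by exact: (poincare_box n0 hd mf).
apply: le_trans low; apply: (@le_trans _ _ (((m / M) ^+ 2 / n%:R ^+ (d + 2))%:E * ((Zi ^+ 2)%:E * ((M ^+ 2)%:E * I2 Q)))%E).
  by rewrite lee_wpmul2l// lee_fin divr_ge0 ?sqr_ge0// ltW.
apply: (@le_trans _ _ (((m / M) ^+ 2 / n%:R ^+ (d + 2))%:E * ((Zi ^+ 2)%:E * ((M ^+ 2)%:E * ((n%:R ^+ (d + 2))%:E * I2 (jump a b h f)))))%E).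
  rewrite !lee_wpmul2l// lee_fin ?sqr_ge0//.
  by rewrite divr_ge0 ?sqr_ge0// ltW.
rewrite !muleA -!EFinM le_eqVlt; apply/orP; left; apply/eqP; congr (_%:E * _)%E.
by field; rewrite !gt_eqF.
Qed.

Lemma cell_poincare_gibbs (eps : R) (B : set 'rV[R]_d) (f : 'rV[R]_d -> R) :
  (forall x y, B x -> B y -> enorm (x - y) < h) ->
  (1%:E * \int[mu \x mu]_z (\1_B z.1 * \1_B z.2 * (f z.1 - eps * f z.2) ^+ 2)%:E <=
   \int[mu \x mu]_z (near_kernel h z * (\1_B z.1 * \1_B z.2 * (f z.1 - eps * f z.2) ^+ 2))%:E)%E.
Proof.
move=> hB; rewrite mul1e (eq_integral (fun z => (near_kernel h z * (\1_B z.1 * \1_B z.2 * (f z.1 - eps * f z.2) ^+ 2))%:E))//.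
move=> z _; congr EFin.
have [z1|z1] := pselect (B z.1); last by rewrite [\1_B z.1]indicE memNset// !(mul0r, mulr0).
have [z2|z2] := pselect (B z.2); last by rewrite [\1_B z.2]indicE memNset// !(mul0r, mulr0).
have -> : near_kernel h z = 1 by rewrite /near_kernel indicE mem_set//; exact: hB.
by rewrite mul1r.
Qed.

(** Supplies the constant [beta] of [coercive_boxes]: on [B] the density varies by at most exp(kap),
    so mass and weight compare like the volume of the box and h^d. *)
Lemma mass_lower (B : set 'rV[R]_d) (a b : 'rV[R]_d) (C kap : R) : measurable B -> box a b `<=` B ->
  (forall i, a ord0 i <= b ord0 i) -> (forall x, local_average phi h x <= C) -> 0 < C ->
  (forall x y, B x -> B y -> phi y - phi x <= kap * h) ->
  forall x, B x -> (expR (- kap) * \prod_i (b ord0 i - a ord0 i) / (h ^+ d * C)) * wt x <= fine (mu B).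
Proof.
move=> mB boxB ab hC C0 osc x xB.
set P := \prod_i _; have P0 : 0 <= P by apply: prodr_ge0 => i _; rewrite subr_ge0.
have g0 y : 0 <= g y by exact: ltW (bfactor_gt0 phi h y).
have mg := measurable_bfactor Hphi h.
have Z0 := Zinv_gt0 Hphi h_gt0.
have hd0 : 0 < h ^+ d by rewrite exprn_gt0.
apply: (@le_trans _ _ (Zi * (expR (- kap) * g x * P))).
  rewrite (gibbs_weightE Hphi h_gt0).
  have -> : expR (- kap) * P / (h ^+ d * C) * (Zi * h ^+ d * g x * local_average phi h x) =
     Zi * (expR (- kap) * g x * P) * (local_average phi h x / C).
    by field; rewrite !gt_eqF.
  rewrite ler_piMr//; last by rewrite ler_pdivrMr// mul1r.
  by rewrite mulr_ge0 ?(ltW Z0)// mulr_ge0// mulr_ge0 ?expR_ge0.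
have muB : (mu B = Zi%:E * \int[leb d]_y ((\1_B y)%:E * (g y)%:E))%E.
  rewrite -(gibbs_integral Hphi h_gt0); [|by apply/measurable_EFinP; exact: measurable_indic|by move=> y; rewrite lee_fin].
  by rewrite integral_indic// setIT.
rewrite -lee_fin fineK; last by rewrite ge0_fin_numE//; exact: le_lt_trans (probability_le1 mu mB) (ltry _).
rewrite muB EFinM lee_wpmul2l ?lee_fin ?(ltW Z0)//.
have mI : measurable_fun setT (fun y => (\1_(box a b) y)%:E : \bar R).
  by apply/measurable_EFinP; apply: measurable_indic; exact: measurable_box.
apply: (@le_trans _ _ (\int[leb d]_y ((expR (- kap) * g x)%:E * (\1_(box a b) y)%:E))%E).
  rewrite ge0_integralZl_EFin//; last by rewrite mulr_ge0// expR_ge0.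
  rewrite integral_indic ?setIT//; last exact: measurable_box.
  by rewrite [X in (_ <= _ * X)%E]leb_box// EFinM.
apply: ge0_le_integral => //.
- by move=> y _; rewrite mule_ge0// lee_fin ?mulr_ge0 ?expR_ge0.
- exact: emeasurable_funM.
- by apply: emeasurable_funM; apply/measurable_EFinP => //; exact: measurable_indic.
move=> y _; rewrite -!EFinM lee_fin.
have [yK|yK] := pselect (box a b y); last by rewrite indicE memNset// mulr0 mulr_ge0.
have yB := boxB _ yK; rewrite !indicE !mem_set// mulr1 mul1r /bfactor -expRD ler_expR.
have := osc x y xB yB; rewrite -ler_pdivrMr// mulrBl.
by move: (phi y / h) (phi x / h) => u v; lra.
Qed.

End gibbs_boxes.

(** * Coverings and spectral gap *)

Section gibbs_gap.
Context {R : realType} {d : nat} (phi : 'rV[R]_d -> R) (Hphi : hypothesis1 phi).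
Implicit Types (x y : 'rV[R]_d).

Local Notation cphi := (hypothesis1_continuous Hphi).

Definition gibbs_average_L2 (h : R) (h0 : 0 < h) (h1 : h <= 1) :
    forall f, f \in Lfun (nu_infty cphi h) 2 -> average (gibbs cphi h) (near_kernel h) f \in Lfun (nu_infty cphi h) 2 :=
  average_L2 (measurable_near_kernel h) (near_kernel_ge0 h) (near_kernel_le1 h) (near_kernel_sym h)
    (gibbs_weight_gt0 Hphi h0 h1) (nu_factor_gt0 Hphi h0 h1) (nu_integral Hphi h0 h1).

Definition gibbs_average (h : R) (h0 : 0 < h) (h1 : h <= 1) :
    LfunType (nu_infty cphi h) (lee1n 2) -> LfunType (nu_infty cphi h) (lee1n 2) :=
  average_V (measurable_near_kernel h) (near_kernel_ge0 h) (near_kernel_le1 h) (near_kernel_sym h)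
    (gibbs_weight_gt0 Hphi h0 h1) (nu_factor_gt0 Hphi h0 h1) (nu_integral Hphi h0 h1).

Lemma enorm_box x (t : R) : (forall i, `|x ord0 i| <= t) -> enorm x <= d%:R * t.
Proof.
move=> xt; apply: le_trans (enorm_le_l1 x) _.
apply: (@le_trans _ _ (\sum_(i < d) t)); first exact: ler_sum.
by rewrite sumr_const card_ord mulr_natl.
Qed.

(** Turns a difference of local averages into a ratio: a gain [c] is at least [v0 * D] because D <=
    C, and a loss [v] is at most [v * C * D] because 1/C <= D. Here [g] stands for the indicator of
    [G]. *)
Lemma drift_bound (D Dp C c v v0 g : R) : C^-1 <= D -> D <= C -> 0 < C -> 0 <= v0 -> v0 * C <= c -> 0 <= v ->
  - v <= D - Dp -> (g = 1) \/ (g = 0 /\ c <= D - Dp) -> Dp <= (1 - v0 + (v0 + v * C) * g) * D.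
Proof.
move=> CD DC C0 v00 vc w0 hD [->|[-> hc]].
  have : v <= v * C * D.
    by rewrite -mulrA ler_peMr// mulrC -ler_pdivrMr// mul1r.
  by nra.
have : v0 * D <= v0 * C by rewrite ler_wpM2l.
by nra.
Qed.

Lemma gibbs_coercive (h : R) (h0 : 0 < h) (h1 : h <= 1) (p : 'rV[R]_d -> R) (n : nat)
    (B : 'I_n -> set 'rV[R]_d) (a : 'I_n -> 'rV[R]_d) (G : set 'rV[R]_d) (C c v v0 s kap tau k eps : R) :
  continuous p -> eps ^+ 2 = 1 -> 0 < C -> (forall x, C^-1 <= local_average phi h x <= C) ->
  (forall x, - v <= local_average phi h x - local_average p h x) ->
  (forall x, ~ G x -> c <= local_average phi h x - local_average p h x) ->
  0 <= v -> 0 < v0 -> v0 <= 1 -> v0 * C <= c ->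
  (forall i, measurable (B i)) -> 0 < s -> (forall i, box (a i) (a i + const_mx s) `<=` B i) ->
  (forall i x y, B i x -> B i y -> phi y - phi x <= kap * h) ->
  measurable G -> 0 < tau -> 0 <= k -> (forall x, \sum_i \1_(B i) x <= k) ->
  (forall x, \1_G x <= \sum_i (\1_(B i) x : R)) ->
  (forall (f : LfunType (nu_infty cphi h) (lee1n 2)) i,
    tau%:E * \int[gibbs cphi h \x gibbs cphi h]_z (\1_(B i) z.1 * \1_(B i) z.2 * (f z.1 - eps * f z.2) ^+ 2)%:E <=
    \int[gibbs cphi h \x gibbs cphi h]_z (near_kernel h z * (\1_(B i) z.1 * \1_(B i) z.2 * (f z.1 - eps * f z.2) ^+ 2))%:E)%E ->
  exists Bc (l : 'I_n -> LfunType (nu_infty cphi h) (lee1n 2)), 0 <= Bc /\ forall f,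
    v0 / (1 + (v0 + v * C) * k / (tau * (expR (- kap) * s ^+ d / (h ^+ d * C)))) * ipL f f <=
    ipL f f - eps * ipL (gibbs_average h0 h1 f) f + eps * (Bc * \sum_i ipL f (l i) ^+ 2).
Proof.
move=> cp e1 C0 CD hv hc v_0 v00 v01 vc mB s0 boxB osc mG t0 k0 hk hG hP.
pose W (y : 'rV[R]_d) := expR ((phi y - p y) / h).
have aB i : B i (a i).
  by apply: boxB => j; rewrite !mxE lexx lerDl ltW.
pose Z := Zinv phi h * h ^+ d.
have Z0 : 0 < Z by rewrite mulr_gt0 ?exprn_gt0// (Zinv_gt0 Hphi h0).
apply: (@coercive_boxes _ _ _ (gibbs cphi h) (nu_infty cphi h) (near_kernel h) (nu_factor Hphi h)
  (measurable_near_kernel h) (near_kernel_ge0 h) (near_kernel_le1 h) (near_kernel_sym h)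
  (gibbs_weight_gt0 Hphi h0 h1) (nu_factor_gt0 Hphi h0 h1) (nu_integral Hphi h0 h1) n B
  (fun i => Z * expR (- (phi (a i) / h) - kap) * C^-1) W G) => //.
(* The lower bound for the weight on [B i] refers to the corner [a i] of the inner cube, from which
   [phi] differs by at most [kap * h]. *)
- by move=> i; rewrite mulr_gt0 ?invr_gt0// mulr_gt0// expR_gt0.
- move=> i x Bx; rewrite (gibbs_weightE Hphi h0); apply: ler_pM.
  + by rewrite mulr_ge0 ?expR_ge0// ltW.
  + by rewrite invr_ge0 ltW.
  + rewrite ler_wpM2l ?(ltW Z0)// /bfactor ler_expR.
    have := osc i (a i) x (aB i) Bx; rewrite -ler_pdivrMr// mulrBl.
    by move: (phi x / h) (phi (a i) / h) => u1 u2; lra.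
  + by case/andP: (CD x).
- apply: (measurableT_comp (@measurable_expR R)); apply: measurable_funM => //.
  by apply: measurable_funB; [exact: (continuous_measurable_rV cphi)|exact: (continuous_measurable_rV cp)].
- by move=> x; exact: expR_gt0.
- by rewrite mulr_ge0// ltW.
- move=> x; rewrite (ball_ratio_integral Hphi h0 x cp) lee_fin (gibbs_weightE Hphi h0) mulrCA.
  have Zg : 0 <= Zinv phi h * h ^+ d * bfactor phi h x by rewrite mulr_ge0 ?(ltW Z0)// ltW// bfactor_gt0.
  rewrite (ler_wpM2l Zg)//; have /andP[CD1 CD2] := CD x.
  apply: (drift_bound CD1 CD2 C0 (ltW v00) vc v_0 (hv x)).
  have [xG|xG] := pselect (G x); first by left; rewrite indicE mem_set.
  by right; split; [rewrite indicE memNset|exact: hc].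
- by rewrite divr_gt0 ?mulr_gt0 ?exprn_gt0// expR_gt0.
- move=> i x Bx; have := @mass_lower R d phi Hphi h h0 (B i) (a i) (a i + const_mx s) C kap (mB i) (boxB i).
  rewrite (_ : \prod_j _ = s ^+ d); last first.
    by under eq_bigr do rewrite !mxE addrAC subrr add0r; rewrite prodr_const card_ord.
  apply => //.
  + by move=> j; rewrite !mxE lerDl ltW.
  + by move=> y; case/andP: (CD y).
  + exact: osc.
Qed.

Lemma minima_enum (n0 : nat) : (local_minima phi #= `I_n0)%card ->
  exists m : 'I_n0 -> 'rV[R]_d, [/\ injective m, (forall i, local_minima phi (m i)) &
    forall s, local_minima phi s -> exists i, m i = s].
Proof.
move=> Hn; have : (`I_n0 #= local_minima phi)%card by rewrite card_eq_sym.
move=> /card_set_bijP[f [f1 f2 f3]]; exists (fun i => f (val i)); split.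
- by move=> i j ij; apply: val_inj; apply: f2 ij; rewrite inE/=.
- by move=> i; apply: f1 => /=.
- by move=> s /f3[k /= kn <-]; exists (Ordinal kn).
Qed.

(** On a cube of size sqrt h at a minimum, [phi] therefore varies by O(h) and the Gibbs density by a
    bounded factor. *)
Lemma minimum_oscillation : exists2 C, 0 < C & forall m v, local_minima phi m ->
  enorm v <= 1 -> `|phi (m + v) - phi m| <= C * enorm v ^+ 2.
Proof.
have [C C1 [_ tay _ _ bd]] := euclidean_bounds Hphi.
exists (2 * C); first by rewrite mulr_gt0// (lt_le_trans ltr01).
move=> m v lm v1; have [g0 _] := local_minimum_critical Hphi lm.
have := tay m v; rewrite g0 dotv0l subr0 => t1.
have [_ _ hH] := bd m; have q1 := quad_bound hH v.
have e0 := enorm_ge0 v.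
have e3 : enorm v ^+ 3 <= enorm v ^+ 2.
  by rewrite exprS ler_piMl// sqr_ge0.
have C0 : 0 <= C by lra.
have Ce : C * enorm v ^+ 3 <= C * enorm v ^+ 2 by rewrite ler_wpM2l.
have Cs : 0 <= C * enorm v ^+ 2 by rewrite mulr_ge0// sqr_ge0.
move: t1 q1 Ce Cs; move: (C * enorm v ^+ 3) => X1; rewrite -mulrA; move: (C * enorm v ^+ 2) => X2.
move: (phi (m + v) - phi m) (quad _ v) => X3 X4.
by rewrite !ler_norml => /andP[? ?] /andP[? ?] ? ?; apply/andP; split; lra.
Qed.

Lemma lipschitz_constant : exists2 C, 0 < C & forall x y, phi y - phi x <= C * enorm (y - x).
Proof.
have [C C1 [lip _ _ _ _]] := euclidean_bounds Hphi.
exists C; first exact: lt_le_trans ltr01 C1.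
by move=> x y; have := lip x (y - x); rewrite [x + _]addrC subrK; apply: le_trans; exact: ler_norm.
Qed.

(** Gain and loss are both of order h, and so is the lower bound for tau beta, written [tb]; in the
    denominator h cancels, and the bound keeps exactly one factor h. *)
Lemma well_constants (C c v kap A D h t n0 tb K : R) : 0 < K -> 0 < h -> 0 < C -> 0 < c -> 0 <= v -> 0 <= n0 -> K * h <= tb ->
  c / C / (1 + (c / C + v * C) * n0 / K) * h <= (c / C * h) / (1 + (c / C * h + (v * h) * C) * n0 / tb).
Proof.
move=> K0 h0 C0 c0 v0 n00 Kt.
have tb0 : 0 < tb by apply: lt_le_trans Kt; exact: mulr_gt0.
have cC : 0 < c / C by exact: divr_gt0.
have X0 : 0 <= (c / C + v * C) * n0 by rewrite mulr_ge0// addr_ge0 ?(ltW cC)// mulr_ge0// ltW.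
rewrite -[leLHS]mulrA [_^-1 * h]mulrC mulrA ler_wpM2l ?(ltW (mulr_gt0 cC h0))//.
have -> : (c / C * h + v * h * C) * n0 = (c / C + v * C) * n0 * h by ring.
move: X0; move: ((c / C + v * C) * n0) => X X0.
have d1 : 0 < 1 + X * h / tb by rewrite ltr_pwDl// divr_ge0 ?(ltW tb0)// mulr_ge0// ltW.
have d2 : 0 < 1 + X / K by rewrite ltr_pwDl// divr_ge0// ltW.
rewrite lef_pV2 ?posrE// lerD2l -mulrA ler_wpM2l//.
by rewrite ler_pdivrMr// mulrC ler_pdivlMr// mulrC.
Qed.

Lemma indic_sum_le (n : nat) (B : 'I_n -> set 'rV[R]_d) x : \sum_i (\1_(B i) x : R) <= n%:R.
Proof.
apply: (@le_trans _ _ (\sum_(i < n) (1 : R))); last by rewrite sumr_const card_ord.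
by apply: ler_sum => i _; rewrite indicE lern1 leq_b1.
Qed.

Lemma indic_le_sum (n : nat) (B : 'I_n -> set 'rV[R]_d) (G : set 'rV[R]_d) x :
  (G x -> exists i, B i x) -> \1_G x <= \sum_i (\1_(B i) x : R).
Proof.
move=> GB; have [xG|xG] := pselect (G x); last by rewrite indicE memNset// sumr_ge0.
have [i Bi] := GB xG.
by rewrite indicE mem_set// (bigD1 i)//= indicE mem_set// lerDl sumr_ge0.
Qed.

(** With r = sqrt h the number n of steps is of order 1/r, so tau is of order r^(d+2). The volume
    ratio in beta is of order r^d / r^(2d), and the product is of order r^2 = h. *)
Lemma well_factor (r D A C kap : R) (n : nat) : 0 < r -> 0 < D -> 0 < A -> 0 < C -> (0 < n)%N -> n%:R * r <= D ->
  expR (- kap) ^+ 6 * (2 * A) ^+ d / (D ^+ (d + 2) * C) * r ^+ 2 <=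
  (expR (- (2 * kap)) ^+ 2 / n%:R ^+ (d + 2)) * (expR (- (2 * kap)) * (2 * (A * r)) ^+ d / ((r ^+ 2) ^+ d * C)).
Proof.
move=> r0 D0 A0 C0 n_0 nrD.
have nr : 0 < n%:R * r by rewrite mulr_gt0// ltr0n.
have nR : 0 < n%:R :> R by rewrite ltr0n.
have -> : expR (- (2 * kap)) = expR (- kap) ^+ 2 by rewrite -expRM_natl; congr expR; ring.
set E := expR (- kap); have E0 : 0 < E by exact: expR_gt0.
have -> : (E ^+ 2) ^+ 2 / n%:R ^+ (d + 2) * (E ^+ 2 * (2 * (A * r)) ^+ d / ((r ^+ 2) ^+ d * C)) =
   E ^+ 6 * (2 * A) ^+ d / ((n%:R * r) ^+ (d + 2) * C) * r ^+ 2.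
  rewrite !mulrA !exprMn !exprD.
  have rd : r ^+ d != 0 by rewrite expf_neq0// gt_eqF.
  have nd : n%:R ^+ d != 0 :> R by rewrite expf_neq0// gt_eqF.
  move: rd nd; move: (r ^+ d) (n%:R ^+ d) (A ^+ d) (2 ^+ d) => rd nd Ad td rd0 nd0.
  field.
  by rewrite (gt_eqF nR) (gt_eqF r0) (gt_eqF C0) rd0 nd0.
rewrite ler_wpM2r ?sqr_ge0// ler_wpM2l//.
  by rewrite mulr_ge0// exprn_ge0 ?(ltW E0)// mulr_ge0// ltW.
rewrite lef_pV2 ?posrE ?mulr_gt0 ?exprn_gt0// ler_wpM2r ?(ltW C0)//.
by rewrite lerXn2r// ?nnegrE ltW.
Qed.

(** The common form of the two coverings by cubes wider than h, crossed in [N] steps. Since |phi -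
    phi(z i)| <= kap h on a cube, the density ratio there is at most exp(2 kap). *)
Lemma coercive_cubes (h : R) (h0 : 0 < h) (h1 : h <= 1) (p : 'rV[R]_d -> R) (n N : nat)
    (z : 'I_n -> 'rV[R]_d) (G : set 'rV[R]_d) (C c v v0 L kap : R) :
  continuous p -> 0 < C -> (forall x, C^-1 <= local_average phi h x <= C) ->
  (forall x, - v <= local_average phi h x - local_average p h x) ->
  (forall x, ~ G x -> c <= local_average phi h x - local_average p h x) ->
  0 <= v -> 0 < v0 -> v0 <= 1 -> v0 * C <= c -> 0 < L -> (0 < N)%N -> d%:R * (2 * L) < N%:R * h ->
  measurable G -> (forall x, G x -> exists i, box (z i - const_mx L) (z i + const_mx L) x) ->
  (forall i x, box (z i - const_mx L) (z i + const_mx L) x -> `|phi x - phi (z i)| <= kap * h) ->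
  exists Bc (l : 'I_n -> LfunType (nu_infty cphi h) (lee1n 2)), 0 <= Bc /\
    coercive_mod (@ipL _ _ _ (nu_infty cphi h)) (gibbs_average h0 h1)
      (v0 / (1 + (v0 + v * C) * n%:R / (expR (- (2 * kap)) ^+ 2 / N%:R ^+ (d + 2) * (expR (- (2 * kap)) * (2 * L) ^+ d / (h ^+ d * C)))))
      Bc l.
Proof.
move=> cp C0 CD hv hc v_0 v00 v01 vc L0 N0 NL mG GB osc.
pose B i := box (z i - const_mx L) (z i + const_mx L).
have diam i x y : B i x -> B i y -> enorm (x - y) < N%:R * h.
  move=> Bx By; apply: le_lt_trans NL; apply: enorm_box => j.
  have := Bx j; have := By j; rewrite !mxE.
  move: (x ord0 j) (y ord0 j) (z i ord0 j) => x1 y1 z1 /andP[? ?] /andP[? ?].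
  by rewrite ler_norml; apply/andP; split; lra.
have [|||i x y Bx By||||||f i|Bc [l [Bc0 hl]]] := @gibbs_coercive h h0 h1 p n B (fun i => z i - const_mx L) G C c v v0 (2 * L) (2 * kap)
  (expR (- (2 * kap)) ^+ 2 / N%:R ^+ (d + 2)) n%:R 1 cp (expr1n _ 2) C0 CD hv hc v_0 v00 v01 vc.
- by move=> i; exact: measurable_box.
- by rewrite mulr_gt0.
- move=> i x; rewrite /B (_ : z i - const_mx L + const_mx (2 * L) = z i + const_mx L)//.
  by apply/rowP => j; rewrite !mxE; ring.
- have := osc i x Bx; have := osc i y By; rewrite -mulrA; move: (kap * h) => X.
  by rewrite !ler_norml => /andP[? ?] /andP[? ?]; lra.
- exact: mG.
- by rewrite divr_gt0 ?exprn_gt0 ?ltr0n// expR_gt0.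
- by rewrite ler0n.
- by move=> x; exact: indic_sum_le.
- by move=> x; apply: indic_le_sum; exact: GB.
- have mf : measurable_fun setT (f : 'rV[R]_d -> R) by have /Lfun2P[] := V_Lfun f.
  have := @box_poincare_gibbs R d phi Hphi h h0 (z i - const_mx L) (z i + const_mx L) N
    (expR (- (phi (z i) / h) - kap)) (expR (- (phi (z i) / h) + kap)) f N0 (expR_gt0 _).
  rewrite -expRN -expRD (_ : - (phi (z i) / h) - kap + _ = - (2 * kap)); last by ring.
  apply => //; last exact: diam.
  move=> x Bx; rewrite /bfactor !ler_expR; have := osc i x Bx.
  rewrite -ler_pdivrMr// -[X in _ / X](gtr0_norm h0) -normf_div mulrBl.
  by move: (phi x / h) (phi (z i) / h) => u1 u2; rewrite ler_norml => /andP[? ?]; apply/andP; split; lra.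
exists Bc, l; split=> // f; have := hl f.
by rewrite !mul1r.
Qed.

Lemma coercive_wells (n0 : nat) : (local_minima phi #= `I_n0)%card ->
  exists c h1, [/\ 0 < c, 0 < h1, h1 <= 1 & forall (h : R) (h0 : 0 < h) (h1' : h <= 1), h <= h1 ->
    exists Bc (l : 'I_n0 -> LfunType (nu_infty cphi h) (lee1n 2)), 0 <= Bc /\
      coercive_mod (@ipL _ _ _ (nu_infty cphi h)) (gibbs_average h0 h1') (c * h) Bc l].
Proof.
move=> Hn0.
have [p cp [c [v [A [hl [r [[c0 v_0] A0 hl0 hl1 ly]]]]]]] := lyapunov Hphi.
have [C C0 CD] := local_average_bounds Hphi.
have [Co Co0 hCo] := minimum_oscillation.
have [m [minj mlm mall]] := minima_enum Hn0.
(* A cube of half-side A sqrt h has Euclidean radius at most E sqrt h; the condition E^2 h <= 1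
   below keeps it where [minimum_oscillation] applies. *)
pose E := d%:R * A; have E0 : 0 <= E by rewrite mulr_ge0// ltW.
pose kap := Co * E ^+ 2; pose D := 2 * E + 1; have D0 : 0 < D by rewrite /D; lra.
(* The minimum with [C] ensures [v0 <= 1] for v0 = c' h / C. *)
pose c' := Num.min c C; have c'0 : 0 < c' by rewrite lt_min c0 C0.
have c'c : c' <= c by rewrite ge_min lexx.
have c'C : c' <= C by rewrite ge_min lexx orbT.
pose K := expR (- kap) ^+ 6 * (2 * A) ^+ d / (D ^+ (d + 2) * C).
have K0 : 0 < K by rewrite divr_gt0// mulr_gt0 ?exprn_gt0 ?expR_gt0// mulr_gt0.
have [h2 [h20 h21 hh2]] := @small_parameter R [:: (E ^+ 2, 1)] (fun k hk => ltac:(by move: hk; rewrite inE => /eqP ->)).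
exists (c' / C / (1 + (c' / C + v * C) * n0%:R / K)), (Num.min h2 hl); split.
- rewrite divr_gt0 ?divr_gt0// ltr_pwDl// divr_ge0 ?(ltW K0)// mulr_ge0// addr_ge0//.
    by rewrite ltW// divr_gt0.
  by rewrite mulr_ge0// ltW.
- by rewrite lt_min h20.
- by rewrite ge_min h21.
move=> h h0 h1'; rewrite le_min => /andP[hh hhl].
pose q := Num.sqrt h; have q0 : 0 < q by rewrite sqrtr_gt0.
have q2 : q ^+ 2 = h by rewrite sqr_sqrtr// ltW.
have q1 : q <= 1 by rewrite -sqrtr1 ler_sqrt.
have Eq1 : E * q <= 1.
  by apply: le_of_sqr => //; rewrite exprMn q2 expr1n; apply: (hh2 h h0 hh (E ^+ 2, 1)); rewrite inE.
(* Enough steps of length h = q^2 to cross a diameter 2 E q, yet [N * q] stays below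
   [D = 2 * E + 1]. *)
pose N := (Num.truncn (2 * E / q)).+1.
have [N1 N2] : N%:R * q <= D /\ 2 * E < N%:R * q.
  have e0 : 0 <= 2 * E / q by rewrite divr_ge0 ?(ltW q0)// mulr_ge0.
  have /andP[t1 t2] := truncn_itv e0; split; last by rewrite -ltr_pdivrMr.
  by move: t1; rewrite ler_pdivlMr// /N -natr1 mulrDl mul1r /D; lra.
have enB i x : box (m i - const_mx (A * q)) (m i + const_mx (A * q)) x -> enorm (x - m i) <= E * q.
  move=> Bx; rewrite /E -mulrA; apply: enorm_box => j; have := Bx j; rewrite !mxE.
  by move=> /andP[? ?]; rewrite ler_norml; apply/andP; split; lra.
have [||||||||||||Bc [l [Bc0 hB]]] := @coercive_cubes h h0 h1' p n0 N m
   (\bigcup_(i in [set: 'I_n0]) box (m i - const_mx (A * q)) (m i + const_mx (A * q)))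
   C (c' * h) (v * h) (c' / C * h) (A * q) kap cp C0 (fun x => CD h x h0 h1').
- by move=> x; have [] := ly h x h0 hhl.
- move=> x nG; have [_ _ [[s ls xs]|]] := ly h x h0 hhl; last by apply: le_trans; rewrite ler_wpM2r// ltW.
  exfalso; apply: nG; have [i mi] := mall s ls; exists i => // j; rewrite !mxE mi.
  have := le_trans (enorm_coord _ j) xs; rewrite !mxE -/q ler_norml => /andP[? ?].
  by apply/andP; split; lra.
- by rewrite mulr_ge0// ltW.
- by rewrite mulr_gt0// divr_gt0.
- by apply: mulr_ile1 => //; [rewrite ltW// divr_gt0|exact: ltW|rewrite ler_pdivrMr// mul1r].
- by rewrite mulrAC divfK ?gt_eqF.
- exact: mulr_gt0.
- by [].
- have -> : d%:R * (2 * (A * q)) = 2 * E * q by rewrite /E; ring.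
  by rewrite -[X in _ < _ * X]q2 expr2 [ltRHS]mulrA ltr_pM2r.
- by apply: fin_bigcup_measurable => [|i _]; [exact: finite_finset|exact: measurable_box].
- by move=> x [i _ Bx]; exists i.
- move=> i x Bx; have e1 := enB i x Bx.
  have := hCo (m i) (x - m i) (mlm i) (le_trans e1 Eq1); rewrite addrCA subrr addr0 => /le_trans; apply.
  by rewrite /kap -mulrA ler_wpM2l ?(ltW Co0)// -q2 -exprMn lerXn2r ?nnegrE ?enorm_ge0// mulr_ge0// ltW.
exists Bc, l; split=> // f; apply: le_trans (hB f); rewrite ler_wpM2r ?(ip_ge0 (semi_hilbert_L2 _))//.
apply: (@well_constants _ _ _ 0 0 0) => //; first exact: ltW.
have := @well_factor q D A C kap N q0 D0 A0 C0 isT N1.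
by rewrite q2.
Qed.

(** The constant [b] may degenerate with h, since [kap] is of order 1/h on a cube of fixed size;
    only its positivity and the single functional matter for simplicity. *)
Lemma coercive_single : exists h1, [/\ 0 < h1, h1 <= 1 & forall (h : R) (h0 : 0 < h) (h1' : h <= 1), h <= h1 ->
    exists b Bc (l : 'I_1 -> LfunType (nu_infty cphi h) (lee1n 2)), [/\ 0 < b, 0 <= Bc &
      coercive_mod (@ipL _ _ _ (nu_infty cphi h)) (gibbs_average h0 h1') b Bc l]].
Proof.
have [p cp [c [v [A [hl [r [[c0 v_0] A0 hl0 hl1 ly]]]]]]] := lyapunov Hphi.
have [C C0 CD] := local_average_bounds Hphi.
have [Cl Cl0 lip] := lipschitz_constant.
pose c' := Num.min c C; have c'0 : 0 < c' by rewrite lt_min c0 C0.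
have c'c : c' <= c by rewrite ge_min lexx.
have c'C : c' <= C by rewrite ge_min lexx orbT.
exists hl; split=> // h h0 h1' hh.
pose L := `|r| + 1; have L0 : 0 < L by rewrite ltr_wpDl.
pose N := (Num.truncn (d%:R * (2 * L) / h)).+1.
have NL : d%:R * (2 * L) < N%:R * h.
  have e0 : 0 <= d%:R * (2 * L) / h by rewrite divr_ge0 ?(ltW h0)// mulr_ge0// mulr_ge0// ltW.
  by have /andP[_] := truncn_itv e0; rewrite ltr_pdivrMr.
pose kap := Cl * (d%:R * L) / h.
have kh : kap * h = Cl * (d%:R * L) by rewrite divfK ?gt_eqF.
have [|||||||||||i x Bx|Bc [l [Bc0 hB]]] := @coercive_cubes h h0 h1' p 1 N (fun=> 0)
   (eball 0 L) C c' (v * h) (c' / C) L kap cp C0 (fun x => CD h x h0 h1').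
- by move=> x; have [] := ly h x h0 hh.
- move=> x; rewrite /eball/= sub0r enormN => /negP; rewrite -leNgt => xL; have [_ hf _] := ly h x h0 hh; apply: le_trans c'c _; apply: hf.
  by apply: le_trans xL; rewrite /L; have := ler_norm r; lra.
- by rewrite mulr_ge0// ltW.
- exact: divr_gt0.
- by rewrite ler_pdivrMr// mul1r.
- by rewrite divfK ?gt_eqF.
- exact: L0.
- by [].
- exact: NL.
- exact: measurable_eball.
- move=> x; rewrite /eball/= sub0r enormN => xL; exists ord0 => j; rewrite !mxE.
  have := le_lt_trans (enorm_coord x j) xL; rewrite ltr_norml => /andP[? ?].
  by apply/andP; split; lra.
- rewrite kh; have en : enorm x <= d%:R * L.
    apply: enorm_box => j; have := Bx j; rewrite !mxE => /andP[? ?].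
    by rewrite ler_norml; apply/andP; split; lra.
  have := lip x 0; have := lip 0 x; rewrite subr0 sub0r enormN => l1 l2.
  have : Cl * enorm x <= Cl * (d%:R * L) by rewrite ler_wpM2l// ltW.
  by move: (Cl * _) (Cl * (_ * _)) l1 l2 => X Y l1 l2 ?; rewrite ler_norml; apply/andP; split; lra.
exists (c' / C / (1 + (c' / C + v * h * C) * 1%:R / (expR (- (2 * kap)) ^+ 2 / N%:R ^+ (d + 2) * (expR (- (2 * kap)) * (2 * L) ^+ d / (h ^+ d * C))))), Bc, l; split=> //.
have cC0 : 0 < c' / C by exact: divr_gt0.
have vhC : 0 <= v * h * C by apply: mulr_ge0; [apply: mulr_ge0 => //|]; exact: ltW.
rewrite divr_gt0// ltr_pwDl// divr_ge0//; first by rewrite mulr1 addr_ge0// ltW.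
apply: mulr_ge0; first by rewrite divr_ge0 ?exprn_ge0 ?expR_ge0.
by rewrite divr_ge0 ?mulr_ge0 ?expR_ge0 ?exprn_ge0 ?mulr_ge0 ?(ltW h0) ?(ltW C0) ?(ltW L0).
Qed.

End gibbs_gap.

(** * Coercivity from cells of diameter less than h, and integrals of the weight *)

Section gibbs_spectrum.
Context {R : realType} {d : nat} (phi : 'rV[R]_d -> R) (Hphi : hypothesis1 phi).
Implicit Types (x y : 'rV[R]_d).

Local Notation cphi := (hypothesis1_continuous Hphi).

Lemma grid_le (s y : R) (a b : nat) : 0 < s -> a%:R * s <= y -> y < b%:R * s + s -> (a <= b)%N.
Proof.
move=> s0 ay yb; have := le_lt_trans ay yb.
by rewrite -[X in _ < _ + X]mul1r -mulrDl natr1 ltr_pM2r// ltr_nat ltnS.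
Qed.

(** The number of cells grows as h decreases but enters only the functionals. Cells are half-open
    and disjoint, so k = 1; their diameter is below h, so tau = 1 and [phi] oscillates by at most Cl
    h. *)
Lemma coercive_cells : exists b h1, [/\ 0 < b, 0 < h1, h1 <= 1 &
    forall (h : R) (h0 : 0 < h) (h1' : h <= 1), h <= h1 -> forall eps, eps ^+ 2 = 1 ->
    exists (N : nat) Bc (l : 'I_N -> LfunType (nu_infty cphi h) (lee1n 2)), 0 <= Bc /\ forall f,
      b * ipL f f <= ipL f f - eps * ipL (gibbs_average h0 h1' f) f + eps * (Bc * \sum_i ipL f (l i) ^+ 2)].
Proof.
have [p cp [c [v [A [hl [r [[c0 v_0] A0 hl0 hl1 ly]]]]]]] := lyapunov Hphi.
have [C C0 CD] := local_average_bounds Hphi.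
have [Cl Cl0 lip] := lipschitz_constant Hphi.
pose c' := Num.min c C; have c'0 : 0 < c' by rewrite lt_min c0 C0.
have c'c : c' <= c by rewrite ge_min lexx.
have c'C : c' <= C by rewrite ge_min lexx orbT.
have cC0 : 0 < c' / C by exact: divr_gt0.
have vC : 0 <= v * C by rewrite mulr_ge0// ltW.
(* Cells of side 2 u h = h/(d+1) have diameter below h, and each contains a closed cube of half that
   side. *)
pose u : R := (2 * d.+1%:R)^-1; have u0 : 0 < u by rewrite invr_gt0 mulr_gt0// ltr0n.
exists (c' / C / (1 + (c' / C + v * C) * 1 / (1 * (expR (- Cl) * u ^+ d / C)))), hl; split=> //.
  rewrite divr_gt0// ltr_pwDl// mulr1 mul1r divr_ge0//; first by rewrite addr_ge0// ltW.
  by rewrite ltW// divr_gt0// mulr_gt0 ?expR_gt0// exprn_gt0.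
move=> h h0 h1' hh eps e1.
pose L := `|r| + 1; have L0 : 0 < L by rewrite ltr_wpDl.
pose s := 2 * u * h; have s0 : 0 < s by rewrite mulr_gt0// mulr_gt0.
have ds : d%:R * s < h.
  have -> : s = h / d.+1%:R.
    rewrite /s /u; have := ltr0Sn R d; move: (d.+1%:R : R) => X X0; field.
    by rewrite (gt_eqF X0).
  by rewrite mulrA ltr_pdivrMr ?ltr0n// mulrC ltr_pM2l// ltr_nat.
(* Indices 0 to [kk] cover the interval from -L to L in each coordinate. *)
pose kk := Num.truncn (2 * L / s).
pose F := {ffun 'I_d -> 'I_kk.+1}.
pose lo (q : F) (j : 'I_d) : R := - L + (q j)%:R * s.
pose cell (q : F) : set 'rV[R]_d := [set x | forall j, lo q j <= x ord0 j < lo q j + s].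
have cell_inj (q q' : F) x : cell q x -> cell q' x -> q = q'.
  move=> h2 h3; apply/ffunP => j; apply: val_inj => /=; apply/eqP; rewrite eqn_leq.
  have /andP[a1 a2] := h2 j; have /andP[b1 b2] := h3 j; rewrite /lo in a1 a2 b1 b2.
  apply/andP; split; apply: (@grid_le s (x ord0 j + L)) => //; lra.
have mcell q : measurable (cell q).
  rewrite (_ : cell q = \bigcap_(j in [set: 'I_d])
     (fun x : 'rV[R]_d => x ord0 j) @^-1` `[lo q j, lo q j + s[%classic).
    apply: fin_bigcap_measurable => [|j _]; first exact: finite_finset.
    by rewrite -[X in measurable X]setTI; apply: measurable_coord.
  apply/seteqP; split=> [x xab j _ /=|x xab j]; first by rewrite in_itv/=; exact: xab.
  by have := xab j I; rewrite /= in_itv.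
have diam q x y : cell q x -> cell q y -> enorm (x - y) < h.
  move=> Bx By; apply: le_lt_trans ds; apply: enorm_box => j.
  have /andP[a1 a2] := Bx j; have /andP[b1 b2] := By j; rewrite !mxE ler_norml; apply/andP; split; lra.
pose B (i : 'I_#|{: F}|) := cell (enum_val i).
have := @gibbs_coercive R d phi Hphi h h0 h1' p #|{: F}| B (fun i => \row_j lo (enum_val i) j) (eball 0 L)
  C c' v (c' / C) (h * u) Cl 1 1 eps cp e1 C0 (fun x => CD h x h0 h1').
rewrite (_ : expR (- Cl) * (h * u) ^+ d / (h ^+ d * C) = expR (- Cl) * u ^+ d / C); last first.
  rewrite exprMn; move: (h ^+ d) (expf_neq0 d (lt0r_neq0 h0)) (u ^+ d) => X X0 Y.
  by field; rewrite X0 gt_eqF.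
move=> [||||||||||||||||Bc [l hl']] //; last by exists #|{: F}|, Bc, l.
- move=> x; have [lx _ _] := ly h x h0 hh; apply: le_trans lx; rewrite lerN2.
  by rewrite ler_piMr// ltW.
- move=> x; rewrite /eball/= sub0r enormN => /negP; rewrite -leNgt => xL; have [_ hf _] := ly h x h0 hh; apply: le_trans c'c _; apply: hf.
  by apply: le_trans xL; rewrite /L; have := ler_norm r; lra.
- exact: ltW.
- by rewrite ler_pdivrMr// mul1r.
- by rewrite divfK ?gt_eqF.
- by move=> i; exact: mcell.
- exact: mulr_gt0.
- move=> i x Bx j; have := Bx j; rewrite !mxE => /andP[b1 b2]; rewrite b1/=; apply: le_lt_trans b2 _.
  by rewrite ltrD2l /s mulrC; have := mulr_gt0 u0 h0; lra.
- move=> i x y Bx By; apply: le_trans (lip x y) _; rewrite ler_wpM2l// ?(ltW Cl0)//.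
  by apply: ltW; exact: diam By Bx.
- exact: measurable_eball.
- move=> x; have [[i Bi]|nB] := pselect (exists i, B i x).
    rewrite (bigD1 i)//= big1 ?addr0 => [|j ji]; first by rewrite indicE lern1 leq_b1.
    rewrite indicE memNset// => Bj; move/eqP: ji; apply.
    by apply: enum_val_inj; exact: cell_inj Bj Bi.
  by rewrite big1// => i _; rewrite indicE memNset// => Bi; apply: nB; exists i.
- move=> x; apply: indic_le_sum; rewrite /eball/= sub0r enormN => xL.
  pose q : F := [ffun j => inord (Num.truncn ((x ord0 j + L) / s))].
  exists (enum_rank q); rewrite /B enum_rankK => j.
  have := le_lt_trans (enorm_coord x j) xL; rewrite ltr_norml => /andP[x1 x2].
  have e0 : 0 <= (x ord0 j + L) / s by rewrite divr_ge0 ?(ltW s0)//; lra.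
  have /andP[t1 t2] := truncn_itv e0.
  have k0 : 0 <= 2 * L / s by rewrite divr_ge0 ?(ltW s0)//; lra.
  have /andP[_ t4] := truncn_itv k0.
  have qj : (q j : nat) = Num.truncn ((x ord0 j + L) / s).
    rewrite ffunE inordK// -(ltr_nat R); apply: le_lt_trans t1 _; apply: le_lt_trans t4.
    by rewrite ler_pM2r ?invr_gt0//; lra.
  move: t1 t2; rewrite /lo qj; move: (Num.truncn _) => T; rewrite ler_pdivlMr// ltr_pdivrMr// -natr1 mulrDl mul1r => t1 t2.
  by apply/andP; split; lra.
- by move=> f i; apply: cell_poincare_gibbs => x y Bx By; exact: diam Bx By.
Qed.

Section weight_integral.
Variables (h : R) (h0 : 0 < h) (C : R) (C0 : 0 < C).
Hypothesis CD : forall x, C^-1 <= local_average phi h x <= C.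
Local Notation wt := (weight (gibbs cphi h) (near_kernel h)).
Local Notation Z := (Zinv phi h ^+ 2 * h ^+ d).

(** The weight contributes a second Boltzmann factor, so the density of [nu_infty] behaves like
    exp(-2 phi/h). *)
Lemma weight_bfactor_bounds E x :
  (E <= phi x -> wt x * bfactor phi h x * Zinv phi h <= Z * C * expR (- (2 * E / h))) /\
  (phi x <= E -> Z * C^-1 * expR (- (2 * E / h)) <= wt x * bfactor phi h x * Zinv phi h).
Proof.
have Z0 := Zinv_gt0 Hphi h0; have /andP[CD1 CD2] := CD x.
have Zd : 0 <= Z by rewrite mulr_ge0 ?exprn_ge0// ltW.
have -> : wt x * bfactor phi h x * Zinv phi h = Z * local_average phi h x * expR (- (2 * phi x / h)).
  rewrite (gibbs_weightE Hphi h0) (_ : expR (- (2 * phi x / h)) = bfactor phi h x * bfactor phi h x); first by ring.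
  by rewrite /bfactor -expRD; congr expR; rewrite -mulrA; move: (phi x / h) => X; ring.
have D0 : 0 <= local_average phi h x by apply: le_trans CD1; rewrite invr_ge0 ltW.
have Ci : 0 <= C^-1 by rewrite invr_ge0 ltW.
have mono a b : a <= b -> expR (- (2 * b / h)) <= expR (- (2 * a / h)).
  by move=> ab; rewrite ler_expR lerN2 ler_pM2r ?invr_gt0// ler_pM2l.
by split=> /mono hE; apply: ler_pM => //; first [exact: expR_ge0|exact: mulr_ge0|by rewrite ler_wpM2l].
Qed.

Let mF (S : set 'rV[R]_d) : measurable S -> measurable_fun setT (fun x => (\1_S x * wt x)%:E).
Proof.
move=> mS; apply/measurable_EFinP; apply: measurable_funM; first exact: measurable_indic.
exact: (measurable_weight (gibbs cphi h) (measurable_near_kernel h) (near_kernel_ge0 h) (near_kernel_le1 h)).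
Qed.

Let wt0 x : 0 <= wt x.
Proof.
rewrite (gibbs_weightE Hphi h0); have /andP[CD1 _] := CD x.
rewrite mulr_ge0//; last by apply: le_trans CD1; rewrite invr_ge0 ltW.
by rewrite mulr_ge0 ?(ltW (bfactor_gt0 _ _ _))// mulr_ge0 ?exprn_ge0 ?(ltW h0)// ltW// (Zinv_gt0 Hphi h0).
Qed.

Let intE (S : set 'rV[R]_d) : measurable S ->
  (\int[gibbs cphi h]_x (\1_S x * wt x)%:E = \int[leb d]_x (\1_S x * (wt x * bfactor phi h x * Zinv phi h))%:E)%E.
Proof.
move=> mS; have Z0 := Zinv_gt0 Hphi h0.
rewrite (gibbs_integral Hphi h0 (mF mS)); last by move=> x; rewrite lee_fin mulr_ge0.
have mb := measurable_bfactor Hphi h; have b0 x : 0 <= bfactor phi h x by exact: ltW (bfactor_gt0 _ _ _).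
rewrite -ge0_integralZl_EFin//.
- by apply: eq_integral => x _; rewrite -!EFinM; congr EFin; ring.
- by move=> x _; rewrite mule_ge0// lee_fin ?mulr_ge0.
- by apply: emeasurable_funM; [exact: mF|exact/measurable_EFinP].
- exact: ltW.
Qed.

Lemma box_const_integral (a b : 'rV[R]_d) (K : R) : (forall i, a ord0 i <= b ord0 i) -> 0 <= K ->
  (\int[leb d]_x (K * \1_(box a b) x)%:E = (K * \prod_i (b ord0 i - a ord0 i))%:E)%E.
Proof.
move=> ab K0; under eq_integral do rewrite EFinM.
rewrite ge0_integralZl_EFin//; last by apply/measurable_EFinP; apply: measurable_indic; exact: measurable_box.
rewrite integral_indic ?setIT//; last exact: measurable_box.
by rewrite EFinM; congr (_ * _)%E; exact: leb_box.
Qed.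

Let mwb : measurable_fun setT (fun x => wt x * bfactor phi h x * Zinv phi h).
Proof.
apply: measurable_funM => //; apply: measurable_funM; last exact: (measurable_bfactor Hphi h).
exact: (measurable_weight (gibbs cphi h) (measurable_near_kernel h) (near_kernel_ge0 h) (near_kernel_le1 h)).
Qed.

Let wb0 x : 0 <= wt x * bfactor phi h x * Zinv phi h.
Proof. by rewrite mulr_ge0 ?(ltW (Zinv_gt0 Hphi h0))// mulr_ge0// ltW// bfactor_gt0. Qed.

Lemma weight_integral_le (S : set 'rV[R]_d) (a b : 'rV[R]_d) E : measurable S -> S `<=` box a b ->
  (forall i, a ord0 i <= b ord0 i) -> (forall x, S x -> E <= phi x) ->
  (\int[gibbs cphi h]_x (\1_S x * wt x)%:E <= (Z * C * expR (- (2 * E / h)) * \prod_i (b ord0 i - a ord0 i))%:E)%E.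
Proof.
move=> mS Sb ab SE; rewrite intE//.
have K0 : 0 <= Z * C * expR (- (2 * E / h)).
  by rewrite mulr_ge0 ?expR_ge0// mulr_ge0 ?(ltW C0)// mulr_ge0 ?sqr_ge0// exprn_ge0// ltW.
rewrite -box_const_integral//; apply: ge0_le_integral => //.
- by move=> x _; rewrite lee_fin mulr_ge0.
- by apply/measurable_EFinP; apply: measurable_funM => //; exact: measurable_indic.
- by apply/measurable_EFinP; apply: measurable_funM => //; apply: measurable_indic; exact: measurable_box.
move=> x _; rewrite lee_fin; have [xS|xS] := pselect (S x); last by rewrite indicE memNset// mul0r mulr_ge0.
by rewrite !indicE !mem_set// ?mulr1 ?mul1r; [exact: (weight_bfactor_bounds E x).1 (SE x xS)|exact: Sb].
Qed.

Lemma weight_integral_ge (S : set 'rV[R]_d) (a b : 'rV[R]_d) E : measurable S -> box a b `<=` S ->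
  (forall i, a ord0 i <= b ord0 i) -> (forall x, box a b x -> phi x <= E) ->
  ((Z * C^-1 * expR (- (2 * E / h)) * \prod_i (b ord0 i - a ord0 i))%:E <= \int[gibbs cphi h]_x (\1_S x * wt x)%:E)%E.
Proof.
move=> mS Sb ab SE; rewrite intE//.
have K0 : 0 <= Z * C^-1 * expR (- (2 * E / h)).
  by rewrite mulr_ge0 ?expR_ge0// mulr_ge0 ?invr_ge0 ?(ltW C0)// mulr_ge0 ?sqr_ge0// exprn_ge0// ltW.
rewrite -box_const_integral//; apply: ge0_le_integral => //.
- by move=> x _; rewrite lee_fin mulr_ge0.
- by apply/measurable_EFinP; apply: measurable_funM => //; apply: measurable_indic; exact: measurable_box.
- by apply/measurable_EFinP; apply: measurable_funM => //; exact: measurable_indic.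
move=> x _; rewrite lee_fin; have [xS|xS] := pselect (box a b x); last by rewrite indicE memNset// mulr0 mulr_ge0.
by rewrite !indicE !mem_set// ?mulr1 ?mul1r; [exact: (weight_bfactor_bounds E x).2 (SE x xS)|exact: Sb].
Qed.

End weight_integral.

Lemma indic_L2 (h : R) (S : set 'rV[R]_d) : measurable S -> (\1_S : 'rV[R]_d -> R) \in Lfun (nu_infty cphi h) 2.
Proof.
move=> mS; apply/Lfun2P; split; first exact: measurable_indic.
apply: (@le_lt_trans _ _ (\int[nu_infty cphi h]_x (1 : R)%:E)%E); last by rewrite integral_prob_cst ltry.
apply: ge0_le_integral => //.
- by apply/measurable_EFinP; apply: measurable_funX; exact: measurable_indic.
- by move=> x _; rewrite lee_fin indicE; case: (x \in S); rewrite /= ?expr1n ?expr0n.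
Qed.

Lemma sum_VE (h : R) n (c : 'rV[R]_n) (chi : 'I_n -> LfunType (nu_infty cphi h) (lee1n 2)) x :
  (\sum_j c ord0 j *: chi j) x = \sum_j c ord0 j * chi j x.
Proof.
by apply: (big_ind2 (fun (g : LfunType (nu_infty cphi h) (lee1n 2)) (r : R) => g x = r)) => [|u a v b <- <-|i _].
Qed.

End gibbs_spectrum.

(** * Metastable test functions *)

Section metastability.
Context {R : realType} {d : nat} (phi : 'rV[R]_d -> R) (Hphi : hypothesis1 phi).
Implicit Types (x y : 'rV[R]_d).

Local Notation cphi := (hypothesis1_continuous Hphi).

(** One number [q] serves as radius of the wells, as constant of quadratic growth and as separation
    of the minima. *)
Lemma well_radius (n : nat) (m : 'I_n -> 'rV[R]_d) : injective m -> (forall i, local_minima phi (m i)) ->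
  exists q : R, [/\ 0 < q, q <= 1,
    (forall i v, enorm v <= 2 * q -> phi (m i) + q * enorm v ^+ 2 <= phi (m i + v)) &
    (forall i j, i != j -> 4 * q <= enorm (m i - m j))].
Proof.
move=> minj mlm.
have /choice[rm hrm] i : exists rm : R * R, [/\ 0 < rm.1, 0 < rm.2 &
    forall v, enorm v <= rm.1 -> phi (m i) + rm.2 * enorm v ^+ 2 <= phi (m i + v)].
  have [g0 _] := local_minimum_critical Hphi (mlm i).
  have [r [a [r0 a0 ra]]] := coercive_local_minimum Hphi g0 (local_minimum_coercive Hphi (mlm i)).
  by exists (r, a).
pose l : seq (R * R) := [seq (2, (rm i).1) | i <- enum 'I_n] ++ ([seq (1, (rm i).2) | i <- enum 'I_n] ++
  [seq (4, enorm (m p.1 - m p.2)) | p <- [seq p : 'I_n * 'I_n <- enum [set: 'I_n * 'I_n]%SET | p.1 != p.2]]).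
have [|q [q0 q1 hq]] := @small_parameter R l.
  move=> k; rewrite !mem_cat => /or3P[/mapP[i _ ->]|/mapP[i _ ->]|/mapP[p]] /=.
  - by have [] := hrm i.
  - by have [] := hrm i.
  rewrite mem_filter => /andP[pn _ ->] /=; apply: enorm_gt0.
  by rewrite subr_eq0; apply: contra_neq pn => /minj.
exists q; split=> // [i v vq|i j ij].
  have [r0 a0 ra] := hrm i.
  have h1 : 2 * q <= (rm i).1.
    by apply: (hq q q0 (lexx q) (2, (rm i).1)); rewrite mem_cat; apply/orP; left; apply/mapP; exists i; rewrite ?mem_enum.
  have h2 : 1 * q <= (rm i).2.
    apply: (hq q q0 (lexx q) (1, (rm i).2)); rewrite !mem_cat; apply/or3P; apply: Or32.
    by apply/mapP; exists i; rewrite ?mem_enum.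
  apply: le_trans (ra v (le_trans vq h1)); rewrite lerD2l ler_wpM2r ?sqr_ge0//.
  by rewrite mul1r in h2.
apply: (hq q q0 (lexx q) (4, enorm (m i - m j))); rewrite !mem_cat; apply/or3P; apply: Or33.
by apply/mapP; exists (i, j) => //; rewrite mem_filter ij mem_enum inE.
Qed.

Lemma disjoint_sum_sqr (n : nat) (Q : 'I_n -> set 'rV[R]_d) (c : 'I_n -> R) x :
  (forall i j, Q i x -> Q j x -> i = j) ->
  (\sum_j c j * \1_(Q j) x) ^+ 2 = \sum_j c j ^+ 2 * \1_(Q j) x.
Proof.
move=> Qd; have [[i Qi]|nQ] := pselect (exists i, Q i x).
  have z j : j != i -> (\1_(Q j) x : R) = 0.
    by move=> ji; rewrite indicE memNset// => Qj; move/eqP: ji; apply; exact: Qd.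
  rewrite (bigD1 i)//= big1 ?addr0 => [|j ji]; last by rewrite z// mulr0.
  rewrite [RHS](bigD1 i)//= big1 ?addr0 => [|j ji]; last by rewrite z// mulr0.
  by rewrite indicE mem_set// !mulr1.
have z j : (\1_(Q j) x : R) = 0 by rewrite indicE memNset// => Qj; apply: nQ; exists j.
by rewrite !big1 ?expr0n// => j _; rewrite z mulr0.
Qed.

(** A step shorter than q/2 that crosses the sphere of radius q starts in the annulus, away from the
    minimum. *)
Lemma annulus_jump (m x y : 'rV[R]_d) (q h : R) : 0 < q -> 2 * h <= q -> enorm (x - y) < h ->
  (\1_(eball m q) x - \1_(eball m q) y) ^+ 2 <= \1_(eball m (2 * q) `\` eball m (q / 2)) x :> R.
Proof.
move=> q0 hq xy.
have t1 : enorm (m - x) <= enorm (m - y) + enorm (x - y).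
  by have := enormD (m - y) (y - x); rewrite addrA subrK -[enorm (y - x)]enormN opprB.
have t2 : enorm (m - y) <= enorm (m - x) + enorm (x - y).
  by have := enormD (m - x) (x - y); rewrite addrA subrK.
have inS : q / 2 <= enorm (m - x) -> enorm (m - x) < 2 * q -> (eball m (2 * q) `\` eball m (q / 2)) x.
  by move=> h1 h2; split=> //; apply/negP; rewrite -leNgt.
have [xQ|xQ] := pselect (eball m q x); have [yQ|yQ] := pselect (eball m q y).
- by rewrite [\1_(eball m q) x]indicE [\1_(eball m q) y]indicE !mem_set// subrr expr0n.
- have S : (eball m (2 * q) `\` eball m (q / 2)) x.
    by apply: inS; move/negP: yQ; rewrite -leNgt; move: xQ; rewrite /eball/=; lra.
  rewrite [leRHS]indicE mem_set// [\1_(eball m q) x]indicE mem_set// [\1_(eball m q) y]indicE memNset//.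
  by rewrite subr0 expr1n.
- have S : (eball m (2 * q) `\` eball m (q / 2)) x.
    by apply: inS; move/negP: xQ; rewrite -leNgt; move: yQ; rewrite /eball/=; lra.
  rewrite [leRHS]indicE mem_set// [\1_(eball m q) x]indicE memNset// [\1_(eball m q) y]indicE mem_set//.
  by rewrite sub0r sqrrN expr1n.
- by rewrite [\1_(eball m q) x]indicE [\1_(eball m q) y]indicE !memNset// subrr expr0n.
Qed.

Lemma kernel_row_integral (h : R) (S : set 'rV[R]_d) : measurable S ->
  (\int[gibbs cphi h \x gibbs cphi h]_z (\1_S z.1 * near_kernel h z)%:E =
   \int[gibbs cphi h]_x (\1_S x * weight (gibbs cphi h) (near_kernel h) x)%:E)%E.
Proof.
move=> mS; have mS1 : measurable_fun setT (\1_S : 'rV[R]_d -> R) by exact: measurable_indic.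
rewrite fubini_tonelli1//; last 2 first.
- apply/measurable_EFinP; apply: measurable_funM; last exact: measurable_near_kernel.
  exact: (measurableT_comp mS1).
- by move=> z; rewrite lee_fin mulr_ge0// near_kernel_ge0.
apply: eq_integral => x _; rewrite /fubini_F/= EFinM.
rewrite -(weightE (gibbs cphi h) (measurable_near_kernel h) (near_kernel_ge0 h) (near_kernel_le1 h)).
have mk : measurable_fun setT (fun y => (near_kernel h (x, y))%:E).
  have mk2 : measurable_fun setT (fun z : 'rV[R]_d * 'rV[R]_d => (near_kernel h z)%:E).
    by apply/measurable_EFinP; exact: measurable_near_kernel.
  by move: mk2 => /measurable_fun_pair2; exact.
under eq_integral do rewrite EFinM.
by rewrite ge0_integralZl_EFin// => y _; rewrite lee_fin near_kernel_ge0.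
Qed.

Lemma rayleigh_upper (a b kap K X : R) : 0 < kap -> 2 / kap * (a - b) <= K * X -> kap * X <= a -> 0 <= K -> 0 <= X -> (1 - K) * a <= b.
Proof.
move=> k0 h1 h2 K0 X0; have : a - b <= kap / 2 * (K * X).
  by rewrite -ler_pdivrMl ?divr_gt0// invf_div.
have : K * (kap * X) <= K * a by rewrite ler_wpM2l.
have : 0 <= K * (kap * X) by rewrite !mulr_ge0// ltW.
have -> : kap / 2 * (K * X) = K * (kap * X) / 2 by ring.
by move: (K * (kap * X)) => Y; rewrite mulrBl mul1r; move: (K * a) => Z; lra.
Qed.

(** The energy of an indicator lives on an annulus where [phi] exceeds the minimum by [eta]; its
    mass comes from a box where the excess is at most [eta / 2]. With the density exp(-2 phi/h) the
    quotient is of order exp(-eta/h). *)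
Lemma test_functions (n0 : nat) : (local_minima phi #= `I_n0)%card ->
  exists dl h1 : R, [/\ 0 < dl, 0 < h1, h1 <= 1 & forall (h : R) (h0 : 0 < h) (h1' : h <= 1), h <= h1 ->
    exists (chi : 'I_n0 -> LfunType (nu_infty cphi h) (lee1n 2)) t, t < expR (- (dl / h)) /\
      forall c : 'rV[R]_n0, c != 0 -> let f := \sum_j c ord0 j *: chi j in
        0 < ipL f f /\ (1 - t) * ipL f f <= ipL (gibbs_average h0 h1' f) f].
Proof.
move=> Hn0; have [m [minj mlm _]] := minima_enum Hn0.
have [q [q0 q1 hq hsep]] := well_radius minj mlm.
have [C C0 CD] := local_average_bounds Hphi.
have [Cl Cl0 lip] := lipschitz_constant Hphi.
(* The quadratic growth [q * |v|^2] at the inner radius |v| = q/2 of the annulus. *)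
pose eta := q ^+ 3 / 4; have eta0 : 0 < eta by rewrite divr_gt0// exprn_gt0.
pose X := Num.min (eta / 2 / Cl) (q / 2).
have X0 : 0 < X by rewrite lt_min (divr_gt0 (divr_gt0 eta0 _) Cl0)//= divr_gt0.
have Xe : Cl * X <= eta / 2 by rewrite mulrC -ler_pdivlMr// ge_min lexx.
have Xq : X <= q / 2 by rewrite ge_min lexx orbT.
pose w := X / d.+1%:R; have w0 : 0 < w by rewrite divr_gt0// ltr0n.
have dw : d%:R * w <= X.
  by rewrite mulrCA ler_piMr// ?(ltW X0)// ler_pdivrMr ?ltr0n// mul1r ler_nat.
pose V := (4 * q) ^+ d / (2 * w) ^+ d.
have V0 : 0 < V by rewrite divr_gt0// exprn_gt0// mulr_gt0.
(* [n0] comes from squaring a sum of n0 jumps, [C ^+ 2] from the two bounds on local averages, and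
   [V] is a ratio of volumes. *)
pose K := n0%:R * (C ^+ 2 * V).
have K0 : 0 <= K by rewrite mulr_ge0// mulr_ge0 ?sqr_ge0// ltW.
have [|h2 [h20 h21 hh2]] := @small_parameter R [:: (K, eta / 2); (2, q)].
  by move=> k; rewrite !inE => /orP[] /eqP -> //=; rewrite divr_gt0.
exists (eta / 2), h2; split=> //; first by rewrite divr_gt0.
move=> h h0 h1' hh.
have Kh : K * h <= eta / 2 by apply: (hh2 h h0 hh (K, eta / 2)); rewrite !inE eqxx.
have qh : 2 * h <= q by apply: (hh2 h h0 hh (2, q)); rewrite !inE eqxx orbT.
have {}CD x := CD h x h0 h1'.
pose Q i := eball (m i) q; pose S i := eball (m i) (2 * q) `\` eball (m i) (q / 2).
have mQ i : measurable (Q i) by exact: measurable_eball.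
have mS i : measurable (S i) by apply: measurableD; exact: measurable_eball.
pose chi i := to_V (indic_L2 Hphi h (mQ i)).
exists chi, (K * expR (- (eta / h))); split.
  (* Half of the exponent absorbs the prefactor, because K <= eta/(2h) < exp(eta/(2h)). *)
  have -> : - (eta / h) = - (eta / 2 / h) + - (eta / 2 / h) by move: (h^-1) => u; field.
  rewrite expRD mulrA gtr_pMl ?expR_gt0//.
  rewrite expRN ltr_pdivrMr ?expR_gt0// mul1r; apply: lt_le_trans (expR_ge1Dx _).
  by have : K <= eta / 2 / h; [rewrite ler_pdivlMr|move=> Ke; apply: le_lt_trans Ke _; rewrite ltrDr].
move=> c cn0 f.
have fE x : f x = \sum_j c ord0 j * \1_(Q j) x by rewrite /f sum_VE.
have Qd i j x : Q i x -> Q j x -> i = j.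
  move=> Qi Qj; apply/eqP; apply/negP => /negP ij; have := hsep i j ij.
  have := enormD (m i - x) (x - m j); rewrite addrA subrK -[enorm (x - m j)]enormN opprB.
  by move: Qi Qj; rewrite /Q /eball/=; lra.
have f2 x : f x ^+ 2 = \sum_j c ord0 j ^+ 2 * \1_(Q j) x.
  by rewrite fE (@disjoint_sum_sqr _ Q (fun j => c ord0 j))// => i j; exact: Qd.
pose Z := Zinv phi h ^+ 2 * h ^+ d.
have Z0 : 0 < Z by rewrite mulr_gt0 ?exprn_gt0// (Zinv_gt0 Hphi h0).
pose U j := Z * C * expR (- (2 * (phi (m j) + eta) / h)) * (4 * q) ^+ d.
pose Lw j := Z * C^-1 * expR (- (2 * (phi (m j) + eta / 2) / h)) * (2 * w) ^+ d.
have L0 j : 0 < Lw j.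
  rewrite mulr_gt0 ?exprn_gt0 ?(mulr_gt0 _ w0)//; apply: mulr_gt0; last exact: expR_gt0.
  by rewrite mulr_gt0// invr_gt0.
have UL j : U j = C ^+ 2 * V * expR (- (eta / h)) * Lw j.
  rewrite /U /Lw (_ : - (2 * (phi (m j) + eta) / h) = - (eta / h) + - (2 * (phi (m j) + eta / 2) / h)); last first.
    by move: (h^-1) => u; field.
  rewrite expRD /V; move: (expR _) (expR _) => E1 E2.
  have wd : (2 * w) ^+ d != 0 by rewrite expf_neq0// gt_eqF// mulr_gt0.
  move: wd; move: ((2 * w) ^+ d) ((4 * q) ^+ d) => y1 y2 y10.
  by field; rewrite y10 gt_eqF.
have prodE (z : 'rV[R]_d) (L : R) : \prod_i ((z + const_mx L) ord0 i - (z - const_mx L) ord0 i) = (2 * L) ^+ d.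
  rewrite (eq_bigr (fun=> 2 * L)); last by move=> i _; rewrite !mxE; ring.
  by rewrite prodr_const card_ord.
have hQ j : ((Lw j)%:E <= \int[gibbs cphi h]_x (\1_(Q j) x * weight (gibbs cphi h) (near_kernel h) x)%:E)%E.
  have dn x : box (m j - const_mx w) (m j + const_mx w) x -> enorm (x - m j) <= X.
    move=> Bx; apply: le_trans dw; apply: enorm_box => i; have := Bx i; rewrite !mxE.
    by move=> /andP[? ?]; rewrite ler_norml; apply/andP; split; lra.
  have := @weight_integral_ge R d phi Hphi h h0 C C0 CD (Q j) (m j - const_mx w) (m j + const_mx w) (phi (m j) + eta / 2) (mQ j).
  rewrite prodE; apply.
  - move=> x /dn dx; rewrite /Q /eball/= -enormN opprB; apply: le_lt_trans dx _; apply: le_lt_trans Xq _.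
    by rewrite ltr_pdivrMr// ltr_pMr// ltr1n.
  - by move=> i; rewrite !mxE lerD2l; have := w0; lra.
  move=> x /dn dx; have := lip (m j) x; have : Cl * enorm (x - m j) <= Cl * X by rewrite ler_wpM2l// ltW.
  by move: Xe; move: (Cl * X) (Cl * _) (eta / 2) (phi x) (phi (m j)) => X1 X2 X3 X4 X5; lra.
have hS j : (\int[gibbs cphi h]_x (\1_(S j) x * weight (gibbs cphi h) (near_kernel h) x)%:E <= (U j)%:E)%E.
  have := @weight_integral_le R d phi Hphi h h0 C C0 CD (S j) (m j - const_mx (2 * q)) (m j + const_mx (2 * q)) (phi (m j) + eta) (mS j).
  rewrite prodE (_ : 2 * (2 * q) = 4 * q); last by ring.
  apply.
  - move=> x [Sx _] i; have := le_lt_trans (enorm_coord (m j - x) i) Sx; rewrite !mxE ltr_norml => /andP[? ?].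
    by apply/andP; split; lra.
  - by move=> i; rewrite !mxE lerD2l; have := q0; lra.
  move=> x [Sx /negP]; rewrite /eball/= -leNgt => Sx2.
  have e2 : enorm (x - m j) = enorm (m j - x) by rewrite -enormN opprB.
  have := hq j (x - m j); rewrite e2 => /(_ (ltW Sx)); rewrite addrCA subrr addr0; apply: le_trans.
  rewrite lerD2l /eta exprS -mulrA ler_wpM2l ?(ltW q0)//.
  have : (q / 2) ^+ 2 <= enorm (m j - x) ^+ 2 by rewrite lerXn2r ?nnegrE ?enorm_ge0// divr_ge0 ?(ltW q0).
  by rewrite expr_div_n (_ : 2 ^+ 2 = 4 :> R)//; ring.
pose kap := nu_factor Hphi h; have kap0 : 0 < kap by exact: nu_factor_gt0.
pose A := \sum_j c ord0 j ^+ 2 * Lw j.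
have A0 : 0 < A.
  have [j cj] : exists j, c ord0 j != 0.
    apply/existsP; apply: contraNT cn0; rewrite negb_exists => /forallP cz.
    by apply/eqP/rowP => j; rewrite mxE; apply/eqP; have := cz j; rewrite negbK.
  rewrite /A (bigD1 j)//= ltr_pwDl//.
    by rewrite mulr_gt0// lt_def sqr_ge0 andbT sqrf_eq0.
  by apply: sumr_ge0 => i _; rewrite mulr_ge0 ?sqr_ge0// ltW.
have wt0 x : 0 <= weight (gibbs cphi h) (near_kernel h) x by exact: ltW (gibbs_weight_gt0 Hphi h0 h1' x).
have mwt := measurable_weight (gibbs cphi h) (measurable_near_kernel h) (near_kernel_ge0 h) (near_kernel_le1 h).
have mIw (T : set 'rV[R]_d) : measurable T -> measurable_fun setT (fun x => (\1_T x * weight (gibbs cphi h) (near_kernel h) x)%:E).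
  by move=> mT; apply/measurable_EFinP; apply: measurable_funM => //; exact: measurable_indic.
have mf : measurable_fun setT (f : 'rV[R]_d -> R) by have /Lfun2P[] := V_Lfun f.
have low : kap * A <= ipL f f.
  rewrite -lee_fin ipL_sqrE (nu_integral Hphi h0 h1'); last 2 first.
  - by apply/measurable_EFinP; exact: measurable_funX.
  - by move=> x; rewrite lee_fin sqr_ge0.
  rewrite EFinM lee_wpmul2l ?lee_fin ?(ltW kap0)//.
  rewrite (eq_integral (fun x => \sum_j ((c ord0 j ^+ 2)%:E * (\1_(Q j) x * weight (gibbs cphi h) (near_kernel h) x)%:E))%E); last first.
    move=> x _; rewrite f2 -EFinM mulr_suml -sumEFin; apply: eq_bigr => j _.
    by rewrite -EFinM mulrA.
  rewrite ge0_integral_sum//; last 2 first.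
  - by move=> j; apply: emeasurable_funM => //; exact: mIw.
  - by move=> j x _; rewrite mule_ge0// lee_fin ?sqr_ge0 ?mulr_ge0.
  rewrite /A -sumEFin; apply: lee_sum => j _; rewrite ge0_integralZl_EFin ?sqr_ge0//; last 2 first.
  - by move=> x _; rewrite lee_fin mulr_ge0.
  - exact: mIw.
  by rewrite EFinM lee_wpmul2l// lee_fin sqr_ge0.
split; first by apply: lt_le_trans low; exact: mulr_gt0.
apply: (@rayleigh_upper _ _ kap _ A kap0 _ low); last exact: ltW.
  rewrite -lee_fin.
  have := @dirichlet_form _ _ _ (gibbs cphi h) (nu_infty cphi h) (near_kernel h) (nu_factor Hphi h)
    (measurable_near_kernel h) (near_kernel_ge0 h) (near_kernel_le1 h) (near_kernel_sym h)
    (gibbs_weight_gt0 Hphi h0 h1') (nu_factor_gt0 Hphi h0 h1') (nu_integral Hphi h0 h1') 1 f (expr1n _ 2).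
  rewrite mul1r => <-.
  have mk := measurable_near_kernel (R := R) (d := d) h; have k0 := near_kernel_ge0 (R := R) (d := d) h.
  have mSk j : measurable_fun setT (fun z : 'rV[R]_d * 'rV[R]_d => (\1_(S j) z.1 * near_kernel h z)%:E).
    apply/measurable_EFinP; apply: measurable_funM => //.
    have mS1 : measurable_fun setT (\1_(S j) : 'rV[R]_d -> R) by exact: measurable_indic.
    exact: (measurableT_comp mS1).
  apply: (@le_trans _ _ (\int[gibbs cphi h \x gibbs cphi h]_z
     \sum_j ((n0%:R * c ord0 j ^+ 2)%:E * (\1_(S j) z.1 * near_kernel h z)%:E))%E).
    apply: ge0_le_integral => //.
    - by move=> z _; rewrite lee_fin mulr_ge0 ?sqr_ge0.
    - apply/measurable_EFinP; apply: measurable_funM => //; apply: measurable_funX.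
      by apply: measurable_funB; [exact: (measurableT_comp mf)|apply: measurable_funM => //; exact: (measurableT_comp mf)].
    - by apply: emeasurable_sum => j; apply: emeasurable_funM => //; exact: mSk.
    move=> z _; under eq_bigr do rewrite -EFinM; rewrite sumEFin lee_fin.
    have [z12|z12] := pselect (close_pair h z); last first.
      have -> : near_kernel h z = 0 by rewrite /near_kernel indicE memNset.
      by rewrite mul0r; apply: sumr_ge0 => j _; rewrite mulr0 mulr0.
    have -> : near_kernel h z = 1 by rewrite /near_kernel indicE mem_set.
    rewrite !mul1r !fE -sumrB; apply: le_trans (sum_sqr_le _) _.
    rewrite mulr_sumr; apply: ler_sum => j _; rewrite -mulrBr exprMn mulrA mulr1 ler_wpM2l//.
      by rewrite mulr_ge0 ?sqr_ge0.
    exact: annulus_jump q0 qh z12.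
  rewrite ge0_integral_sum//; last 2 first.
  - by move=> j; apply: emeasurable_funM => //; exact: mSk.
  - by move=> j z _; apply: mule_ge0; rewrite lee_fin; apply: mulr_ge0 => //; exact: sqr_ge0.
  have -> : K * expR (- (eta / h)) * A = \sum_j (n0%:R * c ord0 j ^+ 2) * U j.
    rewrite /A mulr_sumr; apply: eq_bigr => j _; rewrite UL /K; ring.
  rewrite -sumEFin; apply: lee_sum => j _; rewrite ge0_integralZl_EFin//; last 2 first.
  - by move=> z _; rewrite lee_fin mulr_ge0.
  - by rewrite mulr_ge0 ?sqr_ge0.
  rewrite [leRHS]EFinM; apply: lee_wpmul2l; first by rewrite lee_fin; apply: mulr_ge0 => //; exact: sqr_ge0.
  apply: le_trans (hS j); rewrite le_eqVlt; apply/orP; left; apply/eqP.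
  exact: kernel_row_integral.
by rewrite mulr_ge0 ?expR_ge0.
Qed.

End metastability.

(** From exp x >= (x/2)^2 at x = a/h. It places the exponential window inside the one of size delta
    h. *)
Lemma exp_small (R : realType) (a h : R) : 0 < a -> 0 < h -> 4 * h <= a ^+ 3 -> expR (- (a / h)) <= a * h.
Proof.
move=> a0 h0 hh; have ah : 0 < a / h by exact: divr_gt0.
have e1 : a / h / 2 <= expR (a / h / 2) by apply: le_trans (expR_ge1Dx _); rewrite lerDr.
have e2 : (a / h / 2) ^+ 2 <= expR (a / h).
  rewrite [X in expR X](splitr (a / h)) expRD expr2; apply: ler_pM => //; by rewrite divr_ge0 ?(ltW ah).
rewrite expRN; apply: (@le_trans _ _ ((a / h / 2) ^+ 2)^-1).
  by rewrite lef_pV2 ?posrE ?expR_gt0// exprn_gt0// divr_gt0.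
have -> : ((a / h / 2) ^+ 2)^-1 = 4 * h * h / a ^+ 2 by field; rewrite !gt_eqF.
rewrite ler_pdivrMr ?exprn_gt0//; have -> : a * h * a ^+ 2 = a ^+ 3 * h by ring.
by rewrite ler_wpM2r// ltW.
Qed.

(** * Assembling the spectral bounds and the eigenvalue counts *)

Theorem theorem1p1 (R : realType) (d : nat) (phi : 'rV[R]_d -> R) (n0 : nat)
    (Hphi : hypothesis1 phi) (Hn0 : (local_minima phi #= `I_n0)%card) :
  exists delta h0 : R, [/\ 0 < delta, 0 < h0 <= 1 &
    forall h : R, 0 < h <= h0 ->
    let nu := nu_infty (hypothesis1_continuous Hphi) h in
    let T := Tstar (hypothesis1_continuous Hphi) h in
    [/\ op_spectrum nu T `<=` real_segment (-1 + delta) 1,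
        essential_spectrum nu T `<=` real_segment (-1 + delta) (1 - delta),
        eigenvalue_count nu T (real_segment (1 - delta * h) 1) n0,
        op_eigenvalue nu T `&` real_segment (1 - delta * h) 1 `<=`
          real_segment (1 - expR (- (delta / h))) 1 &
        has_dim nu (op_eigenspace nu T 1) 1 /\ op_eigenvector nu T 1 (cst 1)]].
Proof.
have [b [hA [b0 hA0 hA1 cells]]] := coercive_cells Hphi.
have [c [hB [c0 hB0 hB1 wells]]] := coercive_wells Hphi Hn0.
have [hC [hC0 hC1 single]] := coercive_single Hphi.
have [dl [hD [dl0 hD0 hD1 tests]]] := test_functions Hphi Hn0.
(* [c / 2] rather than [c]: the upper count concerns eigenvalues strictly above 1 - c h, and must
   include those equal to 1 - delta h. *)
pose delta := Num.min b (Num.min (c / 2) dl).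
have delta0 : 0 < delta by rewrite !lt_min b0 dl0 divr_gt0.
have deltab : delta <= b by rewrite ge_min lexx.
have deltac : delta <= c / 2 by rewrite !ge_min lexx orbT.
have deltadl : delta <= dl by rewrite !ge_min lexx !orbT.
(* The first condition is that of [exp_small]; the second makes delta h < delta, so that the window
   lies in the range of the decomposition. *)
have [|h2 [h20 h21 hh2]] := @small_parameter R [:: (4, delta ^+ 3); (2, 1)].
  by move=> k; rewrite !inE => /orP[] /eqP -> //=; rewrite exprn_gt0.
exists delta, (Num.min (Num.min h2 hA) (Num.min hB (Num.min hC hD))); split=> //.
  by rewrite !lt_min h20 hA0 hB0 hC0 hD0 !ge_min h21.
move=> h /andP[h0]; rewrite !le_min => /andP[/andP[hh hhA] /and3P[hhB hhC hhD]] nu T.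
have h1 : h <= 1 by exact: le_trans h21.
have h3 : 4 * h <= delta ^+ 3 by apply: (hh2 h h0 hh (4, delta ^+ 3)); rewrite !inE eqxx.
have h4 : 2 * h <= 1 by apply: (hh2 h h0 hh (2, 1)); rewrite !inE eqxx orbT.
pose V := LfunType nu (lee1n 2); pose ip := @ipL _ _ _ nu.
pose KL := @gibbs_average_L2 R d phi Hphi h h0 h1.
have HH : semi_hilbert ip by exact: semi_hilbert_L2.
have ip0 (f : V) : 0 <= ip f f by exact: ip_ge0 HH f.
have AE := TstarE Hphi h : forall f x, T f x = _.
have Ksym (f g : V) : ip (K_V KL f) g = ip f (K_V KL g) by exact: average_sym.
have Kb (f : V) : ip (K_V KL f) (K_V KL f) <= ip f f by exact: average_bounded.
have K1 (f : V) : ip (K_V KL f) f <= ip f f by exact: average_le.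
have [Np [Bp [lp [Bp0 cp]]]] := cells h h0 h1 hhA 1 (expr1n _ 2).
have e1 : (-1 : R) ^+ 2 = 1 by rewrite sqrrN expr1n.
have [Nm [Bm [lm [Bm0 cm]]]] := cells h h0 h1 hhA (-1) e1.
have delta_ip (f : V) : delta * ip f f <= b * ip f f by rewrite ler_wpM2r.
have KNd (f : V) : - ((1 - delta) * ip f f) <= ip (K_V KL f) f.
  have := cm f; have := delta_ip f; rewrite -[ipL (gibbs_average _ _ f) f]/(ip (K_V KL f) f).
  have : 0 <= Bm * \sum_i ipL f (lm i) ^+ 2 by rewrite mulr_ge0// sumr_ge0// => i _; rewrite sqr_ge0.
  rewrite -[ipL f f]/(ip f f); move: (Bm * _) (ip f f) (ip (K_V KL f) f) (b * ip f f) => X1 X2 X3 X4.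
  by rewrite mulrBl mul1r; move: (delta * X2) => X5; lra.
have KN1 (f : V) : - ip f f <= ip (K_V KL f) f.
  by apply: le_trans (KNd f); rewrite lerN2 mulrBl mul1r gerBl mulr_ge0// ltW.
have cpd : coercive_mod ip (K_V KL) delta Bp lp.
  move=> f; apply: le_trans (delta_ip f) _; have := cp f; rewrite !mul1r; exact.
have [k [e [lam [Ke Kperp]]]] := spectral_decomposition HH Ksym K1 KN1 Bp0 cpd.
have dh : delta * h < delta.
  by rewrite -[ltRHS]mulr1 ltr_pM2l//; apply: lt_le_trans h4; rewrite ltr_pMl// ltr1n.
have s_le : expR (- (delta / h)) <= delta * h by exact: exp_small.
have few : (#|[pred i | (1 - delta * h <= lam i)%R]| <= n0)%N.
  have [Bw [lw [Bw0 cw]]] := wells h h0 h1 hhB.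
  apply: leq_trans (few_eigenvalues HH Ksym Ke (cw : coercive_mod ip (K_V KL) _ _ _)).
  apply: subset_leq_card; apply/fintype.subsetP => i; rewrite !inE; apply: lt_le_trans.
  rewrite ltrD2l ltrN2 ltr_pM2r//; apply: le_lt_trans deltac _.
  by rewrite ltr_pdivrMr// ltr_pMr// ltr1n.
have many : (n0 <= #|[pred i | (1 - expR (- (delta / h)) <= lam i)%R]|)%N.
  have [chi [t [ts hchi]]] := tests h h0 h1 hhD.
  apply: (@many_eigenvalues _ _ _ HH _ Ksym _ _ _ _ Ke Kperp n0 chi _ t) => //.
    by apply: lt_le_trans ts _; rewrite ler_expR lerN2 ler_pM2r ?invr_gt0.
  by apply: le_trans s_le _; exact: ltW.
(* The smaller index set has at least n0 elements and the larger at most n0, so they coincide. *)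
have sub : [pred i | (1 - expR (- (delta / h)) <= lam i)%R] \subset [pred i | (1 - delta * h <= lam i)%R].
  by apply/fintype.subsetP => i; rewrite !inE; apply: le_trans; rewrite lerD2l lerN2.
have le_card := subset_leq_card sub.
have card1 : #|[pred i | (1 - delta * h <= lam i)%R]| = n0.
  by apply/eqP; rewrite eqn_leq few (leq_trans many le_card).
have card2 : #|[pred i | (1 - expR (- (delta / h)) <= lam i)%R]| = n0.
  by apply/eqP; rewrite eqn_leq many (leq_trans le_card few).
have one : (1%:C)%C = 1 :> R[i] by [].
have vec1 : op_eigenvector nu T 1 (cst 1).
  split; [split|].
  - have -> : (cst 1 : 'rV[R]_d -> R[i]) = cplx (one_V nu) 0 by apply/funext.
    exact: L2_cplx.
  - apply: aeW => x _; rewrite AE mul1r.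
    have -> : complex.Re (R:=R) \o (cst 1 : 'rV[R]_d -> R[i]) = (one_V nu : 'rV[R]_d -> R) by apply/funext.
    rewrite average_one; last exact: gibbs_weight_gt0.
    have -> : complex.Im (R:=R) \o (cst 1 : 'rV[R]_d -> R[i]) = cst 0 by apply/funext.
    rewrite /average (_ : \int[_]_y _ = 0) ?mulr0//.
    by under eq_Rintegral do rewrite mulr0; rewrite Rintegral_cst// mul0r.
  move=> [N [mN N0 hN]]; have : N = setT.
    apply/seteqP; split=> // x _; apply: hN => /= /(_ I) /eqP.
    by rewrite oner_eq0.
  by move=> NT; move: N0; rewrite NT [X in X = _ -> _](@probability_setT _ _ _ nu) => /eqP; rewrite onee_eq0.
split.
- exact: (spectrum_real AE Ksym Kb K1 KNd).
- exact: (essential_spectrum_real AE Ksym Kb K1 KNd Ke Kperp).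
- by rewrite -card1; apply: (eigenvalue_count_family AE Ksym Kb K1 Ke Kperp).
- move=> z [zev [x /andP[x1 x2] zx]]; exists x => //; apply/andP; split=> //.
  have := eigenvalue_spectrum AE Ksym zev; rewrite zx => sx.
  have dx : 1 - delta < x by apply: lt_le_trans x1; rewrite ltrD2l ltrN2.
  have [i lx] := spectrum_eigenvalue AE Ksym Kb Ke Kperp dx sx.
  have /subset_cardP := etrans card2 (esym card1); move=> /(_ sub) /(_ i).
  by rewrite !inE lx x1.
split=> //.
have d1 : 1 - delta < 1 by rewrite gtrBl.
have [i li] : exists i, lam i = 1.
  apply: (spectrum_eigenvalue AE Ksym Kb Ke Kperp d1); apply: (eigenvalue_spectrum AE Ksym).
  by exists (cst 1).
(* With one functional, at most one index has lam > 1 - b1, hence at most one has lam = 1. *)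
have [b1 [B1 [l1 [b10 B10 c1]]]] := single h h0 h1 hhC.
have le1 := few_eigenvalues HH Ksym Ke (c1 : coercive_mod ip (K_V KL) _ _ _).
have := eigenspace_dim AE Ksym Ke Kperp d1; rewrite one (_ : #|_| = 1)//.
apply/eqP; rewrite eqn_leq; apply/andP; split.
  apply: leq_trans le1; apply: subset_leq_card; apply/fintype.subsetP => j; rewrite !inE => /eqP ->.
  by rewrite gtrBl.
by apply/card_gt0P; exists i; rewrite inE li.
Qed.
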